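(* Let $B\in\mathbb Z^+$, $s>0$, $r\in\{1,\dots,B+1\}$, $x\ge0$ with $F(x)<1$. For the $\mathrm{M}^{\varkappa}|\mathrm{G}^{\delta}|1|B$ system put $$q_{r,x}^s(u)=\mathbf P[1\le d_{r,x}(\nu_s)\le u],\quad q_{0,0}^s(u)=\mathbf P[1\le d_{0,0}(\nu_s)\le u],\quad u\in\{1,\dots,B+1\},$$ $$q_{r,x}^s(0)=\mathbf P[d_{r,x}(\nu_s)=0],\qquad q_{0,0}^s(0)=\mathbf P[d_{0,0}(\nu_s)=0].$$ Then for $u\in\{1,\dots,B\}$ $$q_{0,0}^s(u)=\mathbf E A_0^{\delta+u-1}(s)+\frac{C_u(s,\lambda)}{s+\mu-\mu\tilde b(s)},\qquad q_{r,x}^s(u)=A_x^{u-r}(s)+b_r^s(x)\,\frac{C_u(s,\lambda)}{s+\mu-\mu\tilde b(s)},$$ and $$q_{0,0}^s(B+1)=1-\frac{s}{s+\mu-\mu\tilde b(s)},\qquad q_{r,x}^s(B+1)=1-\frac{s\,b_r^s(x)}{s+\mu-\mu\tilde b(s)},$$ $$q_{0,0}^s(0)=\frac{s}{s+\mu-\mu\tilde b(s)},\qquad q_{r,x}^s(0)=\frac{s\,b_r^s(x)}{s+\mu-\mu\tilde b(s)},$$ where $$C_u(s,\lambda)=\frac{s\,Q_u^s}{1-\lambda}-s+\lambda(s+\mu)\left(A_0^u(s)-\mathbf E A_0^{\delta+u}(s)\right).$$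
   Context: Notation: $\mathbb N=\{1,2,\dots\}$, $\mathbb Z^{+}=\{0,1,\dots\}$, $\mathbf E[Y;\mathfrak A]=\mathbf E[Y\,\mathbf I_{\mathfrak A}]$, $0^0=1$. The process. $\varkappa,\delta\in\mathbb N$ and $\eta\in(0,\infty)$ are independent random variables with finite means; $F(x)=\mathbf P[\eta\le x]$; $\delta$ is geometric: $\mathbf P[\delta=n]=(1-\lambda)\lambda^{n-1}$, $n\in\mathbb N$, $\lambda\in[0,1)$. For $x\ge0$ with $F(x)<1$, $\eta_x$ has distribution $\mathbf P[\eta_x\le u]=\frac{F(x+u)-F(x)}{1-F(x)}$, $u\ge 0$. Let $\eta_0(x)=0$, $\eta_1(x)=\eta_x$, $\eta_{n+1}(x)=\eta_x+\eta_1'+\dots+\eta_n'$ with $\eta_i'$ i.i.d. copies of $\eta$; $N_x(t)=\max\{n\in\mathbb Z^+:\eta_n(x)\le t\}$; $\delta_0=0$, $\delta_n=\delta_1'+\dots+\delta_n'$ with $\delta_i'$ i.i.d. copies of $\delta$. $\pi(t)$ is a compound Poisson process with intensity $\mu>0$ and jumps distributed as $\varkappa$: $\mathbf E\theta^{\pi(t)}=e^{tk(\theta)}$, $k(\theta)=\mu(\mathbf E\theta^{\varkappa}-1)$, $|\theta|\le 1$. All sequences and $\pi$ are independent. Define $D_x(t)=\pi(t)-\delta_{N_x(t)}$, the age process $\eta_x^+(t)=t+x$ for $0\le t<\eta_x$ and $\eta_x^+(t)=t-\eta_{N_x(t)}(x)$ for $t\ge\eta_x$, and the reflected process $\overline D_r^{B+1}(x,t)=r+D_x(t)-\max\{0,\sup_{[0,t]}(r+D_x(\cdot))-(B+1)\}$.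 (The letter $k$ as an index is unrelated to the function $k(\cdot)$.) The queue $\mathrm{M}^{\varkappa}|\mathrm{G}^{\delta}|1|B$. The Markov process $Y_{r,x}(t)=(d_{r,x}(t),\eta_{r,x}(t))$, with initial state $(r,x)$, is defined as follows. For $r\in\{1,\dots,B+1\}$ let $\tilde\tau=\inf\{t:\overline D_r^{B+1}(x,t)<1\}$; then $Y_{r,x}(t)=(\overline D_r^{B+1}(x,t),\eta_x^+(t))$ for $0\le t<\tilde\tau$, and from time $\tilde\tau$ on it continues as a fresh copy $Y_{0,0}(t-\tilde\tau)$. The process $Y_{0,0}$ stays at $(0,0)$ for an exponential time $\tilde\mu$ with parameter $\mu$, and then continues as $Y_{i,0}(t-\tilde\mu)$ with probability $\mathbf P[\varkappa=i]$, $i=1,\dots,B$, and as $Y_{B+1,0}(t-\tilde\mu)$ with probability $\mathbf P[\varkappa\ge B+1]$. Interpretation: batches of size $\varkappa$ arrive at Poisson rate $\mu$ to a waiting room of size $B+1$ with partial rejection; at the end of each service cycle (of duration distributed as $\eta$) the content $j$ is reduced by $\min\{j,\delta\}$; $d_{r,x}(t)$ is the number of customers at time $t$. $\nu_s$ is an exponential random variable with parameter $s>0$ independent of the process. Busy period: $b_r(x)=\inf\{t:d_{r,x}(t)=0\}$, $b_r^s(x)=\mathbf E[e^{-sb_r(x)};b_r(x)<\infty]$ for $r\in\{1,\dots,B+1\}$. With $a_i=\mathbf P[\varkappa=i]$, $\hat a_i=\mathbf P[\varkappa>i]$, put $\tilde b(s)=\hat a_B\,b_{B+1}^s(0)+\sum_{i=1}^Ba_i\,b_i^s(0)$.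 Auxiliary functions. $\tilde f_x(s)=\mathbf Ee^{-s\eta_x}$, $\tilde f(s)=\mathbf Ee^{-s\eta}=\tilde f_0(s)$. For $s>0$, $c(s)\in(\lambda,1)$ is the unique solution in $|\theta|<1$ of $\theta-\lambda=(1-\lambda)\tilde f(s-k(\theta))$. The resolvent sequence $\{Q_k^s(x)\}_{k\in\mathbb Z^+}$ is defined by $$\sum_{k\in\mathbb Z^+}\theta^kQ_k^s(x)=\frac{(1-\lambda)\tilde f_x(s-k(\theta))}{(1-\lambda)\tilde f(s-k(\theta))+\lambda-\theta},\qquad |\theta|<c(s);$$ $Q_k^s=Q_k^s(0)$. $\tilde\rho_i(s)=s\int_0^\infty e^{-st}\mathbf P[\pi(t)=i]\,dt$, $A_x^k(s)=\sum_{i=0}^{k}\tilde\rho_i(s)\left[1-Q_{k-i}^s(x)(1-\lambda)^{-1}\right]$ for $k\in\mathbb Z^+$, $A_x^k(s)=0$ for integers $k<0$, and $\mathbf E A_0^{\delta+j}(s)=(1-\lambda)\sum_{i=1}^\infty\lambda^{i-1}A_0^{i+j}(s)$ for $j\in\mathbb Z^+$. *)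

(* Defs.v *)
From HB Require Import structures.
From mathcomp Require Import all_boot all_order all_algebra.
From mathcomp Require Import all_classical all_reals all_analysis.

Set Implicit Arguments.
Unset Strict Implicit.
Unset Printing Implicit Defensive.

Import Order.TTheory GRing.Theory Num.Theory.
Import numFieldNormedType.Exports.

Local Open Scope classical_set_scope.
Local Open Scope ring_scope.

Section primitives.
Context {d : measure_display} {Omega : measurableType d} {R : realType}.
Variable P : probability Omega R.

Definition same_law (d' : measure_display) (T : measurableType d')
    (V W : {RV P >-> T}) :=
  forall A : set T, measurable A -> P (V @^-1` A) = P (W @^-1` A).

Definition exponential_law (a : R) (V : {RV P >-> R}) :=
  forall A : set R, measurable A -> P (V @^-1` A) = exponential_prob a A.

Definition geometric_law (lam : R) (V : {RV P >-> nat}) :=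
  forall n : nat, P (V @^-1` [set n.+1]) = ((1 - lam) * lam ^+ n)%:E.

(* F *)
Definition service_cdf (eta : {RV P >-> R}) (y : R) : R := fine (cdf eta y).

Record primitives_spec (lam mu : R) (kappa delta : {RV P >-> nat})
    (eta : {RV P >-> R}) : Prop := PrimitivesSpec {
  mu_gt0 : 0 < mu;
  lam_ge0 : 0 <= lam;
  lam_lt1 : lam < 1;
  kappa_pos : forall w, (0 < kappa w)%N;
  delta_pos : forall w, (0 < delta w)%N;
  eta_pos : forall w, 0 < eta w;
  delta_law : geometric_law lam delta;
  kappa_mean : ('E_P[fun w => (kappa w)%:R] < +oo)%E;
  delta_mean : ('E_P[fun w => (delta w)%:R] < +oo)%E;
  eta_mean : ('E_P[eta] < +oo)%E;
  primitives_indep : forall (A D : set nat) (S : set R), measurable S ->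
    P (kappa @^-1` A `&` delta @^-1` D `&` eta @^-1` S) =
    (P (kappa @^-1` A) * P (delta @^-1` D) * P (eta @^-1` S))%E
}.

(* The randomness driving one queue process. The process alternates busy
   periods n = 0, 1, 2, ... with idle periods; busy period n uses its own
   service times, removals, and compound Poisson input (given by interarrival
   times [gap] and batch sizes [batch]), and is followed by the idle time
   [idle n], after which a batch of size [entry n] starts busy period n.+1.
   Regeneration as a fresh copy is the mutual independence of all of these. *)
Record inputs := Inputs {
  clock : {RV P >-> R};
  service : nat -> nat -> {RV P >-> R};
  removal : nat -> nat -> {RV P >-> nat};
  gap : nat -> nat -> {RV P >-> R};
  batch : nat -> nat -> {RV P >-> nat};
  idle : nat -> {RV P >-> R};
  entry : nat -> {RV P >-> nat}
}.

End primitives.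

Inductive slot : Type :=
| Clock
| Service of nat & nat
| Removal of nat & nat
| Gap of nat & nat
| Batch of nat & nat
| Idle of nat
| Entry of nat.

HB.instance Definition _ := gen_eqMixin slot.

Section inputs_spec.
Context {d : measure_display} {Omega : measurableType d} {R : realType}.
Context {P : probability Omega R}.

Definition generated (d' : measure_display) (T : measurableType d')
    (V : {RV P >-> T}) : set (set Omega) := preimage_set_system setT V measurable.

Definition slot_events (X : inputs P) (i : slot) : set (set Omega) :=
  match i with
  | Clock => generated (clock X)
  | Service n j => generated (service X n j)
  | Removal n j => generated (removal X n j)
  | Gap n j => generated (gap X n j)
  | Batch n j => generated (batch X n j)
  | Idle n => generated (idle X n)
  | Entry n => generated (entry X n)
  end.

Definition mutually_independent (X : inputs P) :=
  forall (J : seq slot) (E : slot -> set Omega), uniq J ->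
    (forall i, i \in J -> slot_events X i (E i)) ->
    P (\bigcap_(i in [set` J]) E i) = (\prod_(i <- J) fine (P (E i)))%:E.

(* [X] drives the process started at age [y]: only the first service time of
   busy period 0 has the residual law of eta_y, all others have the law of
   eta. Almost sure positivity is required to hold surely. *)
Record inputs_spec (mu s : R) (kappa delta : {RV P >-> nat})
    (eta : {RV P >-> R}) (y : R) (X : inputs P) : Prop := InputsSpec {
  clock_pos : forall w, 0 < clock X w;
  service_pos : forall n i w, 0 < service X n i w;
  removal_pos : forall n i w, (0 < removal X n i w)%N;
  gap_pos : forall n i w, 0 < gap X n i w;
  batch_pos : forall n i w, (0 < batch X n i w)%N;
  idle_pos : forall n w, 0 < idle X n w;
  entry_pos : forall n w, (0 < entry X n w)%N;
  clock_law : exponential_law s (clock X);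
  residual_law : forall u : R, 0 <= u ->
    P [set w | service X 0 0 w <= u] =
    ((service_cdf eta (y + u) - service_cdf eta y) /
     (1 - service_cdf eta y))%:E;
  service_law : forall n i, (n, i) != (0%N, 0%N) ->
    same_law (service X n i) eta;
  removal_law : forall n i, same_law (removal X n i) delta;
  gap_law : forall n i, exponential_law mu (gap X n i);
  batch_law : forall n i, same_law (batch X n i) kappa;
  idle_law : forall n, exponential_law mu (idle X n);
  entry_law : forall n, same_law (entry X n) kappa;
  inputs_indep : mutually_independent X
}.

End inputs_spec.

Section process.
Context {d : measure_display} {Omega : measurableType d} {R : realType}.
Context {P : probability Omega R}.
Variables (X : inputs P) (B : nat).

(* max {n | v 0 + ... + v n.-1 <= t}; the value 0 when there is no maximum
   is only taken on a null event. *)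
Definition renewal_count (v : nat -> R) (t : R) : nat :=
  xget 0%N [set n | \sum_(i < n) v i <= t /\
    forall m : nat, \sum_(i < m) v i <= t -> (m <= n)%N].

Definition service_count (n : nat) (w : Omega) (t : R) : nat :=
  renewal_count (fun i => service X n i w) t.

(* pi(t) *)
Definition compound_poisson (n : nat) (w : Omega) (t : R) : nat :=
  (\sum_(j < renewal_count (fun i => gap X n i w) t) batch X n j w)%N.

(* D_x(t) *)
Definition net_input (n : nat) (w : Omega) (t : R) : R :=
  (compound_poisson n w t)%:R -
  (\sum_(j < service_count n w t) removal X n j w)%N%:R.

Definition reflected (n r : nat) (w : Omega) (t : R) : R :=
  r%:R + net_input n w t -
  Num.max 0 (sup [set r%:R + net_input n w v | v in `[0, t]] - B.+1%:R).

Definition age (n : nat) (y : R) (w : Omega) (t : R) : R :=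
  if t < service X n 0 w then t + y
  else t - \sum_(i < service_count n w t) service X n i w.

(* For r = 0 this is 0: a process started empty begins with an idle period. *)
Definition busy_length (n r : nat) (w : Omega) : \bar R :=
  ereal_inf [set t%:E | t in [set t : R | 0 <= t /\ reflected n r w t < 1]].

Definition busy_level (r n : nat) (w : Omega) : nat :=
  if n is m.+1 then minn (entry X m w) B.+1 else r.

Definition busy_age (y : R) (n : nat) : R := if n is 0 then y else 0.

Fixpoint busy_start (r n : nat) (w : Omega) : \bar R :=
  if n is m.+1 then
    (busy_start r m w + busy_length m (busy_level r m w) w + (idle X m w)%:E)%E
  else 0%E.

Definition busy_at (r : nat) (w : Omega) (t : R) (n : nat) : Prop :=
  (busy_start r n w <= t%:E)%E /\
  (t%:E < busy_start r n w + busy_length n (busy_level r n w) w)%E.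

(* Y_{r,y}(t) *)
Definition queue_state (r : nat) (y : R) (t : R) (w : Omega) : R * R :=
  match pselect (exists n, busy_at r w t n) with
  | left h =>
      let n := sval (cid h) in
      let t' := t - fine (busy_start r n w) in
      (reflected n (busy_level r n w) w t', age n (busy_age y n) w t')
  | right _ => (0, 0)
  end.

(* d_{r,y}(t) *)
Definition customers (r : nat) (y : R) (t : R) (w : Omega) : R :=
  (queue_state r y t w).1.

(* b_r(y) *)
Definition busy_period (r : nat) (y : R) (w : Omega) : \bar R :=
  ereal_inf [set t%:E | t in [set t : R | 0 <= t /\ customers r y t w = 0]].

(* b_r^s(y) *)
Definition busy_transform (s : R) (r : nat) (y : R) : R :=
  fine (\int[P]_(w in [set w | (busy_period r y w < +oo)%E])
          (expR (- s * fine (busy_period r y w)))%:E)%E.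

(* q_{r,y}^s(u) *)
Definition queue_prob (r : nat) (y : R) (u : nat) : R :=
  if u is 0 then fine (P [set w | customers r y (clock X w) w = 0])
  else fine (P [set w | 1 <= customers r y (clock X w) w <= u%:R]).

End process.

(* [X y] drives the processes Y_{r,y}; nothing is assumed jointly on the
   inputs for different ages y. *)
Section formulas.
Context {d : measure_display} {Omega : measurableType d} {R : realType}.
Context {P : probability Omega R}.
Variables (X : R -> inputs P) (lam mu s : R).
Variables (kappa : {RV P >-> nat}) (eta : {RV P >-> R}).

(* a_i and \hat a_i *)
Definition batch_pmf (i : nat) : R := fine (P [set w | kappa w = i]).
Definition batch_tail (i : nat) : R := fine (P [set w | (i < kappa w)%N]).

(* \tilde b(s) *)
Definition busy_mix (B : nat) : R :=
  batch_tail B * busy_transform (X 0) B s B.+1 0 +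
  \sum_(1 <= i < B.+1) batch_pmf i * busy_transform (X 0) B s i 0.

(* k(theta) *)
Definition cumulant (th : R) : R :=
  mu * (fine 'E_P[fun w => th ^+ kappa w] - 1).

Definition laplace (z : R) : R := fine 'E_P[fun w => expR (- z * eta w)].

Definition laplace_residual (y z : R) : R :=
  fine 'E_P[fun w => expR (- z * service (X y) 0 0 w)].

(* c(s), the unique such theta *)
Definition root_c : R :=
  xget 0 [set th | `|th| < 1 /\
    th - lam = (1 - lam) * laplace (s - cumulant th)].

(* {Q_k^s(y)}_k, the unique sequence with the given generating function; the
   real theta with |theta| < c(s) already determine the coefficients. *)
Definition resolvent (y : R) : nat -> R :=
  xget (fun=> 0) [set q : nat -> R | forall th : R, `|th| < root_c ->
    series (fun k => th ^+ k * q k) @ \oo -->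
    (1 - lam) * laplace_residual y (s - cumulant th) /
    ((1 - lam) * laplace (s - cumulant th) + lam - th)].

(* \tilde\rho_i(s) *)
Definition poisson_transform (i : nat) : R :=
  s * fine (\int[lebesgue_measure]_(t in `[0%R, +oo[)
              ((expR (- s * t))%:E *
               P [set w | compound_poisson (X 0) 0 w t = i]))%E.

(* A_y^k(s) *)
Definition resolvA (y : R) (k : int) : R :=
  if k is Posz n then
    \sum_(i < n.+1)
      poisson_transform i * (1 - resolvent y (n - i) * (1 - lam)^-1)
  else 0.

(* E A_0^{delta+j}(s) *)
Definition mean_resolvA (j : nat) : R :=
  (1 - lam) * limn (series (fun i => lam ^+ i * resolvA 0 (i.+1 + j)%N%:Z)).

(* C_u(s,lambda) *)
Definition resolvC (u : nat) : R :=
  s * resolvent 0 u / (1 - lam) - s +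
  lam * (s + mu) * (resolvA 0 u%:Z - mean_resolvA u).

End formulas.

(* Main.v *)
Require Import Defs.
From HB Require Import structures.
From mathcomp Require Import all_boot all_order all_algebra.
From mathcomp Require Import all_classical all_reals all_analysis.
From mathcomp Require Import ring lra zify measurable_realfun.
Set Implicit Arguments.
Unset Strict Implicit.
Unset Printing Implicit Defensive.
Import Order.TTheory GRing.Theory Num.Theory.
Import numFieldNormedType.Exports.
Local Open Scope classical_set_scope.
Local Open Scope ring_scope.

(** Let nu be the clock, exponential with parameter s and independent of the
queue. Every Laplace transform in the formulas is then the probability of an
event decided by the time the clock rings: b_r^s(x) is the probability that the
first busy period ends before the clock rings ([busy_transformE]), and b~ is the
same for a busy period that starts from a random batch. Write D for the quantity
s + mu - mu b~.

Cycles. Busy and idle periods alternate, and the clock forgets its past at the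
start of each of them ([clock_memoryless]). Hence busy period n.+1 starts before
the clock rings with probability b q (b~ q)^n, where b is the probability that
the first one ends in time and q = mu / (s + mu). Summation over the cycles gives
P[1 <= d(nu) <= u] = p + b mu p~ / D ([queue_probE]), where p is the probability
that the clock rings during the first busy period at a content at most u, and p~
its average over the content at which a later busy period starts. For u = B + 1,
p = 1 - b and p~ = 1 - b~, and the probability of an empty queue is what remains.

One busy period. Let u <= B. At the successive ends of services the content of a
busy period that the clock has not yet cut short is a Markov chain, driven by the
compound Poisson input during a service, cut at B + 1, and by geometric removals
([busy_instance]). Two identities make p computable. Let A_x^k be the sequence of
the theorem and M_k = E A_0^(delta + k).
- During a service that starts at content L,
  A_x^(u-L) = P[the clock rings first, at content <= u]
            + sum_i P[the service ends first, with i arrivals] M_(u-L-i);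
  as an identity of formal power series in the service law this is
  [resolvA_renewal].
- At a removal from content m, the geometric law of delta gives
  M_(u-m) = sum_(1 <= L < m) P[delta = m - L] A_0^(u-L) + P[delta >= m] M_(u-1)
  ([Mz_removal]): if delta >= m, the overshoot delta - m + 1 is again a copy of
  delta.
So A^(u-L) solves the equation of the chain with a gain each time the clock
rings at a content at most u, and with the value M_(u-1) each time a busy period
ends; the cut at B + 1 is harmless since A^(u-m) and M_(u-m) vanish for m > u.
Telescoping along the chain, A_x^(u-r) = p + b M_(u-1) ([recursion_limit]).
Averaging this over the entry content and inserting it into the sum over the
cycles leaves the constant mu (a * A_0)_u - (s + mu) M_(u-1), which the relation
(s + mu - mu a(theta)) rho(theta) = s ([clock_series_renewal]) turns into C_u
([resolvC_const]).

Analysis. The sequences of the theorem are given by generating functions on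
|theta| < c(s). They are recognised as coefficients of formal power series built
from W = 1 / (psi - X), where psi = lam + (1 - lam) f and f is the generating
function of the input during a service. As psi(c) = c, W factors through
1 / (c - X) and is O(c^(-k)) ([scale_exists]); this gives convergence inside
|theta| < c and, because lam < c, also lam^n M_n -> 0, which makes the series
that defines E A_0^(delta+j) telescope to M_j ([mean_resolvA_identified]).

Measure theory. Probabilities of the queue are read off only after the events
are shown measurable, which rests on paths being constant to the right of every
time. Independence enters through the sigma-algebras generated by groups of
driving variables: the diagonal of two disjoint groups has a product law
([indep_fubini_ge0]). *)

(** * Independence of groups of driving variables *)

Lemma measure_unique_closed_rays (R : realType) (m1 m2 : {measure set R -> \bar R}) :
  (m1 setT < +oo)%E ->
  (forall x : R, m1 `[x, +oo[%classic = m2 `[x, +oo[%classic) ->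
  forall A, measurable A -> m1 A = m2 A.
Proof.
move=> m1oo m12 A mA.
apply: (measure_unique (@RGenCInfty.G R) (fun n => `[(- n%:R)%R, +oo[%classic)) mA => //.
- exact: RGenCInfty.measurableE.
- move=> _ _ [a ->] [b ->]; exists (Order.max a b).
  apply/seteqP; split => x /=; rewrite !in_itv/= !andbT ge_max.
    by move=> [-> ->].
  by move=> /andP[].
- by move=> i; exists (- i%:R).
- apply/seteqP; split => // x _; exists (Num.truncn `|x|).+1 => //=.
  rewrite in_itv/= andbT lerNl (le_trans (ler_norm _))// normrN ltW//.
  exact: truncnS_gt.
- by move=> _ [x ->].
- move=> k; apply: le_lt_trans m1oo; apply: le_measure => //; rewrite inE//.
Qed.

Lemma measure_unique_open_rays (R : realType) (m1 m2 : {measure set R -> \bar R}) :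
  (m1 setT < +oo)%E ->
  (forall x : R, m1 `]x, +oo[%classic = m2 `]x, +oo[%classic) ->
  forall A, measurable A -> m1 A = m2 A.
Proof.
move=> m1oo m12 A mA.
apply: (measure_unique (@RGenOInfty.G R) (fun n => `](- n%:R)%R, +oo[%classic)) mA => //.
- exact: RGenOInfty.measurableE.
- move=> _ _ [a ->] [b ->]; exists (Order.max a b).
  apply/seteqP; split => x /=; rewrite !in_itv/= !andbT gt_max.
    by move=> [-> ->].
  by move=> /andP[].
- by move=> i; exists (- i%:R).
- apply/seteqP; split => // x _; exists (Num.truncn `|x|).+1 => //=.
  rewrite in_itv/= andbT ltrNl (le_lt_trans (ler_norm _))// normrN.
  exact: truncnS_gt.
- by move=> _ [x ->].
- move=> k; apply: le_lt_trans m1oo; apply: le_measure => //; rewrite inE//.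
Qed.

Section independence.
Context {d : measure_display} {Omega : measurableType d} {R : realType}.
Context {P : probability Omega R}.
Variable X : inputs P.
Hypothesis indepX : mutually_independent X.
Implicit Types J K : set slot.

Definition slots_events J : set (set Omega) := \bigcup_(i in J) slot_events X i.

Lemma slot_eventsT i : slot_events X i setT.
Proof.
by case: i => *; exists setT => //; rewrite preimage_setT setTI.
Qed.

Lemma generatedI (d' : measure_display) (T : measurableType d') (V : {RV P >-> T}) A B :
  generated V A -> generated V B -> generated V (A `&` B).
Proof.
move=> [A' mA' <-] [B' mB' <-]; exists (A' `&` B'); first exact: measurableI.
by rewrite preimage_setI setIIr.
Qed.

Lemma slot_eventsI i A B : slot_events X i A -> slot_events X i B ->
  slot_events X i (A `&` B).
Proof. by case: i => *; exact: generatedI. Qed.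

Lemma generated_measurable (d' : measure_display) (T : measurableType d') (V : {RV P >-> T}) A :
  generated V A -> measurable A.
Proof.
move=> [A' mA' <-]; exact: measurable_funPT.
Qed.

Lemma slot_events_measurable i A : slot_events X i A -> measurable A.
Proof. by case: i => [|n j|n j|n j|n j|n|n] /=; apply: generated_measurable. Qed.

(** A pi-system that generates the events of the slots in J, and on which mutual
independence is a product formula. *)
Definition cylinders J : set (set Omega) := [set A | exists s : seq slot,
  exists E : slot -> set Omega, [/\ uniq s, forall i, i \in s -> J i,
  forall i, slot_events X i (E i) & A = \bigcap_(i in [set` s]) E i]].

Lemma cylindersI J : setI_closed (cylinders J).
Proof.
move=> _ _ [s1 [E1 [u1 J1 e1 ->]]] [s2 [E2 [u2 J2 e2 ->]]].
exists (undup (s1 ++ s2)), (fun i => (if i \in s1 then E1 i else setT) `&`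
  (if i \in s2 then E2 i else setT)); split.
- exact: undup_uniq.
- by move=> i; rewrite mem_undup mem_cat => /orP[/J1|/J2].
- by move=> i; apply: slot_eventsI; case: ifP => // _; exact: slot_eventsT.
- apply/seteqP; split => w /=.
    move=> [h1 h2] i /=; rewrite mem_undup mem_cat => _; split.
      by case: ifP => // /h1.
    by case: ifP => // /h2.
  move=> h; split => i /= ii; have := h i; rewrite /= mem_undup mem_cat ii ?orbT => /(_ isT) [].
    by [].
  by [].
Qed.

Lemma cylinders_sub J : slots_events J `<=` cylinders J.
Proof.
move=> A [i Ji iA]; exists [:: i], (fun j => if j == i then A else setT); split => //.
- by move=> j; rewrite inE => /eqP->.
- by move=> j; case: eqP => [->//|_]; exact: slot_eventsT.
- apply/seteqP; split => w /=.
    by move=> Aw j; rewrite /= inE => /eqP->; rewrite eqxx.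
  by move=> /(_ i); rewrite /= inE eqxx => /(_ isT).
Qed.

Lemma cylinders_measurable J : cylinders J `<=` measurable.
Proof.
move=> _ [s [E [us _ eE ->]]]; apply: fin_bigcap_measurable; first by apply/finite_seqP; exists s.
by move=> k _; exact: (slot_events_measurable (eE k)).
Qed.

Lemma slots_events_measurable J : slots_events J `<=` measurable.
Proof. by move=> A /cylinders_sub; exact: cylinders_measurable. Qed.

Lemma cylindersT J : cylinders J setT.
Proof.
exists [::], (fun=> setT); split => //; first by move=> i; exact: slot_eventsT.
by apply/seteqP; split.
Qed.

Lemma cylinders_indep J K A B : J `&` K = set0 ->
  cylinders J A -> cylinders K B -> P (A `&` B) = (P A * P B)%E.
Proof.
move=> JK [s1 [E1 [u1 J1 e1 ->]]] [s2 [E2 [u2 J2 e2 ->]]].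
have s12 i : i \in s1 -> i \in s2 -> False.
  by move=> /J1 Ji /J2 Ki; have : (J `&` K) i by []; rewrite JK.
rewrite !indepX//.
pose E i := if i \in s1 then E1 i else E2 i.
have -> : \bigcap_(i in [set` s1]) E1 i `&` \bigcap_(i in [set` s2]) E2 i =
    \bigcap_(i in [set` s1 ++ s2]) E i.
  apply/seteqP; split => w /=.
    move=> [h1 h2] i /=; rewrite mem_cat /E; case: ifPn => [/h1//|_ /= /h2//].
  move=> h; split => i /= ii; have := h i; rewrite /= mem_cat ii ?orbT => /(_ isT).
    by rewrite /E ii.
  by rewrite /E; case: ifPn => // /s12 => /(_ ii).
rewrite indepX.
- rewrite big_cat /= EFinM; congr (_%:E * _%:E)%E; rewrite big_seq [RHS]big_seq;
    apply: eq_bigr => i ii; rewrite /E ?ii//; case: ifPn => // /s12 /(_ ii) [].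
- rewrite cat_uniq u1 u2 andbT /=; apply/hasPn => i i2; apply/negP => i1.
  exact: s12 i1 i2.
- by move=> i _; rewrite /E; case: ifPn.
Qed.

(** Independence passes from cylinders to generated events one factor at a time:
for fixed B, both A |-> P (A `&` B) and A |-> P A * P B are finite measures that
agree on a pi-system. *)
Lemma sigma_indep_cylinder J K A B : J `&` K = set0 ->
  <<s slots_events J>> A -> cylinders K B -> P (A `&` B) = (P A * P B)%E.
Proof.
move=> JK sA kB.
have mB : measurable B := cylinders_measurable kB.
have PB0 : 0 <= fine (P B) by exact: fine_ge0.
have PBE : P B = ((NngNum PB0)%:num)%:E by rewrite /= fineK// fin_num_measure.
have {}sA : <<s cylinders J>> A.
  by move: sA; apply: sub_smallest2r; [exact: smallest_sigma_algebra|exact: cylinders_sub].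
suff -> : P (A `&` B) = mscale (NngNum PB0) P A by rewrite /mscale -PBE muleC.
change (mrestr P mB A = mscale (NngNum PB0) P A).
apply: (@g_sigma_algebra_measure_unique _ R Omega (cylinders J) (@cylinders_measurable J)
  (fun=> setT) (fun=> cylindersT J)) (@cylindersI J) _ _ _ sA.
- exact: bigcup_const.
- move=> A' jA'; change (P (A' `&` B) = ((NngNum PB0)%:num)%:E * P A')%E.
  by rewrite -PBE muleC; exact: cylinders_indep JK jA' kB.
- move=> _; change (P (setT `&` B) < +oo)%E.
  by rewrite setTI (le_lt_trans (probability_le1 _ mB))// ltry.
Qed.

Lemma sigma_indep J K A B : J `&` K = set0 ->
  <<s slots_events J>> A -> <<s slots_events K>> B -> P (A `&` B) = (P A * P B)%E.
Proof.
move=> JK sA sB.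
have mA : measurable A.
  by apply: smallest_sub sA; [exact: sigma_algebra_measurable|exact: slots_events_measurable].
have PA0 : 0 <= fine (P A) by exact: fine_ge0.
have PAE : P A = ((NngNum PA0)%:num)%:E by rewrite /= fineK// fin_num_measure.
have {}sB : <<s cylinders K>> B.
  by move: sB; apply: sub_smallest2r; [exact: smallest_sigma_algebra|exact: cylinders_sub].
suff -> : P (A `&` B) = mscale (NngNum PA0) P B by rewrite /mscale -PAE.
rewrite setIC; change (mrestr P mA B = mscale (NngNum PA0) P B).
apply: (@g_sigma_algebra_measure_unique _ R Omega (cylinders K) (@cylinders_measurable K)
  (fun=> setT) (fun=> cylindersT K)) (@cylindersI K) _ _ _ sB.
- exact: bigcup_const.
- move=> B' kB'; change (P (B' `&` A) = ((NngNum PA0)%:num)%:E * P B')%E.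
  by rewrite -PAE setIC; exact: sigma_indep_cylinder JK sA kB'.
- move=> _; change (P (setT `&` A) < +oo)%E.
  by rewrite setTI (le_lt_trans (probability_le1 _ mA))// ltry.
Qed.

(** The sample space with only the events decided by the slots in J: a function is
measurable on it when it depends on these variables alone. Independence
is used in the form of measurability on such spaces. *)
Definition Osub J : measurableType _ := g_sigma_algebraType (slots_events J).

Lemma measurable_id_Osub J : measurable_fun [set: Omega] (id : Omega -> Osub J).
Proof.
move=> _ A mA; rewrite setTI preimage_id.
by apply: smallest_sub mA; [exact: sigma_algebra_measurable|exact: slots_events_measurable].
Qed.

Definition idsub J (w : Omega) : Osub J := w.

HB.instance Definition _ J := @isMeasurableFun.Build _ _ Omega (Osub J)
  (@idsub J) (@measurable_id_Osub J).

Definition diag J K (w : Omega) : Osub J * Osub K := (w, w).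

Lemma measurable_diag J K : measurable_fun [set: Omega] (@diag J K).
Proof.
exact: measurable_fun_pair (@measurable_id_Osub J) (@measurable_id_Osub K).
Qed.

HB.instance Definition _ J K := @isMeasurableFun.Build _ _ Omega (Osub J * Osub K)%type
  (@diag J K) (@measurable_diag J K).

(** The law of the diagonal is the product of the laws on the two factors, since
both agree on rectangles by [sigma_indep]. *)
Lemma indep_fubini_ge0 J K (f : Osub J * Osub K -> \bar R) : J `&` K = set0 ->
  measurable_fun setT f -> (forall z, (0 <= f z)%E) ->
  (\int[P]_w f (w, w) = \int[P]_w1 \int[P]_w2 f (w1, w2))%E.
Proof.
move=> JK mf f0.
pose PJ := distribution P (@idsub J).
pose PK := distribution P (@idsub K).
have -> : (\int[P]_w f (w, w) = \int[distribution P (@diag J K)]_z f z)%E.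
  by rewrite ge0_integral_pushforward//=.
transitivity (\int[(PJ \x PK)%E]_z f z)%E.
  apply: eq_measure_integral => /= A mA _; apply/esym.
  apply: product_measure_unique => // B C mB mC.
  exact: (sigma_indep JK mB mC).
rewrite fubini_tonelli1//.
rewrite ge0_integral_pushforward//=.
- apply: eq_integral => w _; rewrite /fubini_F/= ge0_integral_pushforward//=.
  exact: measurable_fun_pair2.
- exact: measurable_fun_fubini_tonelli_F.
- by move=> w _; exact: integral_ge0.
Qed.

End independence.

(** * Indicators and expectations *)

Section indicator.
Context {R : realType}.

(** Indicators of propositions: pointwise identities between them are
equivalences of statements about paths. *)
Definition ind (Q : Prop) : R := `[< Q >]%:R.

Lemma indT (Q : Prop) : Q -> ind Q = 1.
Proof. by move=> q; rewrite /ind asboolT. Qed.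

Lemma indF (Q : Prop) : ~ Q -> ind Q = 0.
Proof. by move=> q; rewrite /ind asboolF. Qed.

Lemma indE (b : bool) : ind b = b%:R.
Proof. by rewrite /ind asboolb. Qed.

Lemma ind_eq (Q Q' : Prop) : (Q <-> Q') -> ind Q = ind Q'.
Proof. by move=> QQ'; rewrite (propext QQ'). Qed.

Lemma indM (Q Q' : Prop) : ind Q * ind Q' = ind (Q /\ Q').
Proof. by rewrite /ind asbool_and; case: asbool; rewrite ?mul1r ?mul0r. Qed.

Lemma ind_ge0 Q : 0 <= ind Q. Proof. exact: ler0n. Qed.

Lemma ind_le1 Q : ind Q <= 1.
Proof. by rewrite /ind; case: asbool. Qed.

Lemma sum_ind (v m : nat) (F : nat -> R) : \sum_(i < m) ind (v = i) * F i = ind (v < m)%N * F v.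
Proof.
rewrite [in RHS]indE; case: ltnP => vm.
  rewrite (bigD1 (Ordinal vm))//= indT// big1 ?addr0// => i iv; rewrite indF ?mul0r// => e.
  by move: iv; rewrite -val_eqE/= e eqxx.
by rewrite mul0r big1// => i _; rewrite indF ?mul0r// => e; have := ltn_ord i; rewrite -e ltnNge vm.
Qed.

Lemma sum_ind1 (v m : nat) : \sum_(i < m) ind (v = i) = ind (v < m)%N.
Proof.
rewrite -[RHS]mulr1 -(sum_ind v m (fun=> 1)).
by apply: eq_bigr => i _; rewrite mulr1.
Qed.

Lemma ind_split (N v : nat) (F : nat -> R) : (1 <= v < N)%N -> \sum_(1 <= L < N) ind (v = L) * F L = F v.
Proof.
move=> vN; have vin : v \in index_iota 1 N by rewrite mem_index_iota.
have U : uniq (index_iota 1 N) by exact: iota_uniq.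
rewrite (bigD1_seq v)// /= indT// mul1r big1 ?addr0// => L Lv.
by rewrite indF ?mul0r// => e; move: Lv; rewrite e eqxx.
Qed.

End indicator.

Section unitf.
Context {d : measure_display} {T : measurableType d} {R : realType}.

(** For these functions integrability is automatic, so that expectations can be
handled as real numbers. *)
Definition unitf (F : T -> R) := measurable_fun [set: T] F /\ forall w, 0 <= F w <= 1.

Lemma unitf_ind (Q : T -> Prop) : measurable [set w | Q w] -> unitf (fun w => ind (Q w)).
Proof.
move=> mQ; split; last by move=> w; rewrite ind_ge0 ind_le1.
rewrite (_ : (fun w => _) = \1_[set w | Q w]); first exact: measurable_indic.
by apply/funext => w; rewrite indicE /ind; congr (_%:R); apply/asboolP/idP; rewrite inE.
Qed.

Lemma unitf_cst (c : R) : 0 <= c <= 1 -> unitf (fun=> c).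
Proof. by split => //; exact: measurable_cst. Qed.

Lemma unitfM F G : unitf F -> unitf G -> unitf (fun w => F w * G w).
Proof.
move=> [mF F01] [mG G01]; split; first exact: measurable_funM.
move=> w; have /andP[F0 F1] := F01 w; have /andP[G0 G1] := G01 w.
by rewrite mulr_ge0//= mulr_ile1.
Qed.

Lemma unitf_prod (I : Type) (s : seq I) (F : I -> T -> R) :
  (forall i, unitf (F i)) -> unitf (fun w => \prod_(i <- s) F i w).
Proof.
move=> uF; elim: s => [|i s IH].
  rewrite (_ : (fun w => _) = fun=> 1); first by apply: unitf_cst; rewrite ler01 lexx.
  by apply/funext => w; rewrite big_nil.
rewrite (_ : (fun w => _) = fun w => F i w * \prod_(j <- s) F j w); first exact: unitfM.
by apply/funext => w; rewrite big_cons.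
Qed.

Lemma unitf_EFin F : unitf F -> measurable_fun setT (EFin \o F).
Proof. by move=> [mF _]; exact/measurable_EFinP. Qed.

End unitf.

Lemma unitf_comp d d' (T : measurableType d) (T' : measurableType d') (R : realType)
  (F : T' -> R) (g : T -> T') : unitf F -> measurable_fun [set: T] g ->
  unitf (fun w => F (g w)).
Proof. by move=> [mF F01] mg; split => //; exact: measurableT_comp. Qed.

Lemma unitf_integrable d (T : measurableType d) (R : realType)
  (mu : {finite_measure set T -> \bar R}) (F : T -> R) :
  unitf F -> mu.-integrable setT (EFin \o F).
Proof.
move=> [mF F01]; apply: measurable_bounded_integrable => //.
  by rewrite -ge0_fin_numE// fin_num_measure.
exists 1; split => // M M1 w _ /=.
have /andP[F0 F1] := F01 w.
by rewrite ger0_norm// (le_trans F1)// ltW.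
Qed.

Section expectation.
Context {d : measure_display} {Omega : measurableType d} {R : realType}.
Variable P : probability Omega R.

Definition Ex (F : Omega -> R) : R := \int[P]_w F w.

Lemma Ex_EFin F : unitf F -> (\int[P]_w (F w)%:E)%E = (Ex F)%:E.
Proof.
move=> uF; rewrite /Ex /Rintegral fineK//.
exact: integrable_fin_num (unitf_integrable P uF).
Qed.

Lemma eq_Ex F G : (forall w, F w = G w) -> Ex F = Ex G.
Proof. by move=> FG; apply: eq_Rintegral => w _; exact: FG. Qed.

Lemma Ex_cst c : Ex (fun=> c) = c.
Proof. by rewrite /Ex Rintegral_cst//= probability_setT mulr1. Qed.

Lemma Ex_ge0 F : (forall w, 0 <= F w) -> 0 <= Ex F.
Proof. by move=> F0; apply: Rintegral_ge0 => w _. Qed.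

Lemma ExD F G : unitf F -> unitf G -> Ex (fun w => F w + G w) = Ex F + Ex G.
Proof. by move=> uF uG; rewrite /Ex RintegralD//; exact: unitf_integrable. Qed.

Lemma ExB F G : unitf F -> unitf G -> Ex (fun w => F w - G w) = Ex F - Ex G.
Proof. by move=> uF uG; rewrite /Ex RintegralB//; exact: unitf_integrable. Qed.

Lemma ExZ c F : unitf F -> Ex (fun w => c * F w) = c * Ex F.
Proof. by move=> uF; rewrite /Ex RintegralZl//; exact: unitf_integrable. Qed.

Lemma Ex_le F G : unitf F -> unitf G -> (forall w, F w <= G w) -> Ex F <= Ex G.
Proof. by move=> uF uG FG; apply: le_Rintegral => //; exact: unitf_integrable. Qed.

Lemma Ex_le1 F : unitf F -> Ex F <= 1.
Proof.
move=> uF; rewrite -[leRHS](Ex_cst 1); apply: Ex_le => //.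
  by apply: unitf_cst; rewrite ler01 lexx.
by move=> w; have [_ /(_ w)/andP[]] := uF.
Qed.

Lemma Ex01 F : unitf F -> 0 <= Ex F <= 1.
Proof.
by move=> uF; rewrite Ex_le1// Ex_ge0// => w; have [_ /(_ w)/andP[]] := uF.
Qed.

Lemma Ex_ind (Q : Omega -> Prop) : measurable [set w | Q w] ->
  Ex (fun w => ind (Q w)) = fine (P [set w | Q w]).
Proof.
move=> mQ; rewrite /Ex /Rintegral; congr fine.
rewrite -[in RHS](setIT [set w | Q w]) -integral_indic//; apply: eq_integral => w _.
Qed.

Lemma Ex_sum (I : Type) (s : seq I) (F : I -> Omega -> R) : (forall i, unitf (F i)) ->
  Ex (fun w => \sum_(i <- s) F i w) = \sum_(i <- s) Ex (F i).
Proof.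
move=> uF.
have iF i : P.-integrable setT (EFin \o F i) by exact: unitf_integrable.
elim: s => [|i s IH].
  by rewrite big_nil -[RHS](Ex_cst 0); apply: eq_Ex => w; rewrite big_nil.
rewrite big_cons -IH /Ex -RintegralD//.
  by apply: eq_Rintegral => w _; rewrite big_cons.
rewrite (_ : _ \o _ = fun w => (\sum_(j <- s) (F j w)%:E)%E).
  by apply: integrable_sum => // j _; exact: iF.
by apply/funext => w; rewrite /= sumEFin.
Qed.

Lemma Ex_comb (c : nat -> R) (U : nat -> Omega -> R) m : (forall i, unitf (U i)) ->
  Ex (fun w => \sum_(i < m) c i * U i w) = \sum_(i < m) c i * Ex (U i).
Proof.
move=> uU; have iU i : P.-integrable setT (EFin \o (fun w => c i * U i w)).
  rewrite (_ : _ \o _ = fun w => ((c i)%:E * (U i w)%:E)%E); last by apply/funext => w; rewrite /= EFinM.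
  by apply: integrableZl => //; exact: unitf_integrable.
elim: m => [|m IH].
  by rewrite big_ord0 -[RHS](Ex_cst 0); apply: eq_Ex => w; rewrite big_ord0.
rewrite big_ord_recr/= -IH -ExZ// /Ex -RintegralD//.
  by apply: eq_Rintegral => w _; rewrite big_ord_recr.
rewrite (_ : _ \o _ = fun w => (\sum_(i < m) (c i * U i w)%:E)%E).
  by apply: integrable_sum => // j _; exact: iU.
by apply/funext => w; rewrite /= sumEFin.
Qed.

Lemma Ex_cvg (F : nat -> Omega -> R) (G : Omega -> R) :
  (forall n, unitf (F n)) -> (forall w, F n w @[n --> \oo] --> G w) ->
  unitf G -> Ex (F n) @[n --> \oo] --> Ex G.
Proof.
move=> uF FG uG.
have := @dominated_convergence _ Omega R P setT measurableT (fun n w => (F n w)%:E)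
  (fun w => (G w)%:E) (fun=> 1%E).
move=> [].
- by move=> n; exact: unitf_EFin.
- exact: unitf_EFin.
- by apply: nearW => w _; apply: cvg_EFin; [exact: nearW|exact: FG].
- by apply: (@unitf_integrable _ _ _ P (fun=> 1)); apply: unitf_cst; rewrite ler01 lexx.
- apply: nearW => w n _; rewrite lee_fin.
  by have [_ /(_ w)/andP[F0 F1]] := uF n; rewrite ger0_norm.
move=> _ _; rewrite Ex_EFin//.
rewrite (_ : (fun n => _) = fun n => (Ex (F n))%:E); first by move=> /fine_cvg.
by apply/funext => n; rewrite Ex_EFin.
Qed.

(** [Ex_cvg] applied to (1 + F n) / 2. *)
Lemma Ex_cvg_norm (F : nat -> Omega -> R) (G : Omega -> R) :
  (forall n, measurable_fun setT (F n)) -> measurable_fun setT G ->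
  (forall n w, `|F n w| <= 1) -> (forall w, F n w @[n --> \oo] --> G w) ->
  Ex (F n) @[n --> \oo] --> Ex G.
Proof.
move=> mF mG F1 FG.
have G1 w : `|G w| <= 1.
  by apply: (cvgr_to_le (cvg_norm (FG w))); apply: nearW => n; exact: F1.
pose H (F : Omega -> R) w := 2^-1 * (1 + F w).
have uH (K : Omega -> R) : measurable_fun setT K -> (forall w, `|K w| <= 1) -> unitf (H K).
  move=> mK K1; split; first by apply: measurable_funM => //; exact: measurable_funD.
  by move=> w; have := K1 w; rewrite ler_norml /H => /andP[a b]; apply/andP; split; lra.
have E (K : Omega -> R) : measurable_fun setT K -> (forall w, `|K w| <= 1) -> Ex K = 2 * Ex (H K) - 1.
  move=> mK K1; have u := uH K mK K1.
  have u1 : unitf (fun w => 1 - H K w).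
    split; first by apply: measurable_funB => //; case: u.
    by move=> w; have [_ /(_ w)/andP[a b]] := u; rewrite subr_ge0 b lerBlDr lerDl.
  rewrite -(eq_Ex (F := fun w => H K w - (1 - H K w))); last by move=> w; rewrite /H; field.
  rewrite ExB// ExB// ?Ex_cst; last by apply: unitf_cst; rewrite lexx ler01.
  by ring.
rewrite E// (_ : (fun n => _) = fun n => 2 * Ex (H (F n)) - 1); last by apply/funext => n; rewrite E.
apply: cvgB; last exact: cvg_cst.
apply: cvgMr; apply: Ex_cvg => [n|w|]; [exact: uH| |exact: uH].
by apply: cvgMr; apply: cvgD; [exact: cvg_cst|exact: FG].
Qed.

Lemma Ex_same_law d' (T : measurableType d') (V W : {RV P >-> T}) (F : T -> R) :
  same_law V W -> unitf F -> Ex (fun w => F (V w)) = Ex (fun w => F (W w)).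
Proof.
move=> VW uF; apply: EFin_inj; rewrite -!Ex_EFin; last 2 first.
- exact: unitf_comp.
- exact: unitf_comp.
have F0 t : (0 <= (F t)%:E)%E by rewrite lee_fin; have [_ /(_ t)/andP[]] := uF.
have mF := unitf_EFin uF.
rewrite -(@ge0_integral_distribution _ _ _ _ _ P V (EFin \o F))//.
rewrite -(@ge0_integral_distribution _ _ _ _ _ P W (EFin \o F))//.
by apply: eq_measure_integral => A mA _; exact: VW.
Qed.

End expectation.

Section fubini.
Context {d : measure_display} {Omega : measurableType d} {R : realType}.
Context {P : probability Omega R}.
Variable X : inputs P.
Hypothesis indepX : mutually_independent X.
Implicit Types J K : set slot.
Local Notation Osub := (Osub X).

Lemma unitf_Osub J (F : Omega -> R) : unitf (F : Osub J -> R) -> unitf F.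
Proof.
by move=> [mF F01]; split => //; apply: measurableT_comp mF (@measurable_id_Osub _ _ _ _ X J).
Qed.

Lemma measurable_Osub J d' (T : measurableType d') (V : {RV P >-> T}) i : J i ->
  generated V `<=` slot_events X i -> measurable_fun [set: Osub J] (V : Osub J -> T).
Proof.
move=> Ji Vi _ A mA; rewrite setTI; apply: sub_sigma_algebra; exists i => //; apply: Vi.
by exists A => //; rewrite setTI.
Qed.

Lemma Ex_fubini J K (F : Omega * Omega -> R) : J `&` K = set0 ->
  unitf (F : Osub J * Osub K -> R) ->
  Ex P (fun w => F (w, w)) = Ex P (fun w1 => Ex P (fun w2 => F (w1, w2))).
Proof.
move=> JK [mF F01].
have u2 w1 : unitf (fun w2 => F (w1, w2)).
  apply: (@unitf_Osub K); split => //.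
  exact: (@measurable_fun_pair2 _ _ _ (Osub J) (Osub K) _ F w1 mF).
have mE : measurable_fun setT (EFin \o (F : Osub J * Osub K -> R)) by exact/measurable_EFinP.
have H := @indep_fubini_ge0 _ _ _ _ X indepX J K (EFin \o F) JK mE _.
rewrite /Ex /Rintegral /= H; last by move=> z; rewrite lee_fin; have /andP[] := F01 z.
by congr fine; apply: eq_integral => w1 _; rewrite /= Ex_EFin.
Qed.

Lemma unitf_fubini J K (F : Omega * Omega -> R) :
  unitf (F : Osub J * Osub K -> R) ->
  unitf ((fun w1 => Ex P (fun w2 => F (w1, w2))) : Osub J -> R).
Proof.
move=> [mF F01].
have mE : measurable_fun setT (EFin \o (F : Osub J * Osub K -> R)) by exact/measurable_EFinP.
have u2 w1 : unitf ((fun w2 => F (w1, w2)) : Osub K -> R).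
  split => //; exact: (@measurable_fun_pair2 _ _ _ (Osub J) (Osub K) _ F w1 mF).
split; last by move=> w; apply: Ex01; apply: (@unitf_Osub K); exact: u2.
have mG := @measurable_fun_fubini_tonelli_F _ _ (Osub J) (Osub K) R
  (distribution P (@idsub _ _ _ _ X K)) (EFin \o (F : Osub J * Osub K -> R)) mE.
apply: (eq_measurable_fun (fun w1 => fine (fubini_F (distribution P (@idsub _ _ _ _ X K)) (EFin \o (F : Osub J * Osub K -> R)) w1))).
  move=> w1 _; rewrite /fubini_F ge0_integral_pushforward//=.
  - by apply/measurable_EFinP; case: (u2 w1).
  - by move=> w2 _; rewrite lee_fin; have /andP[] := F01 (w1, w2).
apply: (measurableT_comp (fine_measurable measurableT)); apply: mG => z.
by rewrite lee_fin; have /andP[] := F01 z.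
Qed.

Lemma ExM J K (F G : Omega -> R) : J `&` K = set0 ->
  unitf (F : Osub J -> R) -> unitf (G : Osub K -> R) ->
  Ex P (fun w => F w * G w) = Ex P F * Ex P G.
Proof.
move=> JK uF uG.
rewrite (@Ex_fubini J K (fun z => F z.1 * G z.2) JK)/=; last first.
  apply: unitfM.
    exact: (unitf_comp uF (@measurable_fst _ _ _ _)).
  exact: (unitf_comp uG (@measurable_snd _ _ _ _)).
rewrite mulrC -ExZ; last exact: unitf_Osub uF.
by apply: eq_Ex => w; rewrite ExZ 1?mulrC//; exact: unitf_Osub uG.
Qed.

End fubini.

(** * Exponential variables *)

(** The Radon-Nikodym derivative of nu is almost everywhere h. *)
Lemma density_integral d (T : measurableType d) (R : realType)
  (mu : {sigma_finite_measure set T -> \bar R}) (nu : {finite_measure set T -> \bar R})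
  (h : T -> \bar R) : mu.-integrable setT h ->
  (forall A, measurable A -> nu A = (\int[mu]_(x in A) h x)%E) ->
  forall f : T -> \bar R, nu.-integrable setT f ->
  (\int[nu]_x f x = \int[mu]_x (f x * h x))%E.
Proof.
move=> ih nuE f intf.
have dom : nu `<< mu.
  apply/null_content_dominatesP => A mA muA0; rewrite nuE//.
  apply: null_set_integral => //.
  by apply: measurable_funTS; exact: measurable_int ih.
rewrite -(Radon_Nikodym_change_of_variables dom)//=.
have mf := measurable_int nu intf.
have mh := measurable_int mu ih.
apply: ae_eq_integral => //.
- apply: emeasurable_funM; first exact: mf.
  exact: (measurable_int mu (@Radon_Nikodym_integrable _ _ _ (charge_of_finite_measure nu) mu dom)).
- exact: emeasurable_funM.
- apply: ae_eqe_mul2l => /=.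
  rewrite (@Radon_NikodymE _ _ _ (charge_of_finite_measure nu) mu dom)/=; case: cid => /= g [h1 h2 h3].
  apply: integral_ae_eq => //=.
  by move=> E E01 mE; rewrite -h3// -nuE.
Qed.

Section exponential.
Context {d : measure_display} {Omega : measurableType d} {R : realType}.
Context {P : probability Omega R}.
Variables (a : R) (V : {RV P >-> R}).
Hypotheses (a0 : 0 < a) (expV : exponential_law a V).
Local Notation Ex := (Ex P).
Local Notation mu := lebesgue_measure.

Lemma Ex_exponential (phi : R -> R) : unitf phi ->
  ((Ex (fun w => phi (V w)))%:E = \int[mu]_x (phi x * exponential_pdf a x)%:E)%E.
Proof.
move=> uphi.
rewrite -Ex_EFin; last by apply: unitf_comp.
have phi0 t : (0 <= (phi t)%:E)%E by rewrite lee_fin; have [_ /(_ t)/andP[]] := uphi.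
(* the same variable, seen as valued in the type carrying Lebesgue measure *)
have mV : measurable_fun setT (V : Omega -> measurableTypeR R) := measurable_funPT V.
pose V' : {mfun Omega >-> measurableTypeR R} :=
  HB.pack_for {mfun Omega >-> measurableTypeR R} (V : Omega -> measurableTypeR R)
  (@isMeasurableFun.Build _ _ Omega (measurableTypeR R) (V : Omega -> measurableTypeR R) mV).
have mphi : measurable_fun [set: measurableTypeR R] (EFin \o phi) := unitf_EFin uphi.
rewrite -(@ge0_integral_distribution _ _ _ _ _ P V' (EFin \o phi))//.
rewrite (@density_integral _ (measurableTypeR R) R mu (distribution P V') (EFin \o exponential_pdf a)).
- by apply: eq_integral => x _; rewrite /= -EFinM.
- exact: integrable_exponential_pdf.
- by move=> A mA; rewrite -/(exponential_prob a A) -expV.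
- apply: (@unitf_integrable _ (measurableTypeR R) _ (distribution P V')).
  by case: uphi.
Qed.

Lemma exponential_itvE (t : R) : 0 <= t -> P (V @^-1` `[t, +oo[%classic) = (expR (- a * t))%:E.
Proof.
move=> t0.
rewrite expV// /exponential_prob.
rewrite (@ge0_continuous_FTC2y _ _ (fun x => - (expR (- a * x))) _ 0)//.
- by rewrite sub0e EFinN oppeK.
- by move=> x _; apply: exponential_pdf_ge0; exact: ltW.
- apply: (@continuous_subspaceW R^o _ _ [set` `[0, +oo[%R]); last first.
    exact: within_continuous_exponential_pdf.
  by move=> x /=; rewrite !in_itv/= !andbT; exact: le_trans.
- rewrite -oppr0; apply: cvgN.
  rewrite (_ : (fun x => expR (- a * x)) =
               (fun z => expR (- z)) \o (fun z => a * z)); last first.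
    by apply: eq_fun => x; rewrite mulNr.
  apply: (@cvg_comp _ _ _ _ _ _ (pinfty_nbhs R)); last exact: cvgr_expR.
  exact: gt0_cvgMry.
- apply: cvgN; apply/cvg_at_right_filter.
  apply: continuous_comp; last exact: continuous_expR.
  by apply: continuousM => //; apply: (@continuousN _ R^o); exact: cst_continuous.
- move=> x; rewrite in_itv/= andbT => tx; rewrite derive1_exponential_pdf//.
  by rewrite in_itv/= andbT (le_lt_trans t0).
Qed.

Lemma Ex_exponential_ge (t : R) : 0 <= t -> Ex (fun w => ind (t <= V w)) = expR (- a * t).
Proof.
move=> t0; rewrite Ex_ind; last first.
  rewrite -[X in measurable X]setTI; exact: measurable_fun_ler.
rewrite (_ : [set w | _] = V @^-1` `[t, +oo[%classic) ?exponential_itvE//.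
by apply/seteqP; split => w /=; rewrite in_itv/= andbT.
Qed.


Hypothesis posV : forall w, 0 < V w.

(** Restricted to the positive half-line, the law of V - t and the law of V
scaled by exp (- a t) give the same mass to each closed ray. *)
Lemma exponential_memoryless (t : R) (phi : R -> R) : 0 <= t -> unitf phi ->
  (forall x, x < 0 -> phi x = 0) ->
  Ex (fun w => phi (V w - t)) = expR (- a * t) * Ex (fun w => phi (V w)).
Proof.
move=> t0 uphi phiN.
have mW : measurable_fun setT (fun w => V w - t) by apply: measurable_funB.
pose W : {RV P >-> R} := HB.pack_for {mfun Omega >-> R} (fun w => V w - t)
  (@isMeasurableFun.Build _ _ Omega R (fun w => V w - t) mW).
have mpos : measurable (`[0, +oo[%classic : set R) by exact: measurable_itv.
have e0 : 0 <= expR (- a * t) by exact: expR_ge0.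
pose m1 := mrestr (distribution P W) mpos.
pose m2 := mscale (NngNum e0) (mrestr (distribution P V) mpos).
have m12 A : measurable A -> m1 A = m2 A.
  apply: measure_unique_closed_rays.
    change (distribution P W (setT `&` `[0%R, +oo[%classic) < +oo)%E.
    rewrite setTI; apply: le_lt_trans (ltry 1).
    exact: (@probability_le1 _ _ _ (distribution P W)).
  move=> x; change (P (W @^-1` (`[x, +oo[%classic `&` `[0%R, +oo[%classic)) =
    (expR (- a * t))%:E * P (V @^-1` (`[x, +oo[%classic `&` `[0%R, +oo[%classic)))%E.
  have -> : `[x, +oo[%classic `&` `[0, +oo[%classic = `[Order.max x 0, +oo[%classic :> set R.
    by apply/seteqP; split => y /=; rewrite !in_itv/= !andbT ge_max; [move=> [-> ->]|move=> /andP[]].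
  rewrite exponential_itvE ?le_max ?lexx ?orbT//.
  have -> : W @^-1` `[Order.max x 0, +oo[%classic = V @^-1` `[Order.max x 0 + t, +oo[%classic.
    by apply/seteqP; split => y /=; rewrite !in_itv/= !andbT lerBrDr.
  rewrite exponential_itvE ?addr_ge0 ?le_max ?lexx ?orbT//.
  by rewrite -EFinM -expRD; congr (expR _)%:E; ring.
have phi0 y : (0 <= (phi y)%:E)%E by rewrite lee_fin; have [_ /(_ y)/andP[]] := uphi.
have mphi := unitf_EFin uphi.
have restrE (U : {RV P >-> R}) : (\int[mrestr (distribution P U) mpos]_x (phi x)%:E)%E =
    (Ex (fun w => phi (U w)))%:E.
  rewrite -Ex_EFin; last exact: unitf_comp.
  rewrite -(@ge0_integral_distribution _ _ _ _ _ P U (EFin \o phi))//.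
  rewrite (@density_integral _ _ R (distribution P U)
    (mrestr (distribution P U) mpos) (EFin \o \1_`[0, +oo[%classic))//.
  - apply: eq_integral => x _; rewrite /= -EFinM indicE; congr (_%:E).
    have [x0|x0] := ltP x 0; first by rewrite phiN// mul0r.
    by rewrite mem_set ?mulr1//= in_itv/= x0.
  - exact: integrable_indic.
  - by move=> A mA; rewrite integral_indic// setIC.
  - exact: unitf_integrable.
apply: EFin_inj; rewrite EFinM -(restrE V) -[in LHS](restrE W).
rewrite -(@ge0_integral_mscale _ _ _ _ _ _ (NngNum e0))//.
by apply: eq_measure_integral => A mA _; exact: m12.
Qed.

Lemma Ex_exponential_exp (s : R) : 0 <= s ->
  Ex (fun w => expR (- s * V w)) = a / (a + s).
Proof.
move=> s0.
have as0 : 0 < a + s by rewrite ltr_pwDl.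
pose phi (x : R) := ind (0 <= x) * expR (- s * x).
have uphi : unitf phi.
  split; last first.
    move=> x; rewrite /phi indE; have [x0|x0] := leP 0 x; rewrite ?mul0r ?lexx ?ler01//.
    by rewrite mul1r expR_ge0 -expR0 ler_expR mulNr oppr_le0 mulr_ge0.
  apply: measurable_funM; last first.
    by apply: measurableT_comp => //; exact: measurable_funM.
  apply: (unitf_ind _).1; rewrite -[X in measurable X]setTI; exact: measurable_fun_ler.
rewrite (@eq_Ex _ _ _ _ _ (fun w => phi (V w))); last first.
  by move=> w; rewrite /phi indT ?mul1r// ltW.
apply: EFin_inj; rewrite Ex_exponential//.
transitivity (\int[mu]_x ((a / (a + s))%:E * (exponential_pdf (a + s) x)%:E))%E.
  apply: eq_integral => x _; rewrite -EFinM; congr (_%:E).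
  rewrite /phi indE; have [x0|x0] := ltP x 0.
    by rewrite !lt0_exponential_pdf// !mulr0.
  rewrite mul1r !exponential_pdfE// [RHS]mulrA divfK ?gt_eqF//.
  by rewrite mulrCA -expRD; congr (_ * expR _); ring.
rewrite ge0_integralZl//=.
- by rewrite integral_exponential_pdf// mule1.
- by apply/measurable_EFinP; exact: measurable_exponential_pdf.
- by move=> x _; rewrite lee_fin exponential_pdf_ge0// ltW.
- by rewrite lee_fin divr_ge0// ltW.
Qed.

Definition poisson_weight (m : nat) (t : R) : R :=
  expR (- a * t) * (a * t) ^+ m / m`!%:R.

Lemma measurable_poisson_weight m : measurable_fun setT (poisson_weight m).
Proof.
apply: measurable_funM => //; apply: measurable_funM.
  by apply: measurableT_comp => //; exact: measurable_funM.
by apply: measurable_funX; exact: measurable_funM.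
Qed.

Lemma poisson_weight_ge0 m t : 0 <= t -> 0 <= poisson_weight m t.
Proof.
move=> t0; rewrite /poisson_weight !mulr_ge0// ?expR_ge0 ?exprn_ge0 ?invr_ge0//.
by rewrite mulr_ge0// ltW.
Qed.

(** A Poisson process with first event V has m.+1 events by time t when V <= t and
m events follow in the remaining time t - V. *)
Lemma Ex_exponential_poisson_weight (m : nat) (t : R) : 0 <= t ->
  unitf (fun x : R => ind (0 <= x <= t) * poisson_weight m (t - x)) ->
  Ex (fun w => ind (V w <= t) * poisson_weight m (t - V w)) = poisson_weight m.+1 t.
Proof.
move=> t0 uphi.
rewrite (@eq_Ex _ _ _ _ _ (fun w => ind (0 <= V w <= t) * poisson_weight m (t - V w))); last first.
  by move=> w; rewrite (ltW (posV w)).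
have [->|/eqP t'0] := eqVneq t 0.
  rewrite /poisson_weight !mulr0 expr0n/= mulr0 mul0r -[RHS](Ex_cst P 0).
  by apply: eq_Ex => w; rewrite (lt_geF (posV w)) andbF indF// mul0r.
have {t'0}tp : 0 < t by rewrite lt_neqAle t0 andbT eq_sym; exact/eqP.
apply: EFin_inj; rewrite (@Ex_exponential (fun x => ind (0 <= x <= t) * poisson_weight m (t - x)))//.
pose f (x : R) := expR (- a * t) * a * (a * (t - x)) ^+ m / m`!%:R.
pose c := expR (- a * t) / m.+1`!%:R.
pose F : R -> R := - (c *: ((a *: (cst t - id)) ^+ m.+1)).
have FE x : F x = - (c * (a * (t - x)) ^+ m.+1) by rewrite /F !fctE.
transitivity (\int[mu]_(x in `[0%R, t]) (f x)%:E)%E.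
  rewrite [RHS]integral_mkcond; apply: eq_integral => x _; rewrite patchE.
  case: ifPn; rewrite ?inE ?notin_setE/= in_itv/= => xt.
    rewrite indT// mul1r exponential_pdfE; last by case/andP : xt.
    congr (_%:E); rewrite /f /poisson_weight.
    have -> : expR (- a * t) = expR (- a * (t - x)) * expR (- a * x).
      by rewrite -expRD; congr expR; ring.
    ring.
  by rewrite indF ?mul0r//; exact/negP.
have dF (x : R) : is_derive x 1 F (f x).
  have m0 : m`!%:R != 0 :> R by rewrite pnatr_eq0 -lt0n fact_gt0.
  have m10 : m.+1%:R != 0 :> R by rewrite pnatr_eq0.
  rewrite /F; apply: is_derive_eq.
  rewrite /GRing.scale/= !fctE /f /c factS natrM /GRing.scale /=.
  have m1 : m%:R + 1 != 0 :> R by rewrite natr1.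
  have m1' : 1 + m%:R != 0 :> R by rewrite addrC.
  by field; rewrite ?m0 ?m1 ?m1' ?m10.
rewrite (@continuous_FTC2 _ f F)//.
- rewrite -EFinB; congr (_%:E); rewrite !FE /c /poisson_weight subrr subr0 mulr0 expr0n/=.
  by rewrite mulr0 oppr0 sub0r opprK mulrAC.
- apply: continuous_subspaceT => x.
  have -> : f = (expR (- a * t) * a / m`!%:R) *: ((a *: (cst t - id)) ^+ m).
    by apply/funext => y; rewrite /f !fctE /GRing.scale /=; ring.
  apply: differentiable_continuous; apply/derivable1_diffP.
  by apply: ex_derive.
- split => //.
  + apply: cvg_at_right_filter; apply: differentiable_continuous; apply/derivable1_diffP.
    by have [] := dF 0.
  + apply: cvg_at_left_filter; apply: differentiable_continuous; apply/derivable1_diffP.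
    by have [] := dF t.
- by move=> x _; rewrite derive1E; have [_ ->] := dF x.
Qed.

End exponential.

(** * Formal power series *)

(** Identities between convolutions of sequences become ring identities once
sequences are a commutative ring. *)
Definition fps (R : Type) : Type := nat -> R.

Section fps_ring.
Variable R : comNzRingType.
Implicit Types (a b c : fps R).

HB.instance Definition _ := GRing.Zmodule.copy (fps R) (nat -> R).

Definition fps_mul a b : fps R := fun n => \sum_(i < n.+1) a i * b (n - i)%N.
Definition fps_one : fps R := fun n => (n == 0%N)%:R.
Definition fps_trunc N a : {poly R} := \poly_(i < N) a i.

(** A coefficient of a product depends on finitely many coefficients only; through
truncation, the ring laws are those of polynomials. *)
Lemma fps_mul_poly a b n N : (n < N)%N -> fps_mul a b n = (fps_trunc N a * fps_trunc N b)`_n.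
Proof.
move=> nN; rewrite coefM /fps_mul; apply: eq_bigr => i _.
rewrite !coef_poly (leq_ltn_trans _ nN) ?(leq_ltn_trans _ nN)//.
  by rewrite leq_subr.
by rewrite -ltnS.
Qed.

Lemma fps_mul_trunc a b c n N : (n < N)%N ->
  fps_mul (fps_mul a b) c n = (fps_trunc N a * fps_trunc N b * fps_trunc N c)`_n.
Proof.
move=> nN; rewrite coefM /fps_mul; apply: eq_bigr => i _.
rewrite -(@fps_mul_poly _ _ i N); last by rewrite (leq_ltn_trans _ nN)// -ltnS.
by rewrite coef_poly (leq_ltn_trans _ nN)// leq_subr.
Qed.

Lemma fps_mulC : commutative fps_mul.
Proof.
by move=> a b; apply/funext => n; rewrite !(@fps_mul_poly _ _ n n.+1)// mulrC.
Qed.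

Lemma fps_mulA : associative fps_mul.
Proof.
move=> a b c; apply/funext => n.
rewrite fps_mulC !(@fps_mul_trunc _ _ _ n n.+1)//.
by rewrite mulrC mulrA.
Qed.

Lemma fps_mul1 : left_id fps_one fps_mul.
Proof.
move=> a; apply/funext => n; rewrite /fps_mul big_ord_recl /fps_one eqxx mul1r subn0.
by rewrite big1 ?addr0// => i _; rewrite mul0r.
Qed.

Lemma fps_mulDl : left_distributive fps_mul +%R.
Proof.
move=> a b c; apply/funext => n; rewrite /fps_mul -[RHS]/(_ + _) -big_split/=.
by apply: eq_bigr => i _; rewrite -mulrDl.
Qed.

Lemma fps_one_neq0 : fps_one != 0 :> fps R.
Proof.
apply/eqP => /(congr1 (fun f : nat -> R => f 0%N)).
by move/eqP; rewrite /fps_one eqxx oner_eq0.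
Qed.

HB.instance Definition _ := GRing.Zmodule_isComNzRing.Build (fps R)
  fps_mulA fps_mulC fps_mul1 fps_mulDl fps_one_neq0.

Lemma fpsME a b n : (a * b) n = \sum_(i < n.+1) a i * b (n - i)%N.
Proof. by []. Qed.
Lemma fpsDE a b n : (a + b) n = a n + b n. Proof. by []. Qed.
Lemma fpsNE a n : (- a) n = - a n. Proof. by []. Qed.
Lemma fps1E n : (1 : fps R) n = (n == 0%N)%:R. Proof. by []. Qed.

Definition fpsC (x : R) : fps R := fun n => if n is 0 then x else 0.
Definition fpsX : fps R := fun n => (n == 1%N)%:R.
Definition fps_ones : fps R := fun=> 1.

Lemma fpsCM x a n : (fpsC x * a) n = x * a n.
Proof.
rewrite fpsME big_ord_recl subn0 big1 ?addr0// => i _.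
by rewrite /fpsC/= mul0r.
Qed.

Lemma fpsXM a n : (fpsX * a) n = if n is m.+1 then a m else 0.
Proof.
rewrite fpsME big_ord_recl /fpsX/= mul0r add0r; case: n => [|n].
  by rewrite big_ord0.
rewrite big_ord_recl/= mul1r subn1/= big1 ?addr0// => i _.
by rewrite mul0r.
Qed.

Lemma fpsC_sub x y : fpsC (x - y) = fpsC x - fpsC y.
Proof. by apply/funext => -[|n] //; rewrite -[RHS]/(_ - _)/= subrr. Qed.

Lemma fpsC_mul x y : fpsC (x * y) = fpsC x * fpsC y.
Proof. by apply/funext => -[|n]; rewrite fpsCM//= mulr0. Qed.

Lemma fpsC1 : fpsC 1 = 1.
Proof. by apply/funext => -[|n]. Qed.

Lemma fps_onesM a n : (fps_ones * a) n = \sum_(i < n.+1) a i.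
Proof. by rewrite mulrC fpsME; apply: eq_bigr => i _; rewrite mulr1. Qed.

Lemma fps_onesK : fps_ones * (1 - fpsX) = 1.
Proof.
apply/funext => n; rewrite fps_onesM big_ord_recl.
rewrite -[(1 - fpsX) _]/(1 - 0) subr0; case: n => [|n].
  by rewrite big_ord0 addr0.
rewrite big_ord_recl -[(1 - fpsX) _]/(0 - 1) sub0r big1 ?addr0 ?subrr//.
by move=> i _; rewrite -[LHS]/(0 - 0) subr0.
Qed.

Lemma fps_pow_lt a m n : a 0%N = 0 -> (n < m)%N -> (a ^+ m) n = 0.
Proof.
move=> a0; elim: m n => // m IH n nm; rewrite exprS fpsME big1// => i _.
have [->|i0] := eqVneq (i : nat) 0%N; first by rewrite a0 mul0r.
rewrite IH ?mulr0//.
move: i i0 => [i /= ii]; rewrite -lt0n => i0; lia.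
Qed.

End fps_ring.

Section fps_inverse.
Variable R : fieldType.
Implicit Types a : fps R.

(** The first n coefficients of 1 / a. The list is kept because each coefficient is
computed from all the earlier ones. *)
Fixpoint fps_inv_seq a (n : nat) : seq R :=
  if n is m.+1 then let l := fps_inv_seq a m in
    rcons l (((m == 0%N)%:R - \sum_(i < m) a i.+1 * nth 0 l (m - i.+1)%N) / a 0%N)
  else [::].

Definition fps_inv a : fps R := fun n => nth 0 (fps_inv_seq a n.+1) n.

Lemma size_fps_inv_seq a n : size (fps_inv_seq a n) = n.
Proof. by elim: n => //= n IH; rewrite size_rcons IH. Qed.

Lemma nth_fps_inv_seq a n k : (k < n)%N -> nth 0 (fps_inv_seq a n) k = fps_inv a k.
Proof.
elim: n => // n IH; rewrite ltnS leq_eqVlt => /orP[/eqP->//|kn].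
by rewrite /= nth_rcons size_fps_inv_seq kn IH.
Qed.

Lemma fps_invK a : a 0%N != 0 -> a * fps_inv a = 1.
Proof.
move=> a0; apply/funext => n; rewrite fpsME big_ord_recl subn0.
rewrite {1}/fps_inv /= nth_rcons size_fps_inv_seq ltnn eqxx mulrC divfK//.
rewrite [X in _ + X](eq_bigr (fun i : 'I_n => a i.+1 * nth 0 (fps_inv_seq a n) (n - i.+1)%N)); last first.
  by move=> i _; rewrite /bump leq0n add1n nth_fps_inv_seq//; case: i => i /= ii; lia.
by rewrite subrK fps1E.
Qed.

End fps_inverse.

(** * Sums of power series *)

Section tannery.
Context {R : realType}.
Implicit Types (a b : fps R) (u m : nat -> R).

Lemma seriesEord u n : series u n = \sum_(i < n) u i.
Proof. by rewrite /series/= big_mkord. Qed.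

Lemma cvg_series_ge0 u (M : R) : (forall n, 0 <= u n) -> (forall n, \sum_(i < n) u i <= M) ->
  cvgn (series u).
Proof.
move=> u0 uM; apply: nondecreasing_is_cvgn.
  by apply: nondecreasing_series => n _ _; exact: u0.
by exists M => _ [n _ <-]; rewrite seriesEord.
Qed.

Lemma near_sum_le (T : nat -> nat -> R) (t : nat -> R) N (e : R) : 0 < e ->
  (forall i, T n i @[n --> \oo] --> t i) ->
  \forall n \near \oo, \sum_(i < N) `|T n i - t i| <= e.
Proof.
move=> e0 Tt; elim: N e e0 => [|N IH] e e0.
  by apply: nearW => n; rewrite big_ord0 ltW.
have e20 : 0 < e / 2 by rewrite divr_gt0.
have {}IH := IH _ e20.
have /cvgrPdist_le/(_ _ e20) HN := Tt N.
near=> n; rewrite big_ord_recr/= [leRHS](splitr e) lerD//.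
  by near: n.
by rewrite distrC; near: n.
Unshelve. all: by end_near. Qed.

(** Dominated convergence for sums whose number of terms grows along with the
terms. *)
Lemma tannery (T : nat -> nat -> R) (t m : nat -> R) :
  (forall n i, `|T n i| <= m i) -> cvgn (series m) ->
  (forall i, T n i @[n --> \oo] --> t i) ->
  (\sum_(i < n) T n i - \sum_(i < n) t i) @[n --> \oo] --> 0.
Proof.
move=> Tm cm Tt.
have m0 i : 0 <= m i by apply: le_trans (Tm 0%N i).
have tm i : `|t i| <= m i.
  by apply: (cvgr_to_le (cvg_norm (Tt i))); exact: nearW.
have e_N (e : R) : 0 < e -> exists N, forall n, (N <= n)%N -> \sum_(N <= i < n) m i <= e.
  move=> e0; have /cvgrPdist_le/(_ _ e0)[N _ HN] := cm.
  exists N => n Nn; have := HN N (leqnn N) => /=.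
  have nd : {homo series m : n m / (n <= m)%N >-> n <= m}.
    by apply: nondecreasing_series => k _ _; exact: m0.
  have le_lim := nondecreasing_cvgn_le nd cm.
  rewrite ger0_norm ?subr_ge0//; apply: le_trans.
  rewrite lerBrDl; apply: le_trans (le_lim n).
  by rewrite /series/= [leRHS](big_cat_nat (n := N)).
apply/cvgrPdist_le => e e0.
have e30 : 0 < e / 3 by rewrite divr_gt0.
have [N HN] := e_N _ e30.
near=> n.
rewrite sub0r normrN -sumrB; apply: le_trans (ler_norm_sum _ _ _) _.
rewrite -(big_mkord xpredT (fun i => `|T n i - t i|)) (big_cat_nat (n := N))//=; last first.
  by near: n; exists N.
have -> : e = e / 3 + (e / 3 + e / 3) by field.
apply: lerD.
  by rewrite big_mkord; near: n; exact: near_sum_le.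
have Nn : (N <= n)%N by near: n; exists N.
apply: (@le_trans _ _ (\sum_(N <= i < n) (m i + m i))).
  apply: ler_sum => i _; apply: le_trans (ler_normB _ _) _; exact: lerD.
by rewrite big_split/= lerD// HN.
Unshelve. all: by end_near. Qed.

Lemma triangle_sum (F : nat -> nat -> R) N :
  \sum_(n < N) \sum_(i < n.+1) F i (n - i)%N = \sum_(i < N) \sum_(j < N - i) F i j.
Proof.
elim: N => [|N IH]; first by rewrite !big_ord0.
rewrite big_ord_recr/= IH.
transitivity (\sum_(i < N.+1) (\sum_(j < N - i) F i j + F i (N - i)%N)).
  by rewrite big_split/=; congr (_ + _); rewrite big_ord_recr/= subnn big_ord0 addr0.
by apply: eq_bigr => i _; rewrite subSn ?big_ord_recr// -ltnS.
Qed.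

Definition summ (th : R) (a : fps R) (l : R) := series (fun k => th ^+ k * a k) @ \oo --> l.
Definition abssumm (th : R) (a : fps R) := exists M : R, forall n, \sum_(i < n) `|th ^+ i * a i| <= M.

Lemma fps_mul_sum th a b N : \sum_(n < N) th ^+ n * (a * b) n =
  \sum_(i < N) th ^+ i * a i * (\sum_(j < N - i) th ^+ j * b j).
Proof.
transitivity (\sum_(n < N) \sum_(i < n.+1) (th ^+ i * a i) * (th ^+ (n - i) * b (n - i)%N)).
  apply: eq_bigr => n _; rewrite fpsME mulr_sumr; apply: eq_bigr => i _.
  rewrite -[in th ^+ n](subnKC (ltnSE (ltn_ord i))) exprD; ring.
rewrite (triangle_sum (fun i j => (th ^+ i * a i) * (th ^+ j * b j))).
by apply: eq_bigr => i _; rewrite mulr_sumr.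
Qed.

Lemma abssumm_cvg th a : abssumm th a -> exists l, summ th a l.
Proof.
move=> [M HM]; apply/cvg_ex; apply: normed_cvg.
by apply: (@cvg_series_ge0 (fun k => `|th ^+ k * a k|) M) => // n; exact: normr_ge0.
Qed.

(** Only a converges absolutely. A partial sum of the Cauchy product is the sum of
the terms of a weighted by partial sums of b, and [tannery] applies. *)
Lemma mertens th a b al be : abssumm th a -> summ th a al -> summ th b be ->
  summ th (a * b) (al * be).
Proof.
move=> [M HM] sa sb.
pose B k := \sum_(j < k) th ^+ j * b j.
have Bb : B k @[k --> \oo] --> be.
  by rewrite (_ : B = series (fun k => th ^+ k * b k))//; apply/funext => k; rewrite seriesEord.
have /cvg_seq_bounded[K [_ HK]] : cvgn B by apply/cvg_ex; exists be.
have {}HK n : `|B n| <= `|K| + 1.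
  by apply: (HK (`|K| + 1)) => //; rewrite (le_lt_trans (ler_norm _))// ltrDl.
have := @tannery (fun N i => th ^+ i * a i * B (N - i)%N) (fun i => th ^+ i * a i * be)
  (fun i => `|th ^+ i * a i| * (`|K| + 1)) _ _ _.
move=> /(_ _ _ _)H.
rewrite /summ (_ : series _ = fun N => (\sum_(i < N) th ^+ i * a i * B (N - i)%N -
  \sum_(i < N) th ^+ i * a i * be) + (\sum_(i < N) th ^+ i * a i) * be); last first.
  by apply/funext => N; rewrite seriesEord fps_mul_sum -mulr_suml subrK.
rewrite -[X in _ --> X]add0r; apply: cvgD.
  apply: H.
  - by move=> n i; rewrite normrM ler_wpM2l.
  - apply: (@cvg_series_ge0 (fun i => `|th ^+ i * a i| * (`|K| + 1)) (M * (`|K| + 1))); first by move=> n; rewrite mulr_ge0// addr_ge0.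
    by move=> n; rewrite -mulr_suml ler_wpM2r// addr_ge0.
  - by move=> i; apply: cvgMr; rewrite (cvg_centern i).
apply: cvgMl.
by rewrite (_ : (fun N => _) = series (fun k => th ^+ k * a k))//; apply/funext => k; rewrite seriesEord.
Qed.

(** The bound is explicit because powers of a series bounded by 1 have to stay
bounded by 1, uniformly in the exponent. *)
Definition bndsumm (th : R) (a : fps R) (M : R) := forall n, \sum_(i < n) `|th ^+ i * a i| <= M.

Lemma bndsummM th a b M K : bndsumm th a M -> bndsumm th b K -> bndsumm th (a * b) (M * K).
Proof.
move=> HM HK n.
pose a' : fps R := fun i => `|a i|; pose b' : fps R := fun i => `|b i|.
have HM' k : \sum_(i < k) `|th| ^+ i * a' i <= M.
  by apply: le_trans (HM k); apply: ler_sum => i _; rewrite normrM normrX.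
have HK' k : \sum_(i < k) `|th| ^+ i * b' i <= K.
  by apply: le_trans (HK k); apply: ler_sum => i _; rewrite normrM normrX.
have K0 : 0 <= K by apply: le_trans (HK 0%N); rewrite big_ord0.
apply: (@le_trans _ _ (\sum_(i < n) `|th| ^+ i * (a' * b') i)).
  apply: ler_sum => i _; rewrite normrM normrX ler_wpM2l ?exprn_ge0// !fpsME.
  by apply: le_trans (ler_norm_sum _ _ _) _; apply: ler_sum => j _; rewrite normrM.
rewrite fps_mul_sum; apply: (@le_trans _ _ (\sum_(i < n) `|th| ^+ i * a' i * K)).
  by apply: ler_sum => i _; apply: ler_wpM2l; [rewrite mulr_ge0 ?exprn_ge0// normr_ge0|exact: HK'].
by rewrite -mulr_suml ler_wpM2r.
Qed.

Lemma summ1 th : summ th 1 1.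
Proof.
rewrite /summ; apply: cvg_near_cst; exists 1%N => // n /= n1.
rewrite seriesEord; case: n n1 => // n _; rewrite big_ord_recl expr0 mul1r fps1E big1 ?addr0// => i _.
by rewrite fps1E mulr0.
Qed.

Lemma bndsumm1 th : bndsumm th 1 1.
Proof.
move=> [|n]; first by rewrite big_ord0.
rewrite big_ord_recl expr0 mul1r fps1E normr1 big1 ?addr0// => i _.
by rewrite fps1E mulr0 normr0.
Qed.

Lemma summX th a al (m : nat) : abssumm th a -> summ th a al -> summ th (a ^+ m) (al ^+ m).
Proof.
move=> aa sa; elim: m => [|m IH]; first exact: summ1.
by rewrite !exprS; apply: mertens.
Qed.

Lemma bndsummX th a (m : nat) : bndsumm th a 1 -> bndsumm th (a ^+ m) 1.
Proof.
move=> ba; elim: m => [|m IH]; first exact: bndsumm1.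
by rewrite exprS -[X in bndsumm _ _ X](mulr1 1); apply: bndsummM.
Qed.

(** If dd k is the first nonzero coefficient, the terms after it are O(th^(k+1)) as
th tends to 0, by comparison with a geometric series at radius c / 2. *)
Lemma summ_uniq_zero (c : R) (dd : fps R) : 0 < c ->
  (forall th, `|th| < c -> summ th dd 0) -> forall k, dd k = 0.
Proof.
move=> c0 H k; elim/ltn_ind: k => k IH; apply/eqP; apply/negPn/negP => dk.
pose r := c / 2.
have r0 : 0 < r by rewrite divr_gt0.
have rc : r < c by rewrite ltr_pdivrMr// ltr_pMr// ltr1n.
have : (fun n => r ^+ n * dd n) @ \oo --> 0.
  apply: cvg_series_cvg_0; apply/cvg_ex; exists 0; apply: H; by rewrite gtr0_norm.
move=> /cvgP/cvg_seq_bounded[K [_ HK]].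
pose M := `|K| + 1.
have {}HK n : `|r ^+ n * dd n| <= M.
  by apply: (HK M) => //; rewrite /M (le_lt_trans (ler_norm _))// ltrDl.
have M0 : 0 < M by rewrite /M ltr_wpDl.
have ndk : 0 < `|dd k| by rewrite normr_gt0.
have key th : 0 < th <= r / 2 -> `|dd k| <= 2 * M * (th / r ^+ k.+1).
  move=> /andP[th0 thr].
  have q0 : 0 < th / r by rewrite divr_gt0.
  have q1 : th / r <= 1 / 2 by rewrite ler_pdivrMr//; apply: le_trans thr _; lra.
  have bound N : (k < N)%N -> `|th ^+ k * dd k - \sum_(n < N) th ^+ n * dd n| <= 2 * M * (th / r) ^+ k.+1.
    move=> kN; rewrite -(big_mkord xpredT (fun n => th ^+ n * dd n)) (big_cat_nat (n := k))//=; last exact: ltnW.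
    rewrite big_nat_cond big1 ?add0r; last by move=> i /andP[/andP[_ ik] _]; rewrite IH// mulr0.
    rewrite big_ltn// opprD addrA subrr add0r normrN.
    apply: le_trans (ler_norm_sum _ _ _) _.
    have geo p : \sum_(k.+1 <= i < k.+1 + p) (th / r) ^+ i <= 2 * (th / r) ^+ k.+1 - 2 * (th / r) ^+ (k.+1 + p).
      elim: p => [|p IHp]; first by rewrite addn0 big_geq// subrr.
      rewrite addnS big_nat_recr/=; last by rewrite leq_addr.
      have := exprn_ge0 (k.+1 + p) (ltW q0).
      have : (th / r) ^+ (k.+1 + p).+1 <= 1 / 2 * (th / r) ^+ (k.+1 + p).
        by rewrite exprS ler_wpM2r// exprn_ge0// ltW.
      lra.
    apply: (@le_trans _ _ (\sum_(k.+1 <= i < N) M * (th / r) ^+ i)).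
      apply: ler_sum => i _; rewrite expr_div_n.
      have := HK i; rewrite !normrM !normrX (gtr0_norm r0) (gtr0_norm th0) => HKi.
      rewrite mulrCA ler_wpM2l ?exprn_ge0 ?(ltW th0)//.
      by rewrite ler_pdivlMr ?exprn_gt0// mulrC.
    rewrite -mulr_sumr -mulrA mulrCA ler_wpM2l ?(ltW M0)//.
    rewrite -(subnKC kN); apply: le_trans (geo _) _.
    by rewrite gerBl mulr_ge0// exprn_ge0// ltW.
  have thc : `|th| < c by rewrite gtr0_norm// (le_lt_trans thr)// (lt_trans _ rc)// ltr_pdivrMr// ltr_pMr// ltr1n.
  have : `|th ^+ k * dd k| <= 2 * M * (th / r) ^+ k.+1.
    have lim : `|th ^+ k * dd k - \sum_(n < N) th ^+ n * dd n| @[N --> \oo] --> `|th ^+ k * dd k - 0|.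
      apply: cvg_norm; apply: cvgB; first exact: cvg_cst.
      have := H th thc; rewrite /summ.
      by rewrite (_ : series _ = fun N => \sum_(n < N) th ^+ n * dd n)//; apply/funext => N; rewrite seriesEord.
    rewrite subr0 in lim; apply: cvgr_to_le lim _.
    by near=> N; apply: bound; near: N; exists k.+1.
  rewrite normrM normrX (gtr0_norm th0) expr_div_n [th ^+ k.+1]exprS => h.
  rewrite -(ler_pM2l (exprn_gt0 k th0)); apply: le_trans h _.
  by rewrite le_eqVlt; apply/orP; left; apply/eqP; ring.
(* small enough for the bound of key to be at most half of |dd k| *)
pose th := Order.min (r / 2) (`|dd k| * r ^+ k.+1 / (4 * M)).
have rk0 : 0 < r ^+ k.+1 by exact: exprn_gt0.
have th0 : 0 < th by rewrite lt_min !divr_gt0 ?mulr_gt0.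
have := key th; rewrite th0 ge_min lexx/= => /(_ isT).
have : th <= `|dd k| * r ^+ k.+1 / (4 * M) by rewrite ge_min lexx orbT.
rewrite ler_pdivlMr ?mulr_gt0// -(@ler_pdivrMr _ (r ^+ k.+1))// => h1 h2.
have : `|dd k| <= `|dd k| / 2.
  apply: le_trans h2 _; move: h1; rewrite mulrAC; lra.
move: ndk; lra.
Unshelve. all: by end_near. Qed.

Lemma summ_uniq (c : R) (a b : fps R) (l : R -> R) : 0 < c ->
  (forall th, `|th| < c -> summ th a (l th)) ->
  (forall th, `|th| < c -> summ th b (l th)) -> a = b.
Proof.
move=> c0 sa sb; apply/funext => k; apply/eqP; rewrite -subr_eq0; apply/eqP.
apply: (@summ_uniq_zero c (a - b)) => // th thc.
rewrite /summ (_ : series _ = (series (fun k => th ^+ k * a k) \- series (fun k => th ^+ k * b k))).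
  by rewrite -(subrr (l th)); apply: cvgB; [exact: sa|exact: sb].
by apply/funext => N /=; rewrite !seriesEord -sumrB; apply: eq_bigr => i _; rewrite -mulrBr.
Qed.

End tannery.

Section summ_linear.
Context {R : realType}.
Implicit Types (a b : fps R).

Lemma summD th a b al be : summ th a al -> summ th b be -> summ th (a + b) (al + be).
Proof.
move=> ha hb; rewrite /summ (_ : series _ = fun n => series (fun k => th ^+ k * a k) n + series (fun k => th ^+ k * b k) n).
  exact: cvgD.
by apply/funext => n; rewrite !seriesEord -big_split/=; apply: eq_bigr => i _; rewrite fpsDE mulrDr.
Qed.

Lemma summZ (th c : R) a al : summ th a al -> summ th (fpsC c * a) (c * al).
Proof.
move=> ha; rewrite /summ (_ : series _ = fun n => c * series (fun k => th ^+ k * a k) n).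
  exact: cvgMr.
apply/funext => n; rewrite !seriesEord mulr_sumr; apply: eq_bigr => i _.
by rewrite fpsCM; ring.
Qed.

Lemma summC th (c : R) : summ th (fpsC c) c.
Proof. by have := @summZ th c _ _ (summ1 th); rewrite !mulr1. Qed.

Lemma summXvar (th : R) : summ th (fpsX R) th.
Proof.
rewrite /summ; apply: cvg_near_cst; exists 2%N => // n /= n2.
rewrite seriesEord (bigD1 (Ordinal n2))//= /fpsX expr1 mulr1 big1 ?addr0// => i ih.
by case: eqVneq => [e|_]; rewrite ?mulr0//; move: ih; rewrite -val_eqE/= e.
Qed.

Lemma summ_unique th a al be : summ th a al -> summ th a be -> al = be.
Proof. by move=> ha hb; apply: cvg_unique ha hb. Qed.

Lemma summ_le th th' a al be : (forall i, 0 <= a i) -> 0 <= th <= th' -> summ th a al -> summ th' a be -> al <= be.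
Proof.
move=> a0 /andP[t0 tt] ha hb; apply: ler_cvg_to ha hb _; apply: nearW => n.
by rewrite !seriesEord; apply: ler_sum => i _; rewrite ler_wpM2r// lerXn2r// nnegrE// (le_trans t0).
Qed.

End summ_linear.

Lemma bounded_abssumm (R : realType) (a : fps R) (th : R) : (forall i, `|a i| <= 1) -> `|th| < 1 -> abssumm th a.
Proof.
move=> a1 th1; exists (1 - `|th|)^-1 => n.
apply: le_trans (_ : \sum_(i < n) `|th| ^+ i <= _).
  by apply: ler_sum => i _; rewrite normrM normrX ler_piMr// exprn_ge0.
have h : 0 < 1 - `|th| by rewrite subr_gt0.
rewrite -(ler_pM2l h) divff ?gt_eqF//.
have -> : (1 - `|th|) * \sum_(i < n) `|th| ^+ i = 1 - `|th| ^+ n.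
  by rewrite -[1 - `|th|]opprB mulNr -subrX1 opprB.
by rewrite gerBl exprn_ge0.
Qed.

(** * Growth of 1 / (psi - X) and the resolvent identities *)

Section scale.
Context {R : realType}.
Variables (psi : fps R) (c psi1 : R).
Hypotheses (c0 : 0 < c) (c1 : c < 1).
Hypotheses (psi_ge0 : forall i, 0 <= psi i) (psi_c : summ c psi c).
Hypotheses (psi_le : forall n, \sum_(i < n) psi i <= psi1) (psi1_lt1 : psi1 < 1).

(* H_j is the sum of psi_i c^(i-1-j) over i > j, rewritten by means of psi(c) = c *)
Let H : fps R := fun j => (c - \sum_(i < j.+1) c ^+ i * psi i) / c ^+ j.+1.

Let cpos k : 0 < c ^+ k. Proof. exact: exprn_gt0. Qed.

Let psi_term i : 0 <= c ^+ i * psi i.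
Proof. by rewrite mulr_ge0// ltW. Qed.

Let psi_partial n : \sum_(i < n) c ^+ i * psi i <= c.
Proof.
rewrite -(seriesEord (fun k => c ^+ k * psi k)).
have nd : {homo series (fun k => c ^+ k * psi k) : n m / (n <= m)%N >-> n <= m}.
  by apply: nondecreasing_series => k _ _.
have := nondecreasing_cvgn_le nd (cvgP _ psi_c) n.
by rewrite (cvg_lim _ psi_c).
Qed.

Let H_ge0 j : 0 <= H j.
Proof. by rewrite /H; apply: divr_ge0; [rewrite subr_ge0; exact: psi_partial|exact: ltW]. Qed.

Let H_factor : (fpsC c - fpsX R) * (1 - H) = psi - fpsX R.
Proof.
rewrite mulrBr mulr1 mulrBl; apply/funext => n.
rewrite -[LHS]/((fpsC c n - fpsX R n) - ((fpsC c * H) n - (fpsX R * H) n)).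
rewrite -[RHS]/(psi n - fpsX R n) fpsCM fpsXM; case: n => [|n].
  rewrite /fpsX/= /H big_ord_recl big_ord0 addr0 expr0 mul1r expr1.
  by field; rewrite gt_eqF.
rewrite /= /H big_ord_recr/= [c ^+ n.+2]exprS.
set S := \sum_(i < n.+1) _; set E := c ^+ n.+1.
have e0 : E != 0 by rewrite /E gt_eqF.
have e1 : c != 0 by rewrite gt_eqF.
by field; rewrite e0 e1.
Qed.

Let H_tail n : H n <= psi1 - \sum_(i < n.+1) psi i.
Proof.
rewrite ler_pdivrMr//.
have lim : (series (fun k => c ^+ k * psi k) N - \sum_(i < n.+1) c ^+ i * psi i) @[N --> \oo] -->
    c - \sum_(i < n.+1) c ^+ i * psi i.
  by apply: cvgB; [exact: psi_c|exact: cvg_cst].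
apply: (cvgr_to_le lim).
near=> N.
have nN : (n.+1 <= N)%N by near: N; exists n.+1.
rewrite /series/= -(big_mkord xpredT (fun i => c ^+ i * psi i)) (big_cat_nat (n := n.+1))//=.
rewrite addrAC subrr add0r.
apply: (@le_trans _ _ (\sum_(n.+1 <= i < N) c ^+ n.+1 * psi i)).
  apply: ler_sum_nat => i /andP[ni _]; rewrite ler_wpM2r//.
  by apply: ler_wiXn2l => //; exact: ltW.
rewrite -mulr_sumr mulrC ler_wpM2r ?(ltW (cpos _))//.
rewrite lerBrDl; apply: le_trans (psi_le N).
by rewrite -!(big_mkord xpredT psi) [leRHS](big_cat_nat (n := n.+1)).
Unshelve. all: by end_near. Qed.

Let H_sum n : \sum_(i < n) H i <= (psi1 - c) / (1 - c).
Proof.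
have c10 : 0 < 1 - c by rewrite subr_gt0.
have psi1c : c <= psi1.
  apply: le_trans (_ : \sum_(i < n.+1) psi i + H n <= _); last by rewrite -lerBrDl H_tail.
  have -> : H n = (c - \sum_(i < n.+1) c ^+ i * psi i) / c ^+ n.+1 by [].
  apply: (@le_trans _ _ (\sum_(i < n.+1) c ^+ i * psi i + (c - \sum_(i < n.+1) c ^+ i * psi i))).
    by rewrite subrKC.
  apply: lerD.
    apply: ler_sum => i _; rewrite ler_piMl// exprn_ile1//; exact: ltW.
  have e1 : c ^+ n.+1 <= 1 by rewrite exprn_ile1// ltW.
  by rewrite ler_pdivlMr// ler_piMr// subr_ge0; exact: psi_partial.
rewrite ler_pdivlMr//.
case: n => [|n]; first by rewrite big_ord0 mul0r subr_ge0.
suff E : (\sum_(i < n.+1) H i) * (1 - c) = \sum_(i < n.+1) psi i - c + H n.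
  by rewrite E addrAC lerD2r -lerBrDl H_tail.
elim: n => [|n IH].
  rewrite !big_ord_recl !big_ord0 !addr0 /H big_ord_recl big_ord0 addr0 expr0 mul1r expr1 /=.
  by field; rewrite gt_eqF.
rewrite big_ord_recr/= mulrDl IH [in RHS]big_ord_recr/=.
suff : H n = c * H n.+1 + psi n.+1 by move=> ->; ring.
have := congr1 (fun f : nat -> R => f n.+1) H_factor.
rewrite mulrBr mulr1 mulrBl -[LHS]/((fpsC c n.+1 - fpsX R n.+1) - ((fpsC c * H) n.+1 - (fpsX R * H) n.+1)).
rewrite -[X in _ = X]/(psi n.+1 - fpsX R n.+1) fpsCM fpsXM /=.
by move=> /(congr1 (fun y => y + fpsX R n.+1)); rewrite subrK => <-; ring.
Qed.

Let h := (psi1 - c) / (1 - c).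

Let h_lt1 : h < 1.
Proof. by rewrite ltr_pdivrMr ?subr_gt0// mul1r ltrD2r. Qed.

Let U : fps R := fps_inv (1 - H).

Let H0_lt1 : H 0%N < 1.
Proof. by apply: le_lt_trans h_lt1; have := H_sum 1; rewrite big_ord_recl big_ord0 addr0. Qed.

Let UE : (1 - H) * U = 1.
Proof. by apply: fps_invK; rewrite -[X in X != 0]/(1 - H 0%N) subr_eq0 gt_eqF. Qed.

Let U_rec : U = 1 + H * U.
Proof. by rewrite -UE; ring. Qed.

Let U_ge0 n : 0 <= U n.
Proof.
elim/ltn_ind: n => n IH.
have E0 : U n = (n == 0%N)%:R + (H 0%N * U n + \sum_(i < n) H i.+1 * U (n - i.+1)%N).
  have := congr1 (fun f : nat -> R => f n) U_rec.
  by rewrite -[X in _ = X -> _]/((n == 0%N)%:R + (H * U) n) fpsME big_ord_recl subn0.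
have E : (1 - H 0%N) * U n = (n == 0%N)%:R + \sum_(i < n) H i.+1 * U (n - i.+1)%N.
  by rewrite mulrBl mul1r {1}E0; ring.
rewrite -(pmulr_rge0 _ (_ : 0 < 1 - H 0%N)) ?subr_gt0// E addr_ge0//.
apply: sumr_ge0 => i _; rewrite mulr_ge0// IH//.
by case: i => i /= ii; lia.
Qed.

Let U_sum n : \sum_(i < n) U i <= (1 - h)^-1.
Proof.
rewrite -[leRHS]mul1r ler_pdivlMr ?subr_gt0//.
have : \sum_(i < n) U i <= 1 + h * \sum_(i < n) U i; last by rewrite mulrBr mulr1 mulrC lerBlDr.
have -> : forall y, (\sum_(i < n) U i <= y) = (\sum_(i < n) (i == 0%N :> nat)%:R + \sum_(i < n) 1 ^+ i * (H * U) i <= y).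
  move=> y; congr (_ <= _); rewrite -big_split/=; apply: eq_bigr => i _.
  have := congr1 (fun f : nat -> R => f i) U_rec.
  by rewrite -[X in _ = X -> _]/((i == 0%N :> nat)%:R + (H * U) i) expr1n mul1r.
apply: lerD.
  case: n => [|n]; first by rewrite big_ord0.
  by rewrite big_ord_recl big1 ?addr0.
rewrite fps_mul_sum.
apply: (@le_trans _ _ (\sum_(i < n) H i * \sum_(i < n) U i)).
  apply: ler_sum => i _; rewrite expr1n mul1r; apply: ler_wpM2l; first exact: H_ge0.
  rewrite (eq_bigr (fun j : 'I_(n - i) => U j)); last by move=> j _; rewrite expr1n mul1r.
  rewrite -!(big_mkord xpredT U) [leRHS](big_cat_nat (n := (n - i)%N)) ?leq_subr//=.
  by rewrite lerDl sumr_ge0.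
by rewrite -mulr_suml ler_wpM2r ?sumr_ge0// H_sum.
Qed.

Let invc : fps R := fun k => c ^- k.+1.

Let invcE : (fpsC c - fpsX R) * invc = 1.
Proof.
rewrite mulrBl; apply/funext => n; rewrite -[LHS]/((fpsC c * invc) n - (fpsX R * invc) n).
rewrite fpsCM fpsXM; case: n => [|n]; rewrite /invc.
  by rewrite expr1 divff ?subr0// gt_eqF.
by rewrite [in X in X - _]exprS invfM mulrA divff ?mul1r ?subrr// gt_eqF.
Qed.

(** As psi(c) = c, psi - X is divisible by c - X: it is (c - X)(1 - H), and H has
nonnegative coefficients of total mass at most (psi1 - c) / (1 - c) < 1. Hence
1 / (1 - H) is summable, and W grows like 1 / (c - X). *)
Lemma scale_exists : exists W : fps R, W * (psi - fpsX R) = 1 /\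
  exists C : R, 0 <= C /\ forall k, `|W k| <= C * c ^- k.+1.
Proof.
exists (invc * U); split.
  by rewrite -H_factor mulrACA -mulrA mulrCA mulrA invcE mul1r mulrC UE.
exists (1 - h)^-1; split; first by rewrite invr_ge0 subr_ge0 ltW.
move=> k; rewrite ger0_norm; last first.
  rewrite fpsME; apply: sumr_ge0 => i _; apply: mulr_ge0; last exact: U_ge0.
  by rewrite /invc invr_ge0; exact: ltW.
rewrite mulrC fpsME.
apply: (@le_trans _ _ (\sum_(i < k.+1) U i * c ^- k.+1)).
  apply: ler_sum => i _; rewrite ler_wpM2l// /invc lef_pV2 ?posrE//.
  by apply: ler_wiXn2l; [exact: ltW|exact: ltW|rewrite ltnS leq_subr].
by rewrite -mulr_suml ler_wpM2r ?U_sum// invr_ge0 ltW.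
Qed.

End scale.

Section growth.
Context {R : realType}.
Variables (W : fps R) (c C : R).
Hypotheses (c0 : 0 < c) (c1 : c < 1) (C0 : 0 <= C).
Hypothesis HW : forall k, `|W k| <= C * c ^- k.+1.

(** The convolution of a bounded sequence with c^(-k-1) is a geometric sum dominated
by its last term, as c < 1. *)
Lemma growthM (F : fps R) (K : R) : 0 <= K -> (forall i, `|F i| <= K) ->
  forall k, `|(F * W) k| <= K * C / (1 - c) * c ^- k.+1.
Proof.
move=> K0 FK k; rewrite fpsME; apply: le_trans (ler_norm_sum _ _ _) _.
apply: (@le_trans _ _ (\sum_(i < k.+1) K * C * c ^- k.+1 * c ^+ i)).
  apply: ler_sum => i _; rewrite normrM -!mulrA; apply: ler_pM => //.
  apply: le_trans (HW _) _; rewrite ler_wpM2l//.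
  have -> : c ^+ k.+1 = c ^+ (k - i).+1 * c ^+ i.
    by rewrite -exprD; congr (_ ^+ _); case: i => i /= ii; lia.
  by rewrite invfM -mulrA mulVf ?mulr1// gt_eqF// exprn_gt0.
rewrite -mulr_sumr mulrAC ler_wpM2r ?invr_ge0 ?exprn_ge0 ?(ltW c0)//.
rewrite ler_wpM2l ?mulr_ge0//.
rewrite -[leRHS]mul1r ler_pdivlMr ?subr_gt0//.
have E n : (\sum_(i < n) c ^+ i) * (1 - c) = 1 - c ^+ n.
  elim: n => [|n IH]; first by rewrite big_ord0 mul0r expr0 subrr.
  by rewrite big_ord_recr/= mulrDl IH exprS; ring.
by rewrite E gerBl exprn_ge0// ltW.
Qed.

Lemma growth_abssumm th : `|th| < c -> abssumm th W.
Proof.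
move=> thc; exists (C / c / (1 - `|th| / c)) => n.
have q1 : `|th| / c < 1 by rewrite ltr_pdivrMr// mul1r.
have q0 : 0 <= `|th| / c by rewrite divr_ge0// ltW.
apply: (@le_trans _ _ (\sum_(i < n) C / c * (`|th| / c) ^+ i)).
  apply: ler_sum => i _; rewrite normrM normrX expr_div_n.
  apply: le_trans (ler_wpM2l (exprn_ge0 _ (normr_ge0 th)) (HW i)) _.
  rewrite exprSr invfM le_eqVlt; apply/orP; left; apply/eqP; ring.
rewrite -mulr_sumr ler_wpM2l ?divr_ge0 ?(ltW c0)//.
rewrite -[leRHS]mul1r ler_pdivlMr ?subr_gt0//.
have E m : (\sum_(i < m) (`|th| / c) ^+ i) * (1 - `|th| / c) = 1 - (`|th| / c) ^+ m.
  elim: m => [|m IH]; first by rewrite big_ord0 mul0r expr0 subrr.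
  by rewrite big_ord_recr/= mulrDl IH exprS; ring.
by rewrite E gerBl exprn_ge0.
Qed.

Lemma growth_geometric (lam : R) j : 0 <= lam -> lam < c ->
  lam ^+ n * W (n + j)%N @[n --> \oo] --> 0.
Proof.
move=> l0 lc; apply/norm_cvg0P.
have q1 : lam / c < 1 by rewrite ltr_pdivrMr// mul1r.
have q0 : 0 <= lam / c by rewrite divr_ge0// ltW.
apply: (@squeeze_cvgr _ _ _ _ (fun=> 0) (fun n => C * c ^- j.+1 * (lam / c) ^+ n)).
- apply: nearW => n; rewrite normr_ge0/= normrM normrX ger0_norm//.
  apply: le_trans (ler_wpM2l (exprn_ge0 _ l0) (HW _)) _.
  rewrite expr_div_n -addnS exprD invfM le_eqVlt; apply/orP; left; apply/eqP; ring.
- exact: cvg_cst.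
- rewrite -[X in _ --> X](mulr0 (C * c ^- j.+1)); apply: cvgMr.
  by apply: cvg_expr; rewrite ger0_norm.
Qed.

End growth.

Section resolvent_algebra.
Context {R : realType}.
Variables (lam : R) (f psi W rho : fps R).
Hypothesis psiE : psi = fpsC lam + fpsC (1 - lam) * f.
Hypothesis WE : W * (psi - fpsX R) = 1.
Hypothesis lam1 : 1 - lam != 0.

Local Notation X := (fpsX R).
Local Notation e := (fps_ones R).

(** With W = 1 / (psi - X) this is the generating function of the sequence Q. *)
Definition resolvent_series (fx : fps R) : fps R := fpsC (1 - lam) * fx * W.
Definition resolvA_series (fx : fps R) : fps R :=
  rho * (e - fpsC (1 - lam)^-1 * resolvent_series fx).
(** The solution M of (X - lam) M = (1 - lam) A_0, that is of
M_(j-1) = (1 - lam) A_0^j + lam M_j with M_(-1) = 0. The means E A_0^(delta + j)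
satisfy this relation, by splitting according to delta = 1 or delta > 1. *)
Definition meanA_series : fps R := fpsC (1 - lam) * rho * e * (f - 1) * W.

Let C1 : fpsC (1 - lam) = 1 - fpsC lam. Proof. by rewrite fpsC_sub fpsC1. Qed.
Let C1V : fpsC (1 - lam)^-1 * fpsC (1 - lam) = 1.
Proof. by rewrite -fpsC_mul mulVf// fpsC1. Qed.

Let factor : (X - fpsC lam) * (f - 1) = (psi - X) - f * (1 - X).
Proof. by rewrite psiE C1; ring. Qed.

Lemma meanA_shift : (X - fpsC lam) * meanA_series = fpsC (1 - lam) * resolvA_series f.
Proof.
rewrite /meanA_series /resolvA_series /resolvent_series.
transitivity (fpsC (1 - lam) * rho * e * W * ((X - fpsC lam) * (f - 1))); first by ring.
rewrite factor.
transitivity (fpsC (1 - lam) * rho * (e * (W * (psi - X)) - f * W * (e * (1 - X)))); first by ring.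
rewrite WE fps_onesK.
transitivity (fpsC (1 - lam) * rho * (e - (fpsC (1 - lam)^-1 * fpsC (1 - lam)) * (f * W))).
  by rewrite C1V; ring.
by ring.
Qed.

(** One service: the coefficient of X^i in rho (1 - fx) is the probability that the
clock rings during the service, after i arrivals, and the coefficient in fx is
the probability that the service ends first, with i arrivals. *)
Lemma resolvA_renewal (fx : fps R) :
  resolvA_series fx = e * (rho * (1 - fx)) + fx * meanA_series.
Proof.
rewrite /meanA_series /resolvA_series /resolvent_series.
have -> : fx * (fpsC (1 - lam) * rho * e * (f - 1) * W) =
   rho * fx * (e * W * (fpsC (1 - lam) * (f - 1))) by ring.
have -> : fpsC (1 - lam) * (f - 1) = (psi - X) - (1 - X) by rewrite psiE C1; ring.
have -> : e * W * ((psi - X) - (1 - X)) = e * (W * (psi - X)) - W * (e * (1 - X)) by ring.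
rewrite WE fps_onesK.
transitivity (rho * (e - (fpsC (1 - lam)^-1 * fpsC (1 - lam)) * (fx * W))); first by ring.
by rewrite C1V; ring.
Qed.

End resolvent_algebra.

(** * Compound Poisson distributions *)

Section compound_pmf.
Context {R : realType}.
Variables (mu : R) (a : fps R).
Hypotheses (mu0 : 0 < mu) (a0 : a 0%N = 0) (a_ge0 : forall i, 0 <= a i).
Hypothesis a_sum : forall n, \sum_(i < n) a i <= 1.

(** Probability of i customers by time t: batches are not empty, so at most i of them
count. The value 0 at negative times is what [exponential_memoryless] asks for. *)
Definition compound_pmf (i : nat) (t : R) : R :=
  ind (0 <= t) * \sum_(m < i.+1) poisson_weight mu m t * (a ^+ m) i.

Lemma poisson_weight_sum t n : 0 <= t -> \sum_(m < n) poisson_weight mu m t <= 1.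
Proof.
move=> t0.
have x0 : 0 <= mu * t by rewrite mulr_ge0// ltW.
have -> : \sum_(m < n) poisson_weight mu m t = expR (- mu * t) * \sum_(m < n) exp_coeff (mu * t) m.
  by rewrite mulr_sumr; apply: eq_bigr => m _; rewrite /poisson_weight /exp_coeff/= mulrA.
have -> : 1 = expR (- mu * t) * expR (mu * t) by rewrite -expRD mulNr addNr expR0.
rewrite ler_wpM2l ?expR_ge0// -seriesEord.
apply: nondecreasing_cvgn_le; last exact: is_cvg_series_exp_coeff.
by apply: nondecreasing_series => m _ _; exact: exp_coeff_ge0.
Qed.

Lemma poisson_weight_le1 t m : 0 <= t -> poisson_weight mu m t <= 1.
Proof.
move=> t0; apply: le_trans (poisson_weight_sum m.+1 t0).
rewrite big_ord_recr/= lerDr; apply: sumr_ge0 => i _.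
exact: poisson_weight_ge0.
Qed.

Lemma compound_bnd th : `|th| <= 1 -> bndsumm th a 1.
Proof.
move=> th1 n; apply: le_trans (a_sum n); apply: ler_sum => i _.
by rewrite normrM normrX (ger0_norm (a_ge0 i)) ler_piMl ?a_ge0 ?exprn_ile1.
Qed.

Lemma pow_ge0 m i : 0 <= (a ^+ m) i.
Proof.
elim: m i => [|m IH] i; first by rewrite expr0 fps1E.
by rewrite exprS fpsME; apply: sumr_ge0 => j _; rewrite mulr_ge0.
Qed.

Lemma pow_le1 m i : (a ^+ m) i <= 1.
Proof.
have n1 : `|1 : R| <= 1 by rewrite normr1.
have := bndsummX m (compound_bnd n1) i.+1; apply: le_trans.
rewrite big_ord_recr/= expr1n mul1r (ger0_norm (pow_ge0 _ _)) lerDr.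
by apply: sumr_ge0.
Qed.

Lemma compound_pmf_neg i t : t < 0 -> compound_pmf i t = 0.
Proof. by move=> t0; rewrite /compound_pmf indF ?mul0r// leNgt t0. Qed.

Lemma compound_pmfE i t : 0 <= t ->
  compound_pmf i t = \sum_(m < i.+1) poisson_weight mu m t * (a ^+ m) i.
Proof. by move=> t0; rewrite /compound_pmf indT ?mul1r. Qed.

Lemma compound_pmf_ge0 i t : 0 <= compound_pmf i t.
Proof.
have [t0|t0] := ltP t 0; first by rewrite compound_pmf_neg.
rewrite compound_pmfE//; apply: sumr_ge0 => m _.
by rewrite mulr_ge0 ?pow_ge0 ?poisson_weight_ge0.
Qed.

Lemma compound_pmf_le1 i t : compound_pmf i t <= 1.
Proof.
have [t0|t0] := ltP t 0; first by rewrite compound_pmf_neg.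
rewrite compound_pmfE//; apply: le_trans (poisson_weight_sum i.+1 t0).
apply: ler_sum => m _; rewrite ler_piMr ?pow_le1 ?poisson_weight_ge0//.
Qed.

Lemma unitf_compound_pmf i : unitf (compound_pmf i).
Proof.
split; last by move=> t; rewrite compound_pmf_ge0 compound_pmf_le1.
apply: measurable_funM.
  by apply: (unitf_ind _).1; rewrite -[X in measurable X]setTI; exact: measurable_fun_ler.
apply: measurable_sum => m; apply: measurable_funM => //.
exact: measurable_poisson_weight.
Qed.

Lemma compound_pmf0 t : 0 <= t -> compound_pmf 0 t = expR (- mu * t).
Proof.
move=> t0; rewrite compound_pmfE// big_ord_recl big_ord0 addr0 /poisson_weight.
by rewrite /= !expr0 fps1E/= fact0 divr1 !mulr1.
Qed.

(** The generating functions of the convolution powers of a are averaged over the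
Poisson weights; [tannery] exchanges the two summations. *)
Lemma compound_pmf_gf th al t : `|th| <= 1 -> summ th a al -> 0 <= t ->
  summ th (fun i => compound_pmf i t) (expR (t * (mu * (al - 1)))).
Proof.
move=> th1 sa t0.
have aa : abssumm th a by exists 1; exact: compound_bnd.
have bX m : bndsumm th (a ^+ m) 1 by apply: bndsummX; exact: compound_bnd.
have sX m : summ th (a ^+ m) (al ^+ m) by exact: summX.
have pw0 m : 0 <= poisson_weight mu m t by exact: poisson_weight_ge0.
rewrite /summ (_ : series _ = fun n => (\sum_(m < n) poisson_weight mu m t * (\sum_(i < n) th ^+ i * (a ^+ m) i) -
   \sum_(m < n) poisson_weight mu m t * al ^+ m) + \sum_(m < n) poisson_weight mu m t * al ^+ m); last first.
  apply/funext => n; rewrite seriesEord subrK.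
  under [RHS]eq_bigr do rewrite mulr_sumr.
  rewrite exchange_big/=; apply: eq_bigr => i _; rewrite compound_pmfE// mulr_sumr.
  rewrite [RHS](bigID (fun m : 'I_n => (m < i.+1)%N))/= [X in _ + X]big1 ?addr0; last first.
    by move=> m; rewrite -leqNgt => im; rewrite fps_pow_lt// !mulr0.
  rewrite (big_ord_widen_cond n xpredT (fun m => th ^+ i * (poisson_weight mu m t * (a ^+ m) i)))//=.
  by apply: eq_bigr => m _; rewrite mulrCA.
rewrite -[X in _ --> X]add0r; apply: cvgD.
  apply: (@tannery _ (fun n m => poisson_weight mu m t * (\sum_(i < n) th ^+ i * (a ^+ m) i))
    (fun m => poisson_weight mu m t * al ^+ m) (fun m => poisson_weight mu m t)).
  - move=> n m; rewrite normrM ger0_norm// ler_piMr//.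
    by apply: le_trans (ler_norm_sum _ _ _) _; exact: bX.
  - by apply: (@cvg_series_ge0 _ _ 1) => // n; exact: poisson_weight_sum.
  - move=> m; apply: cvgMr; have := sX m; rewrite /summ.
    by rewrite (_ : series _ = fun n => \sum_(i < n) th ^+ i * (a ^+ m) i)//; apply/funext => n; rewrite seriesEord.
rewrite (_ : (fun n => _) = fun n => expR (- mu * t) * series (exp_coeff (mu * t * al)) n); last first.
  apply/funext => n; rewrite seriesEord mulr_sumr; apply: eq_bigr => m _.
  rewrite /poisson_weight /exp_coeff/= [(mu * t * al) ^+ m]exprMn.
  by set y := (mu * t) ^+ m; set z := al ^+ m; ring.
have -> : expR (t * (mu * (al - 1))) = expR (- mu * t) * expR (mu * t * al).
  by rewrite -expRD; congr expR; ring.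
apply: cvgMr; exact: is_cvg_series_exp_coeff.
Qed.

Section renewal.
Context {d : measure_display} {Omega : measurableType d}.
Context {P : probability Omega R}.
Variable V : {RV P >-> R}.
Hypotheses (expV : exponential_law mu V) (posV : forall w, 0 < V w).

(** Either the first gap V is longer than t, or it is followed by a batch of size c
and the input starts afresh. *)
Lemma compound_pmf_renewal i t : 0 <= t ->
  compound_pmf i t = (i == 0%N)%:R * expR (- mu * t) +
    \sum_(c < i.+1) a c * Ex P (fun w => compound_pmf (i - c) (t - V w)).
Proof.
move=> t0.
have u m : unitf (fun x : R => ind (0 <= x <= t) * poisson_weight mu m (t - x)).
  split; last first.
    move=> x; rewrite indE; case: (boolP (0 <= x <= t)) => [/andP[x0 xt]|_]; last first.
      by rewrite mul0r lexx ler01.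
    by rewrite mul1r poisson_weight_ge0 ?poisson_weight_le1// ?subr_ge0.
  apply: measurable_funM.
    apply: (unitf_ind _).1; have -> : [set w : R | 0 <= w <= t] = `[0, t]%classic.
      by apply/seteqP; split => x /=; rewrite in_itv/=.
    exact: measurable_itv.
  apply: (measurableT_comp (measurable_poisson_weight mu m)).
  exact: measurable_funB.
have uV m : unitf (fun w => ind (V w <= t) * poisson_weight mu m (t - V w)).
  rewrite (_ : (fun w => _) = fun w => (fun x : R => ind (0 <= x <= t) * poisson_weight mu m (t - x)) (V w)).
    by apply: (unitf_comp (u m)).
  by apply/funext => w; rewrite (ltW (posV w)).
have E (c : nat) : Ex P (fun w => compound_pmf (i - c) (t - V w)) =
    \sum_(m < (i - c).+1) (a ^+ m) (i - c)%N * poisson_weight mu m.+1 t.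
  transitivity (Ex P (fun w => \sum_(m < (i - c).+1) (a ^+ m) (i - c)%N *
     (ind (V w <= t) * poisson_weight mu m (t - V w)))).
    apply: eq_Ex => w; rewrite /compound_pmf subr_ge0 mulr_sumr; apply: eq_bigr => m _.
    by ring.
  rewrite Ex_sum; last first.
    by move=> m; apply: unitfM; [apply: unitf_cst; rewrite pow_ge0 pow_le1|exact: uV].
  apply: eq_bigr => m _; rewrite ExZ//; congr (_ * _).
  exact: Ex_exponential_poisson_weight.
under eq_bigr do rewrite E.
case: i {E} => [|i].
  rewrite compound_pmf0// eqxx mul1r big_ord_recl big_ord0 addr0.
  by rewrite a0 mul0r addr0.
rewrite mul0r add0r compound_pmfE// big_ord_recl [in X in X + _ = _]/= expr0 fps1E mulr0 add0r.
transitivity (\sum_(m < i.+1) \sum_(c < i.+2) poisson_weight mu m.+1 t * (a c * (a ^+ m) (i.+1 - c)%N)).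
  by apply: eq_bigr => m _; rewrite lift0 exprS fpsME mulr_sumr.
rewrite exchange_big/=; apply: eq_bigr => c _.
have [c0|c0] := eqVneq (c : nat) 0%N.
  by rewrite c0 a0 mul0r big1// => m _; rewrite mul0r mulr0.
rewrite mulr_sumr.
rewrite [LHS](bigID (fun m : 'I_i.+1 => (m < (i.+1 - c).+1)%N))/= [X in _ + X]big1 ?addr0; last first.
  by move=> m; rewrite -leqNgt => im; rewrite fps_pow_lt ?mulr0.
rewrite (big_ord_widen_cond i.+1 xpredT (fun m => a c * ((a ^+ m) (i.+1 - c)%N * poisson_weight mu m.+1 t)))//=; last first.
  by move: c0; rewrite -lt0n; lia.
by apply: eq_bigr => m _; ring.
Qed.

End renewal.
End compound_pmf.

(** * Renewal paths *)

Section renewal_paths.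
Context {R : realType}.
Implicit Types (v : nat -> R) (t u g : R) (k : nat -> nat).

Definition partial_sum v (n : nat) : R := \sum_(i < n) v i.

Definition positive_seq v := forall n, 0 < v n.
Definition unbounded_sums v := forall t, exists n, t < partial_sum v n.

Lemma partial_sum0 v : partial_sum v 0 = 0.
Proof. by rewrite /partial_sum big_ord0. Qed.

Lemma partial_sumS v n : partial_sum v n.+1 = partial_sum v n + v n.
Proof. by rewrite /partial_sum big_ord_recr. Qed.

Lemma partial_sum_lt v m n : positive_seq v -> (m < n)%N -> partial_sum v m < partial_sum v n.
Proof.
move=> v0; elim: n => // n IH; rewrite ltnS leq_eqVlt => /orP[/eqP->|/IH mn].
  by rewrite partial_sumS ltrDl.
by apply: lt_trans mn _; rewrite partial_sumS ltrDl.
Qed.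

Lemma partial_sum_le v m n : positive_seq v -> (m <= n)%N -> partial_sum v m <= partial_sum v n.
Proof.
move=> v0; rewrite leq_eqVlt => /orP[/eqP->//|mn]; exact/ltW/partial_sum_lt.
Qed.

Lemma partial_sum_ge0 v n : positive_seq v -> 0 <= partial_sum v n.
Proof. by move=> v0; rewrite -(partial_sum0 v) partial_sum_le. Qed.

Definition between v t n := partial_sum v n <= t < partial_sum v n.+1.

Lemma partial_sum_ltn v t m n : positive_seq v -> partial_sum v m <= t ->
  t < partial_sum v n -> (m < n)%N.
Proof.
move=> v0 m1 n2; rewrite ltnNge; apply/negP => /(partial_sum_le v0) nm.
by have := lt_le_trans n2 (le_trans nm m1); rewrite ltxx.
Qed.

Lemma renewal_countE v t n : positive_seq v -> between v t n -> renewal_count v t = n.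
Proof.
move=> v0 /andP[n1 n2]; rewrite /renewal_count; apply: xget_unique.
  by split => // m mt; rewrite -ltnS; exact: (@partial_sum_ltn v t).
move=> m [m1 m2]; apply/eqP; rewrite eqn_leq m2// andbT -ltnS.
exact: (@partial_sum_ltn v t).
Qed.

(** No index is largest in this case, and the count takes its default value. *)
Lemma renewal_count_junk v t : positive_seq v -> (forall n, ~~ between v t n) -> renewal_count v t = 0%N.
Proof.
move=> v0 nb; rewrite /renewal_count; case: xgetP => // n _ [n1 n2].
have := nb n; rewrite /between n1/= -leNgt => n3.
by have := n2 _ n3; rewrite ltnn.
Qed.

Lemma betweenP v t : positive_seq v -> unbounded_sums v -> 0 <= t -> between v t (renewal_count v t).
Proof.
move=> v0 uv t0; have [n tn] := uv t.
have : exists n, t < partial_sum v n by exists n.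
move=> /(@ex_minnP (fun n => t < partial_sum v n))[[|m] mt min].
  by move: mt; rewrite partial_sum0 ltNge t0.
have b : between v t m.
  rewrite /between mt andbT leNgt; apply/negP => /min; by rewrite ltnn.
by rewrite (renewal_countE v0 b).
Qed.

Lemma renewal_count_le v t u : positive_seq v -> unbounded_sums v -> 0 <= t -> t <= u ->
  (renewal_count v t <= renewal_count v u)%N.
Proof.
move=> v0 uv t0 tu.
have /andP[a _] := betweenP v0 uv t0; have /andP[_ b] := betweenP v0 uv (le_trans t0 tu).
rewrite -ltnS ltnNge; apply/negP => /(partial_sum_le v0) c.
by have := lt_le_trans b (le_trans c (le_trans a tu)); rewrite ltxx.
Qed.

(** Paths are constant to the right of every time, also after the epochs have
accumulated: the count then stays at its default value. *)
Lemma renewal_count_right v t : positive_seq v -> 0 <= t -> exists2 e, 0 < e &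
  forall u, t <= u < t + e -> renewal_count v u = renewal_count v t.
Proof.
move=> v0 t0.
have [[n b]|nb] := pselect (exists n, between v t n).
  have /andP[b1 b2] := b.
  exists (partial_sum v n.+1 - t); first by rewrite subr_gt0.
  move=> u /andP[tu ut]; rewrite (renewal_countE v0 b); apply: renewal_countE => //.
  by rewrite /between (le_trans b1 tu)/= (lt_le_trans ut)// addrC subrK.
have all_le n : partial_sum v n <= t.
  elim: n => [|n IH]; first by rewrite partial_sum0.
  by rewrite leNgt; apply/negP => tn; apply: nb; exists n; rewrite /between IH.
exists 1 => // u /andP[tu _]; rewrite !renewal_count_junk// => n; apply/negP => /andP[_].
  by rewrite ltNge all_le.
by rewrite ltNge (le_trans (all_le _) tu).
Qed.

Definition cons_seq (T : Type) (x : T) (v : nat -> T) (n : nat) : T := if n is m.+1 then v m else x.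

Lemma partial_sum_cons g v n : partial_sum (cons_seq g v) n.+1 = g + partial_sum v n.
Proof. by rewrite /partial_sum big_ord_recl. Qed.

Lemma cons_pos g v : 0 < g -> positive_seq v -> positive_seq (cons_seq g v).
Proof. by move=> g0 v0 [|n]//=. Qed.

Lemma renewal_count_head g v t : 0 < g -> positive_seq v -> 0 <= t < g ->
  renewal_count (cons_seq g v) t = 0%N.
Proof.
move=> g0 v0 /andP[t0 tg]; apply: renewal_countE; first exact: cons_pos.
by rewrite /between partial_sum0 t0 partial_sum_cons partial_sum0 addr0.
Qed.

Lemma renewal_count_tail g v t : 0 < g -> positive_seq v -> unbounded_sums v -> g <= t ->
  renewal_count (cons_seq g v) t = (renewal_count v (t - g)).+1.
Proof.
move=> g0 v0 uv gt; have /andP[b1 b2] : between v (t - g) (renewal_count v (t - g)).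
  by apply: betweenP => //; rewrite subr_ge0.
apply: renewal_countE; first exact: cons_pos.
by rewrite /between !partial_sum_cons -lerBrDl b1 -ltrBlDl b2.
Qed.

Lemma renewal_count_shift g v t u : positive_seq v -> unbounded_sums v ->
  0 <= t < g -> 0 <= u -> renewal_count (cons_seq g v) (t + u) = renewal_count (cons_seq (g - t) v) u.
Proof.
move=> v0 uv /andP[t0 tg] u0.
have g0 : 0 < g by exact: le_lt_trans tg.
have [lt|ge] := ltP (t + u) g.
  rewrite !renewal_count_head// ?subr_gt0 ?lt ?addr_ge0// u0/=.
  by rewrite ltrBrDl.
rewrite !renewal_count_tail ?subr_gt0//; last by rewrite lerBlDl.
by congr (_.+1); congr renewal_count; ring.
Qed.

Definition compound v k t : nat := (\sum_(j < renewal_count v t) k j)%N.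

Lemma compound_head g v k t : 0 < g -> positive_seq v -> 0 <= t < g ->
  compound (cons_seq g v) k t = 0%N.
Proof. by move=> *; rewrite /compound renewal_count_head// big_ord0. Qed.

Lemma compound_tail g v c k t : 0 < g -> positive_seq v -> unbounded_sums v -> g <= t ->
  compound (cons_seq g v) (cons_seq c k) t = (c + compound v k (t - g))%N.
Proof. by move=> *; rewrite /compound renewal_count_tail// big_ord_recl. Qed.

Lemma compound_shift g v k t u : positive_seq v -> unbounded_sums v ->
  0 <= t < g -> 0 <= u -> compound (cons_seq g v) k (t + u) = compound (cons_seq (g - t) v) k u.
Proof. by move=> *; rewrite /compound renewal_count_shift. Qed.

Lemma compound0 v k : positive_seq v -> compound v k 0 = 0%N.
Proof.
move=> v0; rewrite /compound (renewal_countE (n := 0%N))// ?big_ord0//.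
by rewrite /between partial_sum0 lexx partial_sumS partial_sum0 add0r v0.
Qed.

Lemma compound_le v k t u : positive_seq v -> unbounded_sums v -> 0 <= t -> t <= u ->
  (compound v k t <= compound v k u)%N.
Proof.
move=> v0 uv t0 tu; rewrite /compound -!(big_mkord predT).
rewrite [leqRHS](big_cat_nat (n := renewal_count v t))//= ?leq_addr//.
exact: renewal_count_le.
Qed.

Lemma compound_right v k t : positive_seq v -> 0 <= t -> exists2 e, 0 < e &
  forall u, t <= u < t + e -> compound v k u = compound v k t.
Proof.
by move=> v0 t0; have [e e0 H] := renewal_count_right v0 t0; exists e => // u /H; rewrite /compound => ->.
Qed.

(** Events on finitely many increments, as lists of durations and values: the law is
computed by peeling off one batch, or one duration, at a time. *)
Fixpoint increments (l : seq (R * nat)) (f : R -> nat) : Prop :=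
  if l is (t, i) :: l' then f t = i /\ increments l' (fun u => (f (t + u)%R - i)%N) else True.

Lemma eq_increments l f f' : (forall p, p \in l -> 0 <= p.1) -> (forall u, 0 <= u -> f u = f' u) ->
  increments l f <-> increments l f'.
Proof.
elim: l f f' => [//|[t i] l IH] f f' l0 ff' /=.
have t0 : 0 <= t by apply: (l0 (t, i)); rewrite mem_head.
rewrite ff'//; split => -[-> H]; split => //; move: H; apply IH => //;
  by [move=> p pl; apply: l0; rewrite inE pl orbT | move=> u u0; rewrite ff'// addr_ge0].
Qed.

End renewal_paths.

Section measurable_paths.
Context {d : measure_display} {T : measurableType d} {R : realType}.

Lemma measurable_nat (f : T -> nat) : (forall n, measurable [set z | f z = n]) ->
  measurable_fun setT f.
Proof.
move=> mf _ A _; rewrite setTI.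
rewrite (_ : f @^-1` A = \bigcup_(n in A) [set z | f z = n]); last first.
  apply/seteqP; split => z /=; first by move=> Az; exists (f z).
  by move=> [n An /= ->].
by apply: bigcup_measurable => n _.
Qed.

Lemma measurable_nat_pred (f : T -> nat) (Q : nat -> Prop) : measurable_fun setT f ->
  measurable [set z | Q (f z)].
Proof.
move=> mf; rewrite (_ : [set z | _] = f @^-1` [set x | Q x])//.
by rewrite -[X in measurable X]setTI; exact: mf.
Qed.

Lemma measurable_eqn (f g : T -> nat) : measurable_fun setT f -> measurable_fun setT g ->
  measurable [set z | f z = g z].
Proof.
move=> mf mg.
rewrite (_ : [set z | _] = \bigcup_n (f @^-1` [set n] `&` g @^-1` [set n])).
  apply: bigcupT_measurable => n; apply: measurableI; rewrite -[X in measurable X]setTI.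
    exact: mf.
  exact: mg.
apply/seteqP; split => z /=; first by move=> fg; exists (g z).
by move=> [n _ [/= -> ->]].
Qed.

Lemma measurable_ler (f g : T -> R) : measurable_fun setT f -> measurable_fun setT g ->
  measurable [set z | f z <= g z].
Proof.
move=> mf mg; rewrite -[X in measurable X]setTI; exact: measurable_fun_ler.
Qed.

Lemma measurable_ltr (f g : T -> R) : measurable_fun setT f -> measurable_fun setT g ->
  measurable [set z | f z < g z].
Proof.
move=> mf mg; rewrite -[X in measurable X]setTI; exact: measurable_fun_ltr.
Qed.

Lemma measurable_nat2 (T' : Type) (f g : T -> nat) (h : nat -> nat -> nat) : measurable_fun setT f -> measurable_fun setT g ->
  measurable_fun setT (fun z => h (f z) (g z)).
Proof.
move=> mf mg; apply: measurable_nat => n.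
rewrite (_ : [set z | _] = \bigcup_a \bigcup_b
  ((f @^-1` [set a] `&` g @^-1` [set b]) `&` [set _ | h a b = n])).
  apply: bigcupT_measurable => a; apply: bigcupT_measurable => b; apply: measurableI.
    by apply: measurableI; rewrite -[X in measurable X]setTI; [exact: mf|exact: mg].
  have [e|ne] := pselect (h a b = n).
    by rewrite (_ : [set _ | _] = setT)//; apply/seteqP; split.
  by rewrite (_ : [set _ | _] = set0)//; apply/seteqP; split.
apply/seteqP; split => z /=; first by move=> fg; exists (f z) => //; exists (g z).
by move=> [a _ [b _ [[/= -> ->]]]].
Qed.

Variables (v : nat -> T -> R) (k : nat -> T -> nat) (tau : T -> R).
Hypothesis v0 : forall z, positive_seq (v ^~ z).
Hypothesis mv : forall n, measurable_fun setT (v n).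
Hypothesis mk : forall n, measurable_fun setT (k n).
Hypothesis mtau : measurable_fun setT tau.

Lemma measurable_partial_sum n : measurable_fun setT (fun z => partial_sum (v ^~ z) n).
Proof. exact: measurable_sum. Qed.

Lemma measurable_between n : measurable [set z | between (v ^~ z) (tau z) n].
Proof.
rewrite (_ : [set z | _] = [set z | partial_sum (v ^~ z) n <= tau z] `&`
  [set z | tau z < partial_sum (v ^~ z) n.+1]).
  apply: measurableI.
    by apply: measurable_ler => //; exact: measurable_partial_sum.
  by apply: measurable_ltr => //; exact: measurable_partial_sum.
by apply/seteqP; split => z /=; [move=> /andP|move=> ?; apply/andP].
Qed.

Lemma measurable_renewal_count : measurable_fun setT (fun z => renewal_count (v ^~ z) (tau z)).
Proof.
apply: measurable_nat => n.
have E m : (0 < m)%N -> [set z | renewal_count (v ^~ z) (tau z) = m] = [set z | between (v ^~ z) (tau z) m].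
  move=> m0; apply/seteqP; split => z /=; last exact: renewal_countE.
  move=> cm; have [[j b]|nb] := pselect (exists j, between (v ^~ z) (tau z) j).
    by rewrite -cm (renewal_countE _ b).
  have := @renewal_count_junk _ (v ^~ z) (tau z) (v0 z).
  rewrite cm => m00; exfalso; have : m = 0%N by apply: m00 => j; apply/negP => b; apply: nb; exists j.
  by move=> e; rewrite e in m0.
case: n => [|n]; last by rewrite E//; exact: measurable_between.
rewrite (_ : [set z | _] = ~` \bigcup_n [set z | renewal_count (v ^~ z) (tau z) = n.+1]).
  apply: measurableC; apply: bigcupT_measurable => n; rewrite E//; exact: measurable_between.
apply/seteqP; split => z /=; first by move=> e [m _ /=]; rewrite e.
by case e : (renewal_count _ _) => // [m] H; exfalso; apply: H; exists m => //=; rewrite e.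
Qed.

Lemma measurable_sum_nat n : measurable_fun setT (fun z => (\sum_(j < n) k j z)%N).
Proof.
elim: n => [|n IH].
  rewrite (_ : (fun z => _) = fun=> 0%N); first exact: measurable_cst.
  by apply/funext => z; rewrite big_ord0.
rewrite (_ : (fun z => _) = fun z => (\sum_(j < n) k j z + k n z)%N).
  exact: (measurable_nat2 nat addn).
by apply/funext => z; rewrite big_ord_recr.
Qed.

Lemma measurable_compound : measurable_fun setT (fun z => compound (v ^~ z) (k ^~ z) (tau z)).
Proof.
apply: measurable_nat => i.
rewrite (_ : [set z | _] = \bigcup_n ([set z | renewal_count (v ^~ z) (tau z) = n] `&`
  [set z | (\sum_(j < n) k j z)%N = i])).
  apply: bigcupT_measurable => n; apply: measurableI; apply: measurable_eqn => //.
  - exact: measurable_renewal_count.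
  - exact: measurable_sum_nat.
apply/seteqP; split => z /=.
  by move=> e; exists (renewal_count (v ^~ z) (tau z)).
by move=> [n _ [/= <-]].
Qed.

End measurable_paths.

(** * Almost sure properties *)

Section almost_sure.
Context {d : measure_display} {Omega : measurableType d} {R : realType}.
Variable P : probability Omega R.
Local Notation Ex := (Ex P).

Definition almost_surely (G : Omega -> Prop) := measurable [set w | G w] /\ Ex (fun w => ind (G w)) = 1.

Lemma eq_Ex_as (G : Omega -> Prop) F F' : almost_surely G -> unitf F -> unitf F' ->
  (forall w, G w -> F w = F' w) -> Ex F = Ex F'.
Proof.
move=> [mG PG] uF uF' FF'.
have key H : unitf H -> Ex (fun w => ind (G w) * H w) = Ex H.
  move=> uH; have uG : unitf (fun w => ind (G w) : R) := unitf_ind mG.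
  have u1 : unitf (fun w : Omega => 1 - ind (G w) : R).
    split; first by apply: measurable_funB => //; case: uG.
    by move=> w; rewrite subr_ge0 ind_le1/= lerBlDr lerDl ind_ge0.
  have u2 := unitfM u1 uH.
  have : Ex (fun w => (1 - ind (G w)) * H w) = 0.
    apply/eqP; rewrite eq_le; apply/andP; split; last first.
      by apply: Ex_ge0 => w; have [_ /(_ w)/andP[]] := u2.
    have -> : 0 = Ex (fun w => 1 - ind (G w)).
      rewrite (@ExB _ _ _ P (fun=> 1))// ?Ex_cst ?PG ?subrr//.
      by apply: unitf_cst; rewrite ler01 lexx.
    apply: Ex_le => // w; have [_ /(_ w)/andP[H0 H1]] := uH; have [_ /(_ w)/andP[? ?]] := u1.
    by rewrite ler_piMr.
  have -> : (fun w => (1 - ind (G w)) * H w) = fun w => H w - ind (G w) * H w.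
    by apply/funext => w; ring.
  rewrite ExB//; last exact: unitfM.
  by move=> /eqP; rewrite subr_eq0 => /eqP.
rewrite -(key F)// -(key F')//; apply: eq_Ex => w.
have [g|g] := pselect (G w); first by rewrite FF'.
by rewrite indF// !mul0r.
Qed.

Lemma almost_surelyI (G G' : Omega -> Prop) : almost_surely G -> almost_surely G' ->
  almost_surely (fun w => G w /\ G' w).
Proof.
move=> aG [mG' PG']; have [mG _] := aG; split; first exact: measurableI.
rewrite -PG'; apply: (eq_Ex_as aG).
- by apply: unitf_ind; exact: measurableI.
- exact: unitf_ind.
- by move=> w Gw; apply: ind_eq; split => // -[].
Qed.

Lemma almost_surely_null (A : set Omega) : measurable A -> P A = 0%E -> almost_surely (fun w => ~ A w).
Proof.
move=> mA PA; have m : measurable [set w | ~ A w] by exact: measurableC.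
split => //; rewrite Ex_ind//.
have := probability_setC P mA; rewrite PA sube0 => E.
by rewrite (_ : [set w | _] = ~` A)// E.
Qed.

Lemma almost_surely_bigcap (G : nat -> Omega -> Prop) : (forall n, almost_surely (G n)) ->
  almost_surely (fun w => forall n, G n w).
Proof.
move=> aG.
have mC n : measurable [set w | ~ G n w] by apply: measurableC; case: (aG n).
have PC n : P [set w | ~ G n w] = 0%E.
  have [mG PG] := aG n; rewrite Ex_ind// in PG.
  rewrite (_ : [set w | _] = ~` [set w | G n w])// probability_setC//.
  by rewrite -(fineK (fin_num_measure P _ mG)) PG subee.
have := @almost_surely_null (\bigcup_n [set w | ~ G n w]).
rewrite (_ : (fun w => ~ _) = fun w => forall n, G n w); last first.
  apply/funext => w; apply/propext; split => /=.
    by move=> H n; apply: contrapT => g; apply: H; exists n.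
  by move=> H [n _ /=]; apply.
apply; first exact: bigcupT_measurable.
apply/eqP; rewrite eq_le measure_ge0 andbT.
apply: le_trans (_ : (\sum_(i <oo) P [set w | ~ G i w] <= 0)%E).
  by apply: measure_sigma_subadditive => //; exact: bigcupT_measurable.
by rewrite eseries0// => i _ _; rewrite PC.
Qed.

(** If the expectation were 1, each event 1 - F >= 1/n would be null. *)
Lemma Ex_lt1 (F : Omega -> R) : unitf F -> (forall w, F w < 1) -> Ex F < 1.
Proof.
move=> uF F1; rewrite lt_neqAle Ex_le1// andbT; apply/negP => /eqP EF.
have u1 : unitf (fun w : Omega => 1 - F w).
  split; first by apply: measurable_funB => //; case: uF.
  by move=> w; have [_ /(_ w)/andP[? ?]] := uF; rewrite subr_ge0 lerBlDr lerDl; apply/andP.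
have E0 : Ex (fun w => 1 - F w) = 0.
  rewrite (@ExB _ _ _ P (fun=> 1))// ?Ex_cst ?EF ?subrr//.
  by apply: unitf_cst; rewrite ler01 lexx.
have mA n : measurable [set w | n.+1%:R^-1 <= 1 - F w].
  by apply: measurable_ler => //; case: u1.
have aA n : almost_surely (fun w => ~ (n.+1%:R^-1 <= 1 - F w)).
  apply: (@almost_surely_null [set w | n.+1%:R^-1 <= 1 - F w]) => //.
  apply/eqP; rewrite -(fineK (fin_num_measure P _ (mA n))) eqe -Ex_ind//.
  rewrite eq_le Ex_ge0 ?andbT; last by move=> w; exact: ind_ge0.
  rewrite -(@ler_pM2l _ n.+1%:R^-1) ?invr_gt0// mulr0 -ExZ; last exact: unitf_ind.
  rewrite -E0; apply: Ex_le => //.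
    by apply: unitfM; [apply: unitf_cst; rewrite invr_ge0 ler0n invf_le1 ?ler1n|exact: unitf_ind].
  move=> w; have [h|h] := pselect (n.+1%:R^-1 <= 1 - F w); first by rewrite indT ?mulr1.
  by rewrite indF// mulr0; have [_ /(_ w)/andP[]] := u1.
have [mG PG] := almost_surely_bigcap aA.
have : Ex (fun w => ind (forall n, ~ n.+1%:R^-1 <= 1 - F w)) = 0 :> R.
  rewrite -[RHS](Ex_cst P 0); apply: eq_Ex => w; apply: indF => H.
  have F0 : 0 < 1 - F w by rewrite subr_gt0.
  apply: (H (Num.truncn (1 - F w)^-1)).
  by rewrite -[leRHS]invrK lef_pV2 ?posrE ?invr_gt0// ltW// truncnS_gt.
by rewrite PG => /eqP; rewrite oner_eq0.
Qed.

(** On the event that all partial sums stay below M, exp (- S_n) >= exp (- M) for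
every n, so its probability is at most exp M times a vanishing sequence. *)
Lemma unbounded_as (V : nat -> Omega -> R) : (forall n, measurable_fun setT (V n)) ->
  (forall n w, 0 < V n w) ->
  Ex (fun w => expR (- partial_sum (V ^~ w) n)) @[n --> \oo] --> 0 ->
  almost_surely (fun w => unbounded_sums (V ^~ w)).
Proof.
move=> mV V0 E0.
have posV w : positive_seq (V ^~ w) by move=> n; exact: V0.
have mS n : measurable_fun setT (fun w => partial_sum (V ^~ w) n) by exact: measurable_partial_sum.
pose A M := [set w | forall n, partial_sum (V ^~ w) n <= M%:R].
have mA M : measurable (A M).
  rewrite (_ : A M = \bigcap_n [set w | partial_sum (V ^~ w) n <= M%:R]).
    by apply: bigcapT_measurable => n; apply: measurable_ler.
  by apply/seteqP; split => w /= H n; [move=> _; exact: H|exact: H].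
have uE n : unitf (fun w => expR (- partial_sum (V ^~ w) n)).
  split; first by apply: measurableT_comp => //; exact: measurable_funN.
  by move=> w; rewrite expR_ge0 -expR0 ler_expR oppr_le0 partial_sum_ge0.
have aA M : almost_surely (fun w => ~ A M w).
  apply: (@almost_surely_null (A M)) => //.
  apply/eqP; rewrite -(fineK (fin_num_measure P _ (mA M))) eqe.
  rewrite (_ : A M = [set w | A M w])// -Ex_ind; last exact: mA.
  rewrite eq_le Ex_ge0 ?andbT; last by move=> w; exact: ind_ge0.
  rewrite -(@ler_pM2l _ (expR (- M%:R))) ?expR_gt0// mulr0 -ExZ; last by apply: unitf_ind; exact: mA.
  apply: (cvgr_to_ge E0); apply: nearW => n; apply: Ex_le => //.
    by apply: unitfM; [apply: unitf_cst; rewrite expR_ge0/= -[leRHS]expR0 ler_expR oppr_le0 ler0n|apply: unitf_ind; exact: mA].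
  move=> w; have [h|h] := pselect (A M w).
    by rewrite indT ?mulr1// ler_expR lerN2 h.
  by rewrite indF// mulr0 expR_ge0.
have := almost_surely_bigcap aA.
rewrite (_ : (fun w => forall n, _) = fun w => unbounded_sums (V ^~ w))//.
apply/funext => w; apply/propext; split => [H t|H M h].
  apply: contrapT => Hn; apply: (H (Num.truncn `|t|).+1) => n.
  rewrite leNgt; apply/negP => tn; apply: Hn; exists n.
  by apply: le_lt_trans tn; rewrite (le_trans (ler_norm _))// ltW// truncnS_gt.
by have [n] := H M%:R; rewrite ltNge h.
Qed.

(** The identities given the single values of Y are summed. This carries a computation
made for one fixed history of a busy period over to any event of the history. *)
Lemma countable_split (T : countType) (Y : Omega -> T) (F0 F1 : Omega -> R) (p : R) :
  (forall y, measurable [set w | Y w = y]) -> unitf F0 -> unitf F1 ->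
  (forall y, Ex (fun w => ind (Y w = y) * F1 w) = Ex (fun w => ind (Y w = y) * F0 w) * p) ->
  forall C : T -> Prop, Ex (fun w => ind (C (Y w)) * F1 w) = Ex (fun w => ind (C (Y w)) * F0 w) * p.
Proof.
move=> mY u0 u1 H C.
have mC : measurable [set w | C (Y w)].
  rewrite (_ : [set w | _] = \bigcup_k [set w | C (Y w) /\ pickle (Y w) = k]); last first.
    by apply/seteqP; split => w /=; [move=> c; exists (pickle (Y w))|move=> [k _ []]].
  apply: bigcupT_measurable => k.
  case E : (unpickle k : option T) => [y|]; last first.
    rewrite (_ : [set w | _] = set0)//; apply/seteqP; split => // w /= [_ pk].
    by move: E; rewrite -pk pickleK.
  have [c|c] := pselect (C y); last first.
    rewrite (_ : [set w | _] = set0)//; apply/seteqP; split => // w /= [cw pk]; apply: c.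
    by move: E; rewrite -pk pickleK => -[<-].
  have [pk|pk] := eqVneq (pickle y) k; last first.
    rewrite (_ : [set w | _] = set0)//; apply/seteqP; split => // w /= [cw pk'].
    by move: E pk; rewrite -pk' pickleK => -[<-]; rewrite eqxx.
  rewrite (_ : [set w | _] = [set w | Y w = y])//; apply/seteqP; split => w /=.
    by move=> [_ pk']; apply: (pcan_inj pickleK); rewrite pk pk'.
  by move=> ->.
have uC : unitf (fun w => ind (C (Y w)) : R) := unitf_ind mC.
have mk k : measurable [set w | pickle (Y w) = k].
  case E : (unpickle k : option T) => [y|]; last first.
    rewrite (_ : [set w | _] = set0)//; apply/seteqP; split => // w /= pk.
    by move: E; rewrite -pk pickleK.
  have [pk|pk] := eqVneq (pickle y) k; last first.
    rewrite (_ : [set w | _] = set0)//; apply/seteqP; split => // w /= pk'.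
    by move: E pk; rewrite -pk' pickleK => -[<-]; rewrite eqxx.
  rewrite (_ : [set w | _] = [set w | Y w = y])//; apply/seteqP; split => w /=.
    by move=> pk'; apply: (pcan_inj pickleK); rewrite pk pk'.
  by move=> ->.
have one k : Ex (fun w => ind (pickle (Y w) = k) * (ind (C (Y w)) * F1 w)) =
   Ex (fun w => ind (pickle (Y w) = k) * (ind (C (Y w)) * F0 w)) * p.
  case E : (unpickle k : option T) => [y|]; last first.
    have Z (F : Omega -> R) : Ex (fun w => ind (pickle (Y w) = k) * F w) = 0.
      rewrite -[RHS](Ex_cst P 0); apply: eq_Ex => w; rewrite indF ?mul0r// => pk.
      by move: E; rewrite -pk pickleK.
    by rewrite !Z mul0r.
  have [pk|pk] := eqVneq (pickle y) k; last first.
    have Z (F : Omega -> R) : Ex (fun w => ind (pickle (Y w) = k) * F w) = 0.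
      rewrite -[RHS](Ex_cst P 0); apply: eq_Ex => w; rewrite indF ?mul0r// => pk'.
      by move: E pk; rewrite -pk' pickleK => -[<-]; rewrite eqxx.
    by rewrite !Z mul0r.
  have Z (F : Omega -> R) : unitf F -> Ex (fun w => ind (pickle (Y w) = k) * (ind (C (Y w)) * F w)) =
      ind (C y) * Ex (fun w => ind (Y w = y) * F w).
    move=> uF; rewrite -ExZ; last by apply: unitfM => //; exact: unitf_ind.
    apply: eq_Ex => w; have [yw|yw] := pselect (Y w = y).
      by rewrite yw [ind (pickle y = k)]indT// [ind (y = y)]indT// !mul1r.
    rewrite [ind (pickle _ = _)]indF ?(indF yw) ?mul0r ?mulr0//.
    by rewrite -pk => /(pcan_inj pickleK).
  by rewrite !Z// H mulrA.
have lim (F : Omega -> R) : unitf F ->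
    (\sum_(k < n) Ex (fun w => ind (pickle (Y w) = k) * (ind (C (Y w)) * F w))) @[n --> \oo] -->
    Ex (fun w => ind (C (Y w)) * F w).
  move=> uF; have uCF := unitfM uC uF.
  have S n w : \sum_(k < n) ind (pickle (Y w) = k) * (ind (C (Y w)) * F w) =
      ind (pickle (Y w) < n)%N * (ind (C (Y w)) * F w).
    by rewrite -mulr_suml sum_ind1.
  rewrite (_ : (fun n => _) = fun n => Ex (fun w => ind (pickle (Y w) < n)%N * (ind (C (Y w)) * F w))); last first.
    apply/funext => n; rewrite -Ex_sum; first by apply: eq_Ex => w; exact: S.
    by move=> k; apply: unitfM => //; apply: unitf_ind.
  apply: Ex_cvg => //.
  - move=> n; apply: unitfM => //; apply: unitf_ind.
    rewrite (_ : [set w | _] = \bigcup_(k in [set k | (k < n)%N]) [set w | pickle (Y w) = k]).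
      exact: bigcup_measurable.
    by apply/seteqP; split => w /=; [move=> h; exists (pickle (Y w))|move=> [k /= kn ->]].
  - move=> w; apply: cvg_near_cst; exists (pickle (Y w)).+1 => // n /= h.
    by rewrite indT ?mul1r.
apply: (cvg_unique _ (lim _ u1)) => //.
rewrite (_ : (fun n => _) = fun n => (\sum_(k < n) Ex (fun w => ind (pickle (Y w) = k) * (ind (C (Y w)) * F0 w))) * p).
  by apply: cvgMl; exact: lim.
by apply/funext => n; rewrite mulr_suml; apply: eq_bigr => k _; exact: one.
Qed.

End almost_sure.

(** * Increments of the compound Poisson input *)

Section measurable_increments.
Context {d : measure_display} {T : measurableType d} {R : realType}.

Definition durations (l : seq ((T -> R) * nat)) (z : T) : seq (R * nat) :=
  [seq (p.1 z, p.2) | p <- l].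

Lemma measurable_increments (l : seq ((T -> R) * nat)) (f : T -> R -> nat) :
  (forall p, List.In p l -> measurable_fun setT p.1) ->
  (forall tau : T -> R, measurable_fun setT tau -> measurable_fun setT (fun z => f z (tau z))) ->
  measurable [set z | increments (durations l z) (f z)].
Proof.
elim: l f => [|[t i] l IH] f ml mf /=.
  by rewrite (_ : [set z | _] = setT)//; apply/seteqP; split.
have mt : measurable_fun setT t by apply: (ml (t, i)); left.
rewrite (_ : [set z | _] = [set z | f z (t z) = i] `&`
   [set z | increments (durations l z) (fun u => f z (t z + u)%R - i)%N])//.
apply: measurableI.
  by apply: measurable_eqn; [exact: mf|exact: measurable_cst].
apply: IH => [p pl|tau mtau]; first by apply: ml; right.
apply: (measurable_nat2 nat subn); last exact: measurable_cst.
by apply: mf; exact: measurable_funD.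
Qed.

End measurable_increments.

Section independence_more.
Context {d : measure_display} {Omega : measurableType d} {R : realType}.
Context {P : probability Omega R}.
Variable X : inputs P.
Hypothesis indepX : mutually_independent X.
Implicit Types J K : set slot.
Local Notation Osub := (Osub X).
Local Notation Ex := (Ex P).

Lemma measurable_Osub_sub J K d' (T : measurableType d') (f : Omega -> T) : J `<=` K ->
  measurable_fun setT (f : Osub J -> T) -> measurable_fun setT (f : Osub K -> T).
Proof.
move=> JK mf _ A mA; have := mf measurableT A mA; rewrite !setTI.
by apply: sub_smallest2r; [exact: smallest_sigma_algebra|exact: bigcup_subset].
Qed.

Lemma unitf_Osub_sub J K (f : Omega -> R) : J `<=` K ->
  unitf (f : Osub J -> R) -> unitf (f : Osub K -> R).
Proof. by move=> JK [mf f01]; split => //; exact: measurable_Osub_sub JK mf. Qed.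

Lemma Ex_prod_indep (J : nat -> set slot) (G : nat -> Omega -> R) n :
  (forall i j, (i < j)%N -> J i `&` J j = set0) ->
  (forall i, unitf (G i : Osub (J i) -> R)) ->
  Ex (fun w => \prod_(i < n) G i w) = \prod_(i < n) Ex (G i).
Proof.
move=> J0 uG; elim: n => [|n IH].
  by rewrite big_ord0 -[RHS](Ex_cst P 1); apply: eq_Ex => w; rewrite big_ord0.
rewrite big_ord_recr/= -IH -(@ExM _ _ _ _ _ indepX (\bigcup_(i in [set i | (i < n)%N]) J i) (J n)).
- by apply: eq_Ex => w; rewrite big_ord_recr.
- apply/seteqP; split => // z [[i /= ni Ji] Jn].
  by have : (J i `&` J n) z by []; rewrite J0.
- apply: unitf_prod => i; apply: unitf_Osub_sub (uG i).
  by move=> s Js; exists i => /=.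
- exact: uG.
Qed.

End independence_more.

Section busy_law.
Context {d : measure_display} {Omega : measurableType d} {R : realType}.
Context {P : probability Omega R}.
Variables (mu s : R) (kappa delta : {RV P >-> nat}) (eta : {RV P >-> R}) (y : R) (X : inputs P).
Hypothesis hX : inputs_spec mu s kappa delta eta y X.
Hypotheses (mu0 : 0 < mu) (s0 : 0 < s) (kappa0 : forall w, (0 < kappa w)%N).
Local Notation Ex := (Ex P).
Local Notation Osub := (Osub X).

Definition batch_series : fps R := fun i => batch_pmf kappa i.

Let mkappa i : measurable [set w | kappa w = i].
Proof. by apply: measurable_eqn; [exact: measurable_funPT|exact: measurable_cst]. Qed.

Lemma batch_seriesE i : batch_series i = Ex (fun w => ind (kappa w = i)).
Proof. by rewrite Ex_ind. Qed.

Lemma batch_series_ge0 i : 0 <= batch_series i.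
Proof. exact: fine_ge0. Qed.

Lemma batch_series0 : batch_series 0%N = 0.
Proof.
rewrite batch_seriesE -[RHS](Ex_cst P 0); apply: eq_Ex => w; apply: indF => e.
by have := kappa0 w; rewrite e.
Qed.

Lemma batch_series_sum n : \sum_(i < n) batch_series i = Ex (fun w => ind (kappa w < n)%N).
Proof.
under eq_bigr do rewrite batch_seriesE.
rewrite -Ex_sum; last by move=> i; exact: unitf_ind.
by apply: eq_Ex => w; exact: sum_ind1.
Qed.

Lemma batch_series_sum_le1 n : \sum_(i < n) batch_series i <= 1.
Proof.
rewrite batch_series_sum; apply: Ex_le1; apply: unitf_ind.
rewrite (_ : [set w | _] = \bigcup_(i in [set i | (i < n)%N]) [set w | kappa w = i]).
  exact: bigcup_measurable.
by apply/seteqP; split => w /=; [move=> h; exists (kappa w)|move=> [i /= ? ->]].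
Qed.

Local Notation pois := (compound_pmf mu batch_series).

Lemma unitf_pois i : unitf (pois i).
Proof.
by apply: unitf_compound_pmf => //; [exact: batch_series_ge0|exact: batch_series_sum_le1].
Qed.

Definition gaps n w : nat -> R := fun j => gap X n j w.
Definition batches n w : nat -> nat := fun j => batch X n j w.

Lemma gaps_pos n w : positive_seq (gaps n w).
Proof. by move=> j; exact: (gap_pos hX). Qed.

Definition shift_seq (T : Type) (v : nat -> T) (o : nat) : nat -> T := fun j => v (o + j)%N.

Lemma Ex_gap n j (phi : R -> R) : unitf phi -> (forall x, x < 0 -> phi x = 0) -> forall t, 0 <= t ->
  Ex (fun w => phi (gap X n j w - t)) = expR (- mu * t) * Ex (fun w => phi (gap X n j w)).
Proof.
move=> uphi phi0 t t0; apply: exponential_memoryless => //.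
exact: (gap_law hX n j).
Qed.

Lemma gaps_unbounded n : almost_surely P (fun w => unbounded_sums (gaps n w)).
Proof.
apply: (@unbounded_as _ _ _ P (gap X n)).
- by move=> j; exact: measurable_funPT.
- by move=> j w; exact: (gap_pos hX).
have uE j : unitf (fun w : Osub [set Gap n j] => expR (- gap X n j w)).
  split; last first.
    by move=> w; rewrite expR_ge0/= -[leRHS]expR0 ler_expR oppr_le0 ltW// (gap_pos hX).
  apply: measurableT_comp => //; apply: measurableT_comp => //.
  by apply: (@measurable_Osub _ _ _ _ X [set Gap n j] _ _ (gap X n j) (Gap n j)).
rewrite (_ : (fun m => _) = fun m => (mu / (mu + 1)) ^+ m).
  apply: cvg_expr; rewrite ger0_norm ?divr_ge0 ?addr_ge0 ?(ltW mu0)//.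
  by rewrite ltr_pdivrMr ?mul1r ?ltrDl ?addr_gt0.
apply/funext => m.
rewrite (eq_Ex P (G := fun w => \prod_(j < m) expR (- gap X n j w))); last first.
  by move=> w; rewrite /partial_sum -sumrN expR_sum.
rewrite (Ex_prod_indep (inputs_indep hX) (J := fun j => [set Gap n j]) (G := fun j w => expR (- gap X n j w)))//.
  rewrite (eq_bigr (fun=> mu / (mu + 1))) ?prodr_const ?card_ord// => j _.
  rewrite -(@Ex_exponential_exp _ _ _ P mu (gap X n j) mu0 (gap_law hX n j) (gap_pos hX n j) 1)//.
  by apply: eq_Ex => w; rewrite mulN1r.
move=> i j ij; apply/seteqP; split => // z [/= -> [e]].
by move: ij; rewrite e ltnn.
Qed.

Lemma shift_unbounded (v : nat -> R) o : positive_seq v -> unbounded_sums v -> unbounded_sums (shift_seq v o).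
Proof.
move=> v0 uv t; have [n tn] := uv (t + partial_sum v o).
exists n; rewrite -(ltrD2r (partial_sum v o)); apply: lt_le_trans tn _.
apply: (@le_trans _ _ (partial_sum v (o + n))); first by rewrite partial_sum_le// leq_addl.
rewrite {1}/partial_sum -(big_mkord xpredT v) (big_cat_nat (n := o)) ?leq_addr//=.
rewrite big_mkord addrC lerD2r -[X in \sum_(X <= _ < _) _]add0n big_addn addKn big_mkord.
by apply: ler_sum => i _; rewrite /shift_seq addnC.
Qed.

Lemma shift_seqS (T : Type) (v : nat -> T) o : shift_seq v o = cons_seq (v o) (shift_seq v o.+1).
Proof.
by apply/funext => -[|j]; rewrite /shift_seq/= ?addn0// addnS addSn.
Qed.

(** Residual gaps may be negative off the event under study; the renewal paths ask for positive
ones. *)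
Let posr (x : R) : R := if 0 < x then x else 1.

Let posr_gt0 x : 0 < posr x.
Proof. by rewrite /posr; case: ifPn. Qed.

Let posrE x : 0 < x -> posr x = x.
Proof. by rewrite /posr => ->. Qed.

Let measurable_posr d' (T : measurableType d') (f : T -> R) : measurable_fun setT f ->
  measurable_fun setT (fun z => posr (f z)).
Proof.
move=> mf; apply: measurable_fun_ifT => //.
by apply: measurable_fun_ltr.
Qed.

Lemma unitf_increments d' (T : measurableType d') (lf : seq ((T -> R) * nat))
  (v : nat -> T -> R) (k : nat -> T -> nat) :
  (forall p, List.In p lf -> measurable_fun setT p.1) ->
  (forall z, positive_seq (v ^~ z)) -> (forall j, measurable_fun setT (v j)) ->
  (forall j, measurable_fun setT (k j)) ->
  unitf (fun z => ind (increments (durations lf z) (compound (v ^~ z) (k ^~ z))) : R).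
Proof.
move=> ml v0 mv mk; apply: unitf_ind.
apply: (measurable_increments (f := fun z => compound (v ^~ z) (k ^~ z))) => // tau mtau.
exact: measurable_compound.
Qed.

Lemma durations_cst d' (T : measurableType d') (l : seq (R * nat)) (z : T) :
  durations [seq ((fun=> p.1), p.2) | p <- l] z = l.
Proof. by rewrite /durations -map_comp -[RHS]map_id; apply: eq_map => -[]. Qed.

Lemma durations_cst_measurable d' (T : measurableType d') (l : seq (R * nat)) p :
  List.In p [seq ((fun=> p.1) : T -> R, p.2) | p <- l] -> measurable_fun setT p.1.
Proof. by elim: l => //= q l IH [<-|/IH//]; exact: measurable_cst. Qed.

Lemma measurable_gap J n j : J (Gap n j) -> measurable_fun [set: Osub J] (gap X n j : Osub J -> R).
Proof. by move=> Jg; apply: (@measurable_Osub _ _ _ _ X J _ _ (gap X n j) (Gap n j)). Qed.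

Lemma measurable_batch J n j : J (Batch n j) -> measurable_fun [set: Osub J] (batch X n j : Osub J -> nat).
Proof. by move=> Jg; apply: (@measurable_Osub _ _ _ _ X J _ _ (batch X n j) (Batch n j)). Qed.

Lemma measurable_service J n j : J (Service n j) -> measurable_fun [set: Osub J] (service X n j : Osub J -> R).
Proof. by move=> Jg; apply: (@measurable_Osub _ _ _ _ X J _ _ (service X n j) (Service n j)). Qed.

Lemma measurable_removal J n j : J (Removal n j) -> measurable_fun [set: Osub J] (removal X n j : Osub J -> nat).
Proof. by move=> Jg; apply: (@measurable_Osub _ _ _ _ X J _ _ (removal X n j) (Removal n j)). Qed.

Lemma measurable_clock J : J Clock -> measurable_fun [set: Osub J] (clock X : Osub J -> R).
Proof. by move=> Jg; apply: (@measurable_Osub _ _ _ _ X J _ _ (clock X) Clock). Qed.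

Lemma measurable_nat_eq d' (T : measurableType d') (f : T -> nat) c :
  measurable_fun setT f -> measurable [set z | f z = c].
Proof. by move=> mf; apply: measurable_eqn => //; exact: measurable_cst. Qed.

(** The input path seen from the o-th gap on. *)
Definition input n o w := compound (shift_seq (gaps n w) o) (shift_seq (batches n w) o).

(** The input path whose first gap is replaced by x, with the prescribed increments. *)
Let head_event n o l w (x : R) : Prop :=
  0 < x /\ increments l (compound (cons_seq (posr x) (shift_seq (gaps n w) o.+1)) (shift_seq (batches n w) o)).

(** If the first gap exceeds t, its residual has again the law of a gap and the input
after t is a fresh input. *)
Lemma head_law n o l t : 0 <= t ->
  unitf (fun w => ind (head_event n o l w (gap X n o w - t)) : R) /\
  Ex (fun w => ind (head_event n o l w (gap X n o w - t))) =
  expR (- mu * t) * Ex (fun w => ind (increments l (input n o w))).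
Proof.
move=> t0.
pose J := [set z | (exists j, z = Gap n j /\ j <> o) \/ exists j, z = Batch n j].
pose K := [set Gap n o].
have JK : J `&` K = set0.
  by apply/seteqP; split => // z [[[j [-> jo]]|[j ->]] //= [e]].
have uF t' : unitf ((fun z => ind (head_event n o l z.1 (gap X n o z.2 - t'))) : Osub J * Osub K -> R).
  have mg : measurable_fun setT (fun z : Osub J * Osub K => gap X n o z.2 - t').
    by apply: measurable_funB => //; apply: (measurableT_comp (@measurable_gap K n o _)).
  apply: unitf_ind; rewrite /head_event.
  apply: (@measurableI _ _ [set z : Osub J * Osub K | 0 < gap X n o z.2 - t']).
    by apply: measurable_ltr.
  pose lf : seq ((Osub J * Osub K -> R) * nat) := [seq ((fun=> p.1), p.2) | p <- l].
  rewrite [X in measurable X](_ : _ = [set z : Osub J * Osub K | increments (durations lf z)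
    (compound (cons_seq (posr (gap X n o z.2 - t')) (shift_seq (gaps n z.1) o.+1)) (shift_seq (batches n z.1) o))]); last first.
    by apply/seteqP; split => z /=; rewrite durations_cst.
  apply: (measurable_increments (f := fun z : Osub J * Osub K => compound
    (cons_seq (posr (gap X n o z.2 - t')) (shift_seq (gaps n z.1) o.+1)) (shift_seq (batches n z.1) o))).
    by move=> p; exact: durations_cst_measurable.
  move=> tau mtau.
  apply: (measurable_compound
    (v := fun j (z : Osub J * Osub K) => cons_seq (posr (gap X n o z.2 - t')) (shift_seq (gaps n z.1) o.+1) j)
    (k := fun j (z : Osub J * Osub K) => shift_seq (batches n z.1) o j)) => //.
  - by move=> z [|j]; [exact: posr_gt0|exact: gaps_pos].
  - move=> [|j] /=; first exact: measurable_posr.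
    apply: (measurableT_comp (@measurable_gap J n (o.+1 + j) _)) => //.
    by left; exists (o.+1 + j)%N; split => // e; move: e; clear; lia.
  - by move=> j; apply: (measurableT_comp (@measurable_batch J n (o + j) _)) => //; right; exists (o + j)%N.
split; first exact: (unitf_comp (uF t) (@measurable_diag _ _ _ _ X J K)).
rewrite (Ex_fubini (inputs_indep hX) (F := fun z => ind (head_event n o l z.1 (gap X n o z.2 - t))) JK (uF t)).
have E w1 : Ex (fun w2 => ind (head_event n o l w1 (gap X n o w2 - t))) =
    expR (- mu * t) * Ex (fun w2 => ind (head_event n o l w1 (gap X n o w2 - 0))).
  rewrite (Ex_gap n o (phi := fun x => ind (head_event n o l w1 x))) ?subr0//.
  - by congr (_ * _); apply: eq_Ex => w; rewrite subr0.
  - apply: unitf_ind; apply: (@measurableI _ _ [set x : R | 0 < x]).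
      by apply: measurable_ltr.
    pose lf : seq ((R -> R) * nat) := [seq ((fun=> p.1), p.2) | p <- l].
    rewrite [X in measurable X](_ : _ = [set x : R | increments (durations lf x)
      (compound (cons_seq (posr x) (shift_seq (gaps n w1) o.+1)) (shift_seq (batches n w1) o))]); last first.
      by apply/seteqP; split => z /=; rewrite durations_cst.
    apply: (measurable_increments (f := fun x : R => compound
      (cons_seq (posr x) (shift_seq (gaps n w1) o.+1)) (shift_seq (batches n w1) o))).
      by move=> p; exact: durations_cst_measurable.
    move=> tau mtau.
    apply: (measurable_compound (v := fun j (x : R) => cons_seq (posr x) (shift_seq (gaps n w1) o.+1) j)
      (k := fun j (x : R) => shift_seq (batches n w1) o j)) => //.
    - by move=> z [|j]; [exact: posr_gt0|exact: gaps_pos].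
    - by move=> [|j] /=; [exact: measurable_posr|exact: measurable_cst].
  - by move=> x x0; apply: indF => -[]; rewrite ltNge ltW.
rewrite (eq_Ex P (G := fun w1 => expR (- mu * t) * Ex (fun w2 => ind (head_event n o l w1 (gap X n o w2 - 0))))); last exact: E.
have emu : 0 <= expR (- mu * t) <= 1.
  by rewrite expR_ge0/= -[leRHS]expR0 ler_expR mulNr oppr_le0 mulr_ge0// ltW.
rewrite ExZ; last first.
  by apply: (@unitf_Osub _ _ _ _ X J); exact: (unitf_fubini (uF 0)).
congr (_ * _).
rewrite -(Ex_fubini (inputs_indep hX) (F := fun z => ind (head_event n o l z.1 (gap X n o z.2 - 0))) JK (uF 0)).
apply: eq_Ex => w /=; apply: ind_eq; rewrite /head_event subr0.
have g0 := gap_pos hX n o w.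
by rewrite /input [shift_seq (gaps n w) o]shift_seqS posrE//; split => [[_ ?]|?].
Qed.

(** If the first gap ends before t, the remaining path is the input from the next gap
on, independent of the gap and of its batch c. *)
Lemma tail_law n o l t i c (q : R) : 0 <= t ->
  (forall t', 0 <= t' -> Ex (fun w => ind (increments ((t', i) :: l) (input n o.+1 w))) = pois i t' * q) ->
  unitf (fun w => ind (gap X n o w <= t) * (ind (batch X n o w = c) *
      ind (increments ((t - gap X n o w, i) :: l) (input n o.+1 w))) : R) /\
  Ex (fun w => ind (gap X n o w <= t) * (ind (batch X n o w = c) *
      ind (increments ((t - gap X n o w, i) :: l) (input n o.+1 w)))) =
  batch_series c * Ex (fun w => pois i (t - gap X n o w)) * q.
Proof.
move=> t0 IH.
pose J := [set Gap n o; Batch n o].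
pose K := [set z | (exists j, z = Gap n j /\ (o < j)%N) \/ exists j, z = Batch n j /\ (o < j)%N].
have JK : J `&` K = set0.
  by apply/seteqP; split => // z [[->|->] [[j [[]]]|[j [[]]]]] // e; rewrite e ltnn.
have JG : J (Gap n o) by left.
have JB : J (Batch n o) by right.
have mg : measurable_fun setT (fun z : Osub J * Osub K => gap X n o z.1).
  exact: (measurableT_comp (measurable_gap JG)).
have mb : measurable_fun setT (fun z : Osub J * Osub K => batch X n o z.1).
  exact: (measurableT_comp (measurable_batch JB)).
pose F (z : Omega * Omega) : R := ind (gap X n o z.1 <= t) * (ind (batch X n o z.1 = c) *
      ind (increments ((t - gap X n o z.1, i) :: l) (input n o.+1 z.2))).
have uF : unitf (F : Osub J * Osub K -> R).
  apply: unitfM; first by apply: unitf_ind; exact: measurable_ler.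
  apply: unitfM; first by apply: unitf_ind; exact: measurable_nat_eq.
  pose lf : seq ((Osub J * Osub K -> R) * nat) :=
    ((fun z => t - gap X n o z.1), i) :: [seq ((fun=> p.1), p.2) | p <- l].
  rewrite (_ : (fun z => _) = fun z : Osub J * Osub K => ind (increments (durations lf z) (input n o.+1 z.2))); last first.
    by apply/funext => z; rewrite /lf /= durations_cst.
  apply: (unitf_increments (v := fun j (z : Osub J * Osub K) => shift_seq (gaps n z.2) o.+1 j)
    (k := fun j (z : Osub J * Osub K) => shift_seq (batches n z.2) o.+1 j)).
  - move=> p; rewrite [List.In _ _]/= => -[<-|h]; first by apply: measurable_funB.
    exact: (durations_cst_measurable h).
  - by move=> z j; exact: gaps_pos.
  - move=> j; apply: (measurableT_comp (@measurable_gap K n (o.+1 + j) _)) => //.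
    by left; exists (o.+1 + j)%N; split => //; rewrite addSn ltnS leq_addr.
  - move=> j; apply: (measurableT_comp (@measurable_batch K n (o.+1 + j) _)) => //.
    by right; exists (o.+1 + j)%N; split => //; rewrite addSn ltnS leq_addr.
split; first exact: (unitf_comp uF (@measurable_diag _ _ _ _ X J K)).
rewrite (Ex_fubini (inputs_indep hX) JK uF) /F /=.
have u2 w1 : unitf (fun w2 => ind (increments ((t - gap X n o w1, i) :: l) (input n o.+1 w2)) : R).
  have -> : (fun w2 => ind (increments ((t - gap X n o w1, i) :: l) (input n o.+1 w2)) : R) =
    fun w2 => ind (increments (durations [seq ((fun=> p.1) : Omega -> R, p.2) | p <- (t - gap X n o w1, i) :: l] w2) (input n o.+1 w2)).
    by apply/funext => w2; rewrite durations_cst.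
  apply: (unitf_increments (v := fun j w => shift_seq (gaps n w) o.+1 j) (k := fun j w => shift_seq (batches n w) o.+1 j)).
  - exact: durations_cst_measurable.
  - by move=> z j; exact: gaps_pos.
  - by move=> j; exact: measurable_funPT.
  - by move=> j; exact: measurable_funPT.
have upois : unitf (fun w => pois i (t - gap X n o w)).
  by apply: (unitf_comp (unitf_pois i)); apply: measurable_funB.
rewrite (eq_Ex P (G := fun w1 => q * (ind (batch X n o w1 = c) * pois i (t - gap X n o w1)))); last first.
  move=> w1; have [gt|gt] := leP (gap X n o w1) t.
    rewrite (eq_Ex P (G := fun w2 => ind (batch X n o w1 = c) * ind (increments ((t - gap X n o w1, i) :: l) (input n o.+1 w2)))); last first.
      by move=> w2; rewrite indT ?mul1r.
    by rewrite ExZ// IH ?subr_ge0//; ring.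
  rewrite compound_pmf_neg ?subr_lt0// !mulr0 -[RHS](Ex_cst P 0); apply: eq_Ex => w2.
  by rewrite indF ?mul0r.
have ub : unitf (fun w => ind (batch X n o w = c) : R).
  by apply: unitf_ind; apply: measurable_nat_eq; exact: measurable_funPT.
rewrite ExZ; last exact: unitfM.
rewrite (@ExM _ _ _ _ _ (inputs_indep hX) [set Batch n o] [set Gap n o]).
- rewrite batch_seriesE mulrC; congr (_ * _ * _).
  apply: (Ex_same_law (F := fun k => ind (k = c))); first exact: (batch_law hX).
  by apply: unitf_ind; apply: measurable_nat_eq.
- by apply/seteqP; split => // z [-> []].
- by apply: unitf_ind; apply: measurable_nat_eq; exact: measurable_batch.
- apply: (unitf_comp (unitf_pois i)); apply: measurable_funB => //; exact: measurable_gap.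
Qed.

Lemma input_split n o l t i w : 0 <= t -> (forall p, p \in l -> 0 <= p.1) -> unbounded_sums (gaps n w) ->
  ind (increments ((t, i) :: l) (input n o w)) =
  (i == 0%N)%:R * ind (head_event n o l w (gap X n o w - t)) +
  \sum_(c < i.+1) ind (gap X n o w <= t) * (ind (batch X n o w = c) *
      ind (increments ((t - gap X n o w, (i - c)%N) :: l) (input n o.+1 w))) :> R.
Proof.
move=> t0 l0 uv.
have g0 := gap_pos hX n o w.
have vp : positive_seq (shift_seq (gaps n w) o.+1) by move=> j; exact: gaps_pos.
have vu : unbounded_sums (shift_seq (gaps n w) o.+1).
  by apply: shift_unbounded => //; exact: gaps_pos.
have fE : input n o w = compound (cons_seq (gap X n o w) (shift_seq (gaps n w) o.+1)) (shift_seq (batches n w) o).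
  by rewrite /input shift_seqS.
have [gt|gt] := leP (gap X n o w) t.
  rewrite [ind (head_event _ _ _ _ _)]indF ?mulr0 ?add0r; last first.
    by move=> []; rewrite subr_gt0 ltNge gt.
  rewrite (eq_bigr (fun c : 'I_i.+1 => ind (batch X n o w = c) *
     ind (increments ((t - gap X n o w, (i - c)%N) :: l) (input n o.+1 w)))); last first.
    by move=> c _; rewrite indT ?mul1r.
  have tailE u : t <= u -> input n o w u = (batch X n o w + input n o.+1 w (u - gap X n o w))%N.
    move=> tu; rewrite fE [shift_seq (batches n w) o]shift_seqS compound_tail//; exact: le_trans tu.
  have [bi|bi] := leqP (batch X n o w) i; last first.
    rewrite indF ?big1//.
      move=> c _; rewrite indF ?mul0r// => e.
      by have := ltn_ord c; rewrite -e ltnS leqNgt bi.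
    by move=> [+ _]; rewrite tailE// => e; move: bi; rewrite -e ltnNge leq_addr.
  rewrite (bigD1 (Ordinal (bi : batch X n o w < i.+1)%N))//= [X in _ + X]big1 ?addr0; last first.
    move=> c cb; rewrite indF ?mul0r// => e; move: cb; rewrite -val_eqE/= e eqxx//.
  rewrite [ind (_ = _)]indT// mul1r; apply: ind_eq => /=.
  rewrite tailE//.
  have E : increments l (fun u => input n o w (t + u) - i)%N <->
    increments l (fun u => input n o.+1 w (t - gap X n o w + u) - (i - batch X n o w))%N.
    apply: eq_increments => // u u0; rewrite tailE ?lerDl//.
    have -> : t + u - gap X n o w = t - gap X n o w + u by ring.
    by clear -bi; lia.
  split => -[e H].
    by split; [clear -bi e; lia|apply/E].
  by split; [clear -bi e; lia|apply/E].
rewrite [X in _ + X]big1 ?addr0; last first.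
  by move=> c _; rewrite indF ?mul0r.
have f0 : input n o w t = 0%N by rewrite fE compound_head// t0 gt.
have fS u : 0 <= u -> input n o w (t + u) = compound (cons_seq (gap X n o w - t) (shift_seq (gaps n w) o.+1)) (shift_seq (batches n w) o) u.
  by move=> u0; rewrite fE compound_shift// t0 gt.
have [->|i0] := eqVneq i 0%N; last first.
  by rewrite mul0r; apply: indF => -[e _]; move: i0; rewrite -e f0.
rewrite mul1r; apply: ind_eq => /=; rewrite f0 /head_event subr_gt0 gt posrE ?subr_gt0//.
have E : increments l (fun u => input n o w (t + u) - 0)%N <->
    increments l (compound (cons_seq (gap X n o w - t) (shift_seq (gaps n w) o.+1)) (shift_seq (batches n w) o)).
  by apply: eq_increments => // u u0; rewrite subn0 fS.
by split => -[_ H]; split => //; apply/E.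
Qed.

Lemma unitf_input n o l : unitf (fun w => ind (increments l (input n o w)) : R).
Proof.
have -> : (fun w => ind (increments l (input n o w)) : R) =
    fun w => ind (increments (durations [seq ((fun=> p.1) : Omega -> R, p.2) | p <- l] w) (input n o w)).
  by apply/funext => w; rewrite durations_cst.
apply: (unitf_increments (v := fun j w => shift_seq (gaps n w) o j) (k := fun j w => shift_seq (batches n w) o j)).
- exact: durations_cst_measurable.
- by move=> z j; exact: gaps_pos.
- by move=> j; exact: measurable_funPT.
- by move=> j; exact: measurable_funPT.
Qed.

Lemma sum_ind_le1 (k m : nat) (G : nat -> R) : (forall c, 0 <= G c <= 1) ->
  0 <= \sum_(c < m) ind (k = c :> nat) * G c <= 1.
Proof.
move=> G01; have [km|km] := ltnP k m.
  rewrite (bigD1 (Ordinal km))//= indT// mul1r big1 ?addr0// => c ck.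
  by rewrite indF ?mul0r// => e; move: ck; rewrite -val_eqE/= e eqxx.
rewrite big1 ?lexx ?ler01// => c _; rewrite indF ?mul0r// => e.
by have := ltn_ord c; rewrite -e ltnNge km.
Qed.

(** Induction on the list of increments and on the first of them, along the decomposition
[input_split]: a first gap beyond t consumes a duration, and a first gap before t
brings a batch of size at least 1, which leaves a smaller first increment. The
recursion obtained is [compound_pmf_renewal]. *)
Lemma increments_law n o l : (forall p, p \in l -> 0 <= p.1) ->
  Ex (fun w => ind (increments l (input n o w))) = \prod_(p <- l) pois p.2 p.1.
Proof.
elim: l o => [|[t i] l IHl] o l0.
  by rewrite big_nil -[RHS](Ex_cst P 1); apply: eq_Ex => w; exact: indT.
have t0 : 0 <= t by apply: (l0 (t, i)); rewrite mem_head.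
have {}l0 p : p \in l -> 0 <= p.1 by move=> pl; apply: l0; rewrite inE pl orbT.
rewrite big_cons /=; set q := \prod_(p <- l) _.
elim/ltn_ind: i o t t0 => i IHi o t t0.
have [uh Eh] := head_law n o l t0.
have IHc (c : nat) : (c <= i)%N -> (0 < c)%N -> forall t', 0 <= t' ->
    Ex (fun w => ind (increments ((t', (i - c)%N) :: l) (input n o.+1 w))) = pois (i - c) t' * q.
  by move=> ci c0 t' t'0; apply: IHi => //; lia.
have b0 : batch_series 0%N = 0 := batch_series0.
pose T (c : nat) (w : Omega) : R := ind (gap X n o w <= t) * (ind (batch X n o w = c) *
      ind (increments ((t - gap X n o w, (i - c)%N) :: l) (input n o.+1 w))).
have HT (c : 'I_i.+1) : unitf (T c) /\ Ex (T c) = batch_series c * Ex (fun w => pois (i - c) (t - gap X n o w)) * q.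
  have [c0|c0] := posnP c; last first.
    by apply: tail_law => // t' t'0; apply: IHc => //; rewrite -ltnS.
  have T0 w : T c w = 0.
    by rewrite /T [X in _ * (X * _)]indF ?mul0r ?mulr0// c0 => e; have := batch_pos hX n o w; rewrite e.
  have -> : T c = fun=> 0 by apply/funext.
  by rewrite c0 b0 !mul0r Ex_cst; split => //; apply: unitf_cst; rewrite lexx ler01.
have uT : unitf (fun w => \sum_(c < i.+1) T c w).
  split; first by apply: measurable_sum => c; case: (HT c) => -[].
  move=> w; rewrite (eq_bigr (fun c : 'I_i.+1 => ind (batch X n o w = c) * (ind (gap X n o w <= t) *
      ind (increments ((t - gap X n o w, (i - c)%N) :: l) (input n o.+1 w))))); last first.
    by move=> c _; rewrite /T; ring.
  apply: (@sum_ind_le1 _ _ (fun c => ind (gap X n o w <= t) *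
      ind (increments ((t - gap X n o w, (i - c)%N) :: l) (input n o.+1 w)))) => c.
  by rewrite mulr_ge0 ?ind_ge0//= mulr_ile1 ?ind_ge0 ?ind_le1.
have ui : unitf (fun w => (i == 0%N)%:R * ind (head_event n o l w (gap X n o w - t)) : R).
  by apply: unitfM => //; apply: unitf_cst; case: (i == 0%N); rewrite ?lexx ?ler01.
have uS : unitf (fun w => (i == 0%N)%:R * ind (head_event n o l w (gap X n o w - t)) + \sum_(c < i.+1) T c w).
  split; first by apply: measurable_funD; [case: ui|case: uT].
  move=> w; have [gt|gt] := leP (gap X n o w) t.
    rewrite [ind (head_event _ _ _ _ _)]indF ?mulr0 ?add0r; first by case: uT.
    by move=> []; rewrite subr_gt0 ltNge gt.
  rewrite [X in _ + X]big1 ?addr0; first by case: ui.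
  by move=> c _; rewrite /T indF ?mul0r//; move=> h; move: gt; rewrite ltNge h.
rewrite (eq_Ex_as (gaps_unbounded n) (unitf_input n o ((t, i) :: l)) uS (fun w uw => input_split o i t0 l0 uw)).
rewrite ExD//.
rewrite ExZ// Eh IHl// Ex_sum; last by move=> c; case: (HT c).
rewrite (compound_pmf_renewal mu0 batch_series0 batch_series_ge0 batch_series_sum_le1 (gap_law hX n o) (gap_pos hX n o))//.
rewrite mulrDl mulrA; congr (_ + _).
rewrite mulr_suml; apply: eq_bigr => c _; by case: (HT c).
Qed.

End busy_law.

(** * Generating functions of the input *)

Section batch_gf.
Context {d : measure_display} {Omega : measurableType d} {R : realType}.
Context {P : probability Omega R}.
Variables (mu s : R) (kappa : {RV P >-> nat}).
Hypotheses (mu0 : 0 < mu) (s0 : 0 < s) (kappa0 : forall w, (0 < kappa w)%N).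
Local Notation Ex := (Ex P).
Local Notation pois := (compound_pmf mu (batch_series kappa)).

Lemma batch_gf (th : R) : `|th| <= 1 ->
  summ th (batch_series kappa) (fine 'E_P[fun w => th ^+ kappa w]) /\ `|fine 'E_P[fun w => th ^+ kappa w]| <= 1.
Proof.
move=> th1; rewrite unlock -/(Ex (fun w => th ^+ kappa w)).
have mk : measurable_fun setT (kappa : Omega -> nat) by exact: measurable_funPT.
have pow1 i : `|th ^+ i| <= 1 by rewrite normrX exprn_ile1.
have h : summ th (batch_series kappa) (Ex (fun w => th ^+ kappa w)).
  rewrite /summ (_ : series _ = fun m => Ex (fun w => th ^+ kappa w * ind (kappa w < m)%N)); last first.
    apply/funext => m; rewrite seriesEord.
    rewrite (eq_bigr (fun i : 'I_m => th ^+ i * Ex (fun w => ind (kappa w = i)))); last first.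
      by move=> i _; rewrite batch_seriesE.
    rewrite -(@Ex_comb _ _ _ P (fun i => th ^+ i) (fun i w => ind (kappa w = i))); last first.
      by move=> i; apply: unitf_ind; exact: (@measurable_nat_pred _ _ kappa (fun x => x = i) mk).
    apply: eq_Ex => w; rewrite mulrC -(sum_ind _ m (fun i => th ^+ i)).
    by apply: eq_bigr => i _; rewrite mulrC.
  have mp : measurable_fun setT (fun w => th ^+ kappa w).
    by apply: (measurableT_comp (f := fun i : nat => th ^+ i)).
  apply: Ex_cvg_norm => //.
  - move=> m; apply: measurable_funM => //.
    by case: (unitf_ind (R := R) (@measurable_nat_pred _ _ kappa (fun x => (x < m)%N) mk)).
  - by move=> m w; rewrite normrM (ger0_norm (ind_ge0 _)) mulr_ile1 ?ind_ge0 ?ind_le1.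
  - by move=> w; apply: cvg_near_cst; exists (kappa w).+1 => // m /= hm; rewrite indT ?mulr1.
split => //; apply: (cvgr_to_le (cvg_norm h)); apply: nearW => m.
rewrite seriesEord; apply: le_trans (ler_norm_sum _ _ _) _.
exact: (compound_bnd (batch_series_ge0 kappa) (batch_series_sum_le1 kappa) th1 m).
Qed.

Lemma pois_ge0 i t : 0 <= pois i t.
Proof. by have [_ /(_ t)/andP[]] := unitf_pois kappa mu0 i. Qed.

Lemma pois_le1 i t : pois i t <= 1.
Proof. by have [_ /(_ t)/andP[]] := unitf_pois kappa mu0 i. Qed.

Lemma pois_gf (th t : R) : `|th| <= 1 -> 0 <= t ->
  summ th (fun i => pois i t) (expR (t * cumulant mu kappa th)).
Proof.
move=> th1 t0; have [al _] := batch_gf th1.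
by have := compound_pmf_gf mu0 (batch_series0 kappa0) (batch_series_ge0 kappa) (batch_series_sum_le1 kappa) th1 al t0.
Qed.

Lemma cumulant_le0 th : `|th| <= 1 -> cumulant mu kappa th <= 0.
Proof.
move=> th1; have [_ al1] := batch_gf th1.
rewrite /cumulant pmulr_rle0// subr_le0; exact: le_trans (ler_norm _) al1.
Qed.

Lemma cumulant1 : cumulant mu kappa 1 = 0.
Proof.
have E : fine 'E_P[fun w => (1 : R) ^+ kappa w] = 1.
  by rewrite unlock -[RHS](Ex_cst P 1); apply: eq_Ex => w; rewrite expr1n.
by rewrite /cumulant E subrr mulr0.
Qed.

Lemma pois_sum_le1 t m : \sum_(i < m) pois i t <= 1.
Proof.
have [t0|t0] := leP 0 t; last by rewrite big1 ?ler01// => i _; exact: compound_pmf_neg.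
have one : `|1 : R| <= 1 by rewrite normr1.
have := pois_gf one t0; rewrite cumulant1 mulr0 expR0 /summ => h.
have -> : \sum_(i < m) pois i t = series (fun i => 1 ^+ i * pois i t) m.
  by rewrite seriesEord; apply: eq_bigr => i _; rewrite expr1n mul1r.
rewrite -[leRHS](cvg_lim _ h)//; apply: nondecreasing_cvgn_le; last exact: cvgP h.
by apply/nondecreasing_seqP => j; rewrite seriesSr lerDl expr1n mul1r pois_ge0.
Qed.

(** The generating functions at the times t and u multiply. *)
Lemma pois_add (t u : R) i : 0 <= t -> 0 <= u -> pois i (t + u) = \sum_(c < i.+1) pois c t * pois (i - c) u.
Proof.
move=> t0 u0; pose a : fps R := fun i => pois i t; pose b : fps R := fun i => pois i u.
pose ab : fps R := fun i => pois i (t + u).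
have b1 (v : R) k : `|pois k v| <= 1 by rewrite ger0_norm ?pois_le1 ?pois_ge0.
have -> : pois i (t + u) = ab i by [].
suff -> : ab = a * b by rewrite fpsME.
apply: (summ_uniq (c := 1) (l := fun th => expR ((t + u) * cumulant mu kappa th))) => // th th1.
  by apply: pois_gf; rewrite ?addr_ge0// ltW.
rewrite mulrDl expRD; apply: mertens; last by apply: pois_gf; rewrite // ltW.
  by apply: bounded_abssumm => // k; exact: b1.
by apply: pois_gf; rewrite // ltW.
Qed.

(** Law of the input during the random time V, on the event that an independent
exponential clock outlives V. *)
Definition mixed_series (V : Omega -> R) : fps R := fun i => Ex (fun w => expR (- s * V w) * pois i (V w)).

Section mixed.
Variable V : Omega -> R.
Hypotheses (mV : measurable_fun setT V) (V0 : forall w, 0 < V w).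

Let uexp : unitf (fun w => expR (- s * V w)).
Proof.
split; first by apply: measurableT_comp => //; exact: measurable_funM.
by move=> w; rewrite expR_ge0/= -[leRHS]expR0 ler_expR mulNr oppr_le0 mulr_ge0// ltW.
Qed.

Lemma unitf_mixed i : unitf (fun w => expR (- s * V w) * pois i (V w)).
Proof. by apply: unitfM => //; apply: (unitf_comp (unitf_pois kappa mu0 i)). Qed.

Lemma mixed_series_ge0 i : 0 <= mixed_series V i.
Proof. by apply: Ex_ge0 => w; rewrite mulr_ge0 ?expR_ge0 ?pois_ge0. Qed.

Lemma mixed_series_sum m : \sum_(i < m) mixed_series V i <= Ex (fun w => expR (- s * V w)).
Proof.
rewrite -Ex_sum; last by move=> i; exact: unitf_mixed.
have h w : \sum_(i < m) expR (- s * V w) * pois i (V w) <= expR (- s * V w).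
  by rewrite -mulr_sumr ler_piMr ?expR_ge0// pois_sum_le1.
apply: Ex_le => //; split.
  by apply: measurable_sum => i; case: (unitf_mixed i).
move=> w; apply/andP; split; first by apply: sumr_ge0 => i _; rewrite mulr_ge0 ?expR_ge0 ?pois_ge0.
by apply: le_trans (h w) _; case: uexp => _ /(_ w)/andP[].
Qed.

Lemma mixed_gf th : `|th| <= 1 ->
  summ th (mixed_series V) (fine 'E_P[fun w => expR (- (s - cumulant mu kappa th) * V w)]).
Proof.
move=> th1; rewrite unlock -/(Ex (fun w => expR (- (s - cumulant mu kappa th) * V w))).
rewrite /summ (_ : series _ = fun m => Ex (fun w => \sum_(i < m) th ^+ i * (expR (- s * V w) * pois i (V w)))); last first.
  apply/funext => m; rewrite seriesEord (@Ex_comb _ _ _ P (fun i => th ^+ i) (fun i w => expR (- s * V w) * pois i (V w)))//.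
  by move=> i; exact: unitf_mixed.
apply: Ex_cvg_norm.
- by move=> m; apply: measurable_sum => i; apply: measurable_funM => //; case: (unitf_mixed i).
- by apply: measurableT_comp => //; exact: measurable_funM.
- move=> m w; apply: le_trans (ler_norm_sum _ _ _) _; apply: le_trans (pois_sum_le1 (V w) m).
  apply: ler_sum => i _; have := uexp.2 w => /andP[e0 e1].
  rewrite normrM normrX normrM (ger0_norm e0) (ger0_norm (pois_ge0 i (V w))).
  rewrite mulrA ler_piMl ?pois_ge0// mulr_ile1 ?exprn_ge0 ?exprn_ile1//.
- move=> w; have := pois_gf th1 (ltW (V0 w)); rewrite /summ => h.
  rewrite (_ : (fun m => _) = fun m => expR (- s * V w) * series (fun i => th ^+ i * pois i (V w)) m).
    rewrite (_ : - (s - _) * V w = - s * V w + V w * cumulant mu kappa th); last by ring.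
    by rewrite expRD; apply: cvgMr.
  apply/funext => m; rewrite seriesEord mulr_sumr; apply: eq_bigr => i _; ring.
Qed.

End mixed.

Lemma mixed_series_law (V W : {RV P >-> R}) : (forall w, 0 < V w) -> (forall w, 0 < W w) -> same_law V W ->
  mixed_series V = mixed_series W.
Proof.
move=> V0 W0 VW; apply/funext => i.
pose phi (x : R) := ind (0 <= x) * (expR (- s * x) * pois i x).
have uphi : unitf phi.
  split.
    apply: measurable_funM; first by case: (@unitf_ind _ R R (fun x => 0 <= x)); [exact: measurable_ler|by []].
    apply: measurable_funM; last by case: (unitf_pois kappa mu0 i).
    by apply: measurableT_comp => //; exact: measurable_funM.
  move=> x; rewrite /phi; have [x0|x0] := leP 0 x; last by rewrite indF// mul0r lexx ler01.
  rewrite indT// mul1r mulr_ge0 ?expR_ge0 ?pois_ge0//= mulr_ile1 ?expR_ge0 ?pois_ge0 ?pois_le1//.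
  by rewrite -[leRHS]expR0 ler_expR mulNr oppr_le0 mulr_ge0// ltW.
have E (U : Omega -> R) : (forall w, 0 < U w) -> mixed_series U i = Ex (fun w => phi (U w)).
  by move=> U0; apply: eq_Ex => w; rewrite /phi indT ?mul1r// ltW.
by rewrite !E//; exact: Ex_same_law.
Qed.

End batch_gf.

(** * Memorylessness of the clock and the one-service step *)

(** Increments over consecutive durations are differences between consecutive epochs.
Truncated subtraction is exact because f is nondecreasing. *)
Lemma increments_iota (R : realType) (f : R -> nat) (v : nat -> R) (i : nat -> nat) (k o : nat) :
  (forall t u : R, 0 <= t -> t <= u -> (f t <= f u)%N) ->
  (forall m, (o <= m < o + k)%N -> 0 <= v m) -> 0 <= partial_sum v o ->
  increments [seq (v m, i m) | m <- iota o k] (fun u => f (partial_sum v o + u)%R - f (partial_sum v o))%N <->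
  (forall m, (o <= m < o + k)%N -> (f (partial_sum v m.+1) - f (partial_sum v m))%N = i m).
Proof.
have subn3 (a b c : nat) : (a <= b)%N -> (b <= c)%N -> (c - a - (b - a) = c - b)%N by lia.
move=> fle; elim: k o => [|k IH] o v0 So /=.
  by split => // _ m; rewrite addn0 => /andP[a b]; have := leq_trans b a; rewrite ltnn.
have vo : 0 <= v o by apply: v0; rewrite leqnn/= addnS ltnS leq_addr.
have So1 : 0 <= partial_sum v o.+1 by rewrite partial_sumS addr_ge0.
have {}IH := IH o.+1 _ So1.
have E (u : R) : 0 <= u -> (f (partial_sum v o + (v o + u))%R - f (partial_sum v o) - (f (partial_sum v o.+1) - f (partial_sum v o)) =
    f (partial_sum v o.+1 + u)%R - f (partial_sum v o.+1))%N.
  move=> u0; rewrite partial_sumS addrA.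
  have h1 : (f (partial_sum v o) <= f (partial_sum v o + v o)%R)%N by apply: fle; rewrite ?lerDl.
  have h2 : (f (partial_sum v o + v o)%R <= f (partial_sum v o + v o + u)%R)%N by apply: fle; rewrite ?lerDl// -partial_sumS.
  by apply: subn3 h1 h2.
have v0' m : (o.+1 <= m < o.+1 + k)%N -> 0 <= v m by move=> h; apply: v0; move: h; lia.
have EQ c : c = (f (partial_sum v o.+1) - f (partial_sum v o))%N ->
    increments [seq (v m, i m) | m <- iota o.+1 k] (fun u => f (partial_sum v o + (v o + u))%R - f (partial_sum v o) - c)%N <->
    increments [seq (v m, i m) | m <- iota o.+1 k] (fun u => f (partial_sum v o.+1 + u)%R - f (partial_sum v o.+1))%N.
  move=> ->; apply: eq_increments; last by move=> u /E.
  by move=> p /mapP[m]; rewrite mem_iota => /v0' vm -> /=.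
rewrite -partial_sumS; split.
  move=> [e H] m /andP[om mk].
  have [<-//|mo] := eqVneq o m.
  apply: (IH v0').1; last by move: om mk mo; lia.
  by apply/(EQ (i o)).
move=> H; have e : (f (partial_sum v o.+1) - f (partial_sum v o))%N = i o by apply: H; rewrite leqnn/= addnS ltnS leq_addr.
split => //; apply/EQ => //; apply/IH => // m mk; apply: H; move: mk; lia.
Qed.

Section memoryless.
Context {d : measure_display} {Omega : measurableType d} {R : realType}.
Context {P : probability Omega R}.
Variables (mu s : R) (kappa delta : {RV P >-> nat}) (eta : {RV P >-> R}) (y : R) (X : inputs P).
Hypothesis hX : inputs_spec mu s kappa delta eta y X.
Hypotheses (s0 : 0 < s).
Local Notation Ex := (Ex P).
Local Notation Osub := (Osub X).

Lemma Ex_clock_ge t : 0 <= t -> Ex (fun w => ind (t <= clock X w)) = expR (- s * t).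
Proof. by move=> t0; rewrite (Ex_exponential_ge s0 (clock_law hX)). Qed.

(** Given the variables in J the time tau is a constant and
[exponential_memoryless] applies; the variables in K, observed after tau, are
integrated separately. *)
Lemma clock_memoryless J K (rho tau : Omega -> R) (Psi : Omega * R -> R) :
  J `&` K = set0 -> ~ J Clock -> ~ K Clock ->
  unitf (rho : Osub J -> R) -> measurable_fun setT (tau : Osub J -> R) -> (forall w, 0 <= tau w) ->
  unitf (Psi : Osub K * R -> R) ->
  Ex (fun w => rho w * (ind (tau w <= clock X w) * Psi (w, clock X w - tau w))) =
  Ex (fun w => rho w * ind (tau w <= clock X w)) * Ex (fun w => Psi (w, clock X w)).
Proof.
move=> JK JC KC urho mtau tau0 uPsi.
pose C := [set Clock].
have JKC : (J `|` K) `&` C = set0.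
  by apply/seteqP; split => // z [[h|h] /= zc]; rewrite zc in h.
have mC : measurable_fun setT (clock X : Osub C -> R) by exact: measurable_clock.
have mC2 : measurable_fun setT (fun z : Osub (J `|` K) * Osub C => clock X z.2) by exact: (measurableT_comp mC).
have mtau' : measurable_fun setT (tau : Osub (J `|` K) -> R) by apply: measurable_Osub_sub mtau; exact: subsetUl.
have urho' : unitf (rho : Osub (J `|` K) -> R) by apply: unitf_Osub_sub urho; exact: subsetUl.
have mid : measurable_fun setT (id : Osub (J `|` K) -> Osub K).
  by apply: (@measurable_Osub_sub _ _ _ _ X K); [exact: subsetUr|exact: measurable_id].
have utau J' : measurable_fun setT (tau : Osub J' -> R) ->
    unitf (fun z : Osub J' * Osub C => ind (tau z.1 <= clock X z.2) : R).
  move=> mt; apply: unitf_ind; apply: measurable_ler; first exact: (measurableT_comp mt).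
  exact: (measurableT_comp mC).
have uPsi2 : unitf (fun z : Osub (J `|` K) * Osub C => Psi (z.1, clock X z.2 - tau z.1)).
  apply: (unitf_comp uPsi); apply: measurable_fun_pair; first exact: (measurableT_comp mid (@measurable_fst _ _ _ _)).
  by apply: measurable_funB => //; exact: (measurableT_comp mtau' (@measurable_fst _ _ _ _)).
have uPsi0 : unitf (fun z : Osub K * Osub C => Psi (z.1, clock X z.2)).
  apply: (unitf_comp uPsi); apply: measurable_fun_pair; first exact: measurable_fst.
  exact: (measurableT_comp mC).
have KC0 : K `&` C = set0 by apply/seteqP; split => // z [h /= zc]; rewrite zc in h.
have JC0 : J `&` C = set0 by apply/seteqP; split => // z [h /= zc]; rewrite zc in h.
rewrite (Ex_fubini (inputs_indep hX) (F := fun z => rho z.1 * (ind (tau z.1 <= clock X z.2) * Psi (z.1, clock X z.2 - tau z.1))) JKC); last first.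
  apply: unitfM; first exact: (unitf_comp urho' (@measurable_fst _ _ _ _)).
  by apply: unitfM => //; exact: utau.
pose Q w1 := Ex (fun w2 => Psi (w1, clock X w2)).
have uQ : unitf (Q : Osub K -> R) by exact: (unitf_fubini uPsi0).
pose E w1 := expR (- s * tau w1).
have uE : unitf (E : Osub J -> R).
  split; last first.
    by move=> w; rewrite expR_ge0/= -[leRHS]expR0 ler_expR mulNr oppr_le0 mulr_ge0// ltW.
  by apply: measurableT_comp => //; exact: measurable_funM.
have inner w1 : Ex (fun w2 => rho w1 * (ind (tau w1 <= clock X w2) * Psi (w1, clock X w2 - tau w1))) =
    (rho w1 * E w1) * Q w1.
  have uphi : unitf (fun x : R => ind (0 <= x) * Psi (w1, x)).
    apply: unitfM; first by apply: unitf_ind; apply: measurable_ler.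
    by apply: (unitf_comp uPsi); apply: measurable_fun_pair; [exact: measurable_cst|exact: measurable_id].
  have upc t : unitf (fun w2 => ind (0 <= clock X w2 - t) * Psi (w1, clock X w2 - t)).
    by apply: (unitf_comp uphi); apply: measurable_funB.
  rewrite (eq_Ex P (G := fun w2 => rho w1 * (fun x : R => ind (0 <= x) * Psi (w1, x)) (clock X w2 - tau w1))); last first.
    by move=> w2; rewrite /= subr_ge0.
  rewrite ExZ// (exponential_memoryless s0 (clock_law hX) (phi := fun x : R => ind (0 <= x) * Psi (w1, x)))//; last first.
    by move=> x x0; rewrite leNgt x0 indF ?mul0r.
  rewrite mulrA; congr (_ * _); apply: eq_Ex => w2.
  by rewrite (ltW (clock_pos hX w2)) indT// mul1r.
rewrite (eq_Ex P inner).
rewrite (@ExM _ _ _ _ _ (inputs_indep hX) J K)//; last exact: unitfM.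
congr (_ * _).
  rewrite (Ex_fubini (inputs_indep hX) (F := fun z => rho z.1 * ind (tau z.1 <= clock X z.2)) JC0); last first.
    apply: unitfM; first exact: (unitf_comp urho (@measurable_fst _ _ _ _)).
    exact: utau.
  apply: eq_Ex => w1 /=; rewrite ExZ ?Ex_clock_ge//.
  by apply: unitf_ind; apply: measurable_ler.
by rewrite (Ex_fubini (inputs_indep hX) (F := fun z => Psi (z.1, clock X z.2)) KC0).
Qed.

End memoryless.

Section history.
Context {d : measure_display} {Omega : measurableType d} {R : realType}.
Context {P : probability Omega R}.
Variables (mu s : R) (kappa delta : {RV P >-> nat}) (eta : {RV P >-> R}) (y : R) (X : inputs P).
Hypothesis hX : inputs_spec mu s kappa delta eta y X.
Hypotheses (mu0 : 0 < mu) (s0 : 0 < s) (kappa0 : forall w, (0 < kappa w)%N).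
Local Notation Ex := (Ex P).
Local Notation Osub := (Osub X).
Local Notation pois := (compound_pmf mu (batch_series kappa)).

Definition arrivals n w (t : R) : nat := compound (gaps X n w) (batches X n w) t.
Definition services n w : nat -> R := fun j => service X n j w.
Definition epoch n k w : R := partial_sum (services n w) k.

Definition renewal_slots n : set slot := [set z | z = Clock \/
  (exists m, z = Service n m) \/ exists m, z = Removal n m].
Definition input_slots n : set slot := [set z | (exists m, z = Gap n m) \/ exists m, z = Batch n m].

Lemma renewal_input_disjoint n : renewal_slots n `&` input_slots n = set0.
Proof. by apply/seteqP; split => // z [[->|[[m ->]|[m ->]]] [[m']|[m']]]. Qed.

Lemma arrivals_le n w t u : unbounded_sums (gaps X n w) -> 0 <= t -> t <= u ->
  (arrivals n w t <= arrivals n w u)%N.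
Proof. by move=> uw t0 tu; apply: compound_le => //; exact: (gaps_pos hX). Qed.

Lemma measurable_arrivals_sub J n d' (T : measurableType d') (f : T -> Osub J) (tau : T -> R) :
  input_slots n `<=` J -> measurable_fun setT f -> measurable_fun setT tau ->
  measurable_fun setT (fun z => arrivals n (f z) (tau z)).
Proof.
move=> IJ mf mt.
apply: (measurable_compound (v := fun j z => gap X n j (f z)) (k := fun j z => batch X n j (f z))) => //.
- by move=> z j; exact: (gap_pos hX).
- by move=> j; apply: (measurableT_comp _ mf); apply: measurable_gap; apply: IJ; left; exists j.
- by move=> j; apply: (measurableT_comp _ mf); apply: measurable_batch; apply: IJ; right; exists j.
Qed.

Lemma measurable_arrivals n (tau : Omega -> R) :
  measurable_fun setT tau -> measurable_fun setT (fun w => arrivals n w (tau w)).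
Proof.
move=> mt.
apply: (measurable_compound (v := fun j z => gap X n j z) (k := fun j z => batch X n j z)) => //.
by move=> z j; exact: (gap_pos hX).
Qed.

Lemma measurable_forall_lt (Q : nat -> set Omega) k : (forall m, measurable (Q m)) ->
  measurable [set w | forall m, (m < k)%N -> Q m w].
Proof.
move=> mQ; rewrite (_ : [set w | _] = \bigcap_(m in [set m | (m < k)%N]) Q m).
  by apply: bigcap_measurableType.
by apply/seteqP; split => w.
Qed.

(** The durations depend on services, removals and the clock only, so that the input is
independent of them and [increments_law] applies given their values. *)
Lemma history_law n k (tau : nat -> Omega -> R) (i : nat -> nat) (rho : Omega -> R) :
  (forall m, measurable_fun setT (tau m : Osub (renewal_slots n) -> R)) ->
  unitf (rho : Osub (renewal_slots n) -> R) ->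
  (forall w, rho w != 0 -> forall m, (m < k)%N -> 0 <= tau m w) ->
  Ex (fun w => rho w * ind (forall m, (m < k)%N ->
    (arrivals n w (partial_sum (tau ^~ w) m.+1) - arrivals n w (partial_sum (tau ^~ w) m))%N = i m)) =
  Ex (fun w => rho w * \prod_(m < k) pois (i m) (tau m w)).
Proof.
move=> mtau urho rho_tau.
have JK := renewal_input_disjoint n.
set J := renewal_slots n in mtau urho JK *; set K := input_slots n in JK *.
have mtau0 m : measurable_fun setT (tau m).
  exact: (measurableT_comp (mtau m) (@measurable_id_Osub _ _ _ _ X J)).
have urho0 : unitf rho by exact: (@unitf_Osub _ _ _ _ X J).
pose lf : seq ((Omega -> R) * nat) := [seq (tau m, i m) | m <- iota 0 k].
have durE w : durations lf w = [seq (tau m w, i m) | m <- iota 0 k] by rewrite /durations -map_comp.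
pose F (z : Omega * Omega) := rho z.1 * ind (increments (durations lf z.1) (input X n 0 z.2)).
have uF : unitf (F : Osub J * Osub K -> R).
  apply: unitfM; first exact: (unitf_comp urho (@measurable_fst _ _ _ _)).
  pose lf' : seq ((Osub J * Osub K -> R) * nat) := [seq (fun z => tau m z.1, i m) | m <- iota 0 k].
  rewrite (_ : (fun z => _) = fun z : Osub J * Osub K => ind (increments (durations lf' z) (input X n 0 z.2))); last first.
    by apply/funext => z; rewrite durE /lf' /durations -map_comp.
  apply: (unitf_increments (v := fun j (z : Osub J * Osub K) => shift_seq (gaps X n z.2) 0 j)
    (k := fun j (z : Osub J * Osub K) => shift_seq (batches X n z.2) 0 j)).
  - move=> p; rewrite /lf'; elim: (iota 0 k) => //= m l IH [<-|/IH//] /=.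
    exact: (measurableT_comp (mtau m)).
  - by move=> z j; exact: (gap_pos hX).
  - move=> j; apply: (measurableT_comp (@measurable_gap _ _ _ _ X K n j _)) => //.
    by left; exists j.
  - move=> j; apply: (measurableT_comp (@measurable_batch _ _ _ _ X K n j _)) => //.
    by right; exists j.
transitivity (Ex (fun w => F (w, w))).
  apply: (eq_Ex_as (gaps_unbounded hX mu0 n)).
  - apply: unitfM => //; apply: unitf_ind; apply: measurable_forall_lt => // m.
    apply: measurable_nat_eq; apply: (measurable_nat2 nat subn);
      by apply: measurable_arrivals; apply: measurable_partial_sum.
  - exact: (unitf_comp uF (@measurable_diag _ _ _ _ X J K)).
  - move=> w uw; rewrite /F /=; have [->|r0] := eqVneq (rho w) 0; first by rewrite !mul0r.
    congr (_ * _); apply: ind_eq; rewrite durE.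
    have H := @increments_iota R (arrivals n w) (tau ^~ w) i k 0 _ _ _.
    have {}H := H (fun t u t0 tu => arrivals_le uw t0 tu) _ _.
    rewrite add0n partial_sum0 in H.
    have {}H := H (fun m => rho_tau w r0 m) (lexx 0).
    have E : increments [seq (tau m w, i m) | m <- iota 0 k] (input X n 0 w) <->
      increments [seq (tau m w, i m) | m <- iota 0 k] (fun u => arrivals n w (0 + u)%R - arrivals n w 0)%N.
      apply: eq_increments.
        by move=> p /mapP[m]; rewrite mem_iota add0n => /andP[_ mk] -> /=; exact: rho_tau.
      move=> u u0; rewrite add0r /arrivals compound0 ?subn0//; exact: (gaps_pos hX).
    by split => [h|/E/H h m mk]; [apply/E/H => m /andP[_ mk]; exact: h|exact: h].
rewrite (Ex_fubini (inputs_indep hX) JK uF); apply: eq_Ex => w1; rewrite /F /=.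
rewrite ExZ; last exact: (unitf_input hX).
have [->|r0] := eqVneq (rho w1) 0; first by rewrite !mul0r.
congr (_ * _); rewrite (increments_law hX mu0 s0 kappa0); last first.
  by rewrite durE => p /mapP[m]; rewrite mem_iota add0n => /andP[_ mk] -> /=; exact: rho_tau.
by rewrite durE big_map/= -[X in iota _ X]subn0 -/(index_iota 0 k) big_mkord.
Qed.


Definition removals n w : nat -> nat := fun j => removal X n j w.

(** Arrivals and removals of the first k service cycles: the content of the queue
during a busy period is a function of this countable variable. *)
Definition history n k w : seq (nat * nat) :=
  [seq ((arrivals n w (epoch n m.+1 w) - arrivals n w (epoch n m w))%N, removals n w m) | m <- iota 0 k].

Lemma history_eq n k w (l : seq (nat * nat)) : size l = k ->
  history n k w = l <-> (forall m, (m < k)%N -> removals n w m = (nth (0%N, 0%N) l m).2) /\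
    (forall m, (m < k)%N -> (arrivals n w (epoch n m.+1 w) - arrivals n w (epoch n m w))%N = (nth (0%N, 0%N) l m).1).
Proof.
move=> sl; split=> [<-|[H1 H2]].
  by split => m mk; rewrite (nth_map 0%N) ?size_iota// nth_iota.
apply: (@eq_from_nth _ (0%N, 0%N)); rewrite size_map size_iota// => m mk.
rewrite (nth_map 0%N) ?size_iota// nth_iota// add0n H1// H2//.
by case: (nth _ l m).
Qed.

Lemma epoch_ge0 n k w : 0 <= epoch n k w.
Proof. by apply: partial_sum_ge0 => j; exact: (service_pos hX). Qed.

Lemma measurable_epoch J n k : (forall m, (m < k)%N -> J (Service n m)) ->
  measurable_fun setT (epoch n k : Osub J -> R).
Proof.
elim: k => [|k IH] Jm.
  rewrite (_ : epoch n 0 = fun=> 0); first exact: measurable_cst.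
  by apply/funext => w; rewrite /epoch partial_sum0.
rewrite (_ : epoch n k.+1 = fun w => epoch n k w + service X n k w); last first.
  by apply/funext => w; rewrite /epoch partial_sumS.
apply: measurable_funD; first by apply: IH => m mk; apply: Jm; exact: ltnW.
by apply: measurable_service; apply: Jm.
Qed.

Lemma measurable_history n k (l : seq (nat * nat)) : measurable [set w | history n k w = l].
Proof.
have [sl|sl] := eqVneq (size l) k; last first.
  rewrite (_ : [set w | _] = set0)//; apply/seteqP; split => // w /= E.
  by move: sl; rewrite -E size_map size_iota eqxx.
rewrite [X in measurable X](_ : _ = [set w | forall m, (m < k)%N -> [set w | removals n w m = (nth (0%N, 0%N) l m).2] w] `&`
   [set w | forall m, (m < k)%N -> [set w | (arrivals n w (epoch n m.+1 w) - arrivals n w (epoch n m w))%N = (nth (0%N, 0%N) l m).1] w]); last first.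
  by apply/seteqP; split => w /=; rewrite history_eq.
apply: measurableI; apply: measurable_forall_lt => m; apply: measurable_nat_eq.
  exact: measurable_funPT.
have me j : measurable_fun setT (epoch n j).
  by apply: measurable_partial_sum => i; exact: measurable_funPT.
by apply: (measurable_nat2 nat subn); exact: measurable_arrivals.
Qed.

(** One service cycle after an arbitrary event C of the past, observed through q;
g is the time over which its arrivals are counted. The choice of q decides whether
the service or the clock ends first. For a fixed history, [history_law] integrates
out the arrivals, [clock_memoryless] restarts the clock at the k-th epoch, and
[history_law] is used backwards to restore the past. *)
Lemma history_step n k (i : nat) (q g : R * R -> R) (C : seq (nat * nat) -> Prop) :
  unitf q -> measurable_fun setT g ->
  (forall sg t, 0 < sg -> 0 <= t -> q (sg, t) != 0 -> 0 <= g (sg, t)) ->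
  Ex (fun w => ind (C (history n k w)) * (ind (epoch n k w <= clock X w) *
     (q (service X n k w, clock X w - epoch n k w) *
      ind ((arrivals n w (epoch n k w + g (service X n k w, clock X w - epoch n k w))%R -
            arrivals n w (epoch n k w))%N = i)))) =
  Ex (fun w => ind (C (history n k w)) * ind (epoch n k w <= clock X w)) *
  Ex (fun w => q (service X n k w, clock X w) * pois i (g (service X n k w, clock X w))).
Proof.
move=> uq mg qg; pose J0 := renewal_slots n.
have JK := renewal_input_disjoint n.
have ms m : measurable_fun setT (service X n m : Osub J0 -> R).
  by apply: measurable_service; right; left; exists m.
have mr m : measurable_fun setT (removal X n m : Osub J0 -> nat).
  by apply: measurable_removal; right; right; exists m.
have mc : measurable_fun setT (clock X : Osub J0 -> R) by apply: measurable_clock; left.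
have me m : measurable_fun setT (epoch n m : Osub J0 -> R).
  by apply: measurable_epoch => j _; right; left; exists j.
pose pr w := (service X n k w, clock X w - epoch n k w).
have mpr : measurable_fun setT (pr : Osub J0 -> R * R).
  by apply: measurable_fun_pair => //; apply: measurable_funB.
have toO d' (T : measurableType d') (f : Omega -> T) : measurable_fun setT (f : Osub J0 -> T) ->
    measurable_fun setT f.
  by move=> mf; exact: (measurableT_comp mf (@measurable_id_Osub _ _ _ _ X J0)).
have ule : unitf (fun w => ind (epoch n k w <= clock X w) : R).
  by apply: unitf_ind; apply: measurable_ler; exact: toO.
pose D w := (arrivals n w (epoch n k w + g (pr w))%R - arrivals n w (epoch n k w))%N.
have uD : unitf (fun w => ind (D w = i) : R).
  apply: unitf_ind; apply: measurable_nat_eq; apply: (measurable_nat2 nat subn); apply: measurable_arrivals.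
    by apply: measurable_funD; [exact: toO|apply: toO; exact: measurableT_comp mg mpr].
  exact: toO.
have uqpr : unitf (fun w => q (pr w)) by apply: unitf_comp uq _; exact: toO.
apply: countable_split.
- exact: measurable_history.
- exact: ule.
- by apply: unitfM => //; exact: unitfM.
move=> l; have [sl|sl] := eqVneq (size l) k; last first.
  have Z (F : Omega -> R) : Ex (fun w => ind (history n k w = l) * F w) = 0.
    rewrite -[RHS](Ex_cst P 0); apply: eq_Ex => w; rewrite indF ?mul0r// => E.
    by move: sl; rewrite -E size_map size_iota eqxx.
  by rewrite !Z mul0r.
pose il m := if (m < k)%N then (nth (0%N, 0%N) l m).1 else i.
pose rem w := ind (forall m, (m < k)%N -> removals n w m = (nth (0%N, 0%N) l m).2) : R.
have urem J : (forall m, (m < k)%N -> J (Removal n m)) -> unitf (rem : Osub J -> R).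
  move=> Jr; apply: unitf_ind.
  rewrite [X in measurable X](_ : _ = \bigcap_(m in [set m | (m < k)%N]) ((removal X n m : Osub J -> nat) @^-1` [set (nth (0%N, 0%N) l m).2])).
    apply: bigcap_measurableType => m /= mk; rewrite -[X in measurable X]setTI.
    by apply: measurable_removal => //; exact: Jr.
  by apply/seteqP; split => w.
have histE w : ind (history n k w = l) = rem w * ind (forall m, (m < k)%N ->
   (arrivals n w (epoch n m.+1 w) - arrivals n w (epoch n m w))%N = il m) :> R.
  rewrite /rem indM; apply: ind_eq; rewrite history_eq//.
  by split => -[H1 H2]; split => // m mk; move: (H2 m mk); rewrite /il mk.
pose rho0 w := rem w * ind (epoch n k w <= clock X w) : R.
have urho0 : unitf (rho0 : Osub J0 -> R).
  apply: unitfM; first by apply: urem => m _; right; right; exists m.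
  by apply: unitf_ind; apply: measurable_ler.
(* the weight of the past once its arrivals are integrated out: a function of the first k services
   and removals *)
pose pre w := rem w * \prod_(m < k) pois (il m) (service X n m w).
have pos w m : 0 < service X n m w by exact: (service_pos hX).
transitivity (Ex (fun w => pre w * (ind (epoch n k w <= clock X w) * (q (pr w) * pois i (g (pr w)))))).
  pose rho w := rho0 w * q (pr w).
  have urho : unitf (rho : Osub J0 -> R) by apply: unitfM => //; exact: unitf_comp uq mpr.
  (* the increments of the past cycles, followed by the one over the duration g *)
  pose tau m w := if (m < k)%N then service X n m w else g (pr w).
  have mtau m : measurable_fun setT (tau m : Osub J0 -> R).
    by rewrite /tau; case: (m < k)%N => //; exact: measurableT_comp mg mpr.
  have tauS w m : (m <= k)%N -> partial_sum (tau ^~ w) m = epoch n m w.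
    move=> mk; apply: eq_bigr => j _; rewrite /tau (leq_trans (ltn_ord j) mk)//.
  have rho_tau w : rho w != 0 -> forall m, (m < k.+1)%N -> 0 <= tau m w.
    rewrite /rho /rho0 => r0 m _; rewrite /tau; case: ifP => mk; first by exact/ltW/pos.
    apply: qg => //; last by apply: contraNneq r0 => ->; rewrite mulr0.
    rewrite subr_ge0; apply: contrapT => h; move: r0; rewrite [ind (epoch _ _ _ <= _)]indF// mulr0 mul0r.
    by rewrite eqxx.
  have := history_law il mtau urho rho_tau.
  rewrite (_ : (fun w => rho w * _) = (fun w => ind (history n k w = l) *
     (ind (epoch n k w <= clock X w) * (q (pr w) * ind (D w = i))))); last first.
    apply/funext => w; rewrite histE /rho /rho0.
    have -> : ind (forall m, (m < k.+1)%N -> (arrivals n w (partial_sum (tau^~ w) m.+1) -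
        arrivals n w (partial_sum (tau^~ w) m))%N = il m) = ind (forall m, (m < k)%N ->
          (arrivals n w (epoch n m.+1 w) - arrivals n w (epoch n m w))%N = il m) * ind (D w = i) :> R.
      rewrite indM; apply: ind_eq.
      have E : D w = (arrivals n w (partial_sum (tau^~ w) k.+1) - arrivals n w (partial_sum (tau^~ w) k))%N.
        by rewrite partial_sumS (tauS _ k)// /tau ltnn.
      split=> [H|[H1 H2] m].
        split=> [m mk|]; first by rewrite -(H m (ltnW mk)) !tauS// ltnW.
        by rewrite E (H k)// /il ltnn.
      rewrite ltnS leq_eqVlt => /orP[/eqP->|mk]; first by rewrite -E H2 /il ltnn.
      by rewrite !tauS ?H1// ltnW.
    by ring.
  rewrite -/(Ex _) => ->; apply: eq_Ex => w; rewrite big_ord_recr/= /rho /rho0 /pre /il ltnn /tau ltnn.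
  rewrite (eq_bigr (fun m : 'I_k => pois (if (m < k)%N then (nth (0, 0) l m).1 else i) (service X n m w))); last first.
    by move=> m _; rewrite ltn_ord.
  by ring.
pose J : set slot := [set z | exists2 m, (m < k)%N & z = Service n m \/ z = Removal n m].
pose K : set slot := [set Service n k].
have JK0 : J `&` K = set0.
  by apply/seteqP; split => // z [[m mk [->|->]]] //= [e]; move: mk; rewrite e ltnn.
have JC : ~ J Clock by move=> [m _ []].
have KC : ~ K Clock by [].
have upre : unitf (pre : Osub J -> R).
  apply: unitfM; first by apply: urem => m mk; exists m => //; right.
  apply: unitf_prod => m; apply: (unitf_comp (unitf_pois kappa mu0 (il m))).
  by apply: measurable_service; exists m => //; left.
have meJ : measurable_fun setT (epoch n k : Osub J -> R).
  by apply: measurable_epoch => m mk; exists m => //; left.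
pose Psi (z : Omega * R) := q (service X n k z.1, z.2) * pois i (g (service X n k z.1, z.2)).
have uPsi : unitf (Psi : Osub K * R -> R).
  have mp : measurable_fun setT (fun z : Osub K * R => (service X n k z.1, z.2)).
    apply: measurable_fun_pair => //.
    exact: (measurableT_comp (@measurable_service _ _ _ _ X K n k (erefl _)) (@measurable_fst _ _ _ _)).
  apply: unitfM; first exact: unitf_comp uq mp.
  by apply: (unitf_comp (unitf_pois kappa mu0 i)); exact: measurableT_comp mg mp.
have := clock_memoryless hX s0 JK0 JC KC upre meJ (fun w => epoch_ge0 n k w) uPsi.
rewrite /Psi /= => ->; congr (_ * _).
have h0 w : rho0 w != 0 -> forall m, (m < k)%N -> 0 <= service X n m w.
  by move=> _ m _; exact/ltW/pos.
have := history_law il ms urho0 h0.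
rewrite (_ : (fun w => rho0 w * _) = (fun w => ind (history n k w = l) * ind (epoch n k w <= clock X w))); last first.
  by apply/funext => w; rewrite histE /rho0; ring.
by move=> ->; apply: eq_Ex => w; rewrite /rho0 /pre; ring.
Qed.

End history.

(** * Reflected paths at the ends of services *)

Section reflected_paths.
Context {R : realType}.
Variables (v u : nat -> R) (k q : nat -> nat) (B : nat).
Hypotheses (v0 : positive_seq v) (u0 : positive_seq u).

Definition drift_path (t : R) : R := (compound v k t)%:R - (compound u q t)%:R.

Definition reflected_path (r : nat) (t : R) : R :=
  r%:R + drift_path t - Num.max 0 (sup [set r%:R + drift_path t' | t' in `[0, t]] - B.+1%:R).

Definition busy_end (r : nat) : \bar R :=
  ereal_inf [set t%:E | t in [set t : R | 0 <= t /\ reflected_path r t < 1]].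

Lemma drift_path_right t : 0 <= t -> exists2 e, 0 < e &
  forall t', t <= t' < t + e -> drift_path t' = drift_path t.
Proof.
move=> t0; have [e e0 He] := compound_right k v0 t0; have [f f0 Hf] := compound_right q u0 t0.
exists (Num.min e f); first by rewrite lt_min e0.
move=> t' /andP[tt t'e]; rewrite /drift_path He ?Hf// tt (lt_le_trans t'e)// lerD2l ge_min lexx ?orbT//.
Qed.

Lemma reflected_path_right r t : 0 <= t -> exists2 e, 0 < e &
  forall t', t <= t' < t + e -> reflected_path r t' = reflected_path r t.
Proof.
move=> t0; have [e e0 He] := drift_path_right t0; exists e => // t' /andP[tt t'e].
rewrite /reflected_path He ?tt//; congr (_ - Num.max _ (sup _ - _)).
apply/seteqP; split => z [x /=]; rewrite in_itv/= => /andP[x0 xt] <-; last first.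
  by exists x => //; rewrite /= in_itv/= x0 (le_trans xt).
have [tx|tx] := leP t x; last by exists x => //; rewrite /= in_itv/= x0 ltW.
exists t; first by rewrite /= in_itv/= t0 lexx.
by rewrite (He x) ?tx// (le_lt_trans xt).
Qed.

Lemma busy_end_ge0 r : (0 <= busy_end r)%E.
Proof. by apply: le_ereal_inf_tmp => _ [t [t0 _] <-]; rewrite lee_fin. Qed.

Lemma reflected_path_busy r t : 0 <= t -> (t%:E < busy_end r)%E -> 1 <= reflected_path r t.
Proof.
move=> t0 tb; rewrite leNgt; apply/negP => r1.
have : (busy_end r <= t%:E)%E by apply: ereal_inf_lbound; exists t.
by rewrite leNgt tb.
Qed.

Hypotheses (uv : unbounded_sums v) (uu : unbounded_sums u).
Hypothesis no_tie : forall i j, partial_sum v i.+1 != partial_sum u j.+1.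

Local Notation S := (partial_sum u).
Local Notation arr := (compound v k).
Definition removed n : nat := (\sum_(j < n) q j)%N.

(** The reflection term just before the epoch S n. Between two epochs the path only
increases, hence reaches its supremum over a cycle just before the removal: arrivals
are counted up to the epoch, the removal itself is not. *)
Fixpoint overflow (r : nat) n : R := if n is m.+1 then
  Num.max (overflow r m) (r%:R + (arr (S n))%:R - (removed m)%:R - B.+1%:R) else 0.

(** The content right after the n-th removal, up to the first time it falls below 1. *)
Definition level (r : nat) n : R := r%:R + (arr (S n))%:R - (removed n)%:R - overflow r n.

Lemma drift_path_between t n : between u t n -> drift_path t = (arr t)%:R - (removed n)%:R.
Proof. by move=> b; rewrite /drift_path /compound (renewal_countE u0 b). Qed.

Lemma overflow_ge0 r n : 0 <= overflow r n.
Proof. by case: n => //= n; elim: n => [|n IH] /=; rewrite le_max ?lexx// IH. Qed.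

Lemma overflow_mono r m n : (m <= n)%N -> overflow r m <= overflow r n.
Proof.
elim: n => [|n IH]; first by rewrite leqn0 => /eqP->.
rewrite leq_eqVlt => /orP[/eqP->//|]; rewrite ltnS => /IH h.
by rewrite [leRHS]/= le_max h.
Qed.

(** Without ties, the arrivals counted at an epoch are all present strictly before it,
so that the supremum of the path sees them before the removal. *)
Lemma before_epoch n : exists t, between u t n /\ arr t = arr (S n.+1).
Proof.
have S0 : 0 <= S n.+1 by exact: partial_sum_ge0.
have /andP[c1 c2] := betweenP v0 uv S0.
set c := renewal_count v (S n.+1) in c1 c2.
have c3 : partial_sum v c < S n.+1.
  move: c1; rewrite le_eqVlt => /orP[/eqP|//].
  case: (c) => [|c' /eqP]; last by rewrite (negbTE (no_tie _ _)).
  by move=> _; rewrite partial_sum0 -(partial_sum0 u) partial_sum_lt.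
(* c arrivals precede S n.+1; this is the time of the last of them, or S n if that is later *)
exists (Num.max (partial_sum v c) (S n)); split.
  by rewrite /between le_max lexx orbT/= gt_max c3/= partial_sumS ltrDl.
have E : renewal_count v (Num.max (partial_sum v c) (S n)) = c.
  apply: renewal_countE => //; rewrite /between le_max lexx/= gt_max.
  by rewrite (lt_trans c3)//= (le_lt_trans _ c2)// partial_sum_le.
by rewrite /compound E.
Qed.

Lemma between_ge0 t n : between u t n -> 0 <= t.
Proof. by move=> /andP[h _]; apply: le_trans h; exact: partial_sum_ge0. Qed.

Lemma running_max r t n : between u t n ->
  Num.max 0 (sup [set r%:R + drift_path t' | t' in `[0, t]] - B.+1%:R) =
  Num.max (overflow r n) (r%:R + drift_path t - B.+1%:R).
Proof.
move=> b; set A := [set _ | _ in _]; have t0 := between_ge0 b.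
have bound : ubound A (Num.max (overflow r n) (r%:R + drift_path t - B.+1%:R) + B.+1%:R).
  move=> z [x /=]; rewrite in_itv/= => /andP[x0 xt] <-; rewrite -lerBlDr le_max.
  have bx := betweenP u0 uu x0; set m := renewal_count u x in bx.
  have bt : renewal_count u t = n by exact: renewal_countE.
  have mn : (m <= n)%N by rewrite -bt; exact: renewal_count_le.
  move: mn; rewrite leq_eqVlt => /orP[/eqP mn|mn].
    apply/orP; right; rewrite lerD2r lerD2l (drift_path_between b) (drift_path_between bx) mn lerD2r ler_nat.
    exact: compound_le.
  apply/orP; left; apply: le_trans (overflow_mono r mn); rewrite [leRHS]/= le_max; apply/orP; right.
  rewrite lerD2r -addrA lerD2l (drift_path_between bx) lerD2r ler_nat compound_le//.
  by case/andP: bx => _ /ltW.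
have inA x : 0 <= x <= t -> A (r%:R + drift_path x) by move=> h; exists x; rewrite //= in_itv.
have At : A (r%:R + drift_path t) by apply: inA; rewrite t0 lexx.
have leA x : A x -> x <= sup A by apply: ub_le_sup; eexists; exact: bound.
apply/eqP; rewrite eq_le; apply/andP; split.
  rewrite ge_max le_max overflow_ge0/= lerBlDr; apply: ge_sup => //.
  by exists (r%:R + drift_path t).
rewrite ge_max; apply/andP; split; last by rewrite le_max; apply/orP; right; rewrite lerD2r; exact: leA.
have H m : (m <= n)%N -> overflow r m <= Num.max 0 (sup A - B.+1%:R).
  elim: m => [|m IH] mn /=; first by rewrite le_max lexx.
  rewrite ge_max IH ?(ltnW mn)//= le_max; apply/orP; right; rewrite lerD2r.
  have [x [bx <-]] := before_epoch m.
  rewrite -addrA -(drift_path_between bx); apply: leA; apply: inA.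
  rewrite (between_ge0 bx)/=; case/andP: bx => _ /ltW xS; apply: le_trans xS _.
  by case/andP: b => Sn _; apply: le_trans Sn; exact: partial_sum_le.
exact: H.
Qed.

Lemma reflected_path_between r t n : between u t n ->
  reflected_path r t = Num.min (level r n + (arr t - arr (S n))%N%:R) B.+1%:R.
Proof.
move=> b; rewrite /reflected_path (running_max r b) (drift_path_between b) /level.
have h : (arr (S n) <= arr t)%N.
  by apply: compound_le => //; [exact: partial_sum_ge0|case/andP: b].
rewrite natrB//.
set a := (arr t)%:R; set c := (arr (S n))%:R; set d := (removed n)%:R; set o := overflow r n.
rewrite -[X in Num.min X]addrA oppr_max.
have -> : r%:R + (a - d) + Num.min (- o) (- (r%:R + (a - d) - B.+1%:R)) =
   Num.min (r%:R + (a - d) - o) (r%:R + (a - d) - (r%:R + (a - d) - B.+1%:R)) by rewrite addr_minr.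
by congr Num.min; ring.
Qed.

Lemma levelS r n : level r n.+1 = Num.min (level r n + (arr (S n.+1) - arr (S n))%N%:R) B.+1%:R - (q n)%:R.
Proof.
rewrite /level /=.
have h : (arr (S n) <= arr (S n.+1))%N.
  by apply: compound_le => //; [exact: partial_sum_ge0|exact: partial_sum_le].
rewrite natrB// {1}/removed big_ord_recr/= -/(removed n) natrD.
set a := (arr (S n.+1))%:R; set c := (arr (S n))%:R; set d := (removed n)%:R; set o := overflow r n.
rewrite oppr_max addr_minr addr_minl; congr Num.min; ring.
Qed.

Lemma level0 r : level r 0 = r%:R.
Proof.
by rewrite /level partial_sum0 compound0// /removed big_ord0 /=; ring.
Qed.

End reflected_paths.

(** Content after each removal, with 0 absorbing: the busy period is over. *)
Fixpoint chain (I q : nat -> nat) (r B n : nat) : nat := if n is m.+1 then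
  if chain I q r B m == 0%N then 0%N else (minn (chain I q r B m + I m) B.+1 - q m)%N else r.

Section chain_paths.
Context {R : realType}.
Variables (v u : nat -> R) (k q : nat -> nat) (B : nat).
Hypotheses (v0 : positive_seq v) (u0 : positive_seq u).
Hypotheses (uv : unbounded_sums v) (uu : unbounded_sums u).
Hypothesis no_tie : forall i j, partial_sum v i.+1 != partial_sum u j.+1.
Variable r : nat.
Hypothesis r0 : (0 < r <= B.+1)%N.
Local Notation S := (partial_sum u).
Local Notation arr := (compound v k).
Local Notation level := (level v u k q B r).
Local Notation reflected := (reflected_path v u k q B r).
Local Notation bend := (busy_end v u k q B r).

Definition path_arrivals m : nat := (arr (S m.+1) - arr (S m))%N.
Local Notation X := (chain path_arrivals q r B).

Lemma chain_le I q' n : (chain I q' r B n <= B.+1)%N.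
Proof.
elim: n => [|n IH] /=; first by case/andP: r0.
by case: ifP => // _; rewrite leq_subLR (leq_trans (geq_minr _ _))// leq_addl.
Qed.

(** The two recursions agree as long as the content is positive; at the first
passage below 1 the level may be negative where the chain is 0. *)
Lemma chain_level n : ((0 < X n)%N /\ forall j, (j <= n)%N -> level j = (X j)%:R /\ (0 < X j)%N) \/
  (X n = 0%N /\ exists2 j, (j <= n)%N & level j <= 0 /\ forall i, (i < j)%N -> 1 <= level i).
Proof.
elim: n => [|n [[Xn IH]|[Xn [j jn H]]]] /=; last first.
- by right; rewrite Xn; split => //; exists j; rewrite // leqW.
- rewrite gtn_eqF//; have [Ln _] := IH n (leqnn n).
  have LS : level n.+1 = (minn (X n + path_arrivals n) B.+1)%:R - (q n)%:R.
    by rewrite levelS// Ln /path_arrivals -natrD -natr_min.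
  have [le|lt] := leqP (minn (X n + path_arrivals n) B.+1) (q n).
    right; split; first by apply/eqP; rewrite subn_eq0.
    exists n.+1 => //; split; first by rewrite LS subr_le0 ler_nat.
    by move=> i; rewrite ltnS => /IH[-> h]; rewrite ler1n.
  left; rewrite subn_gt0; split => // j; rewrite leq_eqVlt => /orP[/eqP->|]; last by rewrite ltnS => /IH.
  by rewrite /= gtn_eqF// subn_gt0 lt LS natrB// ltnW.
left; case/andP: r0 => r1 _; split => // j; rewrite leqn0 => /eqP->; by rewrite level0.
Qed.

(** Within a cycle the reflected path does not decrease, so it first falls below 1 at
an epoch. *)
Lemma busy_end_le t n : between u t n -> (bend <= t%:E)%E <-> X n = 0%N.
Proof.
move=> b; have t0 : 0 <= t := between_ge0 u0 b.
have reflS j : reflected (S j) = Num.min (level j) B.+1%:R.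
  rewrite (@reflected_path_between _ v u k q B v0 u0 uv uu no_tie r (S j) j).
    by rewrite subnn addr0.
  by rewrite /between lexx partial_sumS ltrDl u0.
have [[Xn H]|[Xn [j jn [Lj _]]]] := chain_level n.
  split=> [|X0]; last by move: Xn; rewrite X0.
  suff : (t%:E < bend)%E by rewrite ltNge => /negbTE->.
  apply: (@lt_le_trans _ _ (S n.+1)%:E); first by case/andP: b => _; rewrite lte_fin.
  apply: le_ereal_inf_tmp => _ [x [x0 x1] <-]; rewrite lee_fin leNgt; apply/negP => xS.
  have bx := betweenP u0 uu x0; set m := renewal_count u x in bx.
  have mn : (m <= n)%N.
    by rewrite -ltnS; apply: (partial_sum_ltn u0 _ xS); case/andP: bx.
  have [Lm Xm] := H m mn; move: x1; rewrite (reflected_path_between k q B v0 u0 uv uu no_tie r bx) Lm.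
  by apply/negP; rewrite -leNgt le_min -natrD !ler1n addn_gt0 Xm.
split => // _; apply: ge_ereal_inf; exists (S j)%:E; last first.
  by rewrite lee_fin; apply: le_trans (partial_sum_le u0 jn) _; case/andP: b.
exists (S j) => //; split; first exact: partial_sum_ge0.
by rewrite reflS gt_min (le_lt_trans Lj).
Qed.

Lemma reflected_chain t n : between u t n -> (0 < X n)%N ->
  reflected t = (minn (X n + (arr t - arr (S n))) B.+1)%:R.
Proof.
move=> b Xn; have [[_ H]|[X0 _]] := chain_level n; last by rewrite X0 in Xn.
have [Ln _] := H n (leqnn n).
by rewrite (reflected_path_between k q B v0 u0 uv uu no_tie r b) Ln -natrD -natr_min.
Qed.

End chain_paths.

(** * Measurability of reflected paths *)

Section measurable_reflected.
Context {d : measure_display} {T : measurableType d} {R : realType}.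

Lemma measurable_sup_range (h : nat -> T -> R) : (forall n, measurable_fun setT (h n)) ->
  measurable_fun setT (fun z => sup (range (h ^~ z))).
Proof.
move=> mh; pose e n z := (h n z)%:E.
rewrite (_ : (fun z => _) = fun z => fine (ereal_sup (range (e ^~ z)))).
  apply: (measurableT_comp (f := @fine R)); first exact: fine_measurable.
  rewrite (_ : (fun z => _) = fun z => esups (e ^~ z) 0).
    by apply: measurable_fun_esups => n; exact/measurable_EFinP.
  apply/funext => z; rewrite /esups/= /sdrop; congr ereal_sup.
  by apply/seteqP; split => _ [n _ <-]; exists n.
apply/funext => z.
have -> : range (e ^~ z) = [set x%:E | x in range (h ^~ z)].
  apply/seteqP; split => x /=; first by move=> [n _ <-]; exists (h n z) => //; exists n.
  by move=> [_ [n _ <-] <-]; exists n.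
have ne : range (h ^~ z) !=set0 by exists (h 0%N z); exists 0%N.
have [ub|nub] := pselect (has_ubound (range (h ^~ z))).
  by rewrite ereal_sup_EFin.
by rewrite hasNub_ereal_sup//= sup_out// => -[].
Qed.

Variables (v u : nat -> T -> R) (k q : nat -> T -> nat) (B : nat).
Hypotheses (v0 : forall z, positive_seq (v ^~ z)) (u0 : forall z, positive_seq (u ^~ z)).
Hypotheses (mv : forall n, measurable_fun setT (v n)) (mu : forall n, measurable_fun setT (u n)).
Hypotheses (mk : forall n, measurable_fun setT (k n)) (mq : forall n, measurable_fun setT (q n)).

Local Notation drift z := (drift_path (v ^~ z) (u ^~ z) (k ^~ z) (q ^~ z)).
Local Notation reflected z := (reflected_path (v ^~ z) (u ^~ z) (k ^~ z) (q ^~ z) B).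
Local Notation bend z := (busy_end (v ^~ z) (u ^~ z) (k ^~ z) (q ^~ z) B).

Lemma measurable_natr (f : T -> nat) : measurable_fun setT f -> measurable_fun setT (fun z => (f z)%:R : R).
Proof. by move=> mf; apply: (measurableT_comp (f := fun n : nat => n%:R : R)). Qed.

Lemma measurable_drift_path (tau : T -> R) : measurable_fun setT tau -> measurable_fun setT (fun z => drift z (tau z)).
Proof.
by move=> mt; apply: measurable_funB; apply: measurable_natr; exact: measurable_compound.
Qed.

Definition rational_time (n : nat) : R := if unpickle n is Some p then ratr p else 0.

Lemma rational_between (a b : R) : a < b -> exists n, a < rational_time n < b.
Proof.
move=> /rat_in_itvoo[p]; rewrite in_itv/= => ab; exists (pickle p).
by rewrite /rational_time pickleK.
Qed.

(** The path is constant to the right of each time, so its supremum over [0, tau] is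
already reached on the rational times and at tau. *)
Lemma measurable_reflected_path r (tau : T -> R) : measurable_fun setT tau -> (forall z, 0 <= tau z) ->
  measurable_fun setT (fun z => reflected z r (tau z)).
Proof.
move=> mt t0; have md := measurable_drift_path mt.
pose h n z := r%:R + drift z (if 0 <= rational_time n <= tau z then rational_time n else tau z).
have E z : [set r%:R + drift z t' | t' in `[0, tau z]] = range (h ^~ z).
  apply/seteqP; split => x [t' /=]; last first.
    move=> _ <-; rewrite /h; case: ifP => [/andP[a b]|_].
      by exists (rational_time t') => //=; rewrite in_itv/= a.
    by exists (tau z) => //=; rewrite in_itv/= t0 lexx.
  rewrite in_itv/= => /andP[t'0 t't] <-.
  have [tt'|t't'] := leP (tau z) t'.
    have -> : t' = tau z by apply/eqP; rewrite eq_le tt' t't.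
    have [n /andP[n1 n2]] := @rational_between (-1) 0 (ltrN10 R).
    by exists n => //; rewrite /h leNgt n2.
  have [e e0 He] := drift_path_right (k ^~ z) (q ^~ z) (v0 z) (u0 z) t'0.
  have [n /andP[n1 n2]] : exists n, t' < rational_time n < Num.min (t' + e) (tau z).
    by apply: rational_between; rewrite lt_min t't' ltrDl e0.
  exists n => //; rewrite /h (le_trans t'0 (ltW n1))/=.
  move: n2; rewrite lt_min => /andP[n2 n3]; rewrite (ltW n3) He//.
  by rewrite (ltW n1).
rewrite (_ : (fun z => _) = fun z => r%:R + drift z (tau z) - Num.max 0 (sup (range (h ^~ z)) - B.+1%:R)); last first.
  by apply/funext => z; rewrite /reflected_path E.
apply: measurable_funB; first exact: measurable_funD.
apply: (measurable_maxr (f := fun=> 0)) => //; apply: measurable_funB => //.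
apply: measurable_sup_range => n; apply: measurable_funD => //.
apply: measurable_drift_path; apply: measurable_fun_ifT => //.
have [h0|h0] := boolP (0 <= rational_time n); last exact: measurable_cst.
exact: measurable_fun_ler.
Qed.

(** A passage below 1 before the time c lasts for some time, hence is seen at a
rational time. *)
Lemma measurable_busy_end r : measurable_fun setT (fun z => bend z r).
Proof.
apply: (measurability _ (ErealGenInftyO.measurableE R)) => //.
move=> _ [_ [c ->] <-]; rewrite setTI.
rewrite (_ : _ @^-1` _ = \bigcup_n ([set _ | 0 <= rational_time n < c] `&`
  [set z | reflected z r (Num.max 0 (rational_time n)) < 1])); last first.
  apply/seteqP; split => z /=; last first.
    move=> [n _ [/andP[n0 nc] /= r1]]; rewrite in_itv/=.
    apply: (@le_lt_trans _ _ (rational_time n)%:E); last by rewrite lte_fin.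
    apply: ereal_inf_lbound; exists (rational_time n) => //; split => //.
    by move: r1; rewrite max_r.
  rewrite in_itv/= => /ereal_inf_lt[_ [t [t0 rt] <-]]; rewrite lte_fin => tc.
  have [e e0 He] := reflected_path_right (k ^~ z) (q ^~ z) B (v0 z) (u0 z) r t0.
  have [n /andP[n1 n2]] : exists n, t < rational_time n < Num.min (t + e) c.
    by apply: rational_between; rewrite lt_min ltrDl e0 tc.
  move: n2; rewrite lt_min => /andP[n2 n3].
  have n0 : 0 <= rational_time n by exact: le_trans (ltW n1).
  exists n => //; split; first by rewrite /= n0.
  by rewrite /= max_r// He// n2 ltW.
apply: bigcupT_measurable => n; apply: measurableI.
  have [h|h] := boolP (0 <= rational_time n < c).
    by rewrite (_ : [set _ | _] = setT)//; apply/seteqP; split.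
  by rewrite (_ : [set _ | _] = set0)//; apply/seteqP; split.
apply: measurable_ltr => //; apply: measurable_reflected_path => // z.
by rewrite le_max lexx.
Qed.

End measurable_reflected.

(** * Busy periods of the queue *)

Section cycles.
Context {d : measure_display} {Omega : measurableType d} {R : realType}.
Context {P : probability Omega R}.
Variables (mu s : R) (kappa delta : {RV P >-> nat}) (eta : {RV P >-> R}) (y : R) (X : inputs P).
Hypothesis hX : inputs_spec mu s kappa delta eta y X.
Variable B : nat.
Local Notation Osub := (Osub X).

Local Notation len n r w := (busy_length X B n r w).
Local Notation lvl := (busy_level X B).
Local Notation start := (busy_start X B).

Lemma services_pos n w : positive_seq (services X n w).
Proof. by move=> j; exact: (service_pos hX). Qed.

Lemma busy_lengthE n r w : len n r w =
  busy_end (gaps X n w) (services X n w) (batches X n w) (removals X n w) B r.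
Proof. by []. Qed.

Lemma reflectedE n r w t : reflected X B n r w t =
  reflected_path (gaps X n w) (services X n w) (batches X n w) (removals X n w) B r t.
Proof. by []. Qed.

Lemma busy_length_ge0 n r w : (0 <= len n r w)%E.
Proof. by rewrite busy_lengthE busy_end_ge0. Qed.

Lemma reflected_busy n r w t : 0 <= t -> (t%:E < len n r w)%E -> 1 <= reflected X B n r w t.
Proof.
move=> t0 h; exact: (@reflected_path_busy _ (gaps X n w) (services X n w) (batches X n w) (removals X n w) B r t t0 h).
Qed.

Lemma busy_start_ge0 r n w : (0 <= start r n w)%E.
Proof.
elim: n => //= n IH; apply: adde_ge0; first by rewrite adde_ge0// busy_length_ge0.
by rewrite lee_fin ltW// (idle_pos hX).
Qed.

Definition started r n w : Prop := (start r n w < +oo)%E.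

Lemma startedE r n w : started r n w -> start r n w = (fine (start r n w))%:E.
Proof. by move=> h; rewrite fineK// ge0_fin_numE// busy_start_ge0. Qed.

Lemma busy_atP r w t n : busy_at X B r w t n <-> [/\ started r n w, fine (start r n w) <= t &
  ((t - fine (start r n w))%:E < len n (lvl r n w) w)%E].
Proof.
rewrite /busy_at; split.
  move=> [h1 h2]; have st : started r n w by apply: le_lt_trans h1 _; exact: ltry.
  by rewrite (startedE st) in h1 h2; split => //; rewrite EFinB lteBlDl.
by move=> [st h1 h2]; rewrite (startedE st) lee_fin -lteBlDl -?EFinB.
Qed.

Lemma busy_start_lt r w m n : (m < n)%N -> (start r m w + len m (lvl r m w) w <= start r n w)%E.
Proof.
elim: n => // n IH; rewrite ltnS leq_eqVlt => /orP[/eqP->|/IH h] /=.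
  by apply: leeDl; rewrite lee_fin ltW// (idle_pos hX).
apply: le_trans h _; rewrite -[leLHS]adde0 -addeA leeD2l//.
by rewrite adde_ge0 ?busy_length_ge0// lee_fin ltW// (idle_pos hX).
Qed.

Lemma busy_at_inj r w t m n : busy_at X B r w t m -> busy_at X B r w t n -> m = n.
Proof.
move=> [m1 m2] [n1 n2]; have [mn|nm|//] := ltngtP m n; exfalso; last first.
  by have h := busy_start_lt r w nm; have := lt_le_trans n2 (le_trans h m1); rewrite ltxx.
by have h := busy_start_lt r w mn; have := lt_le_trans m2 (le_trans h n1); rewrite ltxx.
Qed.

Lemma customers_busy r x w t n : busy_at X B r w t n ->
  customers X B r x t w = reflected X B n (lvl r n w) w (t - fine (start r n w)).
Proof.
move=> bn; rewrite /customers /queue_state; case: pselect => [h|]; last by case; exists n.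
by case: (cid h) => m /= bm; rewrite (busy_at_inj bm bn).
Qed.

Lemma customers_idle r x w t : ~ (exists n, busy_at X B r w t n) -> customers X B r x t w = 0.
Proof. by move=> h; rewrite /customers /queue_state; case: pselect. Qed.

Lemma customers_ge1 r x w t n : busy_at X B r w t n -> 1 <= customers X B r x t w.
Proof.
move=> bn; rewrite (customers_busy x bn); have /busy_atP[_ h1 h2] := bn.
by apply: reflected_busy h2; rewrite subr_ge0.
Qed.

Lemma customers_eq0 r x w t : customers X B r x t w = 0 <-> ~ exists n, busy_at X B r w t n.
Proof.
split=> [e [n /customers_ge1-/(_ x)]|]; last exact: customers_idle.
by rewrite e ler10.
Qed.

Lemma busy_periodE r x w : busy_period X B r x w = len 0 r w.
Proof.
apply/eqP; rewrite eq_le; apply/andP; split.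
  case E : (len 0 r w) => [t||]; last 2 first.
  - by rewrite leey.
  - by have := busy_length_ge0 0 r w; rewrite E.
  have t0 : 0 <= t by rewrite -lee_fin -E busy_length_ge0.
  apply: ereal_inf_lbound; exists t => //; split => //; apply/customers_eq0 => -[[|n] [h1 h2]].
    by move: h2; rewrite /= add0e E ltxx.
  have := busy_start_lt r w (ltn0Sn n); have := h1; case: n h1 h2 => [|n] h1 h2.
    rewrite /= add0e E -EFinD lee_fin gerDl leNgt (idle_pos hX)//.
  move=> _ h; have := le_trans (busy_start_lt r w (ltn0Sn n.+1)) h1.
  have := busy_start_lt r w (isT : (1 < n.+2)%N) => h3.
  move=> _; have := le_trans h3 h1; rewrite /= add0e E.
  have /= l1 := busy_length_ge0 1 (lvl r 1 w) w.
  move=> h4; have : (t%:E + (idle X 0 w)%:E <= t%:E)%E.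
    by apply: le_trans h4; rewrite leeDl.
  by rewrite -EFinD lee_fin gerDl leNgt (idle_pos hX).
apply: le_ereal_inf_tmp => _ [t [t0 /customers_eq0 nb] <-].
rewrite leNgt; apply/negP => h; apply: nb; exists 0%N; split; first by rewrite /= lee_fin.
by rewrite /= add0e.
Qed.

Definition occupied r n (u : nat) w t : Prop := started r n w /\ fine (start r n w) <= t /\
  ((t - fine (start r n w))%:E < len n (lvl r n w) w)%E /\
  reflected X B n (lvl r n w) w (t - fine (start r n w)) <= u%:R.

Lemma customers_occupied r x w t u : (1 <= customers X B r x t w <= u%:R) <-> exists n, occupied r n u w t.
Proof.
split.
  move=> /andP[c1 cu]; have [[n bn]|nb] := pselect (exists n, busy_at X B r w t n); last first.
    by move: c1; rewrite customers_idle// ler10.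
  by exists n; move: cu; rewrite (customers_busy x bn); have /busy_atP[? ? ?] := bn.
move=> [n [h1 [h2 [h3 h4]]]].
have bn : busy_at X B r w t n by apply/busy_atP.
by rewrite (customers_ge1 x bn)/= (customers_busy x bn).
Qed.

Lemma occupied_inj r m n u u' w t : occupied r m u w t -> occupied r n u' w t -> m = n.
Proof.
move=> [h1 [h2 [h3 _]]] [h5 [h6 [h7 _]]].
by apply: (@busy_at_inj r w t); apply/busy_atP.
Qed.


(** The variables that decide busy period n, the content it starts from included. *)
Definition current_slots n : set slot := [set z | (exists m, z = Service n m) \/ (exists m, z = Removal n m) \/
  (exists m, z = Gap n m) \/ (exists m, z = Batch n m) \/ (exists m, z = Entry m /\ m.+1 = n)].

Definition busy_slots n : set slot := [set z | (exists m, z = Service n m) \/ (exists m, z = Removal n m) \/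
  (exists m, z = Gap n m) \/ (exists m, z = Batch n m)].

Lemma busy_current_slots n : busy_slots n `<=` current_slots n.
Proof. by move=> z [h|[h|[h|h]]]; [left|right; left|right; right; left|right; right; right; left]. Qed.

Definition past_slots n : set slot := [set z | exists2 m, (m < n)%N & current_slots m z \/ z = Idle m].

Lemma measurable_busy_length_cst J n r d' (T : measurableType d') (f : T -> Osub J) :
  busy_slots n `<=` J -> measurable_fun setT f ->
  measurable_fun setT (fun z => len n r (f z)).
Proof.
move=> nJ mf; apply: (measurable_busy_end (v := fun j z => gap X n j (f z)) (u := fun j z => service X n j (f z))
  (k := fun j z => batch X n j (f z)) (q := fun j z => removal X n j (f z))).
- by move=> z j; exact: (gap_pos hX).
- by move=> z j; exact: (service_pos hX).
- by move=> j; apply: measurableT_comp mf; apply: measurable_gap; apply: nJ; right; right; left; exists j.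
- by move=> j; apply: measurableT_comp mf; apply: measurable_service; apply: nJ; left; exists j.
- by move=> j; apply: measurableT_comp mf; apply: measurable_batch; apply: nJ; right; right; right; exists j.
- by move=> j; apply: measurableT_comp mf; apply: measurable_removal; apply: nJ; right; left; exists j.
Qed.

Lemma measurable_reflected_cst J n r d' (T : measurableType d') (f : T -> Osub J) (tau : T -> R) :
  busy_slots n `<=` J -> measurable_fun setT f -> measurable_fun setT tau -> (forall z, 0 <= tau z) ->
  measurable_fun setT (fun z => reflected X B n r (f z) (tau z)).
Proof.
move=> nJ mf; apply: (measurable_reflected_path (v := fun j z => gap X n j (f z)) (u := fun j z => service X n j (f z))
  (k := fun j z => batch X n j (f z)) (q := fun j z => removal X n j (f z))).
- by move=> z j; exact: (gap_pos hX).
- by move=> z j; exact: (service_pos hX).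
- by move=> j; apply: measurableT_comp mf; apply: measurable_gap; apply: nJ; right; right; left; exists j.
- by move=> j; apply: measurableT_comp mf; apply: measurable_service; apply: nJ; left; exists j.
- by move=> j; apply: measurableT_comp mf; apply: measurable_batch; apply: nJ; right; right; right; exists j.
- by move=> j; apply: measurableT_comp mf; apply: measurable_removal; apply: nJ; right; left; exists j.
Qed.

Lemma measurable_busy_level J r n d' (T : measurableType d') (f : T -> Osub J) :
  current_slots n `<=` J -> measurable_fun setT f -> measurable_fun setT (fun z => lvl r n (f z)).
Proof.
case: n => [|n] nJ mf; first exact: measurable_cst.
apply: (measurable_nat2 nat minn); last exact: measurable_cst.
apply: measurableT_comp mf; apply: (@measurable_Osub _ _ _ _ X J _ _ (entry X n) (Entry n)) => //.
by apply: nJ; right; right; right; right; exists n.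
Qed.

Lemma measurable_nat_case d' (T : measurableType d') d'' (T' : measurableType d'') (l : T -> nat) (g : nat -> T -> T') :
  measurable_fun setT l -> (forall i, measurable_fun setT (g i)) -> measurable_fun setT (fun z => g (l z) z).
Proof.
move=> ml mg _ A mA; rewrite setTI.
rewrite (_ : _ @^-1` _ = \bigcup_i ([set z | l z = i] `&` (g i @^-1` A))).
  apply: bigcupT_measurable => i; apply: measurableI; first exact: measurable_nat_eq.
  by rewrite -[X in measurable X]setTI; exact: mg.
by apply/seteqP; split => z /=; [move=> h; exists (l z)|move=> [i _ [/= -> h]]].
Qed.

Lemma measurable_busy_length J r n d' (T : measurableType d') (f : T -> Osub J) :
  current_slots n `<=` J -> measurable_fun setT f ->
  measurable_fun setT (fun z => len n (lvl r n (f z)) (f z)).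
Proof.
move=> nJ mf; apply: (@measurable_nat_case _ _ _ _ (fun z => lvl r n (f z)) (fun i z => len n i (f z))).
  exact: measurable_busy_level.
by move=> i; apply: measurable_busy_length_cst => // z /busy_current_slots/nJ.
Qed.

Lemma measurable_reflected J r n d' (T : measurableType d') (f : T -> Osub J) (tau : T -> R) :
  current_slots n `<=` J -> measurable_fun setT f -> measurable_fun setT tau -> (forall z, 0 <= tau z) ->
  measurable_fun setT (fun z => reflected X B n (lvl r n (f z)) (f z) (tau z)).
Proof.
move=> nJ mf mt t0.
apply: (@measurable_nat_case _ _ _ _ (fun z => lvl r n (f z)) (fun i z => reflected X B n i (f z) (tau z))).
  exact: measurable_busy_level.
by move=> i; apply: measurable_reflected_cst => // z /busy_current_slots/nJ.
Qed.

Lemma measurable_idle J n : J (Idle n) -> measurable_fun [set: Osub J] (idle X n : Osub J -> R).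
Proof. by move=> Ji; apply: (@measurable_Osub _ _ _ _ X J _ _ (idle X n) (Idle n)). Qed.

Lemma measurable_busy_start J r n : past_slots n `<=` J -> measurable_fun setT (start r n : Osub J -> \bar R).
Proof.
elim: n => [|n IH] nJ; first exact: measurable_cst.
have mid : measurable_fun setT (id : Osub J -> Osub J) by exact: measurable_id.
apply: emeasurable_funD.
  apply: emeasurable_funD; first by apply: IH => z [m mn h]; apply: nJ; exists m => //; exact: ltnW.
  by apply: (measurable_busy_length r _ mid) => z h; apply: nJ; exists n => //; left.
by apply/measurable_EFinP; apply: measurable_idle; apply: nJ; exists n => //; right.
Qed.

Lemma past_current_disjoint n : past_slots n `&` current_slots n = set0.
Proof.
apply/seteqP; split => // z [[m mn h] c].
have nm : m <> n by move=> e; move: mn; rewrite e ltnn.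
case: h => [h|zI]; last by rewrite zI in c; case: c => [[?]|[[?]|[[?]|[[?]|[? []]]]]].
case: h => [[j e]|[[j e]|[[j e]|[[j e]|[j [e je]]]]]]; rewrite e in c;
  case: c => [[i]|[[i]|[[i]|[[i]|[i []]]]]] => e1; try by [|case: e1 => /nm].
by move=> h; apply: nm; rewrite -je -h; case: e1 => ->.
Qed.

End cycles.

(** * Recursions along a busy period *)

Section busy_recursion.
Context {R : realType}.
Variables (lam : R) (B r : nat).
Hypotheses (lam0 : 0 <= lam) (lam1 : lam < 1).

Definition geometric_pmf (j : nat) : R := if j is i.+1 then (1 - lam) * lam ^+ i else 0.

(** Abstract form of a busy period cut short by the clock: w k L is the mass of content
L after k services, W k m that of content m just before the next removal, and kill k
that of the busy periods ending with this removal. Because of the cut at B.+1,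
[recursion_input] holds for m <= B only; W k B.+1 is determined by the total mass. *)
Record busy_recursion (G : nat -> fps R) (gamma : nat -> R) (w W : nat -> nat -> R) (kill : nat -> R) : Prop :=
  BusyRecursion {
  recursion_init : forall L, w 0%N L = (L == r)%:R;
  recursion_input : forall k m, (1 <= m <= B)%N ->
    W k m = \sum_(1 <= L < B.+2) w k L * ((L <= m)%N%:R * G k (m - L)%N);
  recursion_mass : forall k, \sum_(1 <= m < B.+2) W k m = gamma k * \sum_(1 <= L < B.+2) w k L;
  recursion_removal : forall k L, (1 <= L <= B.+1)%N ->
    w k.+1 L = \sum_(1 <= m < B.+2) W k m * geometric_pmf (m - L);
  recursion_kill : forall k, kill k = \sum_(1 <= m < B.+2) W k m * lam ^+ m.-1;
  recursion_ge0 : forall k m, 0 <= w k m /\ 0 <= W k m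
}.

(** Used to compare busy periods of different ranks, which are driven by different
variables. *)
Lemma recursion_unique G gamma w W kill w' W' kill' :
  busy_recursion G gamma w W kill -> busy_recursion G gamma w' W' kill' -> kill =1 kill'.
Proof.
move=> h h'.
have WW k : (forall L, (1 <= L <= B.+1)%N -> w k L = w' k L) -> forall m, (1 <= m <= B.+1)%N -> W k m = W' k m.
  move=> ww; have WB m : (1 <= m <= B)%N -> W k m = W' k m.
    move=> mB; rewrite (recursion_input h)// (recursion_input h')//.
    by apply: eq_big_nat => L LB; rewrite ww.
  move=> m /andP[m1]; rewrite leq_eqVlt => /orP[/eqP->|mB]; last by rewrite WB// m1.
  have := recursion_mass h k; have := recursion_mass h' k.
  rewrite [in RHS](eq_big_nat _ _ (F2 := w k)); last by move=> L LB; rewrite ww.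
  move=> <-; rewrite !(@big_nat_recr _ _ _ B.+1 1%N)//= (eq_big_nat _ _ (F2 := W' k)).
    by move=> /addrI.
  by move=> L LB; rewrite WB.
have ww k : forall L, (1 <= L <= B.+1)%N -> w k L = w' k L.
  elim: k => [|k IH] L LB; first by rewrite (recursion_init h) (recursion_init h').
  rewrite (recursion_removal h)// (recursion_removal h')//.
  by apply: eq_big_nat => m mB; rewrite (WW _ IH).
move=> k; rewrite (recursion_kill h) (recursion_kill h').
by apply: eq_big_nat => m mB; rewrite (WW _ (ww k)).
Qed.

Lemma geometric_sum m n : \sum_(1 <= L < n) geometric_pmf (m - L) <= 1.
Proof.
have d0 j : 0 <= geometric_pmf j.
  by case: j => //= j; rewrite mulr_ge0 ?exprn_ge0// subr_ge0 ltW.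
have P j : \sum_(1 <= i < j) geometric_pmf i <= 1.
  have -> : \sum_(1 <= i < j) geometric_pmf i = if j is i.+1 then 1 - lam ^+ i else 0.
    case: j => [|j]; first by rewrite big_geq.
    elim: j => [|j IH]; first by rewrite big_geq// expr0 subrr.
    by rewrite big_nat_recr//= IH exprS; ring.
  by case: j => [|j]; rewrite ?ler01// gerBl exprn_ge0.
apply: le_trans (P m.+1).
have big n' : (m <= n')%N -> \sum_(1 <= L < n') geometric_pmf (m - L) <= \sum_(1 <= i < m.+1) geometric_pmf i.
  move=> mn; rewrite [leLHS](bigID (fun L => (L < m)%N))/= [X in _ + X]big1 ?addr0; last first.
    by move=> L; rewrite -leqNgt -subn_eq0 => /eqP->.
  case: m mn => [|m'] mn.
    by rewrite big_nat_cond big_pred0 ?big_geq// => L; lia.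
  have -> : \sum_(1 <= L < n' | (L < m'.+1)%N) geometric_pmf (m'.+1 - L) = \sum_(1 <= L < m'.+1) geometric_pmf (m'.+1 - L).
    by apply: esym; rewrite (@big_nat_widen _ _ _ 1 m'.+1 n' xpredT).
  rewrite big_nat_rev/= (eq_big_nat _ _ (F2 := geometric_pmf)); last first.
    by move=> L LB; congr geometric_pmf; lia.
  by rewrite [leRHS]big_nat_recr// lerDl d0.
apply: le_trans (big (maxn n m) (leq_maxr _ _)).
have [n1|n1] := leqP n 1; first by rewrite big_geq// sumr_ge0.
rewrite [leRHS](big_cat_nat (n := n))//=; last by rewrite leq_maxl.
  by rewrite lerDl sumr_ge0.
exact: ltnW.
Qed.

Lemma recursion_decay G gamma w W kill : busy_recursion G gamma w W kill ->
  forall k, \sum_(1 <= L < B.+2) w k.+1 L <= gamma k * \sum_(1 <= L < B.+2) w k L.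
Proof.
move=> h k; rewrite -(recursion_mass h).
rewrite (eq_big_nat _ _ (F2 := fun L => \sum_(1 <= m < B.+2) W k m * geometric_pmf (m - L))); last first.
  by move=> L LB; rewrite (recursion_removal h).
rewrite exchange_big/=; apply: ler_sum => m _; rewrite -mulr_sumr.
by apply: ler_piMr; [have [] := recursion_ge0 h k m|exact: geometric_sum].
Qed.

(** From the second service on, each one outlives the clock with probability
1 - g0 > 0. *)
Lemma recursion_vanish G gamma w W kill (g0 : R) : busy_recursion G gamma w W kill ->
  (forall k, 0 <= gamma k <= 1) -> (forall k, gamma k.+1 = g0) -> g0 < 1 ->
  (1 <= r <= B.+1)%N ->
  \sum_(1 <= L < B.+2) w k L @[k --> \oo] --> 0.
Proof.
move=> h g01 gE g1 rB; have g00 : 0 <= g0 by rewrite -(gE 0%N); case/andP: (g01 1%N).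
pose t k := \sum_(1 <= L < B.+2) w k L.
have t0 k : 0 <= t k by apply: sumr_ge0 => L _; have [] := recursion_ge0 h k L.
have tb k : t k.+1 <= g0 ^+ k * t 0%N.
  elim: k => [|k IH].
    apply: le_trans (recursion_decay h 0) _; rewrite expr0 ler_wpM2r//; first exact: t0.
    by case/andP: (g01 0%N).
  apply: le_trans (recursion_decay h k.+1) _; rewrite gE exprS -mulrA ler_wpM2l//.
rewrite -[X in X @ _]/t -cvg_shiftS; apply: (@squeeze_cvgr _ _ _ _ (cst 0) (fun k => g0 ^+ k * t 0%N)).
- by apply: nearW => k; rewrite /= t0 tb.
- exact: cvg_cst.
rewrite -[X in _ --> X](mul0r (t 0%N)); apply: cvgMl; apply: cvg_expr.
by rewrite ger0_norm.
Qed.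

Variables (u : nat) (A H : nat -> fps R) (M : fps R).
Hypothesis uB : (1 <= u <= B)%N.
Variable G : nat -> fps R.
Hypothesis A_service : forall k n, A k n = \sum_(i < n.+1) H k i + \sum_(i < n.+1) G k i * M (n - i)%N.
Hypothesis AE : forall k, A k.+1 = A 1%N.
Hypothesis A_removal : (fpsX R - fpsC lam) * M = fpsC (1 - lam) * A 1%N.

(** The sequences A^(u-L) and M_(u-m) of the level u, extended by 0 above u. *)
Let Vz k L : R := (L <= u)%N%:R * A k (u - L)%N.
Let Mz m : R := (m <= u)%N%:R * M (u - m)%N.

Lemma Mz_step m : (1 <= m)%N -> Mz m.+1 = (1 - lam) * Vz 1 m + lam * Mz m.
Proof.
move=> m1; rewrite /Mz /Vz; have [mu|um] := leqP m u; last first.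
  by rewrite [(m.+1 <= u)%N]leqNgt ltnW ?ltnS// !mul0r !mulr0 addr0.
have := congr1 (fun f : fps R => f (u - m)%N) A_removal.
rewrite mulrBl fpsDE fpsNE !fpsCM fpsXM => E.
rewrite !mul1r -E; case: (ltnP m u) => mu'.
  by rewrite (_ : (u - m)%N = (u - m.+1).+1); [rewrite mul1r /=; ring|lia].
by rewrite (_ : u - m = 0)%N; [rewrite mul0r; ring|lia].
Qed.

(** A removal from m leaves L >= 1 customers with probability P[delta = m - L];
otherwise delta >= m, where delta - m + 1 is again a copy of delta and the value is
M_(u-1). *)
Lemma Mz_removal m : (1 <= m)%N ->
  Mz m = \sum_(1 <= L < B.+2) geometric_pmf (m - L) * Vz 1 L + lam ^+ m.-1 * M u.-1.
Proof.
case: m => // m _; elim: m => [|m IH].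
  rewrite big1_seq => [|L]; last by rewrite mem_index_iota => /andP[_ /andP[L1 _]]; rewrite (_ : 1 - L = 0)%N ?mul0r//; lia.
  by rewrite /Mz subn1 /= expr0; case/andP: uB => -> _; rewrite add0r.
rewrite Mz_step// IH mulrDr mulrA -exprS /= addrA; congr (_ + _).
rewrite mulr_sumr.
have V0 L : (u < L)%N -> Vz 1 L = 0 by move=> uL; rewrite /Vz leqNgt uL mul0r.
have [mB|mB] := leqP m.+1 B.+1; last first.
  rewrite V0 ?mulr0 ?add0r; last by case/andP: uB; lia.
  apply: eq_big_nat => L LB.
  have -> : (m.+2 - L = (m - L).+2)%N by lia.
  by have -> : (m.+1 - L = (m - L).+1)%N by [lia]; rewrite /= exprS; ring.
rewrite [X in _ + X = _](@big_cat_nat _ _ _ m.+1 1%N B.+2)//=; last exact: ltnW.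
rewrite [RHS](@big_cat_nat _ _ _ m.+1 1%N B.+2)//=; last exact: ltnW.
rewrite [X in _ + (_ + X) = _]big1_seq ?addr0; last first.
  by move=> L; rewrite mem_index_iota => /andP[_ /andP[mL _]]; rewrite (_ : m.+1 - L = 0)%N ?mul0r ?mulr0//; lia.
rewrite [X in _ = _ + X]big_ltn//= [X in _ = _ + (_ + X)]big1_seq ?addr0; last first.
  by move=> L; rewrite mem_index_iota => /andP[_ /andP[mL _]]; rewrite (_ : m.+2 - L = 0)%N ?mul0r//; lia.
rewrite subSnn /= expr0 mulr1 addrC; congr (_ + _).
apply: eq_big_nat => L LB.
have -> : (m.+2 - L = (m - L).+2)%N by lia.
by have -> : (m.+1 - L = (m - L).+1)%N by [lia]; rewrite /= exprS; ring.
Qed.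

(** Mass of the clock ringing in cycle k at a content at most u. *)
Definition occupancy (w : nat -> nat -> R) k : R :=
  \sum_(1 <= L < B.+2) w k L * ((L <= u)%N%:R * \sum_(i < (u - L).+1) H k i).

(** A service step followed by a removal step. The missing equation at m = B.+1 is
harmless, because the value there is 0. *)
Lemma recursion_step gamma w W kill k : busy_recursion G gamma w W kill ->
  \sum_(1 <= L < B.+2) w k L * Vz k L =
  occupancy w k + \sum_(1 <= L < B.+2) w k.+1 L * Vz k.+1 L + kill k * M u.-1.
Proof.
move=> h; have [u1 uB'] := andP uB.
transitivity (occupancy w k + \sum_(1 <= m < B.+2) W k m * Mz m).
  have -> : \sum_(1 <= m < B.+2) W k m * Mz m = \sum_(1 <= m < B.+2) \sum_(1 <= L < B.+2)
      w k L * ((L <= m)%N%:R * G k (m - L)%N) * Mz m.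
    apply: eq_big_nat => m /andP[m1]; rewrite ltnS leq_eqVlt => /orP[/eqP->|mB].
      by rewrite /Mz leqNgt ltnS uB' mul0r mulr0 big1// => L _; rewrite mulr0.
    by rewrite (recursion_input h) ?m1// mulr_suml.
  rewrite exchange_big/= -big_split/=; apply: eq_big_nat => L /andP[L1 LB].
  rewrite [X in _ = _ + X](eq_bigr (fun m => w k L * ((L <= m)%N%:R * G k (m - L)%N * Mz m))); last by move=> m _; rewrite -!mulrA.
  rewrite -mulr_sumr -mulrDr; congr (_ * _).
  rewrite /Vz; have [Lu|uL] := leqP L u; last first.
    rewrite !mul0r add0r big1_seq// => m _; rewrite /Mz; have [mu|um] := leqP m u; last by rewrite mul0r mulr0.
    by rewrite leqNgt (leq_ltn_trans mu uL) !mul0r.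
  rewrite !mul1r A_service; congr (_ + _).
  rewrite (@big_cat_nat _ _ _ u.+1 1%N B.+2)//=; last by rewrite ltnS leqW.
  rewrite [X in _ = _ + X]big1_seq ?addr0; last first.
    by move=> m; rewrite mem_index_iota => /andP[_ /andP[um _]]; rewrite /Mz (_ : (m <= u)%N = false) ?mul0r ?mulr0//; lia.
  rewrite (@big_cat_nat _ _ _ L 1%N u.+1)//=; last exact: leqW.
  rewrite [X in _ = X + _]big1_seq ?add0r; last first.
    by move=> m; rewrite mem_index_iota => /andP[_ /andP[_ mL]]; rewrite leqNgt mL !mul0r.
  rewrite -[X in \sum_(X <= _ < _) _]add0n big_addn subSn// big_mkord; apply: eq_bigr => i _.
  rewrite leq_addl mul1r addnK /Mz.
  have -> : (i + L <= u)%N by have := ltn_ord i; lia.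
  by rewrite mul1r; congr (_ * M _); lia.
rewrite -addrA; congr (_ + _).
transitivity (\sum_(1 <= m < B.+2) (\sum_(1 <= L < B.+2) W k m * geometric_pmf (m - L) * Vz 1 L + W k m * lam ^+ m.-1 * M u.-1)).
  apply: eq_big_nat => m /andP[m1 _]; rewrite Mz_removal// mulrDr mulr_sumr mulrA; congr (_ + _).
  by apply: eq_bigr => L _; rewrite mulrA.
rewrite big_split/= -mulr_suml -(recursion_kill h); congr (_ + _).
rewrite exchange_big/=; apply: eq_big_nat => L LB.
by rewrite -mulr_suml -(recursion_removal h)// /Vz AE.
Qed.

Lemma recursion_sum gamma w W kill K : busy_recursion G gamma w W kill -> (1 <= r <= B.+1)%N ->
  (r <= u)%N%:R * A 0 (u - r)%N = \sum_(k < K) occupancy w k + (\sum_(k < K) kill k) * M u.-1 +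
    \sum_(1 <= L < B.+2) w K L * Vz K L.
Proof.
move=> h rB; elim: K => [|K IH]; last first.
  by rewrite IH (recursion_step K h) !big_ord_recr/=; ring.
have rin : r \in index_iota 1 B.+2 by rewrite mem_index_iota.
have U : uniq (index_iota 1 B.+2) by exact: iota_uniq.
rewrite !big_ord0 mul0r !add0r (bigD1_seq r)// /=.
rewrite (recursion_init h) eqxx mul1r big1 ?addr0// => L Lr.
by rewrite (recursion_init h) (negbTE Lr) mul0r.
Qed.

(** The identities [recursion_step] telescope, and the remainder is bounded by the mass
of the chain. *)
Lemma recursion_limit gamma w W kill g0 (p b : R) : busy_recursion G gamma w W kill -> (1 <= r <= B.+1)%N ->
  (forall k, 0 <= gamma k <= 1) -> (forall k, gamma k.+1 = g0) -> g0 < 1 ->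
  series (occupancy w) @ \oo --> p -> series kill @ \oo --> b ->
  (r <= u)%N%:R * A 0 (u - r)%N = p + b * M u.-1.
Proof.
move=> h rB g01 gE g1 hp hb.
have hw := recursion_vanish h g01 gE g1 rB.
have : (fun K => series (occupancy w) K + series kill K * M u.-1 + \sum_(1 <= L < B.+2) w K L * Vz K L) @ \oo
   --> p + b * M u.-1 + 0.
  apply: cvgD; first by apply: cvgD => //; exact: cvgMl.
  pose C := \sum_(1 <= L < B.+2) `|Vz 1 L|.
  have C0 : 0 <= C by exact: sumr_ge0.
  pose f K := \sum_(1 <= L < B.+2) w K L * Vz K L.
  rewrite -[X in X @ _]/f -cvg_shiftS; apply/norm_cvg0P.
  apply: (@squeeze_cvgr _ _ _ _ (cst 0) (fun K => (\sum_(1 <= L < B.+2) w K.+1 L) * C)).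
  - apply: nearW => K; rewrite normr_ge0/=.
    apply: le_trans (ler_norm_sum _ _ _) _; rewrite mulr_suml big_nat_cond [leRHS]big_nat_cond.
    apply: ler_sum => L /andP[LB _]; have [w0 _] := recursion_ge0 h K.+1 L.
    rewrite normrM ger0_norm// ler_wpM2l// /Vz AE -/(Vz 1 L) /C.
    have U : uniq (index_iota 1 B.+2) by exact: iota_uniq.
    have Lin : L \in index_iota 1 B.+2 by rewrite mem_index_iota.
    rewrite (bigD1_seq L)// /=.
    by rewrite lerDl sumr_ge0.
  - exact: cvg_cst.
  - rewrite -[X in _ --> X](mul0r C); apply: cvgMl.
    by move: hw; rewrite -cvg_shiftS.
rewrite addr0 (_ : (fun K => _) = cst ((r <= u)%N%:R * A 0 (u - r)%N)).
  by move=> /cvg_lim <-//; rewrite lim_cst.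
by apply/funext => K; rewrite (recursion_sum K h rB) !seriesEord.
Qed.

End busy_recursion.

(** * Regularity of almost all paths *)

Section good_paths.
Context {d : measure_display} {Omega : measurableType d} {R : realType}.
Context {P : probability Omega R}.
Variables (mu s : R) (kappa delta : {RV P >-> nat}) (eta : {RV P >-> R}) (y : R) (X : inputs P).
Hypothesis hX : inputs_spec mu s kappa delta eta y X.
Hypotheses (mu0 : 0 < mu) (s0 : 0 < s) (eta0 : forall w, 0 < eta w).
Local Notation Ex := (Ex P).
Local Notation Osub := (Osub X).

Lemma unitf_exp_service n j : unitf (fun w => expR (- service X n j w) : R).
Proof.
split; first by apply: measurableT_comp => //; apply: measurable_funN; exact: measurable_funPT.
by move=> w; rewrite expR_ge0/= -[leRHS]expR0 ler_expR oppr_le0 ltW// (service_pos hX).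
Qed.

Lemma services_unbounded n : almost_surely P (fun w => unbounded_sums (services X n w)).
Proof.
apply: (@unbounded_as _ _ _ P (service X n)).
- by move=> j; exact: measurable_funPT.
- by move=> j w; exact: (service_pos hX).
pose e0 := Ex (fun w => expR (- eta w)).
pose phi (x : R) := ind (0 <= x) * expR (- x).
have uphi : unitf phi.
  split; first by apply: measurable_funM; [case: (@unitf_ind _ R R (fun x => 0 <= x)); [exact: measurable_ler|by []]|apply: measurableT_comp => //; exact: measurable_funN].
  move=> x; rewrite mulr_ge0 ?ind_ge0 ?expR_ge0//= /phi; have [x0|x0] := leP 0 x; last first.
    by rewrite indF ?mul0r ?ler01.
  by rewrite indT// mul1r -[leRHS]expR0 ler_expR oppr_le0.
have phiE (V : Omega -> R) : (forall w, 0 < V w) -> (fun w => expR (- V w)) = (fun w => phi (V w)).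
  by move=> V0; apply/funext => w; rewrite /phi indT ?mul1r// ltW.
have e0lt : e0 < 1.
  apply: Ex_lt1.
    by rewrite phiE//; apply: unitf_comp uphi _; exact: measurable_funPT.
  by move=> w; rewrite -[ltRHS]expR0 ltr_expR oppr_lt0.
have e0ge : 0 <= e0 by apply: Ex_ge0 => w; exact: expR_ge0.
have ej j : Ex (fun w => expR (- service X n j.+1 w)) = e0.
  rewrite /e0 phiE ?[X in _ = Ex X]phiE//; last by move=> w; exact: (service_pos hX).
  by apply: Ex_same_law => //; apply: (service_law hX); rewrite xpair_eqE andbF.
pose c0 := Ex (fun w => expR (- service X n 0 w)).
have c01 : 0 <= c0 <= 1 := Ex01 P (unitf_exp_service n 0).
have E m : Ex (fun w => expR (- partial_sum (fun j => service X n j w) m.+1)) = c0 * e0 ^+ m.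
  rewrite (eq_Ex P (G := fun w => \prod_(j < m.+1) expR (- service X n j w))); last first.
    by move=> w; rewrite /partial_sum -sumrN expR_sum.
  rewrite (Ex_prod_indep (inputs_indep hX) (J := fun j => [set Service n j]) (G := fun j w => expR (- service X n j w)))//.
  - by rewrite big_ord_recl/= (eq_bigr (fun=> e0)) ?prodr_const ?card_ord// => j _; rewrite -ej.
  - move=> i j ij; apply/seteqP; split => // z [/= -> [e]].
    by move: ij; rewrite e ltnn.
  - move=> j; case: (unitf_exp_service n j) => _ b; split => //.
    by apply: measurableT_comp => //; apply: measurable_funN; exact: measurable_service.
pose f m := Ex (fun w => expR (- partial_sum (fun j => service X n j w) m)).
rewrite -[X in X @ _]/f -cvg_shiftS.
rewrite (_ : [sequence _]_m = fun m => c0 * e0 ^+ m); last by apply/funext => m; exact: E.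
have L : (fun m => c0 * e0 ^+ m) @ \oo --> (0 : R).
  by rewrite -[X in _ --> X](mulr0 c0); apply: cvgMr; apply: cvg_expr; rewrite ger0_norm.
exact: L.
Qed.

(** The last gap is independent of the other times and exponential, hence without
atoms. *)
Lemma no_ties n : almost_surely P (fun w => forall i j,
  partial_sum (gaps X n w) i.+1 != partial_sum (services X n w) j.+1).
Proof.
apply: almost_surely_bigcap => i; apply: almost_surely_bigcap => j.
have mg m : measurable_fun setT (gap X n m : Omega -> R) by exact: measurable_funPT.
have ms m : measurable_fun setT (service X n m : Omega -> R) by exact: measurable_funPT.
have mS : measurable_fun setT (fun w => partial_sum (services X n w) j.+1).
  exact: (measurable_partial_sum (v := fun j w => service X n j w)).
have mG m : measurable_fun setT (fun w => partial_sum (gaps X n w) m).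
  exact: (measurable_partial_sum (v := fun j w => gap X n j w)).
have meq d' (T : measurableType d') (f g : T -> R) : measurable_fun setT f -> measurable_fun setT g ->
    measurable [set z | f z = g z].
  move=> mf mg'; rewrite (_ : [set z | _] = [set z | f z <= g z] `&` [set z | g z <= f z]).
    by apply: measurableI; apply: measurable_ler.
  apply/seteqP; split => z /=; first by move=> ->; rewrite lexx.
  by move=> [a b]; apply/eqP; rewrite eq_le a b.
pose A := [set w | partial_sum (gaps X n w) i.+1 = partial_sum (services X n w) j.+1].
have mA : measurable A by exact: meq.
have := @almost_surely_null _ _ _ P A mA.
rewrite (_ : (fun w => ~ A w) = fun w => partial_sum (gaps X n w) i.+1 != partial_sum (services X n w) j.+1); last first.
  by apply/funext => w; apply/propext; split => [/eqP|/eqP].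
apply; apply/eqP; rewrite -(fineK (fin_num_measure P _ mA)) eqe.
rewrite (_ : A = [set w | A w])// -Ex_ind//.
pose J := [set z | exists2 m, (m < i)%N & z = Gap n m] `|` [set z | exists m, z = Service n m].
pose K := [set Gap n i].
have JK : J `&` K = set0.
  apply/seteqP; split => // z [[[m mi ->]|[m ->]]] //= [e]; move: mi; rewrite e ltnn//.
pose F (z : Omega * Omega) := ind (gap X n i z.2 = partial_sum (services X n z.1) j.+1 - partial_sum (gaps X n z.1) i) : R.
have uF : unitf (F : Osub J * Osub K -> R).
  apply: unitf_ind; apply: meq.
    exact: (measurableT_comp (@measurable_gap _ _ _ _ X K n i (erefl _)) (@measurable_snd _ _ _ _)).
  have m1 : measurable_fun setT (fun w : Osub J => partial_sum (services X n w) j.+1).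
    by apply: measurable_sum => m; apply: measurable_service; right; exists m.
  have m2 : measurable_fun setT (fun w : Osub J => partial_sum (gaps X n w) i).
    by apply: measurable_sum => m; apply: measurable_gap; left; exists m.
  apply: measurable_funB.
    exact: (measurableT_comp m1 (@measurable_fst _ _ _ _)).
  exact: (measurableT_comp m2 (@measurable_fst _ _ _ _)).
rewrite (eq_Ex P (G := fun w => F (w, w))); last first.
  move=> w; apply: ind_eq; rewrite /A /= (partial_sumS (gaps X n w)); have -> : gaps X n w i = gap X n i w by [].
  by split => [<-|->]; ring.
rewrite (Ex_fubini (inputs_indep hX) JK uF) (eq_Ex P (G := fun=> 0)) ?Ex_cst// => w1.
rewrite /F /= Ex_ind; last by apply: meq.
have := gap_law hX n i (A := [set partial_sum (services X n w1) j.+1 - partial_sum (gaps X n w1) i]).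
rewrite (_ : [set w | _] = gap X n i @^-1` [set partial_sum (services X n w1) j.+1 - partial_sum (gaps X n w1) i])//.
by move=> ->//; rewrite /exponential_prob integral_set1.
Qed.

Definition good_paths n w : Prop := unbounded_sums (gaps X n w) /\ unbounded_sums (services X n w) /\
  forall i j, partial_sum (gaps X n w) i.+1 != partial_sum (services X n w) j.+1.

Lemma good_paths_as n : almost_surely P (good_paths n).
Proof.
apply: almost_surelyI; first exact: (gaps_unbounded hX).
by apply: almost_surelyI; [exact: services_unbounded|exact: no_ties].
Qed.

End good_paths.

(** * Markov property of the content at the ends of services *)

Lemma eq_chain I q I' q' r B k : (forall m, (m < k)%N -> I m = I' m /\ q m = q' m) ->
  chain I q r B k = chain I' q' r B k.
Proof.
elim: k => //= k IH H; rewrite IH => [|m mk]; last by apply: H; exact: ltnW.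
by have [-> ->] := H k (ltnSn k).
Qed.

Definition history_chain r B (l : seq (nat * nat)) : nat :=
  chain (fun m => (nth (0%N, 0%N) l m).1) (fun m => (nth (0%N, 0%N) l m).2) r B (size l).

Section busy_instance.
Context {d : measure_display} {Omega : measurableType d} {R : realType}.
Context {P : probability Omega R}.
Variables (mu s lam : R) (kappa delta : {RV P >-> nat}) (eta : {RV P >-> R}) (y : R) (X : inputs P).
Hypothesis hX : inputs_spec mu s kappa delta eta y X.
Hypotheses (mu0 : 0 < mu) (s0 : 0 < s) (kappa0 : forall w, (0 < kappa w)%N) (eta0 : forall w, 0 < eta w).
Hypotheses (lam0 : 0 <= lam) (lam1 : lam < 1) (delta0 : forall w, (0 < delta w)%N) (deltaE : geometric_law lam delta).
Variables (B r n : nat).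
Hypothesis rB : (1 <= r <= B.+1)%N.
Local Notation Ex := (Ex P).
Local Notation Osub := (Osub X).
Local Notation nu := (clock X).
Local Notation S := (fun k w => epoch X n k w).
Local Notation pois := (compound_pmf mu (batch_series kappa)).
Local Notation I := (fun k w => path_arrivals (gaps X n w) (services X n w) (batches X n w) k).
Local Notation Z := (fun k w => chain (path_arrivals (gaps X n w) (services X n w) (batches X n w)) (removals X n w) r B k).

Lemma chain_historyE k w : Z k w = history_chain r B (history X n k w).
Proof.
rewrite /history_chain size_map size_iota; apply: eq_chain => m mk.
by rewrite (nth_map 0%N) ?size_iota// nth_iota.
Qed.

Lemma chain_bound k w : (Z k w <= B.+1)%N.
Proof. exact: chain_le. Qed.

Lemma epochS k w : S k.+1 w = S k w + service X n k w.
Proof. by rewrite /epoch partial_sumS. Qed.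

(** All variables but the removal that ends cycle k, which is therefore independent of the
cycle. *)
Definition all_but k : set slot := [set z | z <> Removal n k].

Lemma measurable_clock_but k : measurable_fun [set: Osub (all_but k)] (nu : Osub (all_but k) -> R).
Proof. exact: measurable_clock. Qed.

Lemma measurable_epoch_but k m : measurable_fun [set: Osub (all_but k)] (epoch X n m : Osub (all_but k) -> R).
Proof. exact: measurable_epoch. Qed.

Lemma measurable_arrivals_but k m : measurable_fun [set: Osub (all_but k)] (I m : Osub (all_but k) -> nat).
Proof.
have mid : measurable_fun setT (id : Osub (all_but k) -> Osub (all_but k)) by exact: measurable_id.
have sub : input_slots n `<=` all_but k by move=> z [[m' ->]|[m' ->]].
by apply: (measurable_nat2 nat subn); apply: (measurable_arrivals_sub hX sub mid); exact: measurable_epoch_but.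
Qed.

Lemma measurable_chain_but k m : (m <= k)%N -> measurable_fun [set: Osub (all_but k)] (Z m : Osub (all_but k) -> nat).
Proof.
elim: m => [|m IH] mk; first exact: measurable_cst.
have mr : measurable_fun [set: Osub (all_but k)] (removal X n m : Osub (all_but k) -> nat).
  by apply: measurable_removal => -[e]; move: mk; rewrite e ltnn.
have mI := @measurable_arrivals_but k m; have {}IH := IH (ltnW mk).
have mA : measurable_fun setT (fun w : Osub (all_but k) => (Z m w + I m w)%N) by exact: (measurable_nat2 nat addn).
have mM : measurable_fun setT (fun w : Osub (all_but k) => minn (Z m w + I m w) B.+1).
  by apply: (measurable_nat2 nat minn mA); exact: measurable_cst.
have mD : measurable_fun setT (fun w : Osub (all_but k) => (minn (Z m w + I m w) B.+1 - removal X n m w)%N).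
  exact: (measurable_nat2 nat subn mM).
exact: (measurable_nat2 nat (fun a b => if a == 0%N then 0%N else b) IH mD).
Qed.

Lemma measurable_chain m : measurable_fun setT (Z m).
Proof. exact: (measurableT_comp (measurable_chain_but (leqnn m)) (@measurable_id_Osub _ _ _ _ X _)). Qed.

(** Content just before the k-th removal. *)
Definition input_level k w : nat := minn (Z k w + I k w) B.+1.

Definition alive k L w : R := ind (Z k w = L) * ind (S k w <= nu w).
Definition before_removal k m w : R := ind (0 < Z k w)%N * ind (input_level k w = m) * ind (S k.+1 w <= nu w).
Definition killed k w : R := ind (0 < Z k w)%N * ind (Z k.+1 w = 0%N) * ind (S k.+1 w <= nu w).
Definition occupied_at u k w : R := ind (0 < Z k w)%N * ind (S k w <= nu w) * ind (nu w < S k.+1 w) *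
  ind (Z k w + (arrivals X n w (nu w) - arrivals X n w (S k w)) <= u)%N.

Definition input_series k : fps R := fun i =>
  Ex (fun w => ind (service X n k w <= nu w) * pois i (service X n k w)).
Definition survival_series k : fps R := fun i =>
  Ex (fun w => ind (nu w < service X n k w) * pois i (nu w)).
Definition service_mass k : R := Ex (fun w => ind (service X n k w <= nu w)).

Let ms k : measurable_fun setT (service X n k : Omega -> R). Proof. exact: measurable_funPT. Qed.
Let mnu : measurable_fun setT (nu : Omega -> R). Proof. exact: measurable_funPT. Qed.
Let mS k : measurable_fun setT (S k).
Proof. exact: (measurable_partial_sum (v := fun j w => service X n j w)). Qed.
Let mI k : measurable_fun setT (I k).
Proof. exact: (measurableT_comp (@measurable_arrivals_but k k) (@measurable_id_Osub _ _ _ _ X _)). Qed.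
Let mIL k : measurable_fun setT (input_level k).
Proof.
apply: (measurable_nat2 nat minn); last exact: measurable_cst.
by apply: (measurable_nat2 nat addn); [exact: measurable_chain|exact: mI].
Qed.

Let uZ k (Q : nat -> Prop) : unitf (fun w => ind (Q (Z k w)) : R).
Proof. by apply: unitf_ind; apply: measurable_nat_pred; exact: measurable_chain. Qed.
Let uI k (Q : nat -> Prop) : unitf (fun w => ind (Q (I k w)) : R).
Proof. by apply: unitf_ind; apply: measurable_nat_pred; exact: mI. Qed.
Let uIL k (Q : nat -> Prop) : unitf (fun w => ind (Q (input_level k w)) : R).
Proof. by apply: unitf_ind; apply: measurable_nat_pred; exact: mIL. Qed.
Let uS k : unitf (fun w => ind (S k w <= nu w) : R).
Proof. by apply: unitf_ind; apply: measurable_ler. Qed.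

Lemma unitf_alive k L : unitf (alive k L).
Proof. by apply: unitfM => //; exact: (uZ k (fun x => x = L)). Qed.
Lemma unitf_before_removal k m : unitf (before_removal k m).
Proof. by apply: unitfM => //; apply: unitfM; [exact: (uZ k (fun x => (0 < x)%N))|exact: (uIL k (fun x => x = m))]. Qed.
Lemma unitf_killed k : unitf (killed k).
Proof. by apply: unitfM => //; apply: unitfM; [exact: (uZ k (fun x => (0 < x)%N))|exact: (uZ k.+1 (fun x => x = 0%N))]. Qed.

(** [history_step] with the arrivals counted over the service, which ends before the
clock rings. *)
Lemma alive_input k L i : Ex (fun w => ind (Z k w = L) * ind (S k.+1 w <= nu w) * ind (I k w = i)) =
  Ex (alive k L) * input_series k i.
Proof.
have mle : measurable_fun setT (fst : R * R -> R) by exact: measurable_fst.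
have uq : unitf (fun p : R * R => ind (p.1 <= p.2) : R).
  by apply: unitf_ind; apply: measurable_ler.
have := history_step hX mu0 s0 kappa0 n k i (fun l => history_chain r B l = L) uq mle.
move=> /(_ (fun sg t sg0 t0 _ => ltW sg0)) /= E.
rewrite (eq_Ex P (G := fun w => ind (history_chain r B (history X n k w) = L) *
   (ind (S k w <= nu w) * (ind (service X n k w <= nu w - S k w) *
      ind ((arrivals X n w (S k w + service X n k w)%R - arrivals X n w (S k w))%N = i))))).
  by rewrite E; congr (_ * _); apply: eq_Ex => w; rewrite /alive chain_historyE.
move=> w; rewrite /path_arrivals -/(arrivals X n w _) -/(epoch X n k.+1 w) -/(epoch X n k w) epochS chain_historyE.
rewrite -!mulrA; congr (_ * _); rewrite mulrA; congr (_ * _).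
rewrite indM; apply: ind_eq; rewrite lerBrDl; split=> [h|[]//]; split => //.
by apply: le_trans h; rewrite lerDl ltW// (service_pos hX).
Qed.

(** [history_step] with the arrivals counted over the remaining lifetime of the clock, which
rings during the service. *)
Lemma alive_occupied k L i : Ex (fun w => ind (Z k w = L) * ind (S k w <= nu w) * ind (nu w < S k.+1 w) *
    ind ((arrivals X n w (nu w) - arrivals X n w (S k w))%N = i)) =
  Ex (alive k L) * survival_series k i.
Proof.
have mle : measurable_fun setT (snd : R * R -> R) by exact: measurable_snd.
have uq : unitf (fun p : R * R => ind (p.2 < p.1) : R).
  by apply: unitf_ind; apply: measurable_ltr.
have := history_step hX mu0 s0 kappa0 n k i (fun l => history_chain r B l = L) uq mle.
move=> /(_ (fun sg t sg0 t0 _ => t0)) /= E.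
rewrite (eq_Ex P (G := fun w => ind (history_chain r B (history X n k w) = L) *
   (ind (S k w <= nu w) * (ind (nu w - S k w < service X n k w) *
      ind ((arrivals X n w (S k w + (nu w - S k w))%R - arrivals X n w (S k w))%N = i))))).
  by rewrite E; congr (_ * _); apply: eq_Ex => w; rewrite /alive chain_historyE.
move=> w; rewrite epochS chain_historyE [(S k w + (_ - _))%R]addrC subrK.
by rewrite -!mulrA ltrBlDl.
Qed.

Lemma input_series_mass k : summ 1 (input_series k) (service_mass k).
Proof.
have one : `|1 : R| <= 1 by rewrite normr1.
have gf t : 0 <= t -> summ 1 (fun i => pois i t) 1.
  by move=> t0; have := pois_gf mu0 kappa0 one t0; rewrite cumulant1 mulr0 expR0.
have up i : unitf (fun w => ind (service X n k w <= nu w) * pois i (service X n k w)).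
  apply: unitfM; first by apply: unitf_ind; apply: measurable_ler.
  by apply: (unitf_comp (unitf_pois kappa mu0 i)).
rewrite /summ (_ : series _ = fun m => Ex (fun w => \sum_(i < m) ind (service X n k w <= nu w) * pois i (service X n k w))); last first.
  apply/funext => m; rewrite seriesEord Ex_sum//; apply: eq_bigr => i _.
  by rewrite expr1n mul1r.
apply: Ex_cvg; last by apply: unitf_ind; apply: measurable_ler.
- move=> m; split; first by apply: measurable_sum => i; case: (up i).
  move=> w; apply/andP; split; first by apply: sumr_ge0 => i _; have [_ /(_ w)/andP[]] := up i.
  rewrite -mulr_sumr mulr_ile1 ?ind_ge0 ?ind_le1 ?(pois_sum_le1 mu0)//.
  by apply: sumr_ge0 => i _; have [_ /(_ (service X n k w))/andP[]] := unitf_pois kappa mu0 i.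
- move=> w; have := gf _ (ltW (service_pos hX n k w)).
  rewrite /summ => h; rewrite (_ : (fun m => _) = fun m => ind (service X n k w <= nu w) * series (fun i => 1 ^+ i * pois i (service X n k w)) m).
    by rewrite -[X in _ --> X]mulr1; apply: cvgMr.
  apply/funext => m; rewrite -mulr_sumr seriesEord; congr (_ * _); apply: eq_bigr => i _.
  by rewrite expr1n mul1r.
Qed.

Lemma alive_mass k L : Ex (fun w => ind (Z k w = L) * ind (S k.+1 w <= nu w)) = Ex (alive k L) * service_mass k.
Proof.
have u0 : unitf (fun w => ind (Z k w = L) * ind (S k.+1 w <= nu w) : R).
  by apply: unitfM => //; exact: (uZ k (fun x => x = L)).
have h : (fun m => Ex (alive k L) * series (fun i => 1 ^+ i * input_series k i) m) @ \oo --> Ex (alive k L) * service_mass k.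
  by apply: cvgMr; exact: input_series_mass.
apply: (cvg_unique _ _ h) => //.
rewrite (_ : (fun m => _) = fun m => Ex (fun w => ind (Z k w = L) * ind (S k.+1 w <= nu w) * ind (I k w < m)%N)).
  apply: Ex_cvg => //.
    by move=> m; apply: unitfM => //; exact: (uI k (fun x => (x < m)%N)).
  by move=> w; apply: cvg_near_cst; exists (I k w).+1 => // m /= h'; rewrite [ind (_ < m)%N]indT ?mulr1.
apply/funext => m; rewrite seriesEord mulr_sumr.
rewrite [RHS](eq_Ex P (G := fun w => \sum_(i < m) ind (Z k w = L) * ind (S k.+1 w <= nu w) * ind (I k w = i))).
  rewrite [RHS]Ex_sum; last by move=> i; apply: unitfM => //; exact: (uI k (fun x => x = i)).
  by apply: eq_bigr => i _; rewrite alive_input expr1n mul1r.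
move=> w; rewrite -mulr_sumr; congr (_ * _); rewrite indE; case: ltnP => hm.
  rewrite (bigD1 (Ordinal hm))//= indT// big1 ?addr0// => i ih; apply: indF => e.
  by move: ih; rewrite -val_eqE/= e eqxx.
by rewrite big1// => i _; apply: indF => e; have := ltn_ord i; rewrite -e ltnNge hm.
Qed.

Lemma ind_split_pos k w (F : nat -> R) : \sum_(1 <= L < B.+2) ind (Z k w = L) * F L = ind (0 < Z k w)%N * F (Z k w).
Proof.
have [z0|z0] := posnP (Z k w).
  rewrite [ind false]indF// mul0r.
  by rewrite big1_seq// => L; rewrite mem_index_iota z0 => /andP[_ L1]; rewrite indF ?mul0r// => e; move: L1; rewrite -e.
by rewrite (ind_split F (N := B.+2)) ?indT ?mul1r// z0 ltnS chain_bound.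
Qed.

Let ualive k L : unitf (fun w => ind (Z k w = L) * ind (S k.+1 w <= nu w) : R).
Proof. by apply: unitfM => //; exact: (uZ k (fun x => x = L)). Qed.

Lemma input_level_bound k w : (input_level k w <= B.+1)%N.
Proof. exact: geq_minr. Qed.

Lemma input_level_pos k w : (0 < Z k w)%N -> (0 < input_level k w)%N.
Proof. by move=> z0; rewrite leq_min ltn_addr. Qed.

Lemma before_removal_input k m : (1 <= m <= B)%N -> Ex (before_removal k m) =
  \sum_(1 <= L < B.+2) Ex (alive k L) * ((L <= m)%N%:R * input_series k (m - L)%N).
Proof.
move=> mB.
transitivity (\sum_(1 <= L < B.+2) Ex (fun w => (L <= m)%N%:R * (ind (Z k w = L) * ind (S k.+1 w <= nu w) * ind (I k w = (m - L)%N)))).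
  rewrite -Ex_sum; last first.
    move=> L; apply: unitfM; first by apply: unitf_cst; case: (L <= m)%N; rewrite ?lexx ?ler01.
    by apply: unitfM => //; exact: (uI k (fun x => x = (m - L)%N)).
  apply: eq_Ex => w.
  rewrite (eq_bigr (fun L => ind (Z k w = L) * ((L <= m)%N%:R * ind (S k.+1 w <= nu w) * ind (I k w = (m - L)%N)))); last first.
    by move=> L _; ring.
  rewrite ind_split_pos /before_removal -!mulrA; congr (_ * _).
  rewrite [ind (S _ _ <= _) * _]mulrC mulrA; congr (_ * _).
  rewrite -[(Z k w <= m)%N%:R]indE indM; apply: ind_eq; rewrite /input_level.
  have := I k w => Ik; rewrite -/(Z k w); move: (Z k w) mB => z mB; move: (path_arrivals _ _ _ _) => i; lia.
apply: eq_bigr => L _; rewrite ExZ ?alive_input; first by rewrite mulrCA.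
by apply: unitfM => //; exact: (uI k (fun x => x = (m - L)%N)).
Qed.

Lemma before_removal_mass k : \sum_(1 <= m < B.+2) Ex (before_removal k m) =
  service_mass k * \sum_(1 <= L < B.+2) Ex (alive k L).
Proof.
rewrite -Ex_sum; last by move=> m; exact: unitf_before_removal.
rewrite mulr_sumr.
transitivity (\sum_(1 <= L < B.+2) Ex (fun w => ind (Z k w = L) * ind (S k.+1 w <= nu w))); last first.
  by apply: eq_bigr => L _; rewrite alive_mass mulrC.
rewrite -Ex_sum//; apply: eq_Ex => w; rewrite ind_split_pos.
rewrite (eq_bigr (fun m => ind (input_level k w = m) * (ind (0 < Z k w)%N * ind (S k.+1 w <= nu w)))); last first.
  by move=> m _; rewrite /before_removal; ring.
have [z0|z0] := posnP (Z k w).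
  by rewrite [ind false]indF// !mul0r big1// => m _; rewrite mulr0.
by rewrite ind_split// input_level_pos// ltnS input_level_bound.
Qed.

Lemma removal_lawE k (Q : nat -> Prop) : Ex (fun w => ind (Q (removal X n k w))) = Ex (fun w => ind (Q (delta w))).
Proof.
apply: (Ex_same_law (F := fun j : nat => ind (Q j))); first exact: (removal_law hX).
by apply: unitf_ind; exact: (@measurable_nat_pred _ _ (id : nat -> nat)).
Qed.

Lemma removal_pmf k j : Ex (fun w => ind (removal X n k w = j)) = geometric_pmf lam j.
Proof.
rewrite (removal_lawE k (fun x => x = j)); case: j => [|j] /=.
  rewrite -[RHS](Ex_cst P 0); apply: eq_Ex => w; apply: indF => e.
  by have := delta0 w; rewrite e.
rewrite Ex_ind; last by apply: (@measurable_nat_pred _ _ delta (fun x => x = j.+1)); exact: measurable_funPT.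
by have := deltaE j; rewrite (_ : _ @^-1` _ = [set w | delta w = j.+1])// => ->.
Qed.

Lemma removal_tail k m : (0 < m)%N -> Ex (fun w => ind (m <= removal X n k w)%N) = lam ^+ m.-1.
Proof.
case: m => // m _; elim: m => [|m IH].
  by rewrite -[RHS](Ex_cst P 1); apply: eq_Ex => w; apply: indT; exact: (removal_pos hX).
have u1 j : unitf (fun w => ind (removal X n k w = j) : R).
  by apply: unitf_ind; apply: (@measurable_nat_pred _ _ (removal X n k) (fun x => x = j)); exact: measurable_funPT.
have u2 j : unitf (fun w => ind (j <= removal X n k w)%N : R).
  by apply: unitf_ind; apply: (@measurable_nat_pred _ _ (removal X n k) (fun x => (j <= x)%N)); exact: measurable_funPT.
have := ExD P (u1 m.+1) (u2 m.+2); rewrite removal_pmf.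
rewrite (eq_Ex P (G := fun w => ind (m.+1 <= removal X n k w)%N)); last first.
  move=> w; have [e|e] := eqVneq (removal X n k w) m.+1.
    by rewrite e [ind (m.+1 = _)]indT// [ind (m.+1 <= _)%N]indT// indF ?addr0// ltnn.
  rewrite [ind (_ = _)]indF ?add0r; last exact/eqP.
  by apply: ind_eq; rewrite [(m.+1 <= _)%N]leq_eqVlt eq_sym (negbTE e).
rewrite IH /= => E; rewrite exprS; have := E; lra.
Qed.

Lemma unitf_before_removal_but k m : unitf (before_removal k m : Osub (all_but k) -> R).
Proof.
have mZ := measurable_chain_but (leqnn k).
have mi : measurable_fun [set: Osub (all_but k)] (input_level k : Osub (all_but k) -> nat).
  apply: (measurable_nat2 nat minn); last exact: measurable_cst.
  by apply: (measurable_nat2 nat addn mZ); exact: measurable_arrivals_but.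
apply: unitfM; first apply: unitfM.
- by apply: unitf_ind; apply: (@measurable_nat_pred _ _ _ (fun x => (0 < x)%N) mZ).
- by apply: unitf_ind; apply: (@measurable_nat_pred _ _ _ (fun x => x = m) mi).
- by apply: unitf_ind; apply: measurable_ler; [exact: measurable_epoch_but|exact: measurable_clock_but].
Qed.

Lemma removal_indep k m (Q : nat -> Prop) : Ex (fun w => before_removal k m w * ind (Q (removal X n k w))) =
  Ex (before_removal k m) * Ex (fun w => ind (Q (removal X n k w))).
Proof.
apply: (ExM (inputs_indep hX) (J := all_but k) (K := [set Removal n k])).
- by apply/seteqP; split => // z [/= h e]; case: (h e).
- exact: unitf_before_removal_but.
- apply: unitf_ind; apply: (@measurable_nat_pred _ (Osub [set Removal n k])).
  exact: measurable_removal.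
Qed.

Let urem k (Q : nat -> Prop) : unitf (fun w => ind (Q (removal X n k w)) : R).
Proof. by apply: unitf_ind; apply: measurable_nat_pred; exact: measurable_funPT. Qed.

(** On a live busy period the content before the removal takes exactly one of the values
1, ..., B.+1. *)
Lemma split_before_removal k w (F : nat -> R) :
  ind (0 < Z k w)%N * ind (S k.+1 w <= nu w) * F (input_level k w) =
  \sum_(1 <= m < B.+2) before_removal k m w * F m.
Proof.
rewrite (eq_bigr (fun m => ind (input_level k w = m) * (ind (0 < Z k w)%N * ind (S k.+1 w <= nu w) * F m))); last first.
  by move=> m _; rewrite /before_removal; ring.
have [z0|z0] := posnP (Z k w).
  by rewrite [ind false]indF// !mul0r big1// => m _; rewrite !mul0r mulr0.
by rewrite ind_split// input_level_pos// ltnS input_level_bound.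
Qed.

Lemma alive_removal k L : (1 <= L <= B.+1)%N -> Ex (alive k.+1 L) =
  \sum_(1 <= m < B.+2) Ex (before_removal k m) * geometric_pmf lam (m - L).
Proof.
move=> LB; under eq_bigr do rewrite -(removal_pmf k) -(removal_indep k _ (fun x => x = _)).
rewrite -Ex_sum; last by move=> m; apply: unitfM; [exact: unitf_before_removal|exact: (urem k (fun x => x = (m - L)%N))].
apply: eq_Ex => w; rewrite -(split_before_removal k w (fun m => ind (removal X n k w = (m - L)%N))).
rewrite /alive /= !indM; apply: ind_eq; rewrite /input_level.
have := removal_pos hX n k w; rewrite -/(removals X n w k); move: (removals X n w k) => q q0.
move: (Z k w) => z; move: (path_arrivals _ _ _ _) => i.
by case: eqVneq => [->|z0]; split; move=> []; [lia|lia|move=> h1 h2; split => //; lia|lia].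
Qed.

Lemma killed_removal k : Ex (killed k) = \sum_(1 <= m < B.+2) Ex (before_removal k m) * lam ^+ m.-1.
Proof.
transitivity (\sum_(1 <= m < B.+2) Ex (fun w => before_removal k m w * ind (m <= removal X n k w)%N)); last first.
  rewrite big_nat_cond [RHS]big_nat_cond; apply: eq_bigr => m /andP[/andP[m1 _] _].
  by rewrite (removal_indep k m (fun x => (m <= x)%N)) removal_tail.
rewrite -Ex_sum; last by move=> m; apply: unitfM; [exact: unitf_before_removal|exact: (urem k (fun x => (m <= x)%N))].
apply: eq_Ex => w; rewrite -(split_before_removal k w (fun m => ind (m <= removal X n k w)%N)).
rewrite /killed /= !indM; apply: ind_eq; rewrite /input_level.
rewrite -/(removals X n w k); move: (removals X n w k) => q.
move: (Z k w) => z; move: (path_arrivals _ _ _ _) => i.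
case: eqVneq => [->|z0]; first by split => -[[]].
by split; [move=> [[h1 h2] h3]; split; [|lia]|move=> [[h1 h2] h3]; split; [split => //; lia|]].
Qed.

Lemma busy_instance : busy_recursion lam B r input_series service_mass
  (fun k L => Ex (alive k L)) (fun k m => Ex (before_removal k m)) (fun k => Ex (killed k)).
Proof.
split.
- move=> L; rewrite -[RHS](Ex_cst P); apply: eq_Ex => w; rewrite /alive /= [ind (_ <= _)]indT.
    by rewrite mulr1 -indE; apply: ind_eq; split => [->|/eqP].
  by rewrite /epoch partial_sum0 ltW// (clock_pos hX).
- exact: before_removal_input.
- exact: before_removal_mass.
- exact: alive_removal.
- exact: killed_removal.
- move=> k m; split; apply: Ex_ge0 => w.
    by have [_ /(_ w)/andP[]] := unitf_alive k m.
  by have [_ /(_ w)/andP[]] := unitf_before_removal k m.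
Qed.

End busy_instance.

(** * Summation along a busy period *)

Section busy_limits.
Context {d : measure_display} {Omega : measurableType d} {R : realType}.
Context {P : probability Omega R}.
Variables (mu s lam : R) (kappa delta : {RV P >-> nat}) (eta : {RV P >-> R}) (y : R) (X : inputs P).
Hypothesis hX : inputs_spec mu s kappa delta eta y X.
Hypotheses (mu0 : 0 < mu) (s0 : 0 < s) (kappa0 : forall w, (0 < kappa w)%N) (eta0 : forall w, 0 < eta w).
Variables (B r n : nat).
Hypothesis rB : (1 <= r <= B.+1)%N.
Local Notation Ex := (Ex P).
Local Notation Osub := (Osub X).
Local Notation nu := (clock X).
Local Notation S := (fun k w => epoch X n k w).
Local Notation Z := (fun k w => chain (path_arrivals (gaps X n w) (services X n w) (batches X n w)) (removals X n w) r B k).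
Local Notation len := (busy_length X B n r).
Local Notation refl := (reflected X B n r).

Let uv w : positive_seq (gaps X n w). Proof. exact: (gaps_pos hX). Qed.
Let us w : positive_seq (services X n w). Proof. exact: (services_pos hX). Qed.

Lemma measurable_busy_length_nu : measurable [set w | (len w <= (nu w)%:E)%E].
Proof.
have sub : busy_slots n `<=` setT by [].
have ml : measurable_fun setT (fun w => len w).
  have ml' := measurable_busy_length_cst (J := setT) hX B r (f := id) sub (@measurable_id _ _ _).
  exact: (measurableT_comp ml' (@measurable_id_Osub _ _ _ _ X setT)).
rewrite -[X in measurable X]setTI; apply: measurable_fun_lee => //.
by apply/measurable_EFinP; exact: measurable_funPT.
Qed.

Lemma measurable_reflected_nu u : measurable [set w | refl w (nu w) <= u%:R].
Proof.
have sub : busy_slots n `<=` setT by [].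
apply: measurable_ler; last exact: measurable_cst.
have mc : measurable_fun setT (nu : Osub setT -> R) by exact: measurable_clock.
have mr := measurable_reflected_cst (J := setT) hX B r (f := id) sub (@measurable_id _ _ _) mc.
apply: (measurableT_comp (mr _) (@measurable_id_Osub _ _ _ _ X setT)).
by move=> w; rewrite ltW// (clock_pos hX).
Qed.

Definition busy_over w : R := ind (len w <= (nu w)%:E)%E.
Definition busy_below u w : R := ind (~ (len w <= (nu w)%:E)%E /\ refl w (nu w) <= u%:R).

Lemma unitf_busy_over : unitf busy_over.
Proof. exact/unitf_ind/measurable_busy_length_nu. Qed.

Lemma unitf_busy_below u : unitf (busy_below u).
Proof.
apply: unitf_ind; apply: measurableI; last exact: measurable_reflected_nu.
by apply: measurableC; exact: measurable_busy_length_nu.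
Qed.

Section one_path.
Variable w : Omega.
Hypothesis gw : good_paths X n w.

Let N := renewal_count (services X n w) (nu w).

Let bN : between (services X n w) (nu w) N.
Proof. by case: gw => _ [uu _]; apply: betweenP => //; rewrite ltW// (clock_pos hX). Qed.

Lemma epoch_le_clock k : (S k w <= nu w) = (k <= N)%N.
Proof.
case/andP: bN => b1 b2; apply/idP/idP => h.
  by rewrite -ltnS; exact: (partial_sum_ltn (us w) h b2).
by apply: le_trans b1; exact: partial_sum_le.
Qed.

Lemma busy_overE : busy_over w = ind (Z N w = 0%N).
Proof. by case: gw => uv' [uu nt]; apply: ind_eq; exact: (busy_end_le (batches X n w) (removals X n w) (uv w) (us w) uv' uu nt rB bN). Qed.

(** The busy period ends at one removal at most, which is counted if it comes before the
clock rings, that is among the first N. *)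
Lemma killed_partial K : \sum_(k < K) killed X B r n k w = ind (Z (minn K N) w = 0%N) :> R.
Proof.
elim: K => [|K IH]; first by rewrite big_ord0 min0n /= indF//; case/andP: rB; case: (r).
rewrite big_ord_recr/= IH /killed epoch_le_clock.
have [NK|KN] := leqP N K.
  by rewrite (minn_idPr (leqW NK)) [ind false]indF// mulr0 addr0.
rewrite (minn_idPl KN) [ind true]indT// mulr1.
have [ZK|ZK] := posnP (Z K w).
  rewrite [ind (_ = _)]indT// [ind false]indF// mul0r addr0 indT// /= ZK eqxx//.
by rewrite [ind true]indT// mul1r [X in X + _]indF ?add0r// => e; rewrite e in ZK.
Qed.

Lemma occupied_partial u K : (u <= B)%N -> \sum_(k < K) occupied_at X B r n u k w =
  (N < K)%N%:R * busy_below u w.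
Proof.
move=> uB.
have H k : occupied_at X B r n u k w = (k == N)%:R * busy_below u w.
  rewrite /occupied_at epoch_le_clock.
  have -> : ind (nu w < S k.+1 w) = ind (N <= k)%N :> R.
    by apply: ind_eq; rewrite ltNge epoch_le_clock -ltnNge ltnS.
  have [->|kN] := eqVneq k N; last first.
    rewrite mul0r; have [kN'|Nk] := ltnP N k; first by rewrite [ind false]indF// mulr0 !mul0r.
    by rewrite [ind (N <= k)%N]indF ?mulr0 ?mul0r//; move: kN Nk; lia.
  rewrite !(indT (leqnn _)) !mulr1 mul1r indM; apply: ind_eq.
  case: gw => uv' [uu nt].
  have E := busy_end_le (batches X n w) (removals X n w) (uv w) (us w) uv' uu nt rB bN.
  have F := reflected_chain (k := batches X n w) (q := removals X n w) (uv w) (us w) uv' uu nt rB bN.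
  rewrite busy_lengthE reflectedE E.
  have E2 : (0 < Z N w)%N -> (reflected_path (gaps X n w) (services X n w) (batches X n w) (removals X n w) B r (nu w) <= u%:R)
     = (Z N w + (arrivals X n w (nu w) - arrivals X n w (S N w)) <= u)%N.
    by move=> /F ->; rewrite ler_nat geq_min [(B.+1 <= u)%N]leqNgt ltnS uB orbF.
  split; first by move=> [z h]; rewrite E2//; split => //; lia.
  by move=> [z]; have z0 : (0 < Z N w)%N by [lia]; rewrite E2.
rewrite (eq_bigr (fun k : 'I_K => (val k == N)%:R * busy_below u w)) => [|k _]; last exact: H.
rewrite -mulr_suml; congr (_ * _); have [NK|KN] := ltnP N K.
  rewrite (bigD1 (Ordinal NK))//= eqxx big1 ?addr0// => i ih.
  by case: eqVneq => // e; move: ih; rewrite -val_eqE/= e eqxx.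
by rewrite big1// => i _; case: eqVneq => // e; have := ltn_ord i; rewrite e ltnNge KN.
Qed.

Lemma busy_below_top : busy_below B.+1 w = 1 - busy_over w.
Proof.
case: gw => uv' [uu nt].
have E := busy_end_le (batches X n w) (removals X n w) (uv w) (us w) uv' uu nt rB bN.
have F := reflected_chain (k := batches X n w) (q := removals X n w) (uv w) (us w) uv' uu nt rB bN.
rewrite /busy_below /busy_over; have [h|h] := pselect (len w <= (nu w)%:E)%E.
  by rewrite [X in 1 - X]indT// subrr indF// => -[].
rewrite [X in 1 - X]indF// subr0 indT//; split => //.
rewrite reflectedE F ?ler_nat ?geq_minr//.
by rewrite lt0n; apply/eqP => z; apply: h; rewrite busy_lengthE E.
Qed.

End one_path.

Let good := good_paths_as hX mu0 eta0 n.

Lemma Ex_cvg_good (F : nat -> Omega -> R) (G : Omega -> R) : (forall K, unitf (F K)) -> unitf G ->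
  (forall w, good_paths X n w -> F K w @[K --> \oo] --> G w) -> Ex (F K) @[K --> \oo] --> Ex G.
Proof.
move=> uF uG FG; have ug : unitf (fun w => ind (good_paths X n w) : R) by apply: unitf_ind; case: good.
have E H : unitf H -> Ex H = Ex (fun w => ind (good_paths X n w) * H w).
  move=> uH; apply: (eq_Ex_as good) => //; first exact: unitfM.
  by move=> w gw; rewrite indT ?mul1r.
rewrite E// (_ : (fun K => Ex (F K)) = fun K => Ex (fun w => ind (good_paths X n w) * F K w)); last first.
  by apply/funext => K; rewrite E.
apply: Ex_cvg => [K|w|]; [exact: unitfM| |exact: unitfM].
have [gw|gw] := pselect (good_paths X n w); first by apply: cvgMr; exact: FG.
by rewrite indF// mul0r; under eq_fun do rewrite mul0r; exact: cvg_cst.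
Qed.

Lemma killed_limit : series (fun k => Ex (killed X B r n k)) @ \oo --> Ex busy_over.
Proof.
have u1 k : unitf (killed X B r n k : Omega -> R) by exact: (unitf_killed hX).
rewrite (_ : series _ = fun K => Ex (fun w => \sum_(k < K) killed X B r n k w)); last first.
  by apply/funext => K; rewrite seriesEord Ex_sum.
have uZ K : unitf (fun w => ind (Z K w = 0%N) : R).
  apply: unitf_ind; apply: (@measurable_nat_pred _ _ _ (fun x => x = 0%N)).
  exact: (measurable_chain hX).
pose G w := ind (good_paths X n w) : R.
have ug : unitf G by apply: unitf_ind; case: good.
pose F K w := G w * \sum_(k < K) killed X B r n k w.
have uF K : unitf (F K).
  split; first by apply: measurable_funM; [case: ug|apply: measurable_sum => k; case: (u1 k)].
  move=> w; rewrite /F /G; have [gw|gw] := pselect (good_paths X n w); last by rewrite indF// mul0r lexx ler01.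
  by rewrite indT// mul1r killed_partial// ind_ge0 ind_le1.
have u2 K : Ex (fun w => \sum_(k < K) killed X B r n k w) = Ex (F K).
  rewrite Ex_sum// /F (eq_Ex P (F := fun w => G w * _) (G := fun w => \sum_(k < K) G w * killed X B r n k w)); last first.
    by move=> w; rewrite mulr_sumr.
  rewrite Ex_sum; last by move=> k; exact: unitfM.
  apply: eq_bigr => k _; apply: (eq_Ex_as good) => //; first exact: unitfM.
  by move=> w gw; rewrite /G indT ?mul1r.
rewrite (_ : (fun K => _) = fun K => Ex (F K)); last by apply/funext => K; rewrite u2.
apply: Ex_cvg_good => //; first exact: unitf_busy_over.
move=> w gw; apply: cvg_near_cst; exists (renewal_count (services X n w) (nu w)) => // K /= NK.
by rewrite /F /G indT// mul1r killed_partial// (minn_idPr NK) busy_overE.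
Qed.

Lemma Ex_occupied u k : (u <= B)%N -> Ex (occupied_at X B r n u k) =
  occupancy B u (survival_series mu kappa X n) (fun k L => Ex (alive X B r n k L)) k.
Proof.
move=> uB; rewrite /occupancy.
have uG L i : unitf (fun w => ind (Z k w = L) * ind (S k w <= nu w) * ind (nu w < S k.+1 w) *
    ind ((arrivals X n w (nu w) - arrivals X n w (S k w))%N = i) : R).
  have mnu : measurable_fun setT (nu : Omega -> R) by exact: measurable_funPT.
  have mS j : measurable_fun setT (S j).
    by apply: (measurable_partial_sum (v := fun j w => service X n j w)) => i'; exact: measurable_funPT.
  apply: unitfM; last first.
    apply: unitf_ind; apply: measurable_nat_eq; apply: (measurable_nat2 nat subn); exact: (measurable_arrivals hX).
  apply: unitfM; last by apply: unitf_ind; apply: measurable_ltr.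
  apply: unitfM; last by apply: unitf_ind; apply: measurable_ler.
  apply: unitf_ind; apply: (@measurable_nat_pred _ _ _ (fun x => x = L)); exact: (measurable_chain hX).
transitivity (\sum_(1 <= L < B.+2) \sum_(i < (u - L).+1) Ex (fun w => (L <= u)%N%:R *
    (ind (Z k w = L) * ind (S k w <= nu w) * ind (nu w < S k.+1 w) *
     ind ((arrivals X n w (nu w) - arrivals X n w (S k w))%N = i)))); last first.
  apply: eq_bigr => L _; rewrite !mulr_sumr; apply: eq_bigr => i _.
  by rewrite ExZ// (alive_occupied hX mu0 s0 kappa0) mulrCA.
have b01 L : 0 <= ((L <= u)%N%:R : R) <= 1 by case: (L <= u)%N; rewrite ?lexx ?ler01.
rewrite (eq_bigr (fun L => Ex (fun w => \sum_(i < (u - L).+1) (L <= u)%N%:R *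
    (ind (Z k w = L) * ind (S k w <= nu w) * ind (nu w < S k.+1 w) *
     ind ((arrivals X n w (nu w) - arrivals X n w (S k w))%N = i))))); last first.
  by move=> L _; rewrite Ex_sum// => i; apply: unitfM => //; exact: unitf_cst.
have inner L w : \sum_(i < (u - L).+1) (L <= u)%N%:R *
    (ind (Z k w = L) * ind (S k w <= nu w) * ind (nu w < S k.+1 w) *
     ind ((arrivals X n w (nu w) - arrivals X n w (S k w))%N = i)) =
   ind (Z k w = L) * (ind (S k w <= nu w) * ind (nu w < S k.+1 w) *
     ind (L + (arrivals X n w (nu w) - arrivals X n w (S k w)) <= u)%N) :> R.
  rewrite -mulr_sumr -mulr_sumr sum_ind1.
  rewrite -[in LHS](indE (L <= u)%N).
  have -> : ind (L + (arrivals X n w (nu w) - arrivals X n w (S k w)) <= u)%N =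
     ind (L <= u)%N * ind ((arrivals X n w (nu w) - arrivals X n w (S k w)) < (u - L).+1)%N :> R.
    by rewrite indM; apply: ind_eq; lia.
  by ring.
rewrite -Ex_sum; last first.
  move=> L; split.
    by apply: measurable_sum => i; apply: measurable_funM => //; case: (uG L i).
  move=> w; rewrite inner !mulr_ge0 ?ind_ge0//=.
  by rewrite !mulr_ile1 ?mulr_ge0 ?mulr_ile1 ?ind_ge0 ?ind_le1.
apply: eq_Ex => w; rewrite (eq_bigr (fun L => ind (Z k w = L) * (ind (S k w <= nu w) * ind (nu w < S k.+1 w) *
     ind (L + (arrivals X n w (nu w) - arrivals X n w (S k w)) <= u)%N))); last by move=> L _; exact: inner.
by rewrite (ind_split_pos X n rB k w (fun L => ind (S k w <= nu w) * ind (nu w < S k.+1 w) *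
   ind (L + (arrivals X n w (nu w) - arrivals X n w (S k w)) <= u)%N)) /occupied_at !mulrA.
Qed.

Lemma occupied_limit u : (u <= B)%N ->
  series (occupancy B u (survival_series mu kappa X n) (fun k L => Ex (alive X B r n k L))) @ \oo --> Ex (busy_below u).
Proof.
move=> uB.
have u1 k : unitf (occupied_at X B r n u k : Omega -> R).
  have mnu : measurable_fun setT (nu : Omega -> R) by exact: measurable_funPT.
  have mS j : measurable_fun setT (S j).
    by apply: (measurable_partial_sum (v := fun j w => service X n j w)) => i'; exact: measurable_funPT.
  have mZ : measurable_fun setT (Z k) by exact: (measurable_chain hX).
  apply: unitfM; last first.
    apply: unitf_ind; apply: (@measurable_nat_pred _ _ (fun w => (Z k w + (arrivals X n w (nu w) - arrivals X n w (S k w)))%N) (fun x => (x <= u)%N)).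
    apply: (measurable_nat2 nat addn mZ); apply: (measurable_nat2 nat subn); exact: (measurable_arrivals hX).
  apply: unitfM; last by apply: unitf_ind; apply: measurable_ltr.
  apply: unitfM; last by apply: unitf_ind; apply: measurable_ler.
  by apply: unitf_ind; apply: (@measurable_nat_pred _ _ _ (fun x => (0 < x)%N) mZ).
rewrite (_ : series _ = fun K => Ex (fun w => \sum_(k < K) occupied_at X B r n u k w)); last first.
  by apply/funext => K; rewrite seriesEord Ex_sum//; apply: eq_bigr => k _; rewrite Ex_occupied.
pose G w := ind (good_paths X n w) : R.
have ug : unitf G by apply: unitf_ind; case: good.
pose F K w := G w * \sum_(k < K) occupied_at X B r n u k w.
have uF K : unitf (F K).
  split; first by apply: measurable_funM; [case: ug|apply: measurable_sum => k; case: (u1 k)].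
  move=> w; rewrite /F /G; have [gw|gw] := pselect (good_paths X n w); last by rewrite indF// mul0r lexx ler01.
  rewrite indT// mul1r occupied_partial//.
  have [_ /(_ w)/andP[h1 h2]] := unitf_busy_below u.
  by case: ltnP; rewrite ?mul1r ?mul0r ?h1 ?h2 ?lexx ?ler01.
have u2 K : Ex (fun w => \sum_(k < K) occupied_at X B r n u k w) = Ex (F K).
  rewrite Ex_sum// /F (eq_Ex P (F := fun w => G w * _) (G := fun w => \sum_(k < K) G w * occupied_at X B r n u k w)); last first.
    by move=> w; rewrite mulr_sumr.
  rewrite Ex_sum; last by move=> k; exact: unitfM.
  apply: eq_bigr => k _; apply: (eq_Ex_as good) => //; first exact: unitfM.
  by move=> w gw; rewrite /G indT ?mul1r.
rewrite (_ : (fun K => _) = fun K => Ex (F K)); last by apply/funext => K; rewrite u2.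
apply: Ex_cvg_good => //; first exact: unitf_busy_below.
move=> w gw; apply: cvg_near_cst; exists (renewal_count (services X n w) (nu w)).+1 => // K /= NK.
by rewrite /F /G indT// mul1r occupied_partial// NK mul1r.
Qed.

Lemma busy_below_topE : Ex (busy_below B.+1) = 1 - Ex busy_over.
Proof.
rewrite -[X in X - _](Ex_cst P) -ExB; last 2 first.
- by apply: unitf_cst; rewrite lexx ler01.
- exact: unitf_busy_over.
have ub := unitf_busy_over; apply: (eq_Ex_as good); first exact: unitf_busy_below.
  split; first by apply: measurable_funB => //; case: ub.
  by move=> w; have [_ /(_ w)/andP[a b]] := ub; rewrite subr_ge0 b lerBlDr lerDl.
by move=> w gw; rewrite busy_below_top.
Qed.

End busy_limits.

Section busy_transform.
Context {d : measure_display} {Omega : measurableType d} {R : realType}.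
Context {P : probability Omega R}.
Variables (mu s : R) (kappa delta : {RV P >-> nat}) (eta : {RV P >-> R}) (y : R) (X : inputs P).
Hypothesis hX : inputs_spec mu s kappa delta eta y X.
Hypotheses (s0 : 0 < s).
Variables (B r : nat).
Local Notation Ex := (Ex P).
Local Notation Osub := (Osub X).

(** An independent exponential clock outlives a time b with probability exp (- s b). *)
Lemma busy_transformE x : busy_transform X B s r x = Ex (busy_over X B r 0).
Proof.
pose b w := busy_length X B 0 r w.
have bE w : busy_period X B r x w = b w by exact: (busy_periodE hX).
pose J := busy_slots 0; pose K := [set Clock].
have JK : J `&` K = set0.
  by apply/seteqP; split => // z [h zc]; rewrite zc in h; case: h => [[?]|[[?]|[[?]|[?]]]].
have mb : measurable_fun setT (b : Osub J -> \bar R).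
  exact: (measurable_busy_length_cst (J := J) hX B r (f := id) (fun z h => h) (@measurable_id _ _ _)).
have mb0 : measurable_fun setT b := measurableT_comp mb (@measurable_id_Osub _ _ _ _ X J).
have b0 w : (0 <= b w)%E by exact: busy_length_ge0.
pose F w := ind (b w < +oo)%E * expR (- s * fine (b w)).
have uF : unitf F.
  apply: unitfM.
    apply: unitf_ind; rewrite -[X in measurable X]setTI; apply: measurable_fun_lte => //.
  split; first by apply: measurableT_comp => //; apply: measurable_funM => //; apply: measurableT_comp mb0; exact: fine_measurable.
  by move=> w; rewrite expR_ge0/= -[leRHS]expR0 ler_expR mulNr oppr_le0 mulr_ge0 ?(ltW s0)// fine_ge0.
rewrite /busy_transform integral_mkcond.
transitivity (Ex F).
  rewrite (_ : (fun w => _) = fun w => (F w)%:E); first by rewrite Ex_EFin.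
  apply/funext => w; rewrite patchE /F bE; case: ifPn => h.
    by rewrite indT ?mul1r//; move: h; rewrite inE /= bE.
  by rewrite indF ?mul0r// => h'; move: h; rewrite notin_setE /= bE.
pose G (z : Omega * Omega) : R := ind (b z.1 <= (clock X z.2)%:E)%E.
have uG : unitf (G : Osub J * Osub K -> R).
  apply: unitf_ind; rewrite -[X in measurable X]setTI; apply: measurable_fun_lee => //.
    exact: (measurableT_comp mb (@measurable_fst _ _ _ _)).
  apply/measurable_EFinP; apply: (measurableT_comp (@measurable_clock _ _ _ _ X K _) (@measurable_snd _ _ _ _)) => //.
rewrite [RHS](eq_Ex P (G := fun w => G (w, w)))// (Ex_fubini (inputs_indep hX) JK uG).
apply: eq_Ex => w; rewrite /F /G /=; have := b0 w; case E : (b w) => [t||] //= t0.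
  rewrite indT ?ltry// mul1r -(Ex_clock_ge hX s0)//.
rewrite indF ?mul0r ?ltxx// -[LHS](Ex_cst P 0); exact: eq_Ex.
Qed.

End busy_transform.

(** * Summation over the cycles *)

Section cycle_law.
Context {d : measure_display} {Omega : measurableType d} {R : realType}.
Context {P : probability Omega R}.
Variables (mu s : R) (kappa delta : {RV P >-> nat}) (eta : {RV P >-> R}) (y : R) (X : inputs P).
Hypothesis hX : inputs_spec mu s kappa delta eta y X.
Hypotheses (mu0 : 0 < mu) (s0 : 0 < s) (kappa0 : forall w, (0 < kappa w)%N).
Variables (B r : nat).
Local Notation Ex := (Ex P).
Local Notation Osub := (Osub X).
Local Notation nu := (clock X).
Local Notation lvl := (busy_level X B r).
Local Notation len n w := (busy_length X B n (lvl n w) w).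
Local Notation start := (busy_start X B r).

Definition over_by n w t : Prop := (len n w <= t%:E)%E.
Definition below_at u n w t : Prop := 0 <= t /\ ~ over_by n w t /\ reflected X B n (lvl n w) w t <= u%:R.

Let mid J : measurable_fun setT (id : Osub J -> Osub J). Proof. exact: measurable_id. Qed.
Let toO J d' (T : measurableType d') (f : Omega -> T) : measurable_fun setT (f : Osub J -> T) -> measurable_fun setT f.
Proof. by move=> mf; exact: (measurableT_comp mf (@measurable_id_Osub _ _ _ _ X J)). Qed.

Lemma unitf_over_by J n : current_slots n `<=` J -> unitf ((fun z => ind (over_by n z.1 z.2)) : Osub J * R -> R).
Proof.
move=> nJ; apply: unitf_ind; rewrite -[X in measurable X]setTI; apply: measurable_fun_lee => //.
  exact: (measurable_busy_length hX B r (f := fst) nJ (@measurable_fst _ _ _ _)).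
exact/measurable_EFinP.
Qed.

Lemma unitf_below_at J u n : current_slots n `<=` J -> unitf ((fun z => ind (below_at u n z.1 z.2)) : Osub J * R -> R).
Proof.
move=> nJ; apply: unitf_ind.
pose tau (z : Osub J * R) := Num.max 0 z.2.
have mt : measurable_fun setT tau by apply: (measurable_maxr (f := fun=> 0)).
have t0 z : 0 <= tau z by rewrite /tau le_max lexx.
have mr := measurable_reflected hX B r (f := fst) nJ (@measurable_fst _ _ _ _) mt t0.
rewrite (_ : [set z | _] = [set z : Osub J * R | 0 <= z.2] `&` ([set z : Osub J * R | ~ over_by n z.1 z.2] `&`
  [set z : Osub J * R | reflected X B n (lvl n z.1) z.1 (tau z) <= u%:R])); last first.
  by apply/seteqP; split => z /= [h [h1]]; rewrite /tau max_r.
apply: measurableI; first exact: measurable_ler.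
apply: measurableI; last by apply: measurable_ler => //; exact: measurable_cst.
apply: measurableC; rewrite -[X in measurable X]setTI; apply: measurable_fun_lee => //.
  exact: (measurable_busy_length hX B r (f := fst) nJ (@measurable_fst _ _ _ _)).
exact/measurable_EFinP.
Qed.

Definition begun n w : R := ind (start n w <= (nu w)%:E)%E.

Let start0 n w : (0 <= start n w)%E. Proof. exact: (busy_start_ge0 hX). Qed.

Lemma begunE n w : begun n w = ind (start n w < +oo)%E * ind (fine (start n w) <= nu w).
Proof.
rewrite indM; apply: ind_eq; have := start0 n w; case: (start n w) => [t||]//= _.
- by rewrite lee_fin ltry; split => [h|[]].
- by rewrite leye_eq; split => // -[].
Qed.

Let Cn n : ~ current_slots n Clock.
Proof. by move=> [[?]|[[?]|[[?]|[[?]|[? []]]]]]. Qed.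
Let Pn n : ~ past_slots n Clock.
Proof. by move=> [m _ [/Cn|]]. Qed.

(** [clock_memoryless] at the start of busy period n, which depends on the past cycles only. *)
Lemma begun_split n (Psi : Omega * R -> R) : unitf (Psi : Osub (current_slots n) * R -> R) ->
  Ex (fun w => begun n w * Psi (w, nu w - fine (start n w))) = Ex (begun n) * Ex (fun w => Psi (w, nu w)).
Proof.
move=> uPsi; pose rho w := ind (start n w < +oo)%E : R; pose tau w := fine (start n w).
have mst := measurable_busy_start hX B r (n := n) (J := past_slots n) (fun z h => h).
have urho : unitf (rho : Osub (past_slots n) -> R).
  by apply: unitf_ind; rewrite -[X in measurable X]setTI; apply: measurable_fun_lte.
have mtau : measurable_fun setT (tau : Osub (past_slots n) -> R).
  by apply: measurableT_comp mst; exact: fine_measurable.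
have tau0 w : 0 <= tau w by exact: fine_ge0.
have := clock_memoryless hX s0 (past_current_disjoint n) (@Pn n) (@Cn n) urho mtau tau0 uPsi.
rewrite (eq_Ex P (F := fun w => rho w * ind (tau w <= nu w)) (G := begun n)); last by move=> w; rewrite begunE.
by move=> <-; apply: eq_Ex => w; rewrite begunE mulrA.
Qed.

Definition ended n w : R := ind (start n w + len n w <= (nu w)%:E)%E.

Lemma endedE n : Ex (ended n) = Ex (begun n) * Ex (fun w => ind (over_by n w (nu w))).
Proof.
rewrite -(begun_split (Psi := fun z => ind (over_by n z.1 z.2))); last exact: unitf_over_by.
apply: eq_Ex => w; rewrite /ended indM; apply: ind_eq.
have := start0 n w; have := busy_length_ge0 X B n (lvl n w) w; rewrite /over_by /=.
case: (start n w) => [t||]//=; case: (len n w) => [b||]//= b0 t0.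
- rewrite -EFinD !lee_fin lerBrDl; split => [h|[]//]; split => //.
  by apply: le_trans h; rewrite lerDl -lee_fin.
- by rewrite !leye_eq; split => // -[].
- by rewrite !leye_eq; split => // -[].
- by rewrite !leye_eq; split => // -[].
Qed.

Lemma occupiedE n u : Ex (fun w => ind (occupied X B r n u w (nu w))) =
  Ex (begun n) * Ex (fun w => ind (below_at u n w (nu w))).
Proof.
rewrite -(begun_split (Psi := fun z => ind (below_at u n z.1 z.2))); last exact: unitf_below_at.
apply: eq_Ex => w; rewrite begunE !indM; apply: ind_eq; rewrite /occupied /below_at /over_by /started /=.
split=> [[h1 [h2 [h3 h4]]]|[[h1 h2] [_ [h3 h4]]]].
  by split => //; rewrite subr_ge0; split => //; split => //; apply/negP; rewrite -ltNge.
by split => //; split => //; split => //; rewrite ltNge; apply/negP.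
Qed.

Lemma Ex_idle n : Ex (fun w => ind (idle X n w <= nu w)) = mu / (s + mu).
Proof.
pose J := [set Idle n]; pose K := [set Clock].
have JK : J `&` K = set0 by apply/seteqP; split => // z [/= ->].
pose G (z : Omega * Omega) : R := ind (idle X n z.1 <= nu z.2).
have uG : unitf (G : Osub J * Osub K -> R).
  apply: unitf_ind; apply: measurable_ler.
    exact: (measurableT_comp (@measurable_idle _ _ _ _ X J n (erefl _)) (@measurable_fst _ _ _ _)).
  exact: (measurableT_comp (@measurable_clock _ _ _ _ X K (erefl _)) (@measurable_snd _ _ _ _)).
rewrite [LHS](eq_Ex P (G := fun w => G (w, w)))// (Ex_fubini (inputs_indep hX) JK uG) addrC.
rewrite -(Ex_exponential_exp mu0 (idle_law hX n) (idle_pos hX n) (ltW s0)).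
by apply: eq_Ex => w; rewrite /G /= (Ex_clock_ge hX s0)// ltW// (idle_pos hX).
Qed.

Lemma begunS n : Ex (begun n.+1) = Ex (ended n) * (mu / (s + mu)).
Proof.
pose T w := (start n w + len n w)%E.
pose J := past_slots n `|` current_slots n; pose K := [set Idle n].
have JK : J `&` K = set0.
  apply/seteqP; split => // z [h /= e]; rewrite e in h; case: h => [[m mn [|[em]]]|].
  - by move=> [[?]|[[?]|[[?]|[[?]|[? []]]]]].
  - by move: mn; rewrite em ltnn.
  - by move=> [[?]|[[?]|[[?]|[[?]|[? []]]]]].
have T0 w : (0 <= T w)%E by rewrite adde_ge0// busy_length_ge0.
have mT : measurable_fun setT (T : Osub J -> \bar R).
  apply: emeasurable_funD; first by apply: (measurable_busy_start hX) => z h; left.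
  have sub : current_slots n `<=` J by move=> z h; right.
  exact: (measurable_busy_length hX B r sub (@mid J)).
pose rho w := ind (T w < +oo)%E : R; pose tau w := fine (T w).
have urho : unitf (rho : Osub J -> R).
  by apply: unitf_ind; rewrite -[X in measurable X]setTI; apply: measurable_fun_lte.
have mtau : measurable_fun setT (tau : Osub J -> R).
  by apply: measurableT_comp mT; exact: fine_measurable.
have tau0 w : 0 <= tau w by exact: fine_ge0.
have JC : ~ J Clock by move=> [/Pn|/Cn].
have KC : ~ K Clock by [].
pose Psi (z : Omega * R) := ind (idle X n z.1 <= z.2) : R.
have uPsi : unitf (Psi : Osub K * R -> R).
  apply: unitf_ind; apply: measurable_ler => //.
  exact: (measurableT_comp (@measurable_idle _ _ _ _ X K n (erefl _)) (@measurable_fst _ _ _ _)).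
have := clock_memoryless hX s0 JK JC KC urho mtau tau0 uPsi.
rewrite (eq_Ex P (F := fun w => rho w * ind (tau w <= nu w)) (G := ended n)); last first.
  move=> w; rewrite indM; apply: ind_eq; rewrite /tau; have := T0 w; rewrite -/(T w).
  case: (T w) => [t||]//= _; first by rewrite lee_fin ltry; split => [[]|].
  by rewrite leye_eq; split => // -[].
rewrite [X in _ * X]Ex_idle => <-; apply: eq_Ex => w; rewrite /begun !indM; apply: ind_eq.
rewrite [start n.+1 w]/(T w + (idle X n w)%:E)%E /tau /Psi /=; have := T0 w.
case: (T w) => [t||]//= _; last by rewrite leye_eq; split => // -[].
rewrite lee_fin ltry lerBrDl; split => [h|[_ []]//]; split => //; split => //.
by apply: le_trans h; rewrite lerDl ltW// (idle_pos hX).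
Qed.

Lemma begun0 : Ex (begun 0) = 1.
Proof.
rewrite -[RHS](Ex_cst P 1); apply: eq_Ex => w; apply: indT.
by rewrite /= lee_fin ltW// (clock_pos hX).
Qed.

Definition begin_rate := mu / (s + mu).

(** Every complete cycle after the first one contributes the same factor: its busy period
ends in time, and so does the idle period that follows. *)
Lemma begun_geometric (bt : R) : (forall n, Ex (fun w => ind (over_by n.+1 w (nu w))) = bt) -> forall n,
  Ex (begun n.+1) = Ex (fun w => ind (over_by 0 w (nu w))) * begin_rate * (bt * begin_rate) ^+ n.
Proof.
move=> hb; elim=> [|n IH]; first by rewrite begunS endedE begun0 mul1r expr0 mulr1.
by rewrite begunS endedE IH hb exprS /begin_rate; ring.
Qed.

Lemma begin_rate01 : 0 <= begin_rate < 1.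
Proof.
rewrite /begin_rate divr_ge0 ?ltW ?addr_gt0//=.
by rewrite ltr_pdivrMr ?addr_gt0// mul1r ltrDr.
Qed.

Let uocc n u : unitf (fun w => ind (occupied X B r n u w (nu w)) : R).
Proof.
have mst : measurable_fun setT (start n).
  exact: toO (measurable_busy_start hX B r (n := n) (J := past_slots n) (fun z h => h)).
have -> : (fun w => ind (occupied X B r n u w (nu w)) : R) =
    fun w => ind (start n w < +oo)%E * ((fun z => ind (below_at u n z.1 z.2)) (w, nu w - fine (start n w))).
  apply/funext => w; rewrite /= indM; apply: ind_eq; rewrite /occupied /below_at /over_by /started /=.
  rewrite subr_ge0; split => [[h1 [h2 [h3 h4]]]|[h1 [h2 [h3 h4]]]]; split => //; split => //; split => //.
    by apply/negP; rewrite -ltNge.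
  by rewrite ltNge; apply/negP.
apply: unitfM.
  by apply: unitf_ind; rewrite -[X in measurable X]setTI; apply: measurable_fun_lte.
apply: (unitf_comp (unitf_below_at (J := current_slots n) u (fun z h => h))).
apply: measurable_fun_pair; first exact: measurable_id_Osub.
apply: measurable_funB; first exact: measurable_funPT.
by apply: measurableT_comp mst; exact: fine_measurable.
Qed.

(** A time belongs to at most one busy period, so that the events of the different cycles
are disjoint. *)
Lemma occupied_union u : measurable [set w | exists n, occupied X B r n u w (nu w)] /\
  series (fun n => Ex (fun w => ind (occupied X B r n u w (nu w)))) @ \oo -->
    Ex (fun w => ind (exists n, occupied X B r n u w (nu w))).
Proof.
have mocc n : measurable [set w | occupied X B r n u w (nu w)].
  have [m _] := uocc n u.
  have := m measurableT [set 1] (measurable_set1 1); rewrite setTI.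
  rewrite (_ : _ @^-1` _ = [set w | occupied X B r n u w (nu w)])//.
  apply/seteqP; split => w /=; last exact: indT.
  by move=> h; apply: contrapT => no; move: h; rewrite indF// => /esym/eqP; rewrite oner_eq0.
have mU : measurable [set w | exists n, occupied X B r n u w (nu w)].
  rewrite (_ : [set w | _] = \bigcup_n [set w | occupied X B r n u w (nu w)]); first exact: bigcupT_measurable.
  by apply/seteqP; split => w /=; move=> [n]; [exists n|exists n].
split => //.
have one w N : \sum_(n < N) ind (occupied X B r n u w (nu w)) = ind (exists2 n, (n < N)%N & occupied X B r n u w (nu w)) :> R.
  have [[n nN on]|no] := pselect (exists2 n, (n < N)%N & occupied X B r n u w (nu w)).
    rewrite [RHS]indT; last by exists n.
    rewrite (bigD1 (Ordinal nN))//= indT// big1 ?addr0// => i ih; apply: indF => oi.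
    by move: ih; rewrite -val_eqE/= (occupied_inj hX oi on) eqxx.
  by rewrite [RHS]indF// big1// => i _; apply: indF => oi; apply: no; exists i.
rewrite (_ : series _ = fun N => Ex (fun w => ind (exists2 n, (n < N)%N & occupied X B r n u w (nu w)))); last first.
  apply/funext => N; rewrite seriesEord -Ex_sum//; apply: eq_Ex => w; exact: one.
apply: Ex_cvg; last exact: unitf_ind.
- move=> N; apply: unitf_ind.
  rewrite (_ : [set w | _] = \bigcup_(n in [set n | (n < N)%N]) [set w | occupied X B r n u w (nu w)]).
    by apply: bigcup_measurable => n _.
  by apply/seteqP; split => w /=; move=> [n h1 h2]; exists n.
- move=> w; apply: cvg_near_cst.
  have [[n on]|no] := pselect (exists n, occupied X B r n u w (nu w)).
    exists n.+1 => // N /= nN; rewrite !indT//; [by exists n|by exists n].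
  by exists 0%N => // N _ /=; rewrite !indF// => -[n _ on]; apply: no; exists n.
Qed.

Lemma queue_probS x u : queue_prob X B r x u.+1 = Ex (fun w => ind (exists n, occupied X B r n u.+1 w (nu w))).
Proof.
have [mU _] := occupied_union u.+1; rewrite Ex_ind// /queue_prob.
congr (fine (P _)); apply/seteqP; split => w /=; by move=> /(customers_occupied hX B r x).
Qed.

(** From the second cycle on the contributions form a geometric series. *)
Lemma queue_probE (bt pt b0 p0 : R) x u : 0 <= bt <= 1 ->
  (forall n, Ex (fun w => ind (over_by n.+1 w (nu w))) = bt) ->
  (forall n, Ex (fun w => ind (below_at u.+1 n.+1 w (nu w))) = pt) ->
  Ex (fun w => ind (over_by 0 w (nu w))) = b0 -> Ex (fun w => ind (below_at u.+1 0 w (nu w))) = p0 ->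
  queue_prob X B r x u.+1 = p0 + b0 * (mu * pt) / (s + mu - mu * bt).
Proof.
move=> /andP[bt0 bt1] hb hp hb0 hp0; rewrite queue_probS; have [_ h] := occupied_union u.+1.
have [q0 q1] := andP begin_rate01.
have z0 : 0 <= bt * begin_rate by rewrite mulr_ge0.
have z1 : bt * begin_rate < 1 by apply: le_lt_trans q1; rewrite ler_piMl.
have den : 0 < s + mu - mu * bt.
  by rewrite -addrA ltr_wpDr// subr_ge0 ler_piMr// ltW.
pose z := bt * begin_rate.
have E N : series (fun n => Ex (fun w => ind (occupied X B r n u.+1 w (nu w)))) N.+1 =
    p0 + series (geometric (b0 * begin_rate * pt) z) N.
  rewrite !seriesEord big_ord_recl/= occupiedE begun0 mul1r hp0; congr (_ + _).
  by apply: eq_bigr => i _; rewrite occupiedE/= (begun_geometric hb) hb0 hp /geometric/=; ring.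
apply: cvg_unique h _ => //.
pose f := series (fun n => Ex (fun w => ind (occupied X B r n u.+1 w (nu w)))).
suff : f @ \oo --> p0 + b0 * (mu * pt) / (s + mu - mu * bt) by [].
rewrite -cvg_shiftS (_ : [sequence _]_N = fun N => p0 + series (geometric (b0 * begin_rate * pt) z) N); last first.
  by apply/funext => N; exact: E.
apply: cvgD; first exact: cvg_cst.
have -> : b0 * (mu * pt) / (s + mu - mu * bt) = b0 * begin_rate * pt * (1 - z)^-1.
  have dn : s + mu - mu * bt != 0 by rewrite gt_eqF.
  have sm : s + mu != 0 by rewrite gt_eqF// addr_gt0.
  have -> : 1 - z = (s + mu - mu * bt) / (s + mu) by rewrite /z /begin_rate; field.
  by rewrite invf_div /begin_rate; move: dn; set D := s + mu - mu * bt => dn; field; rewrite sm dn.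
by apply: cvg_geometric_series; rewrite ger0_norm.
Qed.


Hypothesis eta0 : forall w, 0 < eta w.

Lemma reflected_le_top n i w t : good_paths X n w -> 0 <= t -> reflected X B n i w t <= B.+1%:R.
Proof.
move=> [uv [uu nt]] t0.
have b := betweenP (services_pos hX n w) uu t0.
by rewrite reflectedE (reflected_path_between _ _ B (gaps_pos hX n w) (services_pos hX n w) uv uu nt i b) ge_min lexx orbT.
Qed.

(** On regular paths a busy queue holds between 1 and B.+1 customers. *)
Lemma queue_prob0 x : queue_prob X B r x 0 = 1 - queue_prob X B r x B.+1.
Proof.
rewrite queue_probS; have [mU _] := occupied_union B.+1.
have good : almost_surely P (fun w => forall n, good_paths X n w).
  by apply: almost_surely_bigcap => n; exact: (good_paths_as hX mu0 eta0).
have mB n : measurable [set w | busy_at X B r w (nu w) n].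
  have mst : measurable_fun setT (start n).
    exact: toO (measurable_busy_start hX B r (n := n) (J := past_slots n) (fun z h => h)).
  have ml : measurable_fun setT (fun w => len n w).
    have sub : current_slots n `<=` current_slots n by [].
    exact: (measurableT_comp (measurable_busy_length hX B r sub (@mid _)) (@measurable_id_Osub _ _ _ _ X (current_slots n))).
  have mnu : measurable_fun setT (fun w => (nu w)%:E) by apply/measurable_EFinP; exact: measurable_funPT.
  apply: (@measurableI _ _ [set w | (start n w <= (nu w)%:E)%E]).
    by rewrite -[X in measurable X]setTI; apply: measurable_fun_lee.
  rewrite -[X in measurable X]setTI; apply: measurable_fun_lte => //.
  exact: emeasurable_funD.
have mE : measurable [set w | exists n, busy_at X B r w (nu w) n].
  rewrite (_ : [set w | _] = \bigcup_n [set w | busy_at X B r w (nu w) n]); first exact: bigcupT_measurable.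
  by apply/seteqP; split => w /=; move=> [n]; [exists n|exists n].
have m0 : measurable [set w | customers X B r x (nu w) w = 0].
  rewrite (_ : [set w | _] = ~` [set w | exists n, busy_at X B r w (nu w) n]); first exact: measurableC.
  by apply/seteqP; split => w /= /(customers_eq0 hX B r x).
have uU := unitf_ind (R := R) mU.
rewrite /queue_prob -Ex_ind// -[X in X - _](Ex_cst P) -ExB//; last by apply: unitf_cst; rewrite lexx ler01.
apply: (eq_Ex_as good); first exact: unitf_ind.
  split; first by apply: measurable_funB => //; case: uU.
  by move=> w; rewrite subr_ge0 ind_le1/= lerBlDr lerDl ind_ge0.
move=> w gw; have [[n bn]|nb] := pselect (exists n, busy_at X B r w (nu w) n).
  rewrite [ind (exists _, _)]indT ?subrr; first by apply: indF => /(customers_eq0 hX B r x); apply; exists n.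
  have /(busy_atP hX)[h1 h2 h3] := bn; exists n; split => //; split => //; split => //.
  by apply: reflected_le_top => //; rewrite subr_ge0.
rewrite indT ?indF ?subr0//; last exact/(customers_eq0 hX B r x).
by move=> [n [h1 [h2 [h3 _]]]]; apply: nb; exists n; apply/(busy_atP hX).
Qed.

End cycle_law.

(** * Transforms at the clock time *)

Section clock_transforms.
Context {d : measure_display} {Omega : measurableType d} {R : realType}.
Context {P : probability Omega R}.
Variables (mu s : R) (kappa delta : {RV P >-> nat}) (eta : {RV P >-> R}) (y : R) (X : inputs P).
Hypothesis hX : inputs_spec mu s kappa delta eta y X.
Hypotheses (mu0 : 0 < mu) (s0 : 0 < s) (kappa0 : forall w, (0 < kappa w)%N).
Local Notation Ex := (Ex P).
Local Notation Osub := (Osub X).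
Local Notation nu := (clock X).
Local Notation pois := (compound_pmf mu (batch_series kappa)).

(** The sequence rho: the law of the input during the lifetime of the clock. *)
Definition clock_series : fps R := fun i => Ex (fun w => pois i (nu w)).

Let mnu : measurable_fun setT (nu : Omega -> R). Proof. exact: measurable_funPT. Qed.

Let upn i : unitf (fun w => pois i (nu w)).
Proof. by apply: (unitf_comp (unitf_pois kappa mu0 i)). Qed.

Lemma clock_series_ge0 i : 0 <= clock_series i.
Proof. by apply: Ex_ge0 => w; exact: pois_ge0. Qed.

Lemma clock_series_sum_le1 m : \sum_(i < m) clock_series i <= 1.
Proof.
rewrite -Ex_sum//; apply: Ex_le1; split; first by apply: measurable_sum => i; case: (upn i).
by move=> w; rewrite pois_sum_le1// sumr_ge0// => i _; exact: pois_ge0.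
Qed.

Lemma unitf_expRN (V : Omega -> R) : measurable_fun setT V -> (forall w, 0 <= V w) -> unitf (fun w => expR (- s * V w)).
Proof.
move=> mV V0; split; first by apply: measurableT_comp => //; exact: measurable_funM.
by move=> w; rewrite expR_ge0/= -[leRHS]expR0 ler_expR mulNr oppr_le0 mulr_ge0// ltW.
Qed.

(** The clock rings before the first batch with probability s / (s + mu); otherwise a batch
arrives and, the clock being memoryless, the input starts afresh. *)
Lemma clock_series_renewal : (fpsC (s + mu) - fpsC mu * batch_series kappa) * clock_series = fpsC s.
Proof.
have sm : s + mu != 0 by rewrite gt_eqF// addr_gt0.
have V0 := gap_pos hX 0 0; have expV := gap_law hX 0 0.
pose J := [set Gap 0 0]; pose K := [set Clock].
have JK : J `&` K = set0 by apply/seteqP; split => // z [/= ->].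
have main i : clock_series i = (i == 0%N)%:R * (s / (s + mu)) + \sum_(c < i.+1) batch_series kappa c * (mu / (s + mu) * clock_series (i - c)%N).
  pose T j t := Ex (fun w' => pois j (t - gap X 0 0 w')).
  have uT j : unitf (fun w => pois j (nu w - gap X 0 0 w)).
    by apply: (unitf_comp (unitf_pois kappa mu0 j)); apply: measurable_funB => //; exact: measurable_funPT.
  have uF j : unitf ((fun z => pois j (nu z.1 - gap X 0 0 z.2)) : Osub K * Osub J -> R).
    apply: (unitf_comp (unitf_pois kappa mu0 j)); apply: measurable_funB.
      exact: (measurableT_comp (@measurable_clock _ _ _ _ X K (erefl _)) (@measurable_fst _ _ _ _)).
    exact: (measurableT_comp (@measurable_gap _ _ _ _ X J 0 0 (erefl _)) (@measurable_snd _ _ _ _)).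
  have uTn j : unitf (fun w => T j (nu w)).
    apply: (@unitf_Osub _ _ _ _ X K).
    exact: (unitf_fubini (F := fun z => pois j (nu z.1 - gap X 0 0 z.2)) (uF j)).
  have ET j : Ex (fun w => T j (nu w)) = mu / (s + mu) * clock_series j.
    have KJ : K `&` J = set0 by rewrite setIC.
    rewrite -(Ex_fubini (inputs_indep hX) (F := fun z => pois j (nu z.1 - gap X 0 0 z.2)) KJ (uF j)) /=.
    have JK0 : J `&` K = set0 by [].
    have uF' : unitf ((fun z => pois j (nu z.2 - gap X 0 0 z.1)) : Osub J * Osub K -> R).
      apply: (unitf_comp (unitf_pois kappa mu0 j)); apply: measurable_funB.
        exact: (measurableT_comp (@measurable_clock _ _ _ _ X K (erefl _)) (@measurable_snd _ _ _ _)).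
      exact: (measurableT_comp (@measurable_gap _ _ _ _ X J 0 0 (erefl _)) (@measurable_fst _ _ _ _)).
    rewrite (Ex_fubini (inputs_indep hX) (F := fun z => pois j (nu z.2 - gap X 0 0 z.1)) JK0 uF') /=.
    rewrite (eq_Ex P (G := fun w => clock_series j * expR (- s * gap X 0 0 w))); last first.
      move=> w; rewrite (exponential_memoryless s0 (clock_law hX) _ (phi := pois j)) ?ltW//.
      - by rewrite mulrC.
      - exact: unitf_pois.
      - by move=> x; exact: compound_pmf_neg.
    rewrite ExZ; last by apply: unitf_expRN => [|w]; [exact: measurable_funPT|exact: ltW].
    by rewrite (Ex_exponential_exp mu0 expV V0 (ltW s0)) mulrC [mu + s]addrC.
  rewrite /clock_series (eq_Ex P (G := fun w => (i == 0%N)%:R * expR (- mu * nu w) +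
      \sum_(c < i.+1) batch_series kappa c * T (i - c)%N (nu w))); last first.
    move=> w; apply: (compound_pmf_renewal mu0 (batch_series0 kappa0) (batch_series_ge0 kappa) (batch_series_sum_le1 kappa) expV V0).
    by rewrite ltW// (clock_pos hX).
  have ue : unitf (fun w => expR (- mu * nu w)).
    split; first by apply: measurableT_comp => //; exact: measurable_funM.
    by move=> w; rewrite expR_ge0/= -[leRHS]expR0 ler_expR mulNr oppr_le0 mulr_ge0// ltW// (clock_pos hX).
  have b1 c : 0 <= batch_series kappa c <= 1.
    rewrite batch_series_ge0/=; apply: le_trans (batch_series_sum_le1 kappa c.+1).
    by rewrite big_ord_recr/= lerDr sumr_ge0// => j _; exact: batch_series_ge0.
  rewrite ExD.
  - rewrite ExZ// (Ex_exponential_exp s0 (clock_law hX) (clock_pos hX) (ltW mu0)); congr (_ + _).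
    rewrite Ex_sum; last by move=> c; apply: unitfM => //; exact: unitf_cst.
    by apply: eq_bigr => c _; rewrite ExZ// ET.
  - by apply: unitfM => //; apply: unitf_cst; case: (i == 0%N); rewrite ?lexx ?ler01.
  - split; first by apply: measurable_sum => c; apply: measurable_funM => //; case: (uTn (i - c)%N).
    move=> w; rewrite sumr_ge0/=; last first.
      by move=> c _; rewrite mulr_ge0 ?batch_series_ge0//; have [_ /(_ w)/andP[]] := uTn (i - c)%N.
    apply: le_trans (batch_series_sum_le1 kappa i.+1); apply: ler_sum => c _.
    by rewrite ler_piMr ?batch_series_ge0//; have [_ /(_ w)/andP[]] := uTn (i - c)%N.
apply/funext => i; rewrite mulrBl fpsDE fpsNE -mulrA !fpsCM fpsME main.
rewrite mulrDr mulr_sumr.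
rewrite (eq_bigr (fun c : 'I_i.+1 => mu * (batch_series kappa c * clock_series (i - c)%N))); last first.
  by move=> c _; field.
rewrite -mulr_sumr addrK; case: i {main} => [|i] /=; first by rewrite mul1r; field.
by rewrite mul0r mulr0.
Qed.

Variables (n k : nat).

Let s00 w : 0 < service X n k w. Proof. exact: (service_pos hX). Qed.

Let JS := [set Service n k].
Let KC := [set Clock].
Let JK : JS `&` KC = set0. Proof. by apply/seteqP; split => // z [/= ->]. Qed.
Let msJ : measurable_fun setT (service X n k : Osub JS -> R). Proof. exact: measurable_service. Qed.
Let mnK : measurable_fun setT (nu : Osub KC -> R). Proof. exact: measurable_clock. Qed.

Lemma service_before_clock (f : R -> R) : unitf f ->
  Ex (fun w => ind (service X n k w <= nu w) * f (service X n k w)) = Ex (fun w => expR (- s * service X n k w) * f (service X n k w)).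
Proof.
move=> uf.
have uF : unitf ((fun z => ind (service X n k z.1 <= nu z.2) * f (service X n k z.1)) : Osub JS * Osub KC -> R).
  apply: unitfM; last by apply: (unitf_comp uf); exact: (measurableT_comp msJ).
  by apply: unitf_ind; apply: measurable_ler; [exact: (measurableT_comp msJ)|exact: (measurableT_comp mnK)].
rewrite (Ex_fubini (inputs_indep hX) (F := fun z => ind (service X n k z.1 <= nu z.2) * f (service X n k z.1)) JK uF) /=.
apply: eq_Ex => w; rewrite (eq_Ex P (G := fun w2 => f (service X n k w) * ind (service X n k w <= nu w2))); last first.
  by move=> w2; rewrite mulrC.
rewrite ExZ; first by rewrite (Ex_clock_ge hX s0) ?ltW// mulrC.
by apply: unitf_ind; apply: measurable_ler.
Qed.

Lemma input_seriesE : input_series mu kappa X n k = mixed_series mu s kappa (service X n k).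
Proof. by apply/funext => i; apply: service_before_clock; exact: unitf_pois. Qed.

Lemma service_massE : service_mass X n k = Ex (fun w => expR (- s * service X n k w)).
Proof.
rewrite -[RHS](eq_Ex P (F := fun w => expR (- s * service X n k w) * (fun=> 1) (service X n k w))); last by move=> w; rewrite mulr1.
rewrite -(service_before_clock (f := fun=> 1)); last by apply: unitf_cst; rewrite lexx ler01.
by apply: eq_Ex => w; rewrite mulr1.
Qed.

(** The input until the clock rings splits at the end of a service that the clock outlives:
the input of the service adds to an independent input over the residual clock. What is
left of rho after removing these cases is the input of a service still in progress. *)
Lemma survival_seriesE : survival_series mu kappa X n k = clock_series * (1 - input_series mu kappa X n k).
Proof.
rewrite mulrBr mulr1; apply/funext => i; rewrite fpsDE fpsNE; apply/eqP; rewrite eq_sym subr_eq; apply/eqP.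
have u1 : unitf (fun w => ind (nu w < service X n k w) * pois i (nu w)).
  by apply: unitfM => //; apply: unitf_ind; exact: measurable_ltr.
have u2 : unitf (fun w => ind (service X n k w <= nu w) * pois i (nu w)).
  by apply: unitfM => //; apply: unitf_ind; exact: measurable_ler.
transitivity (Ex (fun w => ind (nu w < service X n k w) * pois i (nu w)) + Ex (fun w => ind (service X n k w <= nu w) * pois i (nu w))).
  rewrite -ExD//; apply: eq_Ex => w; rewrite -mulrDl.
  have [h|h] := leP (service X n k w) (nu w); first by rewrite [ind false]indF// [ind true]indT// add0r mul1r.
  by rewrite [ind false]indF// [ind true]indT// addr0 mul1r.
congr (_ + _); rewrite mulrC fpsME.
have uc c : unitf (fun w => pois c (service X n k w)) by apply: (unitf_comp (unitf_pois kappa mu0 c)).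
have umain c : unitf (fun w => pois c (service X n k w) * (ind (service X n k w <= nu w) * pois (i - c) (nu w - service X n k w))).
  apply: unitfM => //; apply: unitfM; first by apply: unitf_ind; exact: measurable_ler.
  by apply: (unitf_comp (unitf_pois kappa mu0 (i - c))); exact: measurable_funB.
transitivity (Ex (fun w => \sum_(c < i.+1) pois c (service X n k w) * (ind (service X n k w <= nu w) * pois (i - c) (nu w - service X n k w)))).
  apply: eq_Ex => w; have [h|h] := pselect (service X n k w <= nu w); last first.
    by rewrite indF// mul0r big1// => c _; rewrite mul0r mulr0.
  rewrite indT// mul1r -{1}[nu w](subrK (service X n k w)) addrC pois_add ?subr_ge0//; last exact: ltW.
  by apply: eq_bigr => c _; rewrite mul1r.
rewrite Ex_sum//; apply: eq_bigr => c _.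
have JC : ~ JS Clock by []. have KC' : ~ (set0 : set slot) Clock by [].
have JK0 : JS `&` (set0 : set slot) = set0 by rewrite setI0.
have ucJ : unitf ((fun w => pois c (service X n k w)) : Osub JS -> R) by apply: (unitf_comp (unitf_pois kappa mu0 c)).
have uPsi : unitf ((fun z => pois (i - c) z.2) : Osub set0 * R -> R).
  by apply: (unitf_comp (unitf_pois kappa mu0 (i - c))); exact: measurable_snd.
have := clock_memoryless hX s0 (Psi := fun z => pois (i - c) z.2) JK0 JC KC' ucJ msJ (fun w => ltW (s00 w)) uPsi.
move=> /= ->; congr (_ * _); apply: eq_Ex => w; exact: mulrC.
Qed.

End clock_transforms.

Section poisson_transform.
Context {d : measure_display} {Omega : measurableType d} {R : realType}.
Context {P : probability Omega R}.
Variables (mu s : R) (kappa delta : {RV P >-> nat}) (eta : {RV P >-> R}) (X : R -> inputs P).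
Hypothesis hX : inputs_spec mu s kappa delta eta 0 (X 0).
Hypotheses (mu0 : 0 < mu) (s0 : 0 < s) (kappa0 : forall w, (0 < kappa w)%N).
Local Notation pois := (compound_pmf mu (batch_series kappa)).

Lemma compound_poisson_law i t : 0 <= t ->
  P [set w | compound_poisson (X 0) 0 w t = i] = (pois i t)%:E.
Proof.
move=> t0.
have m : measurable [set w | compound_poisson (X 0) 0 w t = i].
  apply: measurable_nat_eq; apply: (measurable_compound (v := fun j z => gap (X 0) 0 j z) (k := fun j z => batch (X 0) 0 j z)) => //.
  by move=> z j; exact: (gap_pos hX).
rewrite -(fineK (fin_num_measure P _ m)) -Ex_ind//; congr (_%:E).
have := increments_law hX mu0 s0 kappa0 0 0 (l := [:: (t, i)]).
rewrite big_cons big_nil mulr1 => <-.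
  by apply: eq_Ex => w; apply: ind_eq; split => [e|[]].
by move=> p; rewrite inE => /eqP->.
Qed.

(** Both are integrals of the compound Poisson probability against the exponential
density. The clock V is arbitrary since only its law matters. *)
Lemma poisson_transformE (V : {RV P >-> R}) i : exponential_law s V -> (forall w, 0 < V w) ->
  poisson_transform X s i = Ex P (fun w => pois i (V w)).
Proof.
move=> expV V0; apply: EFin_inj; rewrite (Ex_exponential s0 expV (phi := pois i)); last exact: unitf_pois.
have up := unitf_pois kappa mu0 i.
have mp : measurable_fun [set: measurableTypeR R] (pois i) by case: up.
have me : measurable_fun [set: measurableTypeR R] (fun t : R => expR (- s * t)).
  by apply: measurableT_comp => //; exact: measurable_funM.
have E : (\int[lebesgue_measure]_x (pois i x * exponential_pdf s x)%:E =
   s%:E * \int[lebesgue_measure]_(t in `[0%R, +oo[) (expR (- s * t) * pois i t)%:E)%E.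
  rewrite -ge0_integralZl//; last 3 first.
  - by apply/measurable_EFinP; apply: measurable_funTS; exact: measurable_funM.
  - by move=> t _; rewrite lee_fin mulr_ge0 ?expR_ge0 ?pois_ge0.
  - by rewrite lee_fin ltW.
  rewrite [RHS]integral_mkcond; apply: eq_integral => x _; rewrite patchE /exponential_pdf patchE.
  by case: ifP => _; [rewrite -EFinM; congr (_%:E); ring|rewrite mulr0].
rewrite /poisson_transform E.
have -> : (\int[lebesgue_measure]_(t in `[0%R, +oo[) ((expR (- s * t))%:E * P [set w | compound_poisson (X 0) 0 w t = i]) =
    \int[lebesgue_measure]_(t in `[0%R, +oo[) (expR (- s * t) * pois i t)%:E)%E.
  apply: eq_integral => t; rewrite inE/= in_itv/= andbT => t0.
  by rewrite compound_poisson_law// EFinM.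
have := Ex_exponential s0 expV up; rewrite E.
set I := integral _ _ _ => h.
have Ifin : I \is a fin_num.
  have I0 : (0 <= I)%E by apply: integral_ge0 => t _; rewrite lee_fin mulr_ge0 ?expR_ge0 ?pois_ge0.
  move: h I0; case: I => [r||]//= h _; move: h; rewrite mulry gtr0_sg// mul1e//.
by rewrite -{2}(fineK Ifin) -EFinM.
Qed.

End poisson_transform.

Section residual_at_zero.
Context {d : measure_display} {Omega : measurableType d} {R : realType}.
Context {P : probability Omega R}.
Variables (mu s : R) (kappa delta : {RV P >-> nat}) (eta : {RV P >-> R}) (X : inputs P).
Hypothesis hX : inputs_spec mu s kappa delta eta 0 X.
Hypothesis eta0 : forall w, 0 < eta w.

Lemma service_cdf0 : service_cdf eta 0 = 0.
Proof.
rewrite /service_cdf /cdf /distribution /pushforward (_ : _ @^-1` _ = set0) ?measure0//.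
by apply/seteqP; split => // w /=; rewrite in_itv/= leNgt eta0.
Qed.

Lemma cdf_same_law (V W : {RV P >-> R}) : (forall u, P [set w | V w <= u] = P [set w | W w <= u]) -> same_law V W.
Proof.
move=> VW A mA; rewrite -[LHS]/(distribution P V A) -[RHS]/(distribution P W A).
apply: measure_unique_open_rays mA => [|x].
  by rewrite -[X in (X < _)%E]/(P setT) probability_setT ltry.
rewrite /distribution /pushforward.
have E (U : {RV P >-> R}) : U @^-1` `]x, +oo[ = ~` [set w | U w <= x].
  by apply/seteqP; split => w /=; rewrite in_itv/= andbT ltNge => /negP.
have m (U : {RV P >-> R}) : measurable [set w | U w <= x].
  by apply: measurable_ler; [exact: measurable_funPT|exact: measurable_cst].
rewrite -[LHS]/(P (V @^-1` `]x, +oo[)) -[RHS]/(P (W @^-1` `]x, +oo[)).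
by rewrite !E !probability_setC// VW.
Qed.

(** As F(0) = 0, the residual law at age 0 is the law of a whole service. *)
Lemma residual0_law : same_law (service X 0 0) eta.
Proof.
apply: cdf_same_law => u; have [u0|u0] := leP 0 u; last first.
  have Z (U : {RV P >-> R}) : (forall w, 0 < U w) -> [set w | U w <= u] = set0.
    by move=> U0; apply/seteqP; split => // w /=; rewrite leNgt (lt_trans u0).
  by rewrite !Z//; exact: (service_pos hX).
rewrite (residual_law hX u0) service_cdf0 add0r !subr0 divr1.
rewrite /service_cdf fineK; last exact: fin_num_measure.
by rewrite /cdf /distribution /pushforward; congr (P _); apply/seteqP; split => w /=; rewrite in_itv.
Qed.

End residual_at_zero.

(** * Identification of the resolvent sequences *)

Section resolvents.
Context {d : measure_display} {Omega : measurableType d} {R : realType}.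
Context {P : probability Omega R}.
Variables (lam mu s : R) (kappa : {RV P >-> nat}) (eta : {RV P >-> R}).
Hypotheses (mu0 : 0 < mu) (s0 : 0 < s) (kappa0 : forall w, (0 < kappa w)%N) (eta0 : forall w, 0 < eta w).
Hypotheses (lam0 : 0 <= lam) (lam1 : lam < 1).
Local Notation Ex := (Ex P).

Definition service_series : fps R := mixed_series mu s kappa eta.
Definition psi_series : fps R := fpsC lam + fpsC (1 - lam) * service_series.

Definition eta_mass := Ex (fun w => expR (- s * eta w)).

Lemma eta_mass01 : 0 <= eta_mass < 1.
Proof.
have u : unitf (fun w => expR (- s * eta w)) by apply: unitf_expRN => // w; exact: ltW.
rewrite Ex_ge0 => [|w]; last exact: expR_ge0.
by apply: Ex_lt1 => // w; rewrite -[ltRHS]expR0 ltr_expR mulNr oppr_lt0 mulr_gt0.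
Qed.

Let lam1' : 0 < 1 - lam. Proof. by rewrite subr_gt0. Qed.

Lemma service_series_ge0 i : 0 <= service_series i.
Proof. exact: mixed_series_ge0. Qed.

Lemma service_series_sum m : \sum_(i < m) service_series i <= eta_mass.
Proof. exact: mixed_series_sum. Qed.

Lemma psi_ge0 i : 0 <= psi_series i.
Proof.
rewrite /psi_series fpsDE fpsCM addr_ge0//; last by rewrite mulr_ge0 ?service_series_ge0 ?(ltW lam1').
by rewrite /fpsC; case: i.
Qed.

Definition psi_mass := lam + (1 - lam) * eta_mass.

Lemma psi_mass_lt1 : psi_mass < 1.
Proof.
have /andP[_ h] := eta_mass01; rewrite /psi_mass -ltrBrDl -[ltRHS]mulr1 ltr_pM2l//.
Qed.

Lemma psi_sum m : \sum_(i < m) psi_series i <= psi_mass.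
Proof.
rewrite /psi_series (eq_bigr (fun i : 'I_m => fpsC lam i + (1 - lam) * service_series i)); last first.
  by move=> i _; rewrite fpsDE fpsCM.
rewrite big_split/= -mulr_sumr lerD//; last by rewrite ler_wpM2l ?(ltW lam1') ?service_series_sum.
by case: m => [|m]; rewrite ?big_ord0// big_ord_recl big1 ?addr0.
Qed.

Definition psi_value th := lam + (1 - lam) * laplace eta (s - cumulant mu kappa th).

Lemma service_gf th : `|th| <= 1 -> summ th service_series (laplace eta (s - cumulant mu kappa th)).
Proof. exact: mixed_gf. Qed.

Lemma psi_gf th : `|th| <= 1 -> summ th psi_series (psi_value th).
Proof. by move=> th1; apply: summD; [exact: summC|exact/summZ/service_gf]. Qed.

Lemma psi_value_mono x x' : 0 <= x -> x <= x' -> x' <= 1 -> psi_value x <= psi_value x'.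
Proof.
move=> x0 xx x1; apply: (summ_le psi_ge0 (th := x) (th' := x')); first by rewrite x0.
- by apply: psi_gf; rewrite ger0_norm// (le_trans xx).
- by apply: psi_gf; rewrite ger0_norm// (le_trans x0).
Qed.

Lemma psi_value_lt1 x : 0 <= x <= 1 -> psi_value x < 1.
Proof.
move=> /andP[x0 x1]; apply: le_lt_trans psi_mass_lt1.
apply: (cvgr_to_le (psi_gf _)); first by rewrite ger0_norm.
apply: nearW => m; rewrite seriesEord; apply: le_trans (psi_sum m).
by apply: ler_sum => i _; rewrite ler_piMl ?psi_ge0// exprn_ile1.
Qed.

Lemma laplaceE z : laplace eta z = Ex (fun w => expR (- z * eta w)).
Proof. by rewrite /laplace unlock. Qed.

Lemma psi_value_gt x : `|x| <= 1 -> lam < psi_value x.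
Proof.
move=> x1; rewrite /psi_value ltrDl mulr_gt0// laplaceE.
pose F w := expR (- (s - cumulant mu kappa x) * eta w); rewrite -/F.
have z0 : 0 <= s - cumulant mu kappa x.
  by rewrite subr_ge0; apply: le_trans (ltW s0); exact: cumulant_le0.
have uF : unitf F.
  split; first by apply: measurableT_comp => //; exact: measurable_funM.
  by move=> w; rewrite expR_ge0/= -[leRHS]expR0 ler_expR mulNr oppr_le0 mulr_ge0// ltW.
have u1 : unitf (fun w => 1 - F w).
  split; first by apply: measurable_funB => //; case: uF.
  by move=> w; have [_ /(_ w)/andP[a b]] := uF; rewrite subr_ge0 b lerBlDr lerDl.
have : Ex (fun w => 1 - F w) < 1 by apply: Ex_lt1 => // w; rewrite ltrBlDr ltrDl expR_gt0.
rewrite (@ExB _ _ _ P (fun=> 1))// ?Ex_cst; last by apply: unitf_cst; rewrite lexx ler01.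
by rewrite ltrBlDr ltrDl.
Qed.

Lemma psi_value_ge x : lam <= psi_value x.
Proof.
rewrite /psi_value lerDl mulr_ge0 ?(ltW lam1')// laplaceE.
by apply: Ex_ge0 => w; exact: expR_ge0.
Qed.

(** The infimum of the points x with psi(x) <= x is a fixed point, by monotonicity alone;
it is below 1 since psi(1) < 1. *)
Lemma root_exists : exists th, `|th| < 1 /\ th - lam = (1 - lam) * laplace eta (s - cumulant mu kappa th).
Proof.
(* the infimum c satisfies psi(c) <= c, hence psi(c) lies in E as well and c <= psi(c) *)
pose E := [set x : R | 0 <= x <= 1 /\ psi_value x <= x].
have E1 : E 1 by split; [rewrite lexx ler01|rewrite ltW// psi_value_lt1// lexx ler01].
have lb : has_lbound E by exists 0 => x [/andP[]].
pose c := inf E.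
have c_le x : E x -> c <= x by move=> Ex; exact: ge_inf.
have le_c a : (forall x, E x -> a <= x) -> a <= c by move=> h; apply: lb_le_inf; [exists 1|move=> x /h].
have c0 : 0 <= c by apply: le_c => x [/andP[]].
have c1 : c <= 1 by exact: c_le.
have h1 : psi_value c <= c.
  by apply: le_c => x Ex; have [/andP[x0 x1] h] := Ex; apply: le_trans h; apply: psi_value_mono => //; exact: c_le.
have p0 : 0 <= psi_value c by apply: le_trans (psi_value_ge c).
have h2 : c <= psi_value c.
  by apply: c_le; split; [rewrite p0 (le_trans h1)|apply: psi_value_mono].
have cE : c = psi_value c by apply/eqP; rewrite eq_le h1 h2.
exists c; rewrite ger0_norm//; split; first by rewrite cE psi_value_lt1// c0.
by rewrite {1}cE /psi_value addrC addKr.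
Qed.

Local Notation c := (root_c lam mu s kappa eta).

Lemma root_cE : `|c| < 1 /\ c = psi_value c.
Proof.
have [h1 h2] := xgetPex 0 root_exists; split => //.
by rewrite {1}/psi_value -h2 addrC subrK.
Qed.

Lemma root_c_gt : lam < c.
Proof. by have [/ltW h e] := root_cE; rewrite [ltRHS]e; exact: psi_value_gt. Qed.

Lemma root_c_lt1 : c < 1.
Proof. by have [h _] := root_cE; exact: le_lt_trans (ler_norm _) h. Qed.

Lemma root_c_gt0 : 0 < c.
Proof. exact: le_lt_trans root_c_gt. Qed.

Lemma scale_series : exists W : fps R, W * (psi_series - fpsX R) = 1 /\
  exists C : R, 0 <= C /\ forall k, `|W k| <= C * c ^- k.+1.
Proof.
apply: (@scale_exists _ psi_series c psi_mass root_c_gt0 root_c_lt1 psi_ge0 _ psi_sum psi_mass_lt1).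
have [h1 h2] := root_cE; rewrite {2}h2; apply: psi_gf; exact: ltW.
Qed.

Variables (W : fps R) (C : R).
Hypotheses (WE : W * (psi_series - fpsX R) = 1) (C0 : 0 <= C) (HW : forall k, `|W k| <= C * c ^- k.+1).

Let small (th : R) : `|th| < c -> `|th| <= 1.
Proof. by move=> h; apply/ltW/(lt_trans h)/root_c_lt1. Qed.

Lemma scale_gf th : `|th| < c -> summ th W (psi_value th - th)^-1.
Proof.
move=> thc; have aW := growth_abssumm root_c_gt0 C0 HW thc.
have [l hl] := abssumm_cvg aW.
have hp : summ th (psi_series - fpsX R) (psi_value th - th).
  have -> : psi_series - fpsX R = psi_series + fpsC (-1) * fpsX R.
    by apply/funext => i; rewrite !fpsDE fpsNE fpsCM mulN1r.
  have h : summ th (fpsC (-1) * fpsX R) (- th) by rewrite -[X in summ _ _ X]mulN1r; apply: summZ; exact: summXvar.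
  by apply: summD h; apply: psi_gf; exact: small.
have := mertens aW hl hp; rewrite WE => h.
have e := summ_unique h (summ1 th).
have nz : psi_value th - th != 0.
  by apply: contra_eqN e => /eqP->; rewrite mulr0 eq_sym oner_eq0.
by rewrite -(mulfK nz l) e mul1r in hl.
Qed.

Lemma resolvent_series_gf (fx : fps R) th l : `|th| < c -> summ th fx l ->
  summ th (resolvent_series lam W fx) ((1 - lam) * l / (psi_value th - th)).
Proof.
move=> thc hf; rewrite /resolvent_series mulrC mulrC [X in summ _ X](mulrC _ W) [X in summ _ _ X]mulrC.
apply: mertens; first exact: (growth_abssumm root_c_gt0 C0 HW thc).
  exact: scale_gf.
exact: summZ.
Qed.

(** Both sequences have the same generating function near 0. *)
Lemma resolvent_identified (X : R -> inputs P) y (fx : fps R) :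
  (forall th, `|th| <= 1 -> summ th fx (laplace_residual X y (s - cumulant mu kappa th))) ->
  resolvent X lam mu s kappa eta y = resolvent_series lam W fx.
Proof.
move=> hf; pose A := [set q : nat -> R | forall th : R, `|th| < c ->
    series (fun k => th ^+ k * q k) @ \oo -->
    (1 - lam) * laplace_residual X y (s - cumulant mu kappa th) /
    ((1 - lam) * laplace eta (s - cumulant mu kappa th) + lam - th)].
have hA : A (resolvent_series lam W fx).
  move=> th thc; rewrite [_ + lam]addrC; apply: resolvent_series_gf => //.
  by apply: hf; exact: small.
have hQ : A (resolvent X lam mu s kappa eta y) by apply: (xgetPex (fun=> 0)); exists (resolvent_series lam W fx).
apply: (summ_uniq root_c_gt0 (l := fun th => (1 - lam) * laplace_residual X y (s - cumulant mu kappa th) /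
    ((1 - lam) * laplace eta (s - cumulant mu kappa th) + lam - th))) => th thc.
  exact: hQ.
exact: hA.
Qed.

Variable rho : fps R.
Hypotheses (rho_ge0 : forall i, 0 <= rho i) (rho_sum : forall m, \sum_(i < m) rho i <= 1).

Lemma resolvA_identified (X : R -> inputs P) y (fx : fps R) n :
  (forall th, `|th| <= 1 -> summ th fx (laplace_residual X y (s - cumulant mu kappa th))) ->
  (forall i, poisson_transform X s i = rho i) ->
  resolvA X lam mu s kappa eta y n%:Z = resolvA_series lam W rho fx n.
Proof.
move=> hf hrho; rewrite /resolvA (resolvent_identified hf) /resolvA_series fpsME; apply: eq_bigr => i _.
by rewrite hrho fpsDE fpsNE fpsCM /fps_ones [_^-1 * _]mulrC.
Qed.

Local Notation M := (meanA_series lam service_series W rho).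

(** M is a bounded sequence times W, hence O(c^(-n)), and lam < c. *)
Lemma meanA_decay j : lam ^+ n * M (n + j)%N @[n --> \oo] --> 0.
Proof.
pose F : fps R := fpsC (1 - lam) * rho * fps_ones R * (service_series - 1).
have FK i : `|F i| <= 2.
  rewrite /F -mulrA -mulrA fpsCM normrM (ger0_norm (ltW lam1')).
  apply: le_trans (_ : `|(rho * (fps_ones R * (service_series - 1))) i| <= _).
    by rewrite ler_piMl// gerBl.
  rewrite mulrA [rho * _]mulrC fpsME; apply: le_trans (ler_norm_sum _ _ _) _.
  apply: le_trans (_ : \sum_(j < i.+1) `|(service_series - 1) (i - j)%N| <= _).
    apply: ler_sum => k _; rewrite normrM ler_piMl// fps_onesM ger0_norm ?rho_sum// sumr_ge0//.
  rewrite (reindex_inj rev_ord_inj)/=.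
  apply: le_trans (_ : \sum_(j < i.+1) (service_series j + (j == 0 :> nat)%:R) <= _).
    apply: ler_sum => k _; rewrite (_ : (i - (i.+1 - k.+1) = k)%N); last by have := ltn_ord k; lia.
    rewrite fpsDE fpsNE fps1E; apply: le_trans (ler_normB _ _) _.
    by rewrite ger0_norm ?service_series_ge0// ger0_norm.
  rewrite big_split/= (_ : 2 = 1 + 1)// lerD//.
    by apply: le_trans (service_series_sum _) _; have /andP[_ /ltW] := eta_mass01.
  by rewrite big_ord_recl big1 ?addr0.
have H := growthM root_c_gt0 root_c_lt1 C0 HW (ler0n R 2) FK.
have K0 : 0 <= 2 * C / (1 - c) by rewrite divr_ge0 ?mulr_ge0// subr_ge0 ltW// root_c_lt1.
exact: (growth_geometric root_c_gt0 H j lam0 root_c_gt).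
Qed.

(** By [meanA_shift] the partial sums, multiplied by 1 - lam, telescope to
M_j - lam^N M_(N+j). *)
Lemma mean_resolvA_identified (X : R -> inputs P) j :
  (forall n, resolvA X lam mu s kappa eta 0 n%:Z = resolvA_series lam W rho service_series n) ->
  mean_resolvA X lam mu s kappa eta j = M j.
Proof.
move=> hA; rewrite /mean_resolvA.
have psiE : psi_series = fpsC lam + fpsC (1 - lam) * service_series by [].
have rec n : M n = (1 - lam) * resolvA_series lam W rho service_series n.+1 + lam * M n.+1.
  have := congr1 (fun a : fps R => a n.+1) (meanA_shift rho psiE WE (lt0r_neq0 lam1')).
  by rewrite mulrBl fpsDE fpsNE !fpsCM fpsXM => <-; rewrite subrK.
pose a (n : nat) := resolvA X lam mu s kappa eta 0 n%:Z.
have {}hA n : a n = resolvA_series lam W rho service_series n by exact: hA.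
have part N : M j = (1 - lam) * series (fun i => lam ^+ i * a (i.+1 + j)%N) N + lam ^+ N * M (N + j)%N.
  rewrite seriesEord; elim: N => [|N IH]; first by rewrite big_ord0 mulr0 add0r expr0 mul1r.
  by rewrite IH (rec (N + j)%N) big_ord_recr/= hA addSn exprS; ring.
have h : series (fun i => lam ^+ i * a (i.+1 + j)%N) @ \oo --> M j / (1 - lam).
  rewrite (_ : series _ = fun N => (M j - lam ^+ N * M (N + j)%N) / (1 - lam)); last first.
    by apply/funext => N; rewrite {1}(part N) addrK mulrC mulKf// gt_eqF.
  apply: cvgMl; rewrite -[X in _ --> X]subr0; apply: cvgB; [exact: cvg_cst|exact: meanA_decay].
by rewrite (cvg_lim _ h)// mulrC divfK// gt_eqF.
Qed.

End resolvents.

(** * Stationarity of the later busy periods and the formulas *)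

Section entry_mixture.
Context {d : measure_display} {Omega : measurableType d} {R : realType}.
Context {P : probability Omega R}.
Variables (mu s : R) (kappa delta : {RV P >-> nat}) (eta : {RV P >-> R}) (y : R) (X : inputs P).
Hypothesis hX : inputs_spec mu s kappa delta eta y X.
Variables (B r n : nat).
Local Notation Ex := (Ex P).
Local Notation Osub := (Osub X).
Local Notation nu := (clock X).
Local Notation lvl := (busy_level X B r n.+1).

(** Law of the content at which a later busy period starts. *)
Definition entry_pmf (i : nat) : R := if (i <= B)%N then batch_pmf kappa i else batch_tail kappa B.

Definition busy_clock_slots : set slot := busy_slots n.+1 `|` [set Clock].

Lemma entry_level_law i : (1 <= i <= B.+1)%N -> Ex (fun w => ind (lvl w = i)) = entry_pmf i.
Proof.
move=> /andP[i1 iB]; rewrite (eq_Ex P (G := fun w => (fun k => ind (minn k B.+1 = i)) (entry X n w)))//.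
rewrite (@Ex_same_law _ _ _ P _ nat (entry X n) kappa (fun k => ind (minn k B.+1 = i))); last 2 first.
- exact: (entry_law hX).
- by apply: unitf_ind; exact: (@measurable_nat_pred _ _ (id : nat -> nat) (fun k => minn k B.+1 = i)).
have mk Q : measurable [set w | Q (kappa w)].
  by apply: measurable_nat_pred; exact: measurable_funPT.
rewrite Ex_ind; last exact: (mk (fun k => minn k B.+1 = i)).
rewrite /entry_pmf; case: leqP => h; rewrite /batch_pmf /batch_tail; congr (fine (P _));
  apply/seteqP; split => w /=; lia.
Qed.

(** The entry batch belongs to the previous cycle and is independent of the services, the input
and the removals of its busy period. *)
Lemma entry_mixture (F : nat -> Omega -> R) : (forall i, unitf (F i : Osub busy_clock_slots -> R)) ->
  Ex (fun w => F (lvl w) w) = \sum_(1 <= i < B.+2) entry_pmf i * Ex (F i).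
Proof.
move=> uF; have uF0 i : unitf (F i) by exact: unitf_Osub (uF i).
have me : measurable_fun setT (entry X n : Osub [set Entry n] -> nat).
  by apply: (@measurable_Osub _ _ _ _ X [set Entry n] _ _ (entry X n) (Entry n)).
have ml i : measurable [set w : Osub [set Entry n] | lvl w = i].
  exact: (@measurable_nat_pred _ (Osub [set Entry n]) (entry X n) (fun k => minn k B.+1 = i) me).
have uL i : unitf ((fun w => ind (lvl w = i)) : Osub [set Entry n] -> R) by exact: unitf_ind.
transitivity (\sum_(1 <= i < B.+2) Ex (fun w => ind (lvl w = i) * F i w)).
  rewrite -Ex_sum; last by move=> i; apply: unitfM => //; exact: unitf_Osub (uL i).
  apply: eq_Ex => w; rewrite (ind_split (fun i => F i w))//= ltnS geq_minr andbT leq_min /=.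
  by rewrite (entry_pos hX).
apply: eq_big_nat => i iB; rewrite (@ExM _ _ _ _ _ (inputs_indep hX) [set Entry n] busy_clock_slots)//.
  by rewrite entry_level_law.
by apply/seteqP; split => // z [/= -> [[[?]|[[?]|[[?]|[?]]]]|]].
Qed.

Lemma entry_pmf_sum : \sum_(1 <= i < B.+2) entry_pmf i = 1.
Proof.
have := entry_mixture (F := fun _ _ => 1); rewrite Ex_cst => E.
rewrite [RHS]E; last by move=> i; apply: unitf_cst; rewrite lexx ler01.
by apply: eq_bigr => i _; rewrite mulr1.
Qed.

Let mid : measurable_fun setT (id : Osub busy_clock_slots -> Osub busy_clock_slots). Proof. exact: measurable_id. Qed.
Let sub : busy_slots n.+1 `<=` busy_clock_slots. Proof. by move=> z; left. Qed.
Let mnu : measurable_fun setT (nu : Osub busy_clock_slots -> R).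
Proof. by apply: measurable_clock; right. Qed.

Let mover i : measurable [set w : Osub busy_clock_slots | (busy_length X B n.+1 i w <= (nu w)%:E)%E].
Proof.
rewrite -[X in measurable X]setTI; apply: measurable_fun_lee => //.
  exact: (measurable_busy_length_cst hX B i sub mid).
exact/measurable_EFinP.
Qed.

Lemma unitf_busy_over_sub i : unitf (busy_over X B i n.+1 : Osub busy_clock_slots -> R).
Proof. exact: unitf_ind. Qed.

Lemma unitf_busy_below_sub u i : unitf (busy_below X B i n.+1 u : Osub busy_clock_slots -> R).
Proof.
apply: unitf_ind; apply: measurableI; first by apply: measurableC; exact: mover.
apply: measurable_ler; last exact: measurable_cst.
by apply: (measurable_reflected_cst hX B i sub mid mnu) => w; rewrite ltW// (clock_pos hX).
Qed.

End entry_mixture.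

Section empty_start.
Context {d : measure_display} {Omega : measurableType d} {R : realType}.
Context {P : probability Omega R}.
Variables (mu s : R) (kappa delta : {RV P >-> nat}) (eta : {RV P >-> R}) (y : R) (X : inputs P).
Hypothesis hX : inputs_spec mu s kappa delta eta y X.

Lemma busy_length_empty B n w : busy_length X B n 0 w = 0%E.
Proof.
apply/eqP; rewrite eq_le busy_length_ge0 andbT; apply: ereal_inf_lbound; exists 0 => //; split => //.
rewrite reflectedE /reflected_path /drift_path (compound0 _ (gaps_pos hX n w)) (compound0 _ (services_pos hX n w)).
by rewrite subrr addr0 sub0r; apply: le_lt_trans ltr01; rewrite oppr_le0 le_max lexx.
Qed.

End empty_start.

Section assembly.
Context {d : measure_display} {Omega : measurableType d} {R : realType}.
Context {P : probability Omega R}.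
Variables (lam mu : R) (kappa delta : {RV P >-> nat}) (eta : {RV P >-> R}).
Hypothesis hprim : primitives_spec lam mu kappa delta eta.
Variable s : R.
Hypothesis s0 : 0 < s.
Variable X : R -> inputs P.
Hypothesis hX : forall y : R, 0 <= y -> service_cdf eta y < 1 -> inputs_spec mu s kappa delta eta y (X y).
Local Notation Ex := (Ex P).

Let mu0 := mu_gt0 hprim.
Let lam0 := lam_ge0 hprim.
Let lam1 := lam_lt1 hprim.
Let kappa0 := kappa_pos hprim.
Let delta0 := delta_pos hprim.
Let eta0 := eta_pos hprim.
Let deltaE := delta_law hprim.
Let lam1' : 0 < 1 - lam. Proof. by rewrite subr_gt0. Qed.

Let F0 : service_cdf eta 0 < 1. Proof. by rewrite service_cdf0// ltr01. Qed.
Let h0 : inputs_spec mu s kappa delta eta 0 (X 0). Proof. exact: hX. Qed.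

Variables (W : fps R) (C : R).
Hypotheses (WE : W * (psi_series lam mu s kappa eta - fpsX R) = 1) (C0 : 0 <= C)
  (HW : forall k, `|W k| <= C * root_c lam mu s kappa eta ^- k.+1).

Local Notation f := (service_series mu s kappa eta).
Local Notation rho := (clock_series mu kappa (X 0)).
Local Notation M := (meanA_series lam f W rho).
Local Notation A0 := (resolvA_series lam W rho f).
Local Notation a := (batch_series kappa).

Section one_age.
Variable y : R.
Hypotheses (y0 : 0 <= y) (Fy : service_cdf eta y < 1).
Let hy : inputs_spec mu s kappa delta eta y (X y). Proof. exact: hX. Qed.

(** The inputs for different ages are related through their laws only, and the law is all
that rho depends on. *)
Lemma clock_series_age : clock_series mu kappa (X y) = rho.
Proof.
apply/funext => i.
rewrite -[LHS](poisson_transformE h0 mu0 s0 kappa0 i (clock_law hy) (clock_pos hy)).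
by rewrite -[RHS](poisson_transformE h0 mu0 s0 kappa0 i (clock_law h0) (clock_pos h0)).
Qed.

Lemma input_series_later (n k : nat) : (n, k) != (0%N, 0%N) -> input_series mu kappa (X y) n k = f.
Proof.
move=> nk; rewrite (input_seriesE hy mu0 s0); apply: mixed_series_law => //.
  exact: (service_pos hy).
exact: (service_law hy).
Qed.

Lemma service_mass_later (n k : nat) : (n, k) != (0%N, 0%N) -> service_mass (X y) n k = eta_mass s eta.
Proof.
move=> nk; rewrite (service_massE hy s0).
pose phi (x : R) := ind (0 <= x) * expR (- s * x).
have uphi : unitf phi.
  split.
    apply: measurable_funM; first by case: (@unitf_ind _ R R (fun x => 0 <= x)); [exact: measurable_ler|by []].
    by apply: measurableT_comp => //; exact: measurable_funM.
  move=> x; rewrite /phi; have [x0|x0] := leP 0 x; last by rewrite indF// mul0r lexx ler01.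
  by rewrite indT// mul1r expR_ge0/= -[leRHS]expR0 ler_expR mulNr oppr_le0 mulr_ge0// ltW.
have E (U : Omega -> R) : (forall w, 0 < U w) -> Ex (fun w => expR (- s * U w)) = Ex (fun w => phi (U w)).
  by move=> U0; apply: eq_Ex => w; rewrite /phi indT ?mul1r// ltW.
rewrite /eta_mass !E//; last exact: (service_pos hy).
by apply: Ex_same_law => //; exact: (service_law hy).
Qed.

Local Notation fx := (mixed_series mu s kappa (service (X y) 0 0)).

Lemma resolvA_age n : resolvA X lam mu s kappa eta y n%:Z = resolvA_series lam W rho fx n.
Proof.
apply: (resolvA_identified mu0 s0 kappa0 eta0 lam0 lam1 WE C0 HW) => [th th1|i].
  by apply: (mixed_gf mu0 s0 kappa0) => //; exact: (service_pos hy).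
by rewrite (poisson_transformE h0 mu0 s0 kappa0 i (clock_law h0) (clock_pos h0)).
Qed.

Variables (B r n : nat).
Hypothesis rB : (1 <= r <= B.+1)%N.

Lemma service_mass01 k : 0 <= service_mass (X y) n k <= 1.
Proof.
apply: Ex01; apply: unitf_ind; apply: measurable_ler; exact: measurable_funPT.
Qed.

(** [recursion_limit] for the recursion of the busy period, whose two hypotheses on A and M are
[resolvA_renewal] and [meanA_shift]. *)
Lemma busy_below_value u : (1 <= u <= B)%N ->
  Ex (busy_below (X y) B r n u) =
  (r <= u)%N%:R * resolvA_series lam W rho (input_series mu kappa (X y) n 0) (u - r)%N -
  Ex (busy_over (X y) B r n) * M u.-1.
Proof.
move=> uB; apply/eqP; rewrite eq_sym subr_eq; apply/eqP.
have psiE : psi_series lam mu s kappa eta = fpsC lam + fpsC (1 - lam) * f by [].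
have l1 : 1 - lam != 0 by rewrite gt_eqF.
pose G k := input_series mu kappa (X y) n k.
pose A k := resolvA_series lam W rho (G k).
have GS k : G k.+1 = f by apply: input_series_later; rewrite xpair_eqE andbF.
have inst := busy_instance hy mu0 s0 kappa0 lam0 lam1 delta0 deltaE n rB.
have [_ uB'] := andP uB.
apply: (recursion_limit lam0 lam1 uB (A := A) (H := survival_series mu kappa (X y) n) (G := G) (M := M)
  (g0 := eta_mass s eta) _ _ _ inst rB service_mass01).
- move=> k m; rewrite /A (resolvA_renewal rho psiE WE l1) fpsDE fps_onesM fpsME; congr (_ + _).
  by rewrite -clock_series_age -(survival_seriesE hy mu0 s0 kappa0).
- by move=> k; rewrite /A !GS.
- by rewrite /A GS; exact: (meanA_shift rho psiE WE l1).
- by move=> k; apply: service_mass_later; rewrite xpair_eqE andbF.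
- by case/andP: (eta_mass01 s0 eta0).
- exact: (occupied_limit hy mu0 s0 kappa0 eta0 rB uB').
- exact: (killed_limit hy mu0 eta0 rB).
Qed.

End one_age.

Lemma input_series_zero n k : input_series mu kappa (X 0) n k = f.
Proof.
have [e|nk] := eqVneq (n, k) (0%N, 0%N); last exact: input_series_later.
case: e => -> ->; rewrite (input_seriesE h0 mu0 s0); apply: mixed_series_law => //.
  exact: (service_pos h0).
exact: residual0_law h0 eta0.
Qed.

Lemma service_mass_zero n k : service_mass (X 0) n k = eta_mass s eta.
Proof.
have [e|nk] := eqVneq (n, k) (0%N, 0%N); last exact: service_mass_later.
case: e => -> ->; rewrite (service_massE h0 s0) /eta_mass.
have E : mixed_series mu s kappa (service (X 0) 0 0) = mixed_series mu s kappa eta.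
  by rewrite -(input_seriesE h0 mu0 s0) input_series_zero.
have one : `|1 : R| <= 1 by rewrite normr1.
have pS w : 0 < service (X 0) 0 0 w by exact: (service_pos h0).
have g1 := mixed_gf mu0 s0 kappa0 (V := service (X 0) 0 0) (measurable_funPT _) pS one.
have g2 := mixed_gf mu0 s0 kappa0 (V := eta) (measurable_funPT _) eta0 one.
rewrite E in g1; have := summ_unique g1 g2.
by rewrite cumulant1// subr0 !unlock.
Qed.

(** Both busy periods obey the same recursion, which determines the masses of the busy
periods that end at each removal. *)
Lemma busy_over_later y B r n : 0 <= y -> service_cdf eta y < 1 -> (1 <= r <= B.+1)%N ->
  Ex (busy_over (X y) B r n.+1) = Ex (busy_over (X 0) B r 0).
Proof.
move=> y0 Fy rB; have hy := hX y0 Fy.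
have i1 := busy_instance hy mu0 s0 kappa0 lam0 lam1 delta0 deltaE n.+1 rB.
have i2 := busy_instance h0 mu0 s0 kappa0 lam0 lam1 delta0 deltaE 0 rB.
have G1 : input_series mu kappa (X y) n.+1 = fun=> f by apply/funext => k; exact: input_series_later.
have G2 : input_series mu kappa (X 0) 0 = fun=> f by apply/funext => k; exact: input_series_zero.
have S1 : service_mass (X y) n.+1 = fun=> eta_mass s eta by apply/funext => k; exact: service_mass_later.
have S2 : service_mass (X 0) 0 = fun=> eta_mass s eta by apply/funext => k; exact: service_mass_zero.
rewrite G1 S1 in i1; rewrite G2 S2 in i2.
have e := recursion_unique i1 i2.
have l1 := killed_limit hy mu0 eta0 (n := n.+1) rB.
have l2 := killed_limit h0 mu0 eta0 (n := 0) rB.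
have ee : (fun k => Ex (killed (X y) B r n.+1 k)) = (fun k => Ex (killed (X 0) B r 0 k)) by apply/funext => k; exact: e.
by rewrite ee in l1; apply: cvg_unique l1 l2.
Qed.

Section formulas.
Variables (B : nat).
Local Notation bt := (busy_mix X s kappa B).
Local Notation Q := (resolvent_series lam W f).

Lemma busy_mixE : bt = \sum_(1 <= i < B.+2) entry_pmf kappa B i * Ex (busy_over (X 0) B i 0).
Proof.
rewrite big_nat_recr//= addrC /busy_mix; congr (_ + _).
  by rewrite (busy_transformE h0 s0) /entry_pmf ltnn.
apply: eq_big_nat => i /andP[_ iB]; rewrite (busy_transformE h0 s0) /entry_pmf.
by rewrite -ltnS iB.
Qed.

Section one_start.
Variables (y : R) (r : nat).
Hypotheses (y0 : 0 <= y) (Fy : service_cdf eta y < 1).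
Let hy : inputs_spec mu s kappa delta eta y (X y). Proof. exact: hX. Qed.

Lemma over_later n : Ex (fun w => ind (over_by (X y) B r n.+1 w (clock (X y) w))) = bt.
Proof.
rewrite (entry_mixture hy B r (n := n) (F := fun i => busy_over (X y) B i n.+1)); last by move=> i; exact: (unitf_busy_over_sub hy).
by rewrite busy_mixE; apply: eq_big_nat => i iB; rewrite busy_over_later.
Qed.

Lemma below_atE u n w : ind (below_at (X y) B r u n w (clock (X y) w)) =
  busy_below (X y) B (busy_level (X y) B r n w) n u w.
Proof.
apply: ind_eq; rewrite /below_at /over_by; split=> [[_ []]//|[h1 h2]].
by rewrite ltW// (clock_pos hy).
Qed.

Lemma below_later u n : (1 <= u <= B)%N -> Ex (fun w => ind (below_at (X y) B r u n.+1 w (clock (X y) w))) =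
  (a * A0) u - bt * M u.-1.
Proof.
move=> uB; rewrite (eq_Ex P (below_atE u n.+1)).
rewrite (entry_mixture hy B r (n := n) (F := fun i => busy_below (X y) B i n.+1 u)); last by move=> i; exact: (unitf_busy_below_sub hy).
rewrite busy_mixE mulr_suml fpsME.
transitivity (\sum_(1 <= i < B.+2) (entry_pmf kappa B i * ((i <= u)%N%:R * A0 (u - i)%N) -
    entry_pmf kappa B i * Ex (busy_over (X 0) B i 0) * M u.-1)).
  apply: eq_big_nat => i iB; rewrite busy_below_value// busy_over_later//.
  by rewrite (input_series_later y0 Fy)// mulrBr !mulrA.
rewrite sumrB; congr (_ - _).
have [u1 uB'] := andP uB.
rewrite (@big_cat_nat _ _ _ u.+1 1%N B.+2)//=; last by rewrite ltnS leqW.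
rewrite [X in _ + X]big1_seq ?addr0; last first.
  move=> i; rewrite mem_index_iota => /andP[_ /andP[ui _]].
  by rewrite (_ : (i <= u)%N = false) ?mul0r ?mulr0//; apply/negbTE; rewrite -ltnNge.
rewrite -(big_mkord xpredT (fun i => a i * A0 (u - i)%N)) [RHS]big_ltn//.
have -> : a 0%N = 0 by exact: (batch_series0 (P := P) kappa0).
rewrite mul0r add0r.
apply: eq_big_nat => i /andP[_]; rewrite ltnS => iu.
by rewrite iu mul1r /entry_pmf (leq_trans iu uB').
Qed.

Lemma below_top_later n : Ex (fun w => ind (below_at (X y) B r B.+1 n.+1 w (clock (X y) w))) = 1 - bt.
Proof.
rewrite (eq_Ex P (below_atE B.+1 n.+1)).
rewrite (entry_mixture hy B r (n := n) (F := fun i => busy_below (X y) B i n.+1 B.+1)); last by move=> i; exact: (unitf_busy_below_sub hy).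
rewrite busy_mixE -(entry_pmf_sum hy B r n) -sumrB.
by apply: eq_big_nat => i iB; rewrite (busy_below_topE hy mu0 eta0)// busy_over_later// mulrBr mulr1.
Qed.

Lemma busy_mix01 : 0 <= bt <= 1.
Proof.
rewrite -(over_later 0); apply: Ex01.
have u := unitf_over_by hy B r (J := current_slots 1) (n := 1) (fun z h => h).
have mg : measurable_fun setT ((fun w => (w, clock (X y) w)) : Omega -> Osub (X y) (current_slots 1) * R).
  by apply: measurable_fun_pair; [exact: measurable_id_Osub|exact: measurable_funPT].
exact: (unitf_comp u mg).
Qed.

Local Notation den := (s + mu - mu * bt).

Lemma den_gt0 : 0 < den.
Proof.
have /andP[_ b1] := busy_mix01.
by rewrite -addrA ltr_wpDr// subr_ge0 ler_piMr// ltW.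
Qed.

(** The numerator of the contribution of the later cycles, in excess of A_x^(u-r):
mu p~ - (s + mu - mu b~) M_(u-1), where p~ = (a * A_0)_u - b~ M_(u-1). *)
Definition constC u : R := mu * (a * A0) u - (s + mu) * M u.-1.

Section busy_start.
Hypothesis rB : (1 <= r <= B.+1)%N.
Local Notation b := (Ex (busy_over (X y) B r 0)).

Lemma queue_prob_busy u x : (1 <= u <= B)%N -> queue_prob (X y) B r x u =
  (r <= u)%N%:R * resolvA_series lam W rho (input_series mu kappa (X y) 0 0) (u - r)%N + b * (constC u / den).
Proof.
case: u => // u uB; have dn : den != 0 by rewrite gt_eqF// den_gt0.
rewrite (queue_probE hy mu0 s0 x busy_mix01 over_later (fun n => below_later n uB) (erefl b) (erefl _)).
rewrite (eq_Ex P (below_atE u.+1 0)) busy_below_value// /constC.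
by field.
Qed.

Lemma queue_prob_busy_top x : queue_prob (X y) B r x B.+1 = 1 - s * b / den.
Proof.
have dn : den != 0 by rewrite gt_eqF// den_gt0.
rewrite (queue_probE hy mu0 s0 x busy_mix01 over_later below_top_later (erefl b) (erefl _)).
rewrite (eq_Ex P (below_atE B.+1 0)) (busy_below_topE hy mu0 eta0)//.
by field.
Qed.

End busy_start.
End one_start.

Section empty_start.

Let over0 : Ex (fun w => ind (over_by (X 0) B 0 0 w (clock (X 0) w))) = 1.
Proof.
rewrite -[RHS](Ex_cst P 1); apply: eq_Ex => w; apply: indT.
by rewrite /over_by /= (busy_length_empty h0) lee_fin ltW// (clock_pos h0).
Qed.

Let below0 u : Ex (fun w => ind (below_at (X 0) B 0 u 0 w (clock (X 0) w))) = 0.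
Proof.
rewrite -[RHS](Ex_cst P 0); apply: eq_Ex => w; apply: indF => -[_ [h _]]; apply: h.
by rewrite /over_by /= (busy_length_empty h0) lee_fin ltW// (clock_pos h0).
Qed.

Local Notation den := (s + mu - mu * bt).

Lemma queue_prob_empty u : (1 <= u <= B)%N -> queue_prob (X 0) B 0 0 u = M u.-1 + constC u / den.
Proof.
case: u => // u uB; have dn : den != 0 by rewrite gt_eqF// (den_gt0 0 (lexx 0) F0).
rewrite (queue_probE h0 mu0 s0 0 (busy_mix01 0 (lexx 0) F0) (over_later 0 (lexx 0) F0)
  (fun n => below_later 0 (lexx 0) F0 n uB) over0 (below0 _)).
by rewrite /constC /=; field.
Qed.

Lemma queue_prob_empty_top : queue_prob (X 0) B 0 0 B.+1 = 1 - s / den.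
Proof.
have dn : den != 0 by rewrite gt_eqF// (den_gt0 0 (lexx 0) F0).
rewrite (queue_probE h0 mu0 s0 0 (busy_mix01 0 (lexx 0) F0) (over_later 0 (lexx 0) F0)
  (below_top_later 0 (lexx 0) F0) over0 (below0 _)).
by field.
Qed.

End empty_start.

Lemma resolvA_zero n : resolvA X lam mu s kappa eta 0 n%:Z = A0 n.
Proof. by rewrite resolvA_age// -(input_seriesE h0 mu0 s0) input_series_zero. Qed.

Lemma mean_resolvA_zero n : mean_resolvA X lam mu s kappa eta n = M n.
Proof.
apply: (mean_resolvA_identified mu0 s0 kappa0 eta0 lam0 lam1 WE C0 HW).
- exact: clock_series_ge0.
- exact: clock_series_sum_le1.
- exact: resolvA_zero.
Qed.

(** The relation (s + mu - mu a) rho = s replaces (a * A_0)_u by A_0^u and Q_u, and the shift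
relation replaces M_(u-1) by A_0^u and M_u. *)
Lemma resolvC_const u : (1 <= u)%N -> resolvC X lam mu s kappa eta u = constC u.
Proof.
move=> u1; rewrite /resolvC resolvA_zero mean_resolvA_zero /constC.
have -> : resolvent X lam mu s kappa eta 0 = Q.
  apply: (resolvent_identified mu0 s0 kappa0 eta0 lam0 lam1 WE C0 HW) => th th1.
  rewrite -(input_series_zero 0 0) (input_seriesE h0 mu0 s0).
  by apply: (mixed_gf mu0 s0 kappa0) => //; exact: (service_pos h0).
have psiE : psi_series lam mu s kappa eta = fpsC lam + fpsC (1 - lam) * f by [].
have l1 : 1 - lam != 0 by rewrite gt_eqF.
have := congr1 (fun g : fps R => g u) (congr1 (fun g => g * (fps_ones R - fpsC (1 - lam)^-1 * Q)) (clock_series_renewal h0 mu0 s0 kappa0)).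
rewrite -mulrA -/A0 mulrBl fpsDE fpsNE -mulrA !fpsCM fpsDE fpsNE fpsCM /fps_ones => E1.
move: E1; rewrite -(mulrA (fpsC mu)) fpsCM => E1.
have := congr1 (fun g : fps R => g u) (meanA_shift rho psiE WE l1).
rewrite mulrBl fpsDE fpsNE !fpsCM fpsXM; case: u u1 E1 => // u _ E1 /= E2.
have -> : M u = (1 - lam) * A0 u.+1 + lam * M u.+1 by rewrite -E2; ring.
have -> : mu * (a * A0) u.+1 = (s + mu) * A0 u.+1 - s * (1 - (1 - lam)^-1 * Q u.+1) by rewrite -E1; ring.
by field.
Qed.

End formulas.
End assembly.

Theorem theorem6 (d : measure_display) (Omega : measurableType d)
  (R : realType) (P : probability Omega R)
  (lam mu : R) (kappa delta : {RV P >-> nat}) (eta : {RV P >-> R})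
  (hprim : primitives_spec lam mu kappa delta eta)
  (s : R) (hs : 0 < s)
  (X : R -> inputs P)
  (hX : forall y : R, 0 <= y -> service_cdf eta y < 1 ->
    inputs_spec mu s kappa delta eta y (X y))
  (B r : nat) (hr : (1 <= r <= B.+1)%N)
  (x : R) (hx : 0 <= x) (hFx : service_cdf eta x < 1) :
  let q := fun (i : nat) (y : R) (u : nat) => queue_prob (X y) B i y u in
  let b := busy_transform (X x) B s r x in
  let den := s + mu - mu * busy_mix X s kappa B in
  let A := resolvA X lam mu s kappa eta in
  let EA := mean_resolvA X lam mu s kappa eta in
  let C := resolvC X lam mu s kappa eta in
  [/\ forall u : nat, (1 <= u <= B)%N ->
        q 0%N 0 u = EA (u - 1)%N + C u / den /\
        q r x u = A x (u%:Z - r%:Z) + b * (C u / den),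
      q 0%N 0 B.+1 = 1 - s / den,
      q r x B.+1 = 1 - s * b / den,
      q 0%N 0 0%N = s / den &
      q r x 0%N = s * b / den].
Proof.
move=> q b den A EA C.
have F0 : service_cdf eta 0 < 1 by rewrite (service_cdf0 (eta_pos hprim)) ltr01.
have h0 := hX 0 (lexx 0) F0; have hxX := hX x hx hFx.
have bE : b = Ex P (busy_over (X x) B r 0) := busy_transformE hxX hs B r x.
have [W [WE [K [K0 HW]]]] := scale_series (mu_gt0 hprim) hs (kappa_pos hprim) (eta_pos hprim) (lam_ge0 hprim) (lam_lt1 hprim).
have q0 : q 0%N 0 B.+1 = 1 - s / den := queue_prob_empty_top hprim hs hX B.
have qx : q r x B.+1 = 1 - s * b / den.
  by rewrite bE; exact: (queue_prob_busy_top hprim hs hX hx hFx hr x).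
split => //.
- move=> u uB; have [u1 _] := andP uB; have CE := resolvC_const hprim hs hX WE K0 HW u1.
  rewrite /C CE; split.
    rewrite /q (queue_prob_empty hprim hs hX WE uB) /EA (mean_resolvA_zero hprim hs hX WE K0 HW).
    by rewrite subn1.
  rewrite /q (queue_prob_busy hprim hs hX WE hx hFx hr x uB) bE; congr (_ + _).
  rewrite (input_seriesE hxX (mu_gt0 hprim) hs) /A.
  have [ru|ur] := leqP r u.
    by rewrite mul1r -(resolvA_age hprim hs hX WE K0 HW hx hFx) subzn.
  rewrite mul0r; have -> : u%:Z - r%:Z = - (r - u)%N%:Z by rewrite -subzn ?opprB// ltnW.
  by case e : (r - u)%N => [|m]; [move: ur e; lia|].
- by rewrite /q (queue_prob0 h0 (mu_gt0 hprim) B 0 (eta_pos hprim)) -/(q 0%N 0 B.+1) q0 subKr.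
- by rewrite /q (queue_prob0 hxX (mu_gt0 hprim) B r (eta_pos hprim)) -/(q r x B.+1) qx subKr.
Qed.
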